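(* Let $p\ge2$ and $m\ge1$ be integers. The vertex operator algebra $\mathcal W(p)^{D_m}$ is $C_2$-cofinite.
   Context: Let $L=\mathbb{Z}\alpha$ with $\langle\alpha,\alpha\rangle=2p$, and $V_L=M(1)\otimes\mathbb{C}[L]$ the lattice vertex algebra ($M(1)$ the Heisenberg vertex algebra) with conformal vector $\omega=\frac{1}{4p}\alpha(-1)^2\mathbf 1+\frac{p-1}{2p}\alpha(-2)\mathbf 1$ (central charge $c_{p,1}=1-6(p-1)^2/p$). $Y(v,z)=\sum_n v_nz^{-n-1}$. $Q=e^{\alpha}_0$, $\widetilde Q=e^{-\alpha/p}_0:V_L\to V_{L-\alpha/p}$. The triplet vertex algebra is $\mathcal W(p)=\mathrm{Ker}_{V_L}\widetilde Q=\bigoplus_{n\ge0}\bigoplus_{i=0}^{2n}U(Vir)Q^ie^{-n\alpha}$. $\Psi$ is the order two automorphism of $\mathcal W(p)$ commuting with the Virasoro algebra with $\Psi(Q^ie^{-n\alpha})=\frac{(-1)^i i!}{(2n-i)!}Q^{2n-i}e^{-n\alpha}$. $D_m\subset\mathrm{Aut}(\mathcal W(p))$ is the dihedral group of order $2m$ generated by $\Psi$ and $\exp[\frac{\pi i}{mp}\alpha(0)]$; $\mathcal W(p)^{D_m}$ is its fixed point subalgebra. A vertex operator algebra $V$ is $C_2$-cofinite if $\mathrm{span}\{a_{-2}b: a,b\in V\}$ has finite codimension in $V$. *)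

(* Defs.v *)
From mathcomp Require Export all_boot all_order all_algebra finmap multiset.
From mathcomp Require Export complex.
From mathcomp Require Export all_classical reals sequences trigo.
From mathcomp Require Export monalg.

Set Implicit Arguments.
Unset Strict Implicit.
Unset Printing Implicit Defensive.

Import Order.TTheory GRing.Theory Num.Theory.

Local Open Scope classical_set_scope.
Local Open Scope complex_scope.
Local Open Scope ring_scope.

(* Basis of M(1) (x) C[Q alpha]: the pair ({i_1, ..., i_k}, r) stands for
   alpha(-i_1-1) ... alpha(-i_k-1) (x) e^(r alpha).  The index i thus encodes
   the mode -(i+1), so that every natural number is allowed. *)
Definition fock_basis : choiceType := ({mset nat}%mset * rat)%type.

(* M(1) (x) C[Q alpha], which contains V_(lambda + L) for all lambda in
   Q alpha; the modes of e^(-alpha/p) map V_L into V_(L - alpha/p). *)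
Definition fock (R : realType) : lmodType R[i] := {malg R[i][fock_basis]}.

Section LinearAlgebra.
Context {R : realType}.
Implicit Types V : lmodType R[i].

Definition lin_ext V (f : fock_basis -> V) (v : fock R) : V :=
  \sum_(b <- msupp v) v@_b *: f b.

Definition lin_span V (S : set V) : set V :=
  [set v | exists n (c : 'I_n -> R[i]) (s : 'I_n -> V),
    (forall i, S (s i)) /\ v = \sum_(i < n) c i *: s i].

(* S + (span of a finite subset of U) = U, for a subspace S of U. *)
Definition finite_codim V (U S : set V) : Prop :=
  exists F : set V,
    [/\ finite_set F, F `<=` U & U `<=` lin_span (F `|` S)].

Definition linear_on V (U : set V) (f : V -> V) : Prop :=
  forall (c : R[i]) u v, U u -> U v -> f (c *: u + v) = c *: f u + f v.

(* Formal power series with operator coefficients: a n is the coefficient of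
   the n-th power of the variable. *)
Definition op_series V := nat -> V -> V.

Definition op_series1 V : op_series V :=
  fun k v => if k == 0%N then v else 0.

Definition op_series_mul V (a b : op_series V) : op_series V :=
  fun k v => \sum_(i < k.+1) a i (b (k - i)%N v).

(* Exponential of a series a with a 0 = 0: a^j only contributes to the
   coefficients of degree k >= j. *)
Definition op_series_exp V (a : op_series V) : op_series V :=
  fun k v =>
    \sum_(j < k.+1)
      (j`!%:R : R[i])^-1 *: iter j (op_series_mul a) (@op_series1 V) k v.

Definition cexp (z : R[i]) : R[i] :=
  let: x +i* y := z in (expR x * cos y) +i* (expR x * sin y).

End LinearAlgebra.

Section Triplet.
Context {R : realType} (p : nat).
Local Notation C := R[i].
Local Notation V := (fock R).

Definition e_ (r : rat) : V := << (mset0, r) >>.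

Definition vac : V := e_ 0.

(* The Heisenberg operators alpha(n), with [alpha(m), alpha(n)] =
   2 p m delta_(m+n,0) and alpha(0) e^(r alpha) = 2 p r e^(r alpha). *)
Definition alpha (n : int) : V -> V :=
  lin_ext (fun b : fock_basis =>
    match n with
    | Posz 0 => ratr (2 * p%:R * b.2) *: << b >>
    | Posz k.+1 =>
        ((2 * p * k.+1 * b.1 k)%N%:R : C) *: << ((b.1 `\ k)%mset, b.2) >>
    | Negz k => << ((k +` b.1)%mset, b.2) >>
    end).

(* exp (sum_(n >= 1) r alpha(-n) z^n / n).  The term n = 0 vanishes because
   0^-1 = 0. *)
Definition exp_creation (r : rat) : op_series V :=
  op_series_exp (fun n v => (ratr r / n%:R : C) *: alpha (- n%:Z) v).

(* exp (- sum_(n >= 1) r alpha(n) z^(-n) / n), as a series in z^-1. *)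
Definition exp_annihilation (r : rat) : op_series V :=
  op_series_exp (fun n v => - (ratr r / n%:R : C) *: alpha n%:Z v).

Definition shift (r : rat) : V -> V :=
  lin_ext (fun b => << (b.1, r + b.2) >>).

(* The coefficient of z^(-n-1) in Y(e^(r alpha), z), which is
   exp_creation * exp_annihilation * shift r * z^(r alpha(0)).
   On the charge s the exponents of z in the last factor are 2 p r s; nothing
   contributes if this is not an integer.  The 2-cocycle of L is trivial as L
   is an even lattice of rank one.  Sums over \in are sums over the support,
   which is finite in all the uses below. *)
Definition exp_mode (r : rat) (n : int) : V -> V :=
  lin_ext (fun b =>
    \sum_(jk \in [set jk : nat * nat |
            jk.1%:R - jk.2%:R + 2 * p%:R * r * b.2 = - n%:~R - 1 :> rat])
      shift r (exp_creation r jk.1 (exp_annihilation r jk.2 << b >>))).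

(* The modes of the normally ordered product
   : (1/a!) (d/dz)^a alpha(z) F(z) :  with F(z) = sum_n F n z^(-n-1). *)
Definition normal_order (a : nat) (F : int -> V -> V) (n : int) (v : V) : V :=
  \sum_(i \in [set: nat])
    ('C(a + i, i)%:R : C) *: alpha (- (a + i).+1%:Z) (F (n + i%:Z) v)
  + (-1) ^+ a *: \sum_(i \in [set: nat])
    ('C(a + i, i)%:R : C) *: F (n - (a + i).+1%:Z) (alpha i%:Z v).

(* mode u n v = u_n v, where Y(u, z) = sum_n u_n z^(-n-1). *)
Definition mode (u : V) (n : int) (v : V) : V :=
  lin_ext (fun b : fock_basis =>
    foldr normal_order (exp_mode b.2) (enum_mset b.1) n v) u.

Definition lattice_VA : set V :=
  [set v | forall b, b \in msupp v -> b.2 \is a Num.int].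

Definition omega : V :=
  ((4 * p)%:R : C)^-1 *: alpha (-1) (alpha (-1) vac)
  + ((p - 1)%:R / (2 * p)%:R : C) *: alpha (-2) vac.

Definition Vir (n : int) : V -> V := mode omega (n + 1).

Definition Q : V -> V := mode (e_ 1) 0.

Definition Qtilde : V -> V := mode (e_ (- p%:R^-1)) 0.

Definition triplet : set V := [set v | lattice_VA v /\ Qtilde v = 0].

Definition is_automorphism (W : set V) (g : V -> V) : Prop :=
  [/\ set_bij W W g, linear_on W g, g vac = vac &
      forall u n v, W u -> W v -> g (mode u n v) = mode (g u) n (g v)].

(* Automorphisms of W(p) are given by functions on the ambient space, of which
   only the values on W(p) are relevant. *)
Definition is_Psi (Psi : V -> V) : Prop :=
  [/\ is_automorphism triplet Psi,
      (forall v, triplet v -> Psi (Psi v) = v) /\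
        (exists v, triplet v /\ Psi v <> v),
      (forall n v, triplet v -> Psi (Vir n v) = Vir n (Psi v)) &
      forall n i : nat, (i <= 2 * n)%N ->
        Psi (iter i Q (e_ (- n%:R))) =
        ((-1) ^+ i * i`!%:R / (2 * n - i)`!%:R : C)
          *: iter (2 * n - i) Q (e_ (- n%:R))].

(* exp (c alpha(0)); the operator alpha(0) is diagonal. *)
Definition exp_alpha0 (c : C) : V -> V :=
  lin_ext (fun b => cexp (c * ratr (2 * p%:R * b.2)) *: << b >>).

Definition rotation (m : nat) : V -> V :=
  exp_alpha0 (0 +i* (pi / (m * p)%:R)).

(* The subgroup of Aut(W(p)) generated by Psi and the rotation. *)
Inductive dihedral (m : nat) (Psi : V -> V) : (V -> V) -> Prop :=
| dihedral_Psi : dihedral m Psi Psi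
| dihedral_rotation : dihedral m Psi (rotation m)
| dihedral_id : dihedral m Psi id
| dihedral_comp g h :
    dihedral m Psi g -> dihedral m Psi h -> dihedral m Psi (g \o h)
| dihedral_inv g h :
    dihedral m Psi g -> set_bij triplet triplet h ->
    (forall v, triplet v -> g (h v) = v) -> dihedral m Psi h.

Definition fixed_points (W : set V) (G : (V -> V) -> Prop) : set V :=
  [set v | W v /\ forall g, G g -> g v = v].

Definition C2_cofinite (U : set V) : Prop :=
  finite_codim U
    (lin_span [set x | exists a b, [/\ U a, U b & x = mode a (-2) b]]).

End Triplet.

(* Main.v *)
Require Import Defs.
From HB Require Import structures.
From mathcomp Require Import zify ring lra.

Set Implicit Arguments.
Unset Strict Implicit.
Unset Printing Implicit Defensive.

Import Order.TTheory GRing.Theory Num.Theory.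

Local Open Scope classical_set_scope.
Local Open Scope complex_scope.
Local Open Scope ring_scope.

(* Let W be the triplet algebra.  The vertex operators of exponentials satisfy the
   Borcherds commutator formula, by the Stone-von Neumann principle: operators
   intertwining the Heisenberg algebra are determined by ground coefficients.
   Hence Q is a derivation commuting with the Virasoro algebra, and an analysis of
   singular vectors shows that W is generated over the Virasoro algebra by the
   vectors Q^i e^(-n alpha), on which Q and Psi Q Psi act as sl_2.

   For M = m and 2m let U_M be the sum of e^(-M alpha) and its image under Psi,
   which is fixed by D_m.  Let Rel be the span of the L(-1) w, of the L(-k) w with
   k >= 3 and of the (U_M)_j w with j <= -2, for all w in W; averaging over D_m maps
   Rel into C_2 of the orbifold.  Modulo Rel, W is spanned by the vectors
   L(-2)^b Q^i e^(-n alpha).  A leading term computation shows that (U_M)_j relates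
   Q^i e^(-n alpha) and Q^(i + 2M) e^(-n alpha) modulo smaller n; the relations for
   m and 2m together leave only n < 4m.

   It remains to show that L(-2) is nilpotent on Q^i e^(-n alpha) modulo Rel.  Let
   eps send every e^(r alpha) and alpha(-1) to 1 and the other alpha(-k) to 0.
   Composing its charge zero part with the automorphisms exp (s Q) exp (t Psi Q Psi)
   turns w into a polynomial in s and t, and kills exactly the span of L(-1) W, of
   the L(-k) W with k >= 3 and of (L(-2) - c) W for a scalar c <> 0.  The value on
   (U_M)_j w is a combination of coefficients of exp (k z), and separating the
   exponents k shows that the values on Rel contain all polynomials arising from
   the Q^i e^(-n alpha).  So Q^i e^(-n alpha) lies in Rel + (L(-2) - c) W, and
   comparing conformal weights gives the nilpotency. *)

(** The obstacle is that the C_2 space of the orbifold contains only products of invariant vectors,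
    so W has to be cut down with the Virasoro modes and the modes of [Uv m] and [Uv (2m)] alone. The
    first invariant gives x_i = -x_(i+2m), which by itself allows non-zero sequences of period 4m.
    Applied twice it gives x_i = x_(i+4m), and the second invariant gives x_i = -x_(i+4m), so 2 x_i
    = 0. The functional is shaped by the creation half of the vertex operators: once alpha(-1) is 1
    and deeper modes are 0, exp(k sum alpha(-n) z^n / n) becomes exp(k z). The charges k occurring
    in U_M are distinct, so the term of charge M can be isolated; its coefficient is (1 - s t)^(2M)
    + s^(2M) up to a scalar, and this factor again yields the two sign relations, now between
    monomials. The scalar c is 1/(4p), the coefficient of alpha(-1)^2 in omega. An identity e = r +
    (L(-2) - c) w splits by weight into c a_i = r_i + L(-2) a_(i-1) for i <> 0. Going up from
    weights where w vanishes puts the a_i with i < 0 in Rel; above the weight of e, the power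
    L(-2)^k e equals -c^(k+1) a_k modulo Rel, and a_k = 0 for large k. *)

(* The core hints of the asymptotics library are tried on every equation and are
   extremely slow on vectors of the Fock space, so equations between vectors or
   complex numbers are only closed syntactically or by assumption. *)
Ltac full_done :=
  trivial; hnf; intros; solve
    [ do ![solve [trivial | apply: sym_equal; trivial]
         | discriminate | contradiction | split]
    | match goal with H : ~ _ |- _ => solve [case H; trivial] end ].

Ltac eq_done :=
  first [ match goal with |- ?x = ?x => exact (erefl x) end
        | assumption | symmetry; assumption | contradiction
        | discriminate | reflexivity ].

Ltac done :=
  solve [ match goal with |- ?x = ?x => exact (erefl x) end
        | assumption
        | intros;
          lazymatch goal with
          | |- @eq ?T _ _ =>
            lazymatch T with
            | context [fock] => eq_done
            | context [complex] => eq_done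
            | _ => first [ eq_done | full_done ]
            end
          | |- _ => full_done
          end ].

(** * Finitely supported sums over nat *)

Definition nsum {V : zmodType} (F : nat -> V) : V := \sum_(i \in [set: nat]) F i.

Section Nsum.
Context {V : zmodType}.
Implicit Types F G : nat -> V.

(** A sum over all of [nat] takes the default value 0 when its support is infinite, so additivity
    needs this finiteness condition. *)
Definition ev0 F := exists N, forall i, (N <= i)%N -> F i = 0.

Lemma nsumE F N : (forall i, (N <= i)%N -> F i = 0) ->
  nsum F = \sum_(i < N) F i.
Proof.
move=> F0; rewrite /nsum (fsbigE (iota 0 N)) ?iota_uniq //.
- rewrite -(big_mkord xpredT) /index_iota subn0; apply: eq_bigl => i; exact: in_setT.
- by move=> i _; rewrite mem_iota /= add0n -leqNgt => /F0.
Qed.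

Lemma eq_nsum F G : F =1 G -> nsum F = nsum G.
Proof. by move=> FG; apply: eq_fsbigr => i _. Qed.

Lemma nsum0 F : (forall i, F i = 0) -> nsum F = 0.
Proof. by move=> F0; apply: fsbig1. Qed.

Lemma nsumD F G : ev0 F -> ev0 G -> nsum (fun i => F i + G i) = nsum F + nsum G.
Proof.
move=> [N F0] [M G0].
rewrite (@nsumE F (maxn N M)); last by move=> i; rewrite geq_max => /andP[/F0].
rewrite (@nsumE G (maxn N M)); last by move=> i; rewrite geq_max => /andP[_ /G0].
rewrite (@nsumE _ (maxn N M)) ?big_split //.
by move=> i; rewrite geq_max => /andP[/F0 -> /G0 ->]; rewrite addr0.
Qed.

Lemma ev0D F G : ev0 F -> ev0 G -> ev0 (fun i => F i + G i).
Proof.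
move=> [N F0] [M G0]; exists (maxn N M) => i.
by rewrite geq_max => /andP[/F0 -> /G0 ->]; rewrite addr0.
Qed.

End Nsum.

Section Nsum2.
Context {V : zmodType}.
Implicit Types F G : nat -> V.

Lemma nsum_lin (V' : zmodType) (f : V -> V') F : f 0 = 0 ->
  (forall x y, f (x + y) = f x + f y) -> ev0 F ->
  f (nsum F) = nsum (fun i => f (F i)).
Proof.
move=> f0 fD [N F0]; rewrite (nsumE F0) (@nsumE _ _ N); last by move=> i /F0 ->.
by apply: (big_morph f).
Qed.

Lemma ev0_lin (V' : zmodType) (f : V -> V') F : f 0 = 0 -> ev0 F ->
  ev0 (fun i => f (F i)).
Proof. by move=> f0 [N F0]; exists N => i /F0 ->. Qed.

Lemma nsumB F G : ev0 F -> ev0 G -> nsum (fun i => F i - G i) = nsum F - nsum G.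
Proof.
move=> eF eG; have eN : ev0 (fun i => - G i) by apply: (ev0_lin (f := -%R)); rewrite ?oppr0.
rewrite nsumD //; congr (_ + _); apply/esym.
by apply: (nsum_lin (f := -%R)); rewrite ?oppr0// => x y; rewrite opprD.
Qed.

Lemma nsum1 F k : (forall i, i != k -> F i = 0) -> nsum F = F k.
Proof.
move=> F0; rewrite (@nsumE _ _ k.+1); last by move=> i ki; apply: F0; rewrite gtn_eqF.
rewrite big_ord_recr/= big1 ?add0r// => i _; apply: F0; by rewrite ltn_eqF.
Qed.

Lemma nsumS F : ev0 F -> nsum F = F 0%N + nsum (fun i => F i.+1).
Proof.
move=> [N F0]; rewrite (@nsumE _ _ N.+1); last by move=> i /ltnW /F0.
by rewrite big_ord_recl (@nsumE _ (fun i => F i.+1) N)// => i Ni; apply: F0; apply: leqW.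
Qed.

Lemma nsum_conv (G : nat -> nat -> V) :
  (exists N, forall i q, (N <= i + q)%N -> G i q = 0) ->
  nsum (fun i => nsum (fun q => G i q)) =
  nsum (fun t => \sum_(i < t.+1) G i (t - i)%N).
Proof.
move=> [N G0].
rewrite (@nsumE _ _ N); last first.
  by move=> i Ni; apply: nsum0 => q; apply: G0; rewrite (leq_trans Ni) ?leq_addr.
rewrite [RHS](@nsumE _ _ N); last first.
  move=> t Nt; rewrite big1// => i _; apply: G0.
  by rewrite subnKC// -ltnS.
under eq_bigr => i _.
  rewrite (@nsumE _ _ N); last by move=> q Nq; apply: G0; rewrite (leq_trans Nq) ?leq_addl.
  over.
transitivity (\sum_(i < N) \sum_(q < N) \sum_(t < N | t == (i + q)%N :> nat) G i q).
  apply: eq_bigr => i _; apply: eq_bigr => q _.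
  case: (ltnP (i + q) N) => iqN.
    by rewrite (big_pred1 (Ordinal iqN))// => t; rewrite -val_eqE.
  by rewrite G0// big1.
under eq_bigr do rewrite (exchange_big_dep xpredT)//=.
rewrite (exchange_big_dep xpredT)//=; apply: eq_bigr => t _.
rewrite -(big_mkord xpredT (fun i => G i (t - i)%N)).
rewrite -(big_mkord xpredT (fun i => \sum_(q < N | t == (i + q)%N :> nat) G i q)).
rewrite (@big_cat_nat _ _ _ t.+1)//= [X in _ + X]big_nat_cond [X in _ + X]big1 ?addr0.
  rewrite !big_nat; apply: eq_bigr => i /= it.
  have ti : (t - i < N)%N by rewrite (leq_ltn_trans (leq_subr _ _)).
  rewrite (big_pred1 (Ordinal ti))// => q /=; rewrite -val_eqE/=.
  by apply/eqP/eqP => [->|->]; lia.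
by move=> i /andP[/andP[ti _] _]; rewrite big1// => q /eqP; lia.
Qed.
End Nsum2.

(** * Equations between linear combinations *)

Inductive mexp (K : Type) :=
  | MVar of nat | MZero | MAdd of mexp K & mexp K | MOpp of mexp K | MScale of K & mexp K.
Arguments MVar {K}. Arguments MZero {K}.

Section Mexp.
Context {K : pzRingType} {V : lmodType K}.
Implicit Types e : mexp K.

Fixpoint meval (env : seq V) e : V :=
  match e with
  | MVar n => nth 0 env n
  | MZero => 0
  | MAdd a b => meval env a + meval env b
  | MOpp a => - meval env a
  | MScale c a => c *: meval env a
  end.

Fixpoint mcoef e (i : nat) : K :=
  match e with
  | MVar n => if Nat.eqb i n then 1 else 0
  | MZero => 0
  | MAdd a b => mcoef a i + mcoef b i
  | MOpp a => - mcoef a i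
  | MScale c a => c * mcoef a i
  end.

Lemma mevalE env e : meval env e = \sum_(i < size env) mcoef e i *: nth 0 env i.
Proof.
elim: e => [n||a IHa b IHb|a IHa|c a IHa] /=; rewrite ?IHa ?IHb.
- have E i : Nat.eqb i n = (i == n) by apply/PeanoNat.Nat.eqb_spec/eqP.
  have [ns|ns] := ltnP n (size env).
    rewrite (bigD1 (Ordinal ns))//= E eqxx scale1r big1 ?addr0// => i.
    by rewrite -val_eqE/= E => /negPf ->; rewrite scale0r.
  rewrite nth_default// big1// => i _; rewrite E ltn_eqF ?scale0r//.
  exact: leq_trans (ltn_ord i) ns.
- by rewrite big1// => i _; rewrite scale0r.
- by rewrite -big_split; apply: eq_bigr => i _; rewrite scalerDl.
- by rewrite -sumrN; apply: eq_bigr => i _; rewrite scaleNr.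
- by rewrite scaler_sumr; apply: eq_bigr => i _; rewrite scalerA.
Qed.

Fixpoint mall (P : nat -> Prop) (n i : nat) : Prop :=
  if n is n'.+1 then P i /\ mall P n' i.+1 else True.

(** This is the correctness of the reflexive tactic [lmod]. The premise unfolds to one scalar
    equation per atom, which [ring] then closes; the atoms need not be independent. *)
Lemma mexp_eq env e e' : mall (fun i => mcoef e i = mcoef e' i) (size env) 0 ->
  meval env e = meval env e'.
Proof.
have mallP P n i : mall P n i -> forall j, (i <= j < i + n)%N -> P j.
  elim: n i => [|n IHn] i /=; first by move=> _ j; rewrite addn0; lia.
  move=> [Pi Pn] j ij; have [<-//|ji] := eqVneq i j.
  by apply: IHn Pn _ _; lia.
move=> /mallP h; rewrite !mevalE; apply: eq_bigr => -[i il] _; congr (_ *: _).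
exact: h.
Qed.

End Mexp.

Ltac msame x y :=
  lazymatch constr:((x, y)) with
  | (?z, ?z) => idtac
  | (@nsum _ ?F, @nsum _ ?F) => idtac
  end.
Ltac madd cmp x l :=
  lazymatch l with
  | nil => constr:(cons x nil)
  | cons ?y ?t =>
      match goal with
      | _ => let _ := match goal with _ => cmp x y end in l
      | _ => let t' := madd cmp x t in constr:(cons y t')
      end
  end.
Ltac matoms cmp t l :=
  lazymatch t with
  | (?a + ?b)%R => let l' := matoms cmp a l in matoms cmp b l'
  | (- ?a)%R => matoms cmp a l
  | (?c *: ?a)%R => matoms cmp a l
  | 0%R => l
  | _ => madd cmp t l
  end.
Ltac mindex cmp x l :=
  lazymatch l with
  | cons ?y ?t =>
      match goal with
      | _ => let _ := match goal with _ => cmp x y end in constr:(O)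
      | _ => let n := mindex cmp x t in constr:(S n)
      end
  end.
Ltac mreify cmp K t l :=
  lazymatch t with
  | (?a + ?b)%R => let a' := mreify cmp K a l in let b' := mreify cmp K b l in constr:(@MAdd K a' b')
  | (- ?a)%R => let a' := mreify cmp K a l in constr:(@MOpp K a')
  | (?c *: ?a)%R => let a' := mreify cmp K a l in constr:(@MScale K c a')
  | 0%R => constr:(@MZero K)
  | _ => let n := mindex cmp t l in constr:(@MVar K n)
  end.
Ltac lmod_with cmp :=
  lazymatch goal with
  | |- @eq ?T ?x ?y =>
      let l0 := constr:(@nil T) in
      let l1 := matoms cmp x l0 in
      let l := matoms cmp y l1 in
      let K := lazymatch type of (fun e => @meval _ _ l e) with mexp ?K -> _ => K end in
      let ex := mreify cmp K x l in
      let ey := mreify cmp K y l in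
      apply: (@mexp_eq _ _ l ex ey);
      lazy [mall mcoef size Nat.eqb]; repeat split; try ring
  end.
Ltac lmod := solve [lmod_with msame].
Ltac lmodu := solve [lmod_with ltac:(fun x y => unify x y)].

Section LinearProp.
Context {K : pzRingType} {V V' : lmodType K}.
Implicit Types f g : V -> V'.

Lemma lin_intro f : (forall (c : K) u v, f (c *: u + v) = c *: f u + f v) -> linear f.
Proof. exact: id. Qed.

Lemma lin_elim f : linear f -> forall (c : K) u v, f (c *: u + v) = c *: f u + f v.
Proof. exact: id. Qed.

Lemma lin0 f : linear f -> f 0 = 0.
Proof.
by move/lin_elim => lf; have := lf (-1) 0 0; rewrite scaleN1r oppr0 addr0 scaleN1r addNr.
Qed.

Lemma linD f : linear f -> forall u v, f (u + v) = f u + f v.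
Proof. by move/lin_elim => lf u v; have := lf 1 u v; rewrite !scale1r. Qed.

Lemma linZ f : linear f -> forall (c : K) u, f (c *: u) = c *: f u.
Proof.
by move=> lf c u; have := lin_elim lf c u 0; rewrite !addr0 (lin0 lf) addr0.
Qed.

Lemma linN f : linear f -> forall u, f (- u) = - f u.
Proof. by move=> lf u; rewrite -scaleN1r (linZ lf) scaleN1r. Qed.

Lemma linB f : linear f -> forall u v, f (u - v) = f u - f v.
Proof. by move=> lf u v; rewrite (linD lf) (linN lf). Qed.

Lemma lin_big f : linear f -> forall I (r : seq I) (Q : pred I) (F : I -> V),
  f (\sum_(i <- r | Q i) F i) = \sum_(i <- r | Q i) f (F i).
Proof. by move=> lf I r Q F; apply: big_morph; [exact: linD|exact: lin0]. Qed.

Lemma lin_nsum f : linear f -> forall F, ev0 F -> f (nsum F) = nsum (fun i => f (F i)).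
Proof. by move=> lf F; apply: nsum_lin; [exact: lin0|exact: linD]. Qed.

Lemma lin_add f g : linear f -> linear g -> linear (fun v => f v + g v).
Proof.
move=> /lin_elim lf /lin_elim lg; apply: lin_intro => c u v.
by rewrite lf lg scalerDr -!addrA; congr (_ + _); rewrite addrCA.
Qed.

Lemma lin_opp f : linear f -> linear (fun v => - f v).
Proof.
by move=> /lin_elim lf; apply: lin_intro => c u v; rewrite lf opprD scalerN.
Qed.

Lemma lin_sub f g : linear f -> linear g -> linear (fun v => f v - g v).
Proof. by move=> lf lg; apply: lin_add => //; apply: lin_opp. Qed.

Lemma lin_sum I (r : seq I) (F : I -> V -> V') : (forall i, linear (F i)) ->
  linear (fun v => \sum_(i <- r) F i v).
Proof.
move=> lF; apply: lin_intro => c u v.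
by rewrite scaler_sumr -big_split; apply: eq_bigr => i _; apply: (lin_elim (lF i)).
Qed.

Lemma lin_if f : linear f -> forall (b : bool) (c : K) x,
  f (if b then c *: x else 0) = if b then c *: f x else 0.
Proof. by move=> lf [] c x; [rewrite (linZ lf)|rewrite (lin0 lf)]. Qed.

Lemma lin_cst0 : linear (fun _ : V => 0 : V').
Proof. by apply: lin_intro => c u v; rewrite scaler0 addr0. Qed.

End LinearProp.

Lemma lin_id (K : pzRingType) (V : lmodType K) : linear (fun v : V => v).
Proof. by []. Qed.

Lemma nsumZ (K : pzRingType) (V : lmodType K) (c : K) (F : nat -> V) : ev0 F ->
  nsum (fun i => c *: F i) = c *: nsum F.
Proof.
move=> eF; apply/esym; apply: (nsum_lin (f := fun v => c *: v)) => //.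
  exact: scaler0.
by move=> x y; rewrite scalerDr.
Qed.

Lemma ev0Z (K : pzRingType) (V : lmodType K) (c : K) (F : nat -> V) : ev0 F -> ev0 (fun i => c *: F i).
Proof. by move=> [N F0]; exists N => i /F0 ->; rewrite scaler0. Qed.

Lemma lin_scale (K : comPzRingType) (V V' : lmodType K) (a : K) (f : V -> V') : linear f -> linear (fun v => a *: f v).
Proof.
move=> /lin_elim lf; apply: lin_intro => c u v.
by rewrite lf scalerDr !scalerA mulrC.
Qed.

Lemma lin_comp (K : pzRingType) (V V' V'' : lmodType K) (f : V' -> V'') (g : V -> V') :
  linear f -> linear g -> linear (fun v => f (g v)).
Proof.
move=> /lin_elim lf /lin_elim lg; apply: lin_intro => c u v; by rewrite lg lf.
Qed.

(** * The Fock spaces and the Heisenberg algebra *)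

Section LinExt.
Context {R : realType}.
Local Notation C := R[i].

Lemma lin_extEw (V : lmodType C) (f : fock_basis -> V) (v : fock R)
    (d : {fset fock_basis}) :
  (msupp v `<=` d)%fset -> lin_ext f v = \sum_(b <- d) v@_b *: f b.
Proof.
move=> vd; rewrite /lin_ext (big_fset_incl _ vd)// => b _ bv.
by rewrite mcoeff_outdom// scale0r.
Qed.

Lemma lin_ext_is_linear (V : lmodType C) (f : fock_basis -> V) :
  linear (lin_ext f : fock R -> V).
Proof.
move=> c u v; pose d := (msupp u `|` msupp v)%fset.
rewrite (@lin_extEw _ _ _ d); last first.
  apply: fsubset_trans (msuppD_le _ _) _; apply: fsetSU; exact: msuppZ_le.
rewrite (@lin_extEw _ _ u d) ?fsubsetUl// (@lin_extEw _ _ v d) ?fsubsetUr//.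
rewrite scaler_sumr -big_split/=; apply: eq_bigr => b _.
by rewrite mcoeffD mcoeffZ scalerDl scalerA.
Qed.

HB.instance Definition _ (V : lmodType C) (f : fock_basis -> V) :=
  GRing.isLinear.Build C (fock R) V *:%R (lin_ext f) (lin_ext_is_linear f).

(* Basis vectors, sealed so that conversion never unfolds the finitely
   supported functions behind them. *)
Lemma bs_sig : {f : fock_basis -> fock R | f = fun b => << b >>}.
Proof. by eexists. Qed.
Definition bs := sval bs_sig.

Lemma bsE b : << b >> = bs b.
Proof. by rewrite /bs (svalP bs_sig). Qed.

Lemma mcoeff_bs b b' : (bs b)@_b' = (b == b')%:R.
Proof. by rewrite -bsE mcoeffU. Qed.

Lemma lin_extU (V : lmodType C) (f : fock_basis -> V) (b : fock_basis) :
  lin_ext f (bs b) = f b.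
Proof.
by rewrite -bsE /lin_ext msuppU oner_eq0 big_seq_fset1 mcoeffUU scale1r.
Qed.

Lemma fockE (v : fock R) : v = \sum_(b <- msupp v) v@_b *: bs b.
Proof.
rewrite {1}(monalgE v); apply: eq_bigr => b _; apply/malgP => k; rewrite -bsE.
by rewrite mcoeffZ !mcoeffU mulr_natr.
Qed.

Lemma fock_ind (P : fock R -> Prop) : P 0 ->
  (forall (c : C) u v, P u -> P v -> P (c *: u + v)) ->
  forall v, (forall b, v@_b != 0 -> P (bs b)) -> P v.
Proof.
move=> P0 Pl v Pb; rewrite (fockE v) big_seq.
apply: (big_ind P) => //.
- by move=> x y Px Py; rewrite -[x]scale1r; apply: Pl.
- move=> b; rewrite -mcoeff_neq0 => /Pb Pbb.
  by rewrite -[_ *: _]addr0; apply: Pl.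
Qed.

Lemma lin_eq (V : lmodType C) (f g : fock R -> V) : linear f -> linear g ->
  (forall b, f (bs b) = g (bs b)) -> f =1 g.
Proof.
move=> lf lg fg v.
apply: (@fock_ind (fun v => f v = g v)) => [|c x y fx fy|b _]; last exact: fg.
  by rewrite (lin0 lf) (lin0 lg).
by rewrite (lin_elim lf) (lin_elim lg) fx fy.
Qed.

Definition supp_in (P : fock_basis -> Prop) (v : fock R) :=
  forall b, v@_b != 0 -> P b.

Lemma supp_in0 P : supp_in P 0.
Proof. by move=> b; rewrite mcoeff0 eqxx. Qed.

Lemma supp_inP P (c : C) u v : supp_in P u -> supp_in P v -> supp_in P (c *: u + v).
Proof.
move=> Pu Pv b; rewrite mcoeffD mcoeffZ.
have [->|/Pu//] := eqVneq (u@_b) 0.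
by rewrite mulr0 add0r => /Pv.
Qed.

Lemma supp_inD P u v : supp_in P u -> supp_in P v -> supp_in P (u + v).
Proof. by move=> Pu Pv; rewrite -[u]scale1r; apply: supp_inP. Qed.

Lemma supp_inZ P (c : C) u : supp_in P u -> supp_in P (c *: u).
Proof. by move=> Pu; rewrite -[_ *: _]addr0; apply: supp_inP => //; exact: supp_in0. Qed.

Lemma supp_inB P u v : supp_in P u -> supp_in P v -> supp_in P (u - v).
Proof. by move=> Pu Pv; rewrite -scaleN1r; apply: supp_inD => //; exact: supp_inZ. Qed.

Lemma supp_in_sum P I (r : seq I) (Q : pred I) (F : I -> fock R) :
  (forall i, Q i -> supp_in P (F i)) -> supp_in P (\sum_(i <- r | Q i) F i).
Proof.
by move=> PF; apply: big_ind => //; [exact: supp_in0|exact: supp_inD].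
Qed.

Lemma supp_in_nsum P (F : nat -> fock R) :
  (forall i, supp_in P (F i)) -> supp_in P (nsum F).
Proof. by move=> PF; apply: supp_in_sum. Qed.

Lemma supp_inU (P : fock_basis -> Prop) b : P b -> supp_in P (bs b).
Proof. by move=> Pb b'; rewrite mcoeff_bs; have [<-//|_] := eqVneq b b'; rewrite eqxx. Qed.

Lemma supp_in_lin (P P' : fock_basis -> Prop) (f : fock R -> fock R) : linear f ->
  (forall b, P b -> supp_in P' (f (bs b))) ->
  forall v, supp_in P v -> supp_in P' (f v).
Proof.
move=> lf Pf v Pv; rewrite (fockE v) (lin_big lf) big_seq.
apply: supp_in_sum => b; rewrite -mcoeff_neq0 => /Pv Pb.
by rewrite (linZ lf); apply: supp_inZ; exact: Pf.
Qed.

Lemma supp_in_sub (P P' : fock_basis -> Prop) (v : fock R) :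
  (forall b, P b -> P' b) -> supp_in P v -> supp_in P' v.
Proof. by move=> PP' Pv b /Pv/PP'. Qed.

Lemma supp_in_eq0 (v : fock R) : supp_in (fun _ => False) v -> v = 0.
Proof.
by move=> Pv; apply/malgP => b; rewrite mcoeff0; apply/eqP/contraT => /Pv.
Qed.

End LinExt.

Section HeisBasis.
Context {R : realType} (p : nat).
Local Notation C := R[i].
Local Notation V := (fock R).

(** The same sealing as for [bs]: behind the opaque witness, [al] can only be unfolded through
    [alphaE]. The pattern recurs for the modes, the shift, omega and the functionals below. *)
Lemma alpha_sig : {f : int -> V -> V | f = Defs.alpha p}.
Proof. by eexists. Qed.
Definition al := sval alpha_sig.

Lemma alphaE : Defs.alpha p = al.
Proof. by rewrite /al (svalP alpha_sig). Qed.

Definition pp : C := (2 * p)%N%:R.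

Lemma alpha_lin n : linear (al n).
Proof. rewrite -alphaE; exact: linearP. Qed.
Lemma alphaZ n (c : C) v : al n (c *: v) = c *: al n v.
Proof. exact: (linZ (alpha_lin n)). Qed.
Lemma alphaD n u v : al n (u + v) = al n u + al n v.
Proof. exact: (linD (alpha_lin n)). Qed.
Lemma alpha0 n : al n 0 = 0.
Proof. exact: (lin0 (alpha_lin n)). Qed.

Lemma alpha0U b : al (Posz 0) (bs b) = ratr (2 * p%:R * b.2) *: bs b.
Proof. rewrite -alphaE -[bs _ in RHS]bsE; exact: lin_extU. Qed.

Lemma alphaPU k b : al k.+1 (bs b) =
  ((2 * p * k.+1 * b.1 k)%N%:R : C) *: bs ((b.1 `\ k)%mset, b.2).
Proof. rewrite -alphaE -[bs _ in RHS]bsE; exact: lin_extU. Qed.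

Lemma alphaNU k b : al (Negz k) (bs b) = bs ((k +` b.1)%mset, b.2).
Proof. rewrite -alphaE -[bs _ in RHS]bsE; exact: lin_extU. Qed.

End HeisBasis.

Lemma msetDB1 (K : choiceType) (A : {mset K}%mset) j k : j != k ->
  ((j +` A) `\ k = j +` (A `\ k))%mset.
Proof.
move=> jk; apply/msetP => x; rewrite msetB1E !mset1DE msetB1E.
case: (eqVneq x j) => [->|_]; last by rewrite !add0n.
by rewrite (negPf jk) !subn0.
Qed.

Lemma msetB1C (K : choiceType) (A : {mset K}%mset) j k :
  ((A `\ j) `\ k = (A `\ k) `\ j)%mset.
Proof. by apply/msetP => x; rewrite !msetB1E; lia. Qed.

Section Heisenberg.
Context {R : realType} (p : nat).
Local Notation C := R[i].
Local Notation V := (fock R).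
Local Notation alpha := (@al R p).
Local Notation pp := (@pp R p).

Lemma heis m n (v : V) : alpha m (alpha n v) =
  alpha n (alpha m v) + (if m + n == 0 then pp * m%:~R else 0) *: v.
Proof.
move: v; pose f v := alpha m (alpha n v) : V.
pose g v := alpha n (alpha m v) + (if m + n == 0 then pp * m%:~R else 0) *: v : V.
apply: (lin_eq (f := f) (g := g)); rewrite /f /g.
- apply: lin_comp; exact: alpha_lin.
- by apply: lin_add; [apply: lin_comp; exact: alpha_lin|apply: lin_scale; exact: lin_id].
move=> [A s]; case: m n {f g} => [[|m]|m] [[|n]|n].
- by rewrite addr0 eqxx mulr0 scale0r addr0.
- by rewrite add0r scale0r addr0 !(alphaPU, alpha0U, alphaZ) /= !scalerA mulrC.
- by rewrite add0r scale0r addr0 !(alphaNU, alpha0U, alphaZ).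
- by rewrite addr0 scale0r addr0 !(alphaPU, alpha0U, alphaZ) /= !scalerA mulrC.
- rewrite (_ : (_ == 0) = false) ?scale0r ?addr0; last by lia.
  rewrite !(alphaPU, alphaZ) /= !scalerA; case: (eqVneq m n) => [->//|mn].
  rewrite msetB1C -!natrM; congr (_%:R *: _).
  by rewrite !msetB1E (negPf mn) eq_sym (negPf mn) !subn0 mulnC.
- rewrite !(alphaNU, alphaPU, alphaZ) /= NegzE /=.
  have -> : (m.+1%:Z - n.+1%:Z == 0) = (m == n) by lia.
  (* For equal modes, annihilating after creating sees a multiplicity larger by one than
     annihilating first. This difference of one is the central term. *)
  case: (eqVneq m n) => [->|mn].
    rewrite mset1DE eqxx msetD1K /pp -[_%:~R]/(n.+1%:R) -natrM.
    case: (posnP (A n)) => [bn|bn].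
      by rewrite bn muln0 scale0r add0r addn0 muln1.
    have -> : (n +` (A `\ n))%mset = A by rewrite msetB1K// -mset_gt0.
    by rewrite -scalerDl -natrD mulnDr muln1 addnC.
  rewrite mset1DE (negPf mn) add0n msetDB1; last by rewrite eq_sym.
  by rewrite scale0r addr0.
- by rewrite addr0 scale0r addr0 !(alphaNU, alpha0U, alphaZ).
- rewrite !(alphaNU, alphaPU, alphaZ) /= NegzE /=.
  have -> : (- m.+1%:Z + n.+1%:Z == 0) = (n == m) by lia.
  case: (eqVneq n m) => [->|nm].
    rewrite mset1DE eqxx msetD1K /pp rmorphN/= -[m.+1%:~R]/(m.+1%:R) mulrN -natrM scaleNr.
    apply/eqP; rewrite eq_sym subr_eq; apply/eqP.
    case: (posnP (A m)) => [bn|bn].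
      by rewrite bn muln0 scale0r add0r addn0 muln1.
    have -> : (m +` (A `\ m))%mset = A by rewrite msetB1K// -mset_gt0.
    by rewrite -scalerDl -natrD mulnDr muln1 addnC.
  rewrite mset1DE (negPf nm) add0n msetDB1; last by rewrite eq_sym.
  by rewrite scale0r addr0.
- rewrite (_ : (_ == 0) = false) ?scale0r ?addr0; last by lia.
  by rewrite !alphaNU /= msetDCA.
Qed.

Lemma heisC m n (v : V) : m + n != 0 -> alpha m (alpha n v) = alpha n (alpha m v).
Proof. by move=> /negPf mn; rewrite heis mn scale0r addr0. Qed.

Lemma heis0 n (v : V) : alpha 0 (alpha n v) = alpha n (alpha 0 v).
Proof.
have [->//|n0] := eqVneq n 0.
by apply: heisC; rewrite add0r.
Qed.

End Heisenberg.

Section Fock.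
Context {R : realType} (p : nat).
Local Notation C := R[i].
Local Notation V := (fock R).
Local Notation alpha := (@al R p).
Local Notation pp := (@pp R p).

Definition es (s : rat) : V := bs (mset0, s).
Lemma e_E s : es s = bs (mset0, s). Proof. by []. Qed.

Lemma esE s : e_ s = es s.
Proof. exact: bsE. Qed.

Lemma mset_ind (P : {mset nat}%mset -> Prop) : P mset0 ->
  (forall k A, P A -> P (k +` A)%mset) -> forall A, P A.
Proof.
move=> P0 PS A; rewrite -(seq_mset_id A); elim: (enum_mset A) => [|k l IHl].
  by rewrite (_ : seq_mset [::] = mset0)//; apply/msetP => x; rewrite mset_seqE mset0E.
rewrite (_ : seq_mset (k :: l) = (k +` seq_mset l)%mset); first exact: PS.
by apply/msetP => x; rewrite mset1DE !mset_seqE/= eq_sym.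
Qed.

Lemma bs_ind s (P : V -> Prop) : P (es s) ->
  (forall k v, P v -> P (alpha (Negz k) v)) -> forall A, P (bs (A, s)).
Proof.
move=> P0 PS; elim/mset_ind => [|k A PA]; first by rewrite -e_E.
by rewrite -(alphaNU p k (A, s)); apply: PS.
Qed.

Definition chg (s : rat) : V -> Prop := supp_in (fun b => b.2 = s).

Lemma chg_ind s (P : V -> Prop) : P 0 ->
  (forall (c : C) u v, P u -> P v -> P (c *: u + v)) -> P (es s) ->
  (forall k v, chg s v -> P v -> P (alpha (Negz k) v)) ->
  forall v, chg s v -> P v.
Proof.
move=> P0 Pl Pe Pa v cv; apply: fock_ind => // -[A t] /cv /= ->.
have [] // : chg s (bs (A, s)) /\ P (bs (A, s)).
elim/mset_ind: A => [|k A [cA PA]]; first by rewrite -e_E; split => //; rewrite e_E; exact: supp_inU.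
by rewrite -(alphaNU p k (A, s)); split; [rewrite alphaNU; exact: supp_inU|exact: Pa].
Qed.

Lemma chg_e s : chg s (es s). Proof. by rewrite e_E; exact: supp_inU. Qed.

Lemma alpha_chg n s v : chg s v -> chg s (alpha n v).
Proof.
apply: (supp_in_lin (alpha_lin p n)) => -[A t] /= ->.
case: n => [[|k]|k].
- rewrite alpha0U; apply: supp_inZ; exact: supp_inU.
- rewrite alphaPU; apply: supp_inZ; exact: supp_inU.
- rewrite alphaNU; exact: supp_inU.
Qed.

Lemma alpha0_chg s v : chg s v -> alpha 0 v = (pp * ratr s) *: v.
Proof.
move=> cv; move: v cv; apply: chg_ind.
- by rewrite alpha0 scaler0.
- move=> c u v eu ev; rewrite alphaD alphaZ eu ev.
  by rewrite scalerDr !scalerA mulrC.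
- by rewrite e_E (alpha0U p (_, _))/= !rmorphM/= !ratr_nat /pp natrM.
- by move=> k v _ ev; rewrite heis0 ev alphaZ.
Qed.

(** The conformal weight of e^(s alpha) for the shifted omega. *)
Definition hw (s : rat) : rat := p%:R * s ^+ 2 - (p%:R - 1) * s.

Lemma hwD r s : hw (r + s) = hw r + hw s + 2 * p%:R * r * s.
Proof. by rewrite /hw; ring. Qed.

Definition lev (A : {mset nat}%mset) : nat := (\sum_(k <- enum_mset A) k.+1)%N.

Lemma lev0 : lev mset0 = 0%N.
Proof. by rewrite /lev enum_mset0 big_nil. Qed.

Lemma enum_msetD1 (K : choiceType) (k : K) (A : {mset K}%mset) :
  perm_eq (enum_mset (k +` A)%mset) (k :: enum_mset A).
Proof.
apply/allP => x _ /=; apply/eqP; rewrite !count_mem_mset mset1DE eq_sym.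
by rewrite -count_mem_mset.
Qed.

Lemma levD k A : lev (k +` A)%mset = (k.+1 + lev A)%N.
Proof. by rewrite /lev (perm_big _ (enum_msetD1 k A)) big_cons. Qed.

(** The weight is read off the basis monomials, before any Virasoro operator exists; that it is the
    eigenvalue of L(0) is [L0_wh]. *)
Definition wh (s w : rat) : V -> Prop :=
  supp_in (fun b => b.2 = s /\ (lev b.1)%:R + hw s = w).

Lemma wh_chg s w v : wh s w v -> chg s v.
Proof. by apply: supp_in_sub => b []. Qed.

Lemma wh_e s : wh s (hw s) (es s).
Proof. by rewrite e_E; apply: supp_inU; rewrite lev0 add0r. Qed.

Lemma alpha_wh n s w v : wh s w v -> wh s (w - n%:~R) (alpha n v).
Proof.
apply: (supp_in_lin (alpha_lin p n)) => -[A t] /= [-> <-].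
case: n => [[|k]|k].
- by rewrite alpha0U; apply: supp_inZ; apply: supp_inU; rewrite subr0.
- rewrite alphaPU; case: (posnP (A k)) => /= [->|Ak].
    by rewrite muln0 scale0r; exact: supp_in0.
  apply: supp_inZ; apply: supp_inU; split => //=.
  have -> : lev A = (k.+1 + lev (A `\ k)%mset)%N by rewrite -levD msetB1K// -mset_gt0.
  by rewrite natrD -[_%:~R]/(k.+1%:R); ring.
- by rewrite alphaNU; apply: supp_inU; split => //=; rewrite levD NegzE rmorphN natrD/=; ring.
Qed.

Lemma wh_lt0 s w v : wh s w v -> w < hw s -> v = 0.
Proof.
move=> wv ws; apply: supp_in_eq0; apply: supp_in_sub wv => -[A t] /= [_ e].
by move: ws; rewrite -e gtrDr ltNge ler0n.
Qed.

Lemma wh_ind (P : V -> Prop) : P 0 ->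
  (forall (c : C) u v, P u -> P v -> P (c *: u + v)) ->
  (forall s w v, wh s w v -> P v) -> forall v, P v.
Proof.
move=> P0 Pl Pw v; apply: fock_ind => // -[A s] _.
by apply: (Pw s ((lev A)%:R + hw s)); apply: supp_inU.
Qed.

Lemma mcoeff_alphaP k v A s : (alpha k.+1 v)@_(A, s) =
  (2 * p * k.+1 * (A k).+1)%N%:R * v@_((k +` A)%mset, s).
Proof.
apply: (fock_ind (P := fun v => (alpha k.+1 v)@_(A, s) = _ * v@_(_, s))) => [|c u w eu ew|[B t] _].
- by rewrite alpha0 !mcoeff0 mulr0.
- by rewrite alphaD alphaZ !(mcoeffD, mcoeffZ) eu ew; ring.
rewrite alphaPU mcoeffZ !mcoeff_bs !xpair_eqE/=.
case: (eqVneq t s) => [_|_]; last by rewrite !andbF !mulr0.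
rewrite !andbT; case: (posnP (B k)) => Bk.
  rewrite Bk muln0 mul0r; case: eqP => [e|_]; last by rewrite mulr0.
  by move: Bk; rewrite e mset1DE eqxx; discriminate.
have -> : ((B `\ k)%mset == A) = (B == (k +` A)%mset).
  apply/eqP/eqP => [<-|->]; last by rewrite msetD1K.
  by rewrite msetB1K// -mset_gt0.
case: eqP => [->|_]; last by rewrite !mulr0.
by rewrite mset1DE eqxx.
Qed.

Lemma mcoeff_alphaN k v A s : (alpha (Negz k) v)@_(A, s) =
  if (0 < A k)%N then v@_((A `\ k)%mset, s) else 0.
Proof.
apply: (fock_ind (P := fun v => (alpha (Negz k) v)@_(A, s) = if (0 < A k)%N then v@_((A `\ k)%mset, s) else 0)) => [|c u w eu ew|[B t] _].
- by rewrite alpha0 !mcoeff0; case: ifP.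
- rewrite alphaD alphaZ !(mcoeffD, mcoeffZ) eu ew; case: ifP => _ //.
  by rewrite mulr0 addr0.
rewrite alphaNU !mcoeff_bs !xpair_eqE/=.
case: ifP => kA.
  congr ((nat_of_bool (_ && _))%:R); apply/eqP/eqP => [<-|->]; first by rewrite msetD1K.
  by rewrite msetB1K// -mset_gt0.
by case: eqP => [e|//=]; move: kA; rewrite -e mset1DE eqxx.
Qed.

Hypothesis p0 : (0 < p)%N.

Definition alphas (l : seq nat) (v : V) : V := foldr (fun k => alpha k.+1) v l.

Lemma alphas_lin l : linear (alphas l).
Proof.
elim: l => [|k l IHl]; first exact: lin_id.
by apply: (lin_comp (alpha_lin p k.+1)).
Qed.

Lemma mcoeff_alphas l A v s : exists2 c : C, c != 0 &
  (alphas l v)@_(A, s) = c * v@_((seq_mset l `+` A)%mset, s).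
Proof.
elim: l A => [|k l IHl] A /=.
  exists 1; rewrite ?oner_eq0// mul1r; congr (v@_(_, _)).
  by apply/msetP => x; rewrite msetE2 mset_seqE.
rewrite mcoeff_alphaP; have [c c0 ->] := IHl (k +` A)%mset.
exists ((2 * p * k.+1 * (A k).+1)%N%:R * c).
  by rewrite mulf_neq0// pnatr_eq0 !muln_eq0/= orbF; case: (p) p0.
rewrite mulrA; congr (_ * v@_(_, _)).
apply/msetP => x; rewrite (msetE2 (seq_mset l)) mset1DE msetE2 !mset_seqE/= (eq_sym x k) addnCA addnA.
by [].
Qed.

(** Applying the annihilation operators of a monomial brings its coefficient, up to a non-zero
    scalar, to the ground position; hence ground coefficients see the whole vector. *)
Lemma alphas_eq0 s v : chg s v ->
  (forall l, (alphas l v)@_(mset0, s) = 0) -> v = 0.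
Proof.
move=> cv av; apply/malgP => -[A t]; rewrite mcoeff0; apply/eqP/contraT => vA.
have /= ts := cv _ vA; subst t.
have [c c0 e] := mcoeff_alphas (enum_mset A) mset0 v s.
move: vA; rewrite av in e; have := esym e; rewrite seq_mset_id msetD0.
by move/eqP; rewrite mulf_eq0 (negPf c0) => /= ->.
Qed.

(* Stone-von Neumann principle: operators whose commutators with the
   Heisenberg algebra stay in their span are determined by their ground
   matrix coefficients. *)
Lemma heis_unique (I : Type) (Z : I -> V -> V) s t :
  (forall i, linear (Z i)) ->
  (forall i v, chg s v -> chg t (Z i v)) ->
  (forall i k, exists l : seq (C * I), forall v, chg s v ->
     alpha k (Z i v) = Z i (alpha k v) + \sum_(x <- l) x.1 *: Z x.2 v) ->
  (forall i, (Z i (es s))@_(mset0, t) = 0) ->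
  forall i v, chg s v -> Z i v = 0.
Proof.
move=> lZ cZ comm gr.
(* Annihilation operators kill the ground vector, so moving one through [Z i] leaves only other
   [Z j] on the same vector. Induction on their number ends at ground coefficients, and [alphas_eq0]
   applies. Creation operators then spread the vanishing to the whole charge sector. *)
have step1 i : Z i (es s) = 0.
  apply: (@alphas_eq0 t); first exact/cZ/chg_e.
  move=> l; elim/last_ind: l i => [|l k IHl] i /=; first exact: gr.
  rewrite /alphas foldr_rcons -/(alphas _ _).
  have [c ->] := comm i k.+1; last exact: chg_e.
  rewrite (_ : alpha k.+1 (es s) = 0); last first.
    by rewrite e_E alphaPU mset0E muln0 scale0r.
  rewrite (lin0 (lZ i)) add0r (lin_big (alphas_lin l)) raddf_sum/= big1// => x _.
  by rewrite (linZ (alphas_lin l)) mcoeffZ IHl mulr0.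
move=> i v cv; elim/chg_ind: v / cv i => [i|c u v IHu IHv i|//|k v cv IHv i].
- exact: (lin0 (lZ i)).
- by rewrite (lin_elim (lZ i)) IHu IHv scaler0 addr0.
- have [l] := comm i (Negz k); move=> /(_ v cv); rewrite IHv alpha0 big1 ?addr0//.
  by move=> x _; rewrite IHv scaler0.
Qed.

End Fock.

(** * Vertex operators of exponentials *)

Section Exponentials.
Context {R : realType} (p : nat).
Local Notation C := R[i].
Local Notation V := (fock R).
Local Notation alpha := (@al R p).
Local Notation pp := (@pp R p).
Local Notation es := (@es R).
Local Notation wh := (@wh R p).

Lemma big_ord_widen0 (W : zmodType) (F : nat -> W) m n : (m <= n)%N ->
  (forall i, (m <= i)%N -> F i = 0) -> \sum_(i < m) F i = \sum_(i < n) F i.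
Proof.
move=> mn F0; rewrite -(nsumE F0); apply: nsumE => i ni.
by apply: F0; apply: leq_trans ni.
Qed.

Lemma fsum_graph (W : zmodType) (G : nat -> nat -> W) (D : set (nat * nat)) (c : int) N :
  (forall jk, D jk <-> jk.1%:Z = jk.2%:Z + c) ->
  (forall j k, (N <= k)%N -> G j k = 0) ->
  \sum_(jk \in D) G jk.1 jk.2 =
  \sum_(k < N) (if k%:Z + c is Posz j then G j k else 0).
Proof.
move=> DP G0.
pose r0 := [seq (`|(k%:Z + c)%R|%N, k) | k <- [seq k <- iota 0 N | 0 <= k%:Z + c]].
rewrite (fsbigE r0); first last.
- move=> [j k] /DP /= jk r0jk; have [kN|/G0 -> //] := ltnP k N.
  case/negP: r0jk; apply/mapP; exists k; last by rewrite -jk.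
  by rewrite mem_filter mem_iota add0n kN andbT -jk.
- move=> [j k] /= /mapP[k']; rewrite mem_filter => /andP[k'c _] [-> ->].
  by apply/DP => /=; rewrite gez0_abs.
- by rewrite map_inj_uniq ?filter_uniq ?iota_uniq// => x y [].
rewrite big_map big_filter_cond -(big_mkord xpredT (fun k => if k%:Z + c is Posz j then G j k else 0)).
rewrite /index_iota subn0 big_mkcond; apply: eq_bigr => k _.
have kD : 0 <= k%:Z + c -> (`|(k%:Z + c)%R|%N, k) \in D.
  by move=> h; rewrite inE; apply/DP => /=; rewrite gez0_abs.
by case: (k%:Z + c) kD => j //= -> .
Qed.

Section Series.
Variable a : op_series V.
Hypothesis la : forall k, linear (a k).
Hypothesis a0 : forall v, a 0%N v = 0.
Let P j := iter j (op_series_mul a) (@op_series1 R V).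

Lemma ser_lin j k : linear (P j k).
Proof.
elim: j k => [|j IHj] k.
  rewrite /P /= /op_series1; case: eqP => _; [exact: lin_id|exact: lin_cst0].
by apply: lin_sum => i; apply: (lin_comp (la i)); exact: IHj.
Qed.

Lemma ser_gt j k v : (k < j)%N -> P j k v = 0.
Proof.
elim: j k v => // j IHj k v kj; rewrite /P/= /op_series_mul big1// => -[[|i] /= ik] _.
  exact: a0.
rewrite -[iter j _ _ _ _]/(P j (k - i.+1)%N v) IHj ?(lin0 (la _))//; lia.
Qed.

Lemma exp_lin k : linear (op_series_exp a k).
Proof. by apply: lin_sum => j; apply: lin_scale; apply: ser_lin. Qed.

Lemma exp_0 v : op_series_exp a 0 v = v.
Proof.
rewrite /op_series_exp big_ord_recl big_ord0 addr0 /= fact0 invr1 scale1r.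
by rewrite /op_series1 eqxx.
Qed.

(** When [T, a(z)] is the scalar series c z^m, the Leibniz rule gives [T, a(z)^j] = j c z^m
    a(z)^(j-1). Dividing by j! and summing yields [exp_comm]: the exponential is multiplied by c
    z^m. *)
Lemma ser_comm (T : V -> V) (m : nat) (c : C) : linear T -> (0 < m)%N ->
  (forall k v, T (a k v) = a k (T v) + (if k == m then c else 0) *: v) ->
  forall j k v, T (P j k v) = P j k (T v) +
    (if (m <= k)%N then (j%:R * c) *: P j.-1 (k - m)%N v else 0).
Proof.
move=> lT m0 Ta; elim=> [|j IHj] k v /=.
  rewrite /P /= /op_series1; case: eqP => [->|_].
    by rewrite leqn0 (gtn_eqF m0) addr0.
  by rewrite (lin0 lT) mul0r scale0r if_same addr0.
rewrite /op_series_mul (lin_big lT).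
under eq_bigr do rewrite Ta IHj.
under eq_bigr do rewrite (linD (la _)).
rewrite big_split/= big_split/= -addrA; congr (_ + _).
case: leqP => mk; last first.
  rewrite big1 ?add0r => [|i _]; last first.
    by rewrite leqNgt (leq_ltn_trans (leq_subr _ _) mk)/= (lin0 (la _)).
  by rewrite big1// => -[i ik] _ /=; rewrite ltn_eqF ?scale0r//; lia.
have -> : \sum_(i < k.+1) (if i == m :> nat then c else 0) *: P j (k - i)%N v =
    c *: P j (k - m)%N v.
  have mk1 : (m < k.+1)%N by [].
  rewrite (bigD1 (Ordinal mk1))//= eqxx big1 ?addr0// => i.
  by rewrite -val_eqE/= => /negPf ->; rewrite scale0r.
rewrite -[j.+1]addn1 natrD mulrDl mul1r scalerDl; congr (_ + _).
case: j IHj => [|j] IHj.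
  rewrite mul0r scale0r big1// => i _; case: ifP => _; rewrite ?mul0r ?scale0r (lin0 (la _))//.
rewrite -[P j.+1 (k - m)%N v]/(\sum_(i < (k - m).+1) a i (P j (k - m - i)%N v)) scaler_sumr /=.
transitivity (\sum_(i < k.+1) if (i <= k - m)%N then (j.+1%:R * c) *: a i (P j (k - m - i)%N v) else 0); last first.
  rewrite -(@big_ord_widen0 _ (fun i => if (i <= k - m)%N then (j.+1%:R * c) *: a i (P j (k - m - i)%N v) else 0) (k - m).+1).
  - by apply: eq_bigr => -[i ik] _ /=; rewrite -ltnS ik.
  - by rewrite ltnS leq_subr.
  - by move=> i; rewrite ltnNge => /negPf ->.
apply: eq_bigr => -[i ik] _ /=.
rewrite (_ : (m <= k - i)%N = (i <= k - m)%N); last by lia.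
by rewrite (lin_if (la i)) subnAC.
Qed.

Lemma exp_comm (T : V -> V) (m : nat) (c : C) : linear T -> (0 < m)%N ->
  (forall k v, T (a k v) = a k (T v) + (if k == m then c else 0) *: v) ->
  forall k v, T (op_series_exp a k v) = op_series_exp a k (T v) +
    (if (m <= k)%N then c *: op_series_exp a (k - m)%N v else 0).
Proof.
move=> lT m0 Ta k v; rewrite {1}/op_series_exp (lin_big lT).
under eq_bigr => j _ do rewrite (linZ lT) (ser_comm lT m0 Ta) scalerDr.
rewrite big_split/=; congr (_ + _).
case: leqP => mk; last by rewrite big1// => i _; rewrite scaler0.
rewrite big_ord_recl /= mul0r scale0r scaler0 add0r /op_series_exp scaler_sumr.
rewrite [RHS](@big_ord_widen0 _ (fun j => c *: ((j`!%:R : C)^-1 *: P j (k - m)%N v)) _ k); first last.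
- by move=> i ki; rewrite ser_gt ?scaler0.
- by lia.
apply: eq_bigr => -[j jk] _ /=; rewrite /bump/= add1n.
rewrite !scalerA; congr (_ *: _).
rewrite factS natrM invfM mulrAC mulrA mulVf ?pnatr_eq0// mul1r mulrC.
by [].
Qed.

End Series.

Lemma exp_wh (a : op_series V) s (f : nat -> rat) :
  f 0%N = 0 -> (forall i j, f (i + j)%N = f i + f j) ->
  (forall k w v, wh s w v -> wh s (w + f k) (a k v)) ->
  forall k w v, wh s w v -> wh s (w + f k) (op_series_exp a k v).
Proof.
move=> f0 fD awh k w v wv; apply: supp_in_sum => j _; apply: supp_inZ.
case: j => j _ /=; elim: j k w v wv => [|j IHj] k w v wv /=.
  rewrite /op_series1; case: eqP => [->|_]; last exact: supp_in0.
  by rewrite f0 addr0.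
apply: supp_in_sum => -[i ik] _ /=.
have -> : f k = f (k - i)%N + f i by rewrite -fD subnK.
by rewrite addrA; apply: awh; exact: IHj.
Qed.

Local Notation Ep r := (@exp_creation R p r).
Local Notation Em r := (@exp_annihilation R p r).

Let ap r : op_series V := fun n v => (ratr r / n%:R : C) *: alpha (- n%:Z) v.
Let am r : op_series V := fun n v => - (ratr r / n%:R : C) *: alpha n%:Z v.

Lemma EpE r : Ep r = op_series_exp (ap r).
Proof. by rewrite /exp_creation alphaE. Qed.

Lemma EmE r : Em r = op_series_exp (am r).
Proof. by rewrite /exp_annihilation alphaE. Qed.

Lemma ap_lin r k : linear (ap r k).
Proof. apply: lin_scale; exact: alpha_lin. Qed.

Lemma am_lin r k : linear (am r k).
Proof. apply: lin_scale; exact: alpha_lin. Qed.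

Lemma ap0 r v : ap r 0%N v = 0.
Proof. by rewrite /ap invr0 mulr0 scale0r. Qed.

Lemma am0 r v : am r 0%N v = 0.
Proof. by rewrite /am invr0 mulr0 oppr0 scale0r. Qed.

Lemma Ep_lin r k : linear (Ep r k).
Proof. rewrite EpE; apply: exp_lin; exact: ap_lin. Qed.

Lemma Em_lin r k : linear (Em r k).
Proof. rewrite EmE; apply: exp_lin; exact: am_lin. Qed.

Lemma Ep_0 r v : Ep r 0%N v = v. Proof. by rewrite EpE exp_0. Qed.
Lemma Em_0 r v : Em r 0%N v = v. Proof. by rewrite EmE exp_0. Qed.

Lemma Ep_wh r k s w v : wh s w v -> wh s (w + k%:R) (Ep r k v).
Proof.
rewrite EpE; apply: exp_wh => [//|i j|{}k {}w {}v wv]; first by rewrite natrD.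
apply: supp_inZ; have := @alpha_wh R p (- k%:Z) _ _ _ wv.
by rewrite rmorphN/= opprK.
Qed.

Lemma Em_wh r k s w v : wh s w v -> wh s (w - k%:R) (Em r k v).
Proof.
rewrite EmE; apply: (exp_wh (f := fun k => - k%:R)) => [|i j|{}k {}w {}v wv].
- by rewrite oppr0.
- by rewrite natrD opprD.
- by apply: supp_inZ; have := @alpha_wh R p k _ _ _ wv.
Qed.

Lemma alphaP_Ep r m k v : alpha m.+1 (Ep r k v) = Ep r k (alpha m.+1 v) +
  (if (m < k)%N then (pp * ratr r) *: Ep r (k - m.+1)%N v else 0).
Proof.
rewrite EpE; apply: exp_comm => //; [exact: ap_lin|exact: ap0|exact: alpha_lin|].
move=> {}k {}v; rewrite /ap alphaZ heis scalerDr scalerA; congr (_ + _ *: _).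
have -> : (m.+1%:Z - k%:Z == 0) = (k == m.+1) by lia.
case: eqP => [->|_]; last by rewrite mulr0.
by rewrite mulrCA -mulrA mulVf ?mulr1// pnatr_eq0.
Qed.

Lemma alphaN_Ep r m k v : alpha (- m%:Z) (Ep r k v) = Ep r k (alpha (- m%:Z) v).
Proof.
have Hc k' v' : alpha (- m%:Z) (ap r k' v') = ap r k' (alpha (- m%:Z) v') + (if k' == 1%N then 0 else 0) *: v'.
  rewrite if_same scale0r addr0 /ap alphaZ.
  case: k' => [|k']; first by rewrite invr0 mulr0 ?oppr0 !scale0r.
  by rewrite heisC//; lia.
by rewrite EpE (exp_comm (ap_lin r) (ap0 r) (alpha_lin p _) (m := 1%N) isT Hc) scale0r if_same addr0.
Qed.

Lemma alphaP_Em r m k v : alpha m%:Z (Em r k v) = Em r k (alpha m%:Z v).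
Proof.
have Hc k' v' : alpha m%:Z (am r k' v') = am r k' (alpha m%:Z v') + (if k' == 1%N then 0 else 0) *: v'.
  rewrite if_same scale0r addr0 /am alphaZ.
  case: k' => [|k']; first by rewrite invr0 mulr0 ?oppr0 !scale0r.
  by rewrite heisC//; lia.
by rewrite EmE (exp_comm (am_lin r) (am0 r) (alpha_lin p _) (m := 1%N) isT Hc) scale0r if_same addr0.
Qed.

Lemma alphaN_Em r m k v : alpha (- m.+1%:Z) (Em r k v) =
  Em r k (alpha (- m.+1%:Z) v) +
  (if (m < k)%N then (pp * ratr r) *: Em r (k - m.+1)%N v else 0).
Proof.
rewrite EmE; apply: exp_comm => //; [exact: am_lin|exact: am0|exact: alpha_lin|].
move=> {}k {}v; rewrite /am alphaZ heis scalerDr scalerA; congr (_ + _ *: _).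
have -> : (- m.+1%:Z + k%:Z == 0) = (k == m.+1) by lia.
case: eqP => [->|_]; last by rewrite mulr0.
by rewrite mulrNz mulNr !mulrN opprK mulrCA -mulrA mulVf ?mulr1// pnatr_eq0.
Qed.

(** Extending the creation series by 0 to negative indices removes all side conditions from the
    commutators with alpha(n). *)
Definition Ez r (c : int) v : V := if c is Posz k then Ep r k v else 0.

Lemma Ez_lin r c : linear (Ez r c).
Proof. case: c => k; [exact: Ep_lin|exact: lin_cst0]. Qed.

Lemma Ez_wh r c s w v : wh s w v -> wh s (w + c%:~R) (Ez r c v).
Proof. case: c => k; [exact: Ep_wh|by move=> _; exact: supp_in0]. Qed.

Lemma alphaP_Ez r m c v : alpha m.+1 (Ez r c v) = Ez r c (alpha m.+1 v) +
  (pp * ratr r) *: Ez r (c - m.+1%:Z) v.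
Proof.
case: c => k /=; last first.
  by rewrite alpha0 scaler0 addr0.
rewrite alphaP_Ep; case: ltnP => mk.
  by rewrite (_ : k%:Z - _ = (k - m.+1)%N) //; lia.
by rewrite (_ : k%:Z - _ = Negz (m - k)) ?scaler0//; lia.
Qed.

Lemma alphaN_Ez r m c v : alpha (- m%:Z) (Ez r c v) = Ez r c (alpha (- m%:Z) v).
Proof. by case: c => k /=; [exact: alphaN_Ep|exact: alpha0]. Qed.

Lemma shift_sig : {f : rat -> V -> V | f = @Defs.shift R}.
Proof. by eexists. Qed.
Definition sh := sval shift_sig.
Lemma shiftE : @Defs.shift R = sh. Proof. by rewrite /sh (svalP shift_sig). Qed.
Local Notation shift := sh.

Lemma exp_mode_sig : {f : rat -> int -> V -> V | f = @Defs.exp_mode R p}.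
Proof. by eexists. Qed.
Definition em := sval exp_mode_sig.
Lemma exp_modeE0 : @Defs.exp_mode R p = em. Proof. by rewrite /em (svalP exp_mode_sig). Qed.

Lemma shift_lin r : linear (shift r).
Proof. rewrite -shiftE; exact: lin_ext_is_linear. Qed.

Lemma shiftU r A s : shift r (bs (A, s)) = bs (A, r + s) :> V.
Proof. rewrite -shiftE -[bs _ in RHS]bsE; exact: lin_extU. Qed.

Lemma shift_wh r s w v : wh s w v -> wh (r + s) (w - hw p s + hw p (r + s)) (shift r v).
Proof.
apply: (supp_in_lin (shift_lin r)) => -[A t] /= [-> <-].
by rewrite shiftU; apply: supp_inU => /=; split => //; ring.
Qed.

Lemma shift_chg r s (v : V) : chg s v -> chg (r + s) (shift r v).
Proof.
apply: (supp_in_lin (shift_lin r)) => -[A t] /= ->.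
by rewrite shiftU; apply: supp_inU.
Qed.

Lemma alpha_shift n r v : n != 0 -> alpha n (shift r v) = shift r (alpha n v).
Proof.
move=> n0; apply: (lin_eq (f := fun v => alpha n (shift r v)) (g := fun v => shift r (alpha n v))).
- apply: lin_comp; [exact: alpha_lin|exact: shift_lin].
- apply: lin_comp; [exact: shift_lin|exact: alpha_lin].
move=> [A s]; case: n n0 => [[//|k]|k] _.
- by rewrite alphaPU shiftU alphaPU (linZ (shift_lin r)) shiftU.
- by rewrite alphaNU !shiftU alphaNU.
Qed.

Lemma exp_mode_lin r n : linear (em r n).
Proof. rewrite -exp_modeE0; exact: lin_ext_is_linear. Qed.

Lemma exp_mode_bs r n b : em r n (bs b) =
  \sum_(jk \in [set jk : nat * nat |
     jk.1%:R - jk.2%:R + 2 * p%:R * r * b.2 = - n%:~R - 1 :> rat])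
      shift r (Ep r jk.1 (Em r jk.2 (bs b))).
Proof.
rewrite -exp_modeE0 -shiftE /Defs.exp_mode lin_extU; apply: eq_fsbigr => jk _; by rewrite bsE.
Qed.

Lemma Em_big r A s k : (lev A < k)%N -> Em r k (bs (A, s)) = 0.
Proof.
move=> Ak; apply: (@wh_lt0 _ p s ((lev A)%:R + hw p s - k%:R)).
  by apply: Em_wh; exact: supp_inU.
by rewrite addrAC gtrDr subr_lt0 ltr_nat.
Qed.

Lemma Em_ev0 r v : ev0 (fun k => Em r k v).
Proof.
move: v; apply: (wh_ind (p := p)) => [|c u v [N uN] [M vM]|s w v wv].
- by exists 0%N => i _; rewrite (lin0 (Em_lin r i)).
- exists (maxn N M) => i; rewrite geq_max => /andP[/uN eu /vM ev].
  by rewrite (lin_elim (Em_lin r i)) eu ev scaler0 addr0.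
have [N Nw] : exists N : nat, w - N%:R < hw p s.
  exists (Num.bound `|w - hw p s|); rewrite ltrBlDl -ltrBlDr.
  exact: (le_lt_trans (ler_norm _) (archi_boundP (normr_ge0 _))).
exists N => i Ni; apply: (wh_lt0 (Em_wh wv)).
by apply: le_lt_trans Nw; rewrite lerD2l lerN2 ler_nat.
Qed.

(** On a fixed charge the integer c is the power of z that creation minus annihilation has to
    supply, once z^(r alpha(0)) has been accounted for. *)
Lemma exp_modeE r n s (c : int) v : chg s v ->
  - n%:~R - 1 - 2 * p%:R * r * s = c%:~R :> rat ->
  em r n v = nsum (fun k => shift r (Ez r (k%:Z + c) (Em r k v))).
Proof.
move=> cv e; have ev k u : Em r k u = 0 -> shift r (Ez r (k%:Z + c) (Em r k u)) = 0.
  by move=> ->; rewrite (lin0 (Ez_lin _ _)) (lin0 (shift_lin _)).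
have evE u : ev0 (fun k => shift r (Ez r (k%:Z + c) (Em r k u))).
  by have [N uN] := Em_ev0 r u; exists N => i /uN; exact: ev.
have lZ k : linear (fun v => shift r (Ez r (k%:Z + c) (Em r k v))).
  apply: (lin_comp (shift_lin r)); apply: (lin_comp (Ez_lin r _)); exact: Em_lin.
apply: (fock_ind (P := fun v => em r n v = nsum (fun k => shift r (Ez r (k%:Z + c) (Em r k v))))).
- by rewrite (lin0 (exp_mode_lin r n)) nsum0// => i; rewrite (lin0 (lZ i)).
- move=> x u w eu ew; rewrite (lin_elim (exp_mode_lin r n)) eu ew.
  under [in RHS]eq_nsum do rewrite (lin_elim (lZ _)).
  rewrite nsumD//; last by apply: (ev0_lin (f := fun u => x *: u)); rewrite ?scaler0.
  congr (_ + _); apply: (nsum_lin (f := fun u => x *: u)) => //; first exact: scaler0.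
  by move=> a b; rewrite scalerDr.
move=> [A t] /cv /= ->; rewrite exp_mode_bs/=.
set D := [set jk : nat * nat | _].
have DP jk : D jk <-> jk.1%:Z = jk.2%:Z + c.
  rewrite /D/=; split => [h|h].
    apply: (@intr_inj rat); rewrite rmorphD/= -e -h; ring.
  have -> : jk.1%:R = jk.2%:R + c%:~R :> rat by rewrite -[jk.1%:R]/(jk.1%:~R) h rmorphD.
  rewrite -e; ring.
rewrite (fsum_graph (G := fun j k => shift r (Ep r j (Em r k (bs (A, s))))) (N := (lev A).+1) DP); last first.
  by move=> j k /Em_big ->; rewrite (lin0 (Ep_lin _ _)) (lin0 (shift_lin _)).
rewrite (@nsumE _ _ (lev A).+1); last by move=> k Nk; apply: ev; rewrite Em_big.
apply: eq_bigr => k _; rewrite /Ez; case: (k%:Z + c) => j //.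
by rewrite (lin0 (shift_lin _)).
Qed.

Lemma exp_mode_nint r n s (v : V) : chg s v ->
  (forall c : int, - n%:~R - 1 - 2 * p%:R * r * s != c%:~R :> rat) ->
  em r n v = 0.
Proof.
move=> cv nc; apply: (fock_ind (P := fun v => em r n v = 0)).
- exact: (lin0 (exp_mode_lin r n)).
- by move=> c u w eu ew; rewrite (lin_elim (exp_mode_lin r n)) eu ew scaler0 addr0.
move=> [A t] /cv /= ->; rewrite exp_mode_bs/= fsbig1// => -[j k] /= h.
by have /eqP[] := nc (j%:Z - k%:Z); rewrite -h rmorphB/=; ring.
Qed.

Lemma exp_mode_wh r n s w v : wh s w v ->
  wh (r + s) (w + hw p r - n%:~R - 1) (em r n v).
Proof.
move=> wv; have cv := wh_chg wv.
have [[c e]|nc] := pselect (exists c : int, - n%:~R - 1 - 2 * p%:R * r * s = c%:~R :> rat).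
  rewrite (exp_modeE cv e); apply: supp_in_nsum => k.
  have := shift_wh (r := r) (Ez_wh (r := r) (c := k%:Z + c) (Em_wh (r := r) (k := k) wv)).
  congr (wh _ _ _); rewrite rmorphD/= -e hwD -[k%:~R]/(k%:R); ring.
rewrite (exp_mode_nint cv) ?(_ : _ = 0)//; first exact: supp_in0.
by move=> c; apply/eqP => e; apply: nc; exists c.
Qed.

Lemma wh_to_chg (f : V -> V) s t : linear f ->
  (forall w v, wh s w v -> exists w', wh t w' (f v)) ->
  forall v, chg s v -> chg t (f v).
Proof.
move=> lf fw v; apply: (supp_in_lin lf) => -[A u] /= ->.
have [w' ] := fw ((lev A)%:R + hw p s) (bs (A, s)) (supp_inU (conj erefl erefl)).
exact: wh_chg.
Qed.

Lemma Ez_Em_chg r c k s (v : V) : chg s v -> chg s (Ez r c (Em r k v)).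
Proof.
apply: (@wh_to_chg (fun v => Ez r c (Em r k v)) s s).
  exact: (lin_comp (Ez_lin r c) (Em_lin r k)).
move=> w u wu; eexists; apply: Ez_wh; apply: Em_wh; exact: wu.
Qed.

Lemma exp_mode_chg r n s (v : V) : chg s v -> chg (r + s) (em r n v).
Proof.
move=> cv; have [[c e]|nc] := pselect (exists c : int, - n%:~R - 1 - 2 * p%:R * r * s = c%:~R :> rat).
  rewrite (exp_modeE cv e); apply: supp_in_nsum => k; apply: shift_chg.
  exact: Ez_Em_chg.
rewrite (exp_mode_nint cv); first exact: supp_in0.
by move=> c; apply/eqP => e; apply: nc; exists c.
Qed.

Lemma nsum_shift m (F : nat -> V) : ev0 F ->
  nsum (fun k => if (m <= k)%N then F (k - m)%N else 0) = nsum F.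
Proof.
move=> [N FN]; rewrite (nsumE FN) (@nsumE _ _ (m + N)); last first.
  by move=> i mi; rewrite ifT; [apply: FN|]; lia.
rewrite big_split_ord/= big1 ?add0r => [|i _]; last by rewrite leqNgt ltn_ord.
by apply: eq_bigr => i _; rewrite leq_addr addKn.
Qed.

Lemma alpha_exp_mode k r n v : alpha k (em r n v) =
  em r n (alpha k v) + (pp * ratr r) *: em r (n + k) v.
Proof.
have lL : linear (fun v => alpha k (em r n v)).
  apply: (lin_comp (alpha_lin p k)); exact: exp_mode_lin.
have lR : linear (fun v => em r n (alpha k v) + (pp * ratr r) *: em r (n + k) v).
  apply: lin_add; first by apply: (lin_comp (exp_mode_lin r n)); exact: alpha_lin.
  by apply: lin_scale; exact: exp_mode_lin.
move: v; apply: (lin_eq lL lR) => -[A s].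
have: chg s (bs (A, s) : V) by exact: supp_inU.
move: (bs (A, s)) => v cv.
have cav : chg s (alpha k v) by exact: alpha_chg.
have [[c e]|nc] := pselect (exists c : int, - n%:~R - 1 - 2 * p%:R * r * s = c%:~R :> rat); last first.
  have nck c : - (n + k)%:~R - 1 - 2 * p%:R * r * s != c%:~R :> rat.
    by apply/eqP => e; apply: nc; exists (c + k); rewrite rmorphD/= -e rmorphD/=; ring.
  have {}nc c : - n%:~R - 1 - 2 * p%:R * r * s != c%:~R :> rat.
    by apply/eqP => e; apply: nc; exists c.
  by rewrite (exp_mode_nint cv nc) (exp_mode_nint cav nc) (exp_mode_nint cv nck) alpha0 scaler0 addr0.
have e' : - (n + k)%:~R - 1 - 2 * p%:R * r * s = (c - k)%:~R :> rat.
  by rewrite rmorphB/= -e rmorphD/=; ring.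
rewrite (exp_modeE cv e) (exp_modeE cav e) (exp_modeE cv e').
have ev0S d u : ev0 (fun k => shift r (Ez r (k%:Z + d) (Em r k u))).
  have [N uN] := Em_ev0 r u; exists N => i /uN ->.
  by rewrite (lin0 (Ez_lin _ _)) (lin0 (shift_lin _)).
rewrite (lin_nsum (alpha_lin p k))//.
rewrite -nsumZ//.
(* A negative k picks up its correction from the annihilation exponential, a positive k from the
   creation exponential, and k = 0 from the change of charge. *)
have [k0|k0|k0] := ltgtP k 0.
- have {k0} [m km] : exists m, k = - m.+1%:Z by case: k k0 {lL lR cav e'} => // m _; exists m.
  have evF : ev0 (fun i => (pp * ratr r) *: shift r (Ez r (i%:Z + (c - k)) (Em r i v))) by exact: ev0Z.
  rewrite -(nsum_shift m.+1 evF) -nsumD//; last first.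
    have [N FN] := evF; exists (m.+1 + N)%N => i Ni; case: ifP => // mi.
    by apply: FN; lia.
  apply: eq_nsum => i; rewrite alpha_shift ?km// alphaN_Ez alphaN_Em (linD (Ez_lin _ _)) (linD (shift_lin _)).
  congr (_ + _); case: ltnP => mi; last first.
    by rewrite (lin0 (Ez_lin _ _)) (lin0 (shift_lin _)).
  rewrite (linZ (Ez_lin _ _)) (linZ (shift_lin _)); congr (_ *: shift r (Ez r _ _)).
  lia.
- have {k0} [m km] : exists m, k = m.+1%:Z by case: k k0 {lL lR cav e'} => // -[//|m] _; exists m.
  rewrite -nsumD//; last exact: ev0Z.
  apply: eq_nsum => i; rewrite alpha_shift ?km// alphaP_Ez alphaP_Em (linD (shift_lin _)) (linZ (shift_lin _)).
  by rewrite addrA.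
have cS i : chg (r + s) (shift r (Ez r (i%:Z + c) (Em r i v))).
  by apply: shift_chg; exact: Ez_Em_chg.
rewrite k0 subr0 -nsumD//; last exact: ev0Z.
apply: eq_nsum => i; rewrite (alpha0_chg p (cS i)) (alpha0_chg p cv).
rewrite (linZ (Em_lin _ _)) (linZ (Ez_lin _ _)) (linZ (shift_lin _)) -scalerDl.
by congr (_ *: _); rewrite rmorphD/= mulrDr addrC.
Qed.

End Exponentials.

(** * Generalized binomial coefficients *)

Section Binomial.
Context {F : numFieldType}.
Implicit Types x y : F.

Definition gb x (i : nat) : F := (\prod_(j < i) (x - j%:R)) / i`!%:R.

Lemma gb0 x : gb x 0 = 1.
Proof. by rewrite /gb big_ord0 fact0 divr1. Qed.

Lemma gbS x i : i.+1%:R * gb x i.+1 = (x - i%:R) * gb x i.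
Proof.
rewrite /gb big_ord_recr/= factS natrM invfM mulrCA.
rewrite -!mulrA mulrCA; congr (_ * _).
have i0 : i.+1%:R != 0 :> F by rewrite pnatr_eq0.
by congr (_ * _); rewrite mulrA divff// mul1r.
Qed.

Lemma natSn0 i : i.+1%:R != 0 :> F. Proof. by rewrite pnatr_eq0. Qed.

Lemma gbSl x i : i.+1%:R * gb x i.+1 = x * gb (x - 1) i.
Proof.
elim: i => [|i IHi]; first by rewrite gbS !gb0 subr0.
apply: (mulfI (natSn0 i)); rewrite gbS mulrCA IHi mulrCA [RHS]mulrCA gbS.
by congr (_ * (_ * _)); rewrite -[i.+1]addn1 natrD; ring.
Qed.

Lemma gb1 x : gb x 1 = x.
Proof. by have := gbS x 0; rewrite gb0 subr0 mulr1 mul1r. Qed.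

Lemma gb_ind (f : nat -> F) x : f 0%N = 1 ->
  (forall i, i.+1%:R * f i.+1 = (x - i%:R) * f i) -> f =1 gb x.
Proof.
move=> f0 fS; elim=> [|i IHi]; first by rewrite gb0.
by apply: (mulfI (natSn0 i)); rewrite fS IHi gbS.
Qed.

Lemma vandermonde x y n : \sum_(i < n.+1) gb x i * gb y (n - i) = gb (x + y) n.
Proof.
move: n; apply: gb_ind => [|n]; first by rewrite big_ord_recl big_ord0 addr0 !gb0 mulr1.
rewrite mulr_sumr.
transitivity (\sum_(i < n.+2) i%:R * gb x i * gb y (n.+1 - i) +
              \sum_(i < n.+2) gb x i * ((n.+1 - i)%:R * gb y (n.+1 - i))).
  rewrite -big_split; apply: eq_bigr => -[i /= ni] _; rewrite natrB//; ring.
rewrite big_ord_recl/= !mul0r add0r [X in _ + X]big_ord_recr/= subnn mul0r mulr0 addr0.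
rewrite -big_split mulr_sumr; apply: eq_bigr => -[i /= ni] _.
rewrite /bump/= add1n gbS subSS subSn// gbS natrB//; ring.
Qed.

Lemma gb_nat n i : gb n%:R i = 'C(n, i)%:R.
Proof.
apply/esym; move: i; apply: gb_ind => [|i]; first by rewrite bin0.
rewrite -natrM mul_bin_left natrM; have [ni|ni] := leqP i n; first by rewrite natrB.
by rewrite bin_small// !mulr0.
Qed.

Lemma gbN x i : gb (- x) i = (-1) ^+ i * gb (x + i%:R - 1) i.
Proof.
rewrite /gb mulrA; congr (_ / _).
rewrite (reindex_inj rev_ord_inj)/= -[X in (-1) ^+ X](card_ord i) -prodrN.
apply: eq_bigr => -[j ji] _ /=; rewrite natrB// -addn1 natrD; ring.
Qed.

(** Both sides are the coefficient of x^i in (1 - x)^(-a-1). In this form the normal ordering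
    coefficients can be convolved by Vandermonde. *)
Lemma binN a i : 'C(a + i, i)%:R = (-1) ^+ i * gb (- a.+1%:R) i.
Proof.
rewrite gbN mulrA -exprMn mulrNN mulr1 expr1n mul1r -gb_nat.
by congr gb; rewrite natrD -addn1 natrD; ring.
Qed.

End Binomial.

(** * Normally ordered products *)

Lemma nsum_exch (W : zmodType) (G : nat -> nat -> W) :
  (exists N, forall i j, (N <= j)%N -> G i j = 0) ->
  (forall j, ev0 (fun i => G i j)) ->
  nsum (fun i => nsum (fun j => G i j)) = nsum (fun j => nsum (fun i => G i j)).
Proof.
move=> [N GN] ev.
have [M GM] : exists M, forall i j, (M <= i)%N -> G i j = 0.
  suff [M GM] : exists M, forall i j, (j < N)%N -> (M <= i)%N -> G i j = 0.
    by exists M => i j Mi; have [/GN//|jN] := leqP N j; apply: GM.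
  elim: N {GN} => [|N [M GM]]; first by exists 0%N.
  have [L GL] := ev N; exists (maxn M L) => i j; rewrite ltnS leq_eqVlt geq_max => jN /andP[Mi Li].
  by case/orP: jN => [/eqP ->|jN]; [exact: GL|exact: GM].
rewrite (@nsumE _ _ M) => [|i Mi]; last by apply: nsum0 => j; exact: GM.
rewrite [RHS](@nsumE _ _ N) => [|j Nj]; last by apply: nsum0 => i; exact: GN.
under eq_bigr do rewrite (nsumE (GN _)).
rewrite exchange_big; apply: eq_bigr => j _.
by rewrite (nsumE (fun i => GM i j)).
Qed.

Section NormalOrder.
Context {K : numFieldType} {V : lmodType K}.
Variables (al : int -> V -> V) (kap : K).
Hypothesis al_lin : forall n, linear (al n).
Hypothesis al_heis : forall m n v, al m (al n v) =
  al n (al m v) + (if m + n == 0 then kap * m%:~R else 0) *: v.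
Hypothesis al_ev0 : forall v, ev0 (fun i => al i%:Z v).
Implicit Types (F G : int -> V -> V) (v : V).

Let al0 n : al n 0 = 0. Proof. exact: lin0. Qed.
Let alD n u v : al n (u + v) = al n u + al n v. Proof. exact: linD. Qed.
Let alZ n (c : K) v : al n (c *: v) = c *: al n v. Proof. exact: linZ. Qed.

Lemma al_comm m n v : m + n != 0 -> al m (al n v) = al n (al m v).
Proof. by move=> /negPf mn; rewrite al_heis mn scale0r addr0. Qed.

Local Notation cb a i := ('C(a + i, i)%:R : K).

Definition field F :=
  (forall n, linear (F n)) /\ (forall n v, ev0 (fun i => F (n + i%:Z) v)).

Lemma field_lin F n : field F -> linear (F n). Proof. by case. Qed.
Lemma field_ev F n v : field F -> ev0 (fun i => F (n + i%:Z) v). Proof. by case=> _. Qed.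
Lemma field0 F n : field F -> F n 0 = 0. Proof. by move=> fF; exact: lin0 (field_lin n fF). Qed.
Lemma fieldD F n u v : field F -> F n (u + v) = F n u + F n v.
Proof. by move=> fF; exact: linD (field_lin n fF) _ _. Qed.
Lemma fieldZ F n (c : K) v : field F -> F n (c *: v) = c *: F n v.
Proof. by move=> fF; exact: linZ (field_lin n fF) _ _. Qed.

(** The creation half of the a-th divided derivative of alpha(z), placed to the left of F; [non] is
    the annihilation half, placed to the right. *)
Definition nop a F n v := nsum (fun i => cb a i *: al (Negz (a + i)) (F (n + i%:Z) v)).
Definition non a F n v := nsum (fun i => cb a i *: F (n - (a + i).+1%:Z) (al i%:Z v)).
Definition fadd F G : int -> V -> V := fun n v => F n v + G n v.
Definition fscale (c : K) F : int -> V -> V := fun n v => c *: F n v.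
Definition no a F := fadd (nop a F) (fscale ((-1) ^+ a) (non a F)).

Lemma fadd_field F G : field F -> field G -> field (fadd F G).
Proof.
move=> fF fG; split => [n|n v]; first by apply: lin_add; exact: field_lin.
by apply: ev0D; exact: field_ev.
Qed.

Lemma fscale_field c F : field F -> field (fscale c F).
Proof.
move=> fF; split => [n|n v]; first by apply: lin_scale; exact: field_lin.
by apply: ev0Z; exact: field_ev.
Qed.

Lemma nop_ev a F n v : field F -> ev0 (fun i => cb a i *: al (Negz (a + i)) (F (n + i%:Z) v)).
Proof. by move=> fF; have [N FN] := field_ev n v fF; exists N => i /FN ->; rewrite al0 scaler0. Qed.

Lemma non_ev a F n v : field F -> ev0 (fun i => cb a i *: F (n - (a + i).+1%:Z) (al i%:Z v)).
Proof. by move=> fF; have [N aN] := al_ev0 v; exists N => i /aN ->; rewrite field0// scaler0. Qed.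

Lemma nop_field a F : field F -> field (nop a F).
Proof.
move=> fF; split => [n|n v].
  apply: lin_intro => c u v; rewrite /nop -nsumZ; last exact: nop_ev.
  rewrite -nsumD; [|exact/ev0Z/nop_ev|exact: nop_ev].
  apply: eq_nsum => i; rewrite fieldD// fieldZ// alD alZ scalerDr !scalerA.
  by rewrite (mulrC c).
have [N FN] := field_ev n v fF; exists N => i Ni; apply: nsum0 => j.
by rewrite -addrA -PoszD FN ?al0 ?scaler0// (leq_trans Ni)// leq_addr.
Qed.

Lemma non_field a F : field F -> field (non a F).
Proof.
move=> fF; split => [n|n v].
  apply: lin_intro => c u v; rewrite /non -nsumZ; last exact: non_ev.
  rewrite -nsumD; [|exact/ev0Z/non_ev|exact: non_ev].
  apply: eq_nsum => i; rewrite alD alZ fieldD// fieldZ// scalerDr !scalerA.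
  by rewrite (mulrC c).
have [J aJ] := al_ev0 v.
have [M FM] : exists M, forall i j, (M <= i)%N -> (j < J)%N -> F (n + i%:Z - (a + j).+1%:Z) (al j%:Z v) = 0.
  elim: J {aJ} => [|J [M FM]]; first by exists 0%N.
  have [L FL] := field_ev (n - (a + J).+1%:Z) (al J%:Z v) fF.
  exists (maxn L M) => i j; rewrite geq_max => /andP[Li Mi]; rewrite ltnS leq_eqVlt => jJ.
  by case/orP: jJ => [/eqP ->|jJ]; [rewrite addrAC FL|exact: FM].
exists M => i Mi; apply: nsum0 => j.
have [Jj|jJ] := leqP J j; first by rewrite aJ// field0// scaler0.
by rewrite FM// scaler0.
Qed.

Lemma no_field a F : field F -> field (no a F).
Proof. by move=> fF; apply: fadd_field; [exact: nop_field|exact/fscale_field/non_field]. Qed.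

Lemma nopD a F G : field F -> field G -> nop a (fadd F G) = fadd (nop a F) (nop a G).
Proof.
move=> fF fG; apply/funext => n; apply/funext => v; rewrite /fadd /nop.
rewrite -nsumD; [|exact: nop_ev|exact: nop_ev].
by apply: eq_nsum => i; rewrite alD scalerDr.
Qed.

Lemma nonD a F G : field F -> field G -> non a (fadd F G) = fadd (non a F) (non a G).
Proof.
move=> fF fG; apply/funext => n; apply/funext => v; rewrite /fadd /non.
rewrite -nsumD; [|exact: non_ev|exact: non_ev].
by apply: eq_nsum => i; rewrite scalerDr.
Qed.

Lemma nopZ a c F : field F -> nop a (fscale c F) = fscale c (nop a F).
Proof.
move=> fF; apply/funext => n; apply/funext => v; rewrite /fscale /nop.
rewrite -nsumZ; last exact: nop_ev.
by apply: eq_nsum => i; rewrite alZ !scalerA mulrC.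
Qed.

Lemma nonZ a c F : field F -> non a (fscale c F) = fscale c (non a F).
Proof.
move=> fF; apply/funext => n; apply/funext => v; rewrite /fscale /non.
rewrite -nsumZ; last exact: non_ev.
by apply: eq_nsum => i; rewrite !scalerA mulrC.
Qed.

Lemma noD a F G : field F -> field G -> no a (fadd F G) = fadd (no a F) (no a G).
Proof.
move=> fF fG; rewrite /no nopD// nonD//; apply/funext => n; apply/funext => v.
by rewrite /fadd /fscale scalerDr addrACA.
Qed.

Lemma noZ a c F : field F -> no a (fscale c F) = fscale c (no a F).
Proof.
move=> fF; rewrite /no nopZ// nonZ//; apply/funext => n; apply/funext => v.
by rewrite /fadd /fscale scalerDr !scalerA mulrC.
Qed.

Lemma nop_comm a b F : field F -> nop a (nop b F) = nop b (nop a F).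
Proof.
move=> fF; apply/funext => n; apply/funext => v; rewrite /nop.
pose G i j := (cb a i * cb b j) *: al (Negz (a + i)) (al (Negz (b + j)) (F (n + i%:Z + j%:Z) v)).
transitivity (nsum (fun i => nsum (fun j => G i j))).
  apply: eq_nsum => i; rewrite (lin_nsum (al_lin _)); last exact: nop_ev.
  rewrite -nsumZ; last by apply: ev0_lin (al0 _) _; exact: nop_ev.
  by apply: eq_nsum => j; rewrite alZ scalerA.
have [N FN] := field_ev n v fF.
rewrite nsum_exch; last 2 first.
- exists N => i j Nj; rewrite /G -addrA -PoszD FN ?al0 ?scaler0//; lia.
- move=> j; exists N => i Ni; rewrite /G -addrA -PoszD FN ?al0 ?scaler0//; lia.
apply: eq_nsum => j; rewrite (lin_nsum (al_lin _)); last exact: nop_ev.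
rewrite -nsumZ; last by apply: ev0_lin (al0 _) _; exact: nop_ev.
apply: eq_nsum => i; rewrite /G alZ scalerA mulrC al_comm// addrAC.
by [].
Qed.

Lemma nop_non a b F : field F -> nop a (non b F) = non b (nop a F).
Proof.
move=> fF; apply/funext => n; apply/funext => v; rewrite /nop /non.
pose G i j := (cb a i * cb b j) *: al (Negz (a + i)) (F (n + i%:Z - (b + j).+1%:Z) (al j%:Z v)).
transitivity (nsum (fun i => nsum (fun j => G i j))).
  apply: eq_nsum => i; rewrite (lin_nsum (al_lin _)); last exact: non_ev.
  rewrite -nsumZ; last by apply: ev0_lin (al0 _) _; exact: non_ev.
  by apply: eq_nsum => j; rewrite alZ scalerA.
rewrite nsum_exch; last 2 first.
- by have [J aJ] := al_ev0 v; exists J => i j /aJ e; rewrite /G e field0// al0 scaler0.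
- move=> j; have [N FN] := field_ev (n - (b + j).+1%:Z) (al j%:Z v) fF.
  by exists N => i /FN e; rewrite /G addrAC e al0 scaler0.
apply: eq_nsum => j; rewrite -nsumZ; last exact: nop_ev.
by apply: eq_nsum => i; rewrite /G scalerA mulrC addrAC.
Qed.

Lemma non_comm a b F : field F -> non a (non b F) = non b (non a F).
Proof.
move=> fF; apply/funext => n; apply/funext => v; rewrite /non.
pose G i j := (cb a i * cb b j) *: F (n - (a + i).+1%:Z - (b + j).+1%:Z) (al j%:Z (al i%:Z v)).
have [J aJ] := al_ev0 v.
have aij (i j : nat) : al i%:Z (al j%:Z v) = al j%:Z (al i%:Z v).
  rewrite al_heis; case: eqP => [h|_]; last by rewrite scale0r addr0.
  by case: i h => // _; rewrite mulr0 scale0r addr0.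
transitivity (nsum (fun i => nsum (fun j => G i j))).
  apply: eq_nsum => i; rewrite -nsumZ; last exact: non_ev.
  by apply: eq_nsum => j; rewrite scalerA.
rewrite nsum_exch; last 2 first.
- by exists J => i j /aJ e; rewrite /G -aij e al0 field0// scaler0.
- by move=> j; exists J => i /aJ e; rewrite /G e al0 field0// scaler0.
apply: eq_nsum => j; rewrite -nsumZ; last exact: non_ev.
by apply: eq_nsum => i; rewrite /G scalerA mulrC aij addrAC.
Qed.

(** Creation modes commute with each other, as do the modes alpha(i) with i >= 0, and the two halves
    stand on opposite sides of F. Hence the iterated normally ordered product depends only on the
    multiset of factors, not on its enumeration. *)
Lemma no_comm a b F : field F -> no a (no b F) = no b (no a F).
Proof.
move=> fF; rewrite /no.
have fp c := nop_field c fF; have fn c := non_field c fF.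
rewrite !nopD ?nonD ?nopZ ?nonZ//; try exact/fscale_field.
rewrite (nop_comm a b fF) (non_comm a b fF) !nop_non//.
apply/funext => n; apply/funext => v; rewrite /fadd /fscale !scalerDr !scalerA.
by rewrite addrACA (mulrC ((-1) ^+ a)).
Qed.

Lemma foldr_no_field l F : field F -> field (foldr no F l).
Proof. by move=> fF; elim: l => //= a l; exact: no_field. Qed.

Lemma foldr_no_mid l1 a l2 F : field F ->
  foldr no F (l1 ++ a :: l2) = no a (foldr no F (l1 ++ l2)).
Proof.
move=> fF; elim: l1 => //= b l1 ->; rewrite no_comm//; exact: foldr_no_field.
Qed.

Lemma foldr_no_perm l l' F : field F -> perm_eq l l' -> foldr no F l = foldr no F l'.
Proof.
move=> fF; elim: l l' => [|a l IHl] l' ll'.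
  by have /perm_nilP -> : perm_eq l' [::] by rewrite perm_sym.
have al' : a \in l' by rewrite -(perm_mem ll') mem_head.
move: ll'; case/splitPr: al' => l1 l2 ll'.
rewrite foldr_no_mid//= (IHl (l1 ++ l2))//.
by rewrite -(perm_cons a) (perm_trans ll')// -cat1s perm_catCA.
Qed.

End NormalOrder.

Section Borcherds.
Context {K : numFieldType} {V : lmodType K}.
Variables (al : int -> V -> V) (kap : K).
Hypothesis al_lin : forall n, linear (al n).
Hypothesis al_heis : forall m n v, al m (al n v) =
  al n (al m v) + (if m + n == 0 then kap * m%:~R else 0) *: v.
Hypothesis al_ev0 : forall v, ev0 (fun i => al i%:Z v).
Implicit Types (F G : int -> V -> V) (v : V).

Let al0 n : al n 0 = 0. Proof. exact: lin0. Qed.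
Let alD n u v : al n (u + v) = al n u + al n v. Proof. exact: linD. Qed.
Let alZ n (c : K) v : al n (c *: v) = c *: al n v. Proof. exact: linZ. Qed.
Local Notation cb a i := ('C(a + i, i)%:R : K).
Local Notation no := (@no K V al).
Local Notation nop := (@nop K V al).
Local Notation non := (@non K V al).

Definition fshift (d : int) F : int -> V -> V := fun n => F (n + d).
Definition fsum N (F : nat -> int -> V -> V) : int -> V -> V :=
  fun n v => \sum_(i < N) F i n v.

Lemma fshift_field d F : field F -> field (fshift d F).
Proof.
move=> fF; split => [n|n v]; first exact: (field_lin _ fF).
have [N FN] := field_ev (n + d) v fF; exists N => i /FN; by rewrite /fshift addrAC.
Qed.

Lemma no_shift a d F : no a (fshift d F) = fshift d (no a F).
Proof.
apply/funext => n; apply/funext => v; rewrite /no /fadd /fscale /nop /non /fshift.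
congr (_ + _ *: _); apply: eq_nsum => i; by rewrite addrAC.
Qed.

Lemma fsum_field N (Fs : nat -> int -> V -> V) : (forall i, field (Fs i)) -> field (fsum N Fs).
Proof.
move=> fF; elim: N => [|N IHN].
  split => [n|n v]; last by exists 0%N => i _; rewrite /fsum big_ord0.
  by apply: lin_intro => c u v; rewrite /fsum !big_ord0 scaler0 addr0.
have -> : fsum N.+1 Fs = fadd (fsum N Fs) (Fs N) by apply/funext => n; apply/funext => v; rewrite /fsum big_ord_recr.
exact: fadd_field.
Qed.

Lemma no_sum a N (Fs : nat -> int -> V -> V) : (forall i, field (Fs i)) ->
  no a (fsum N Fs) = fsum N (fun i => no a (Fs i)).
Proof.
move=> fF; elim: N => [|N IHN].
  apply/funext => n; apply/funext => v; rewrite /no /fadd /fscale /nop /non /fsum.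
  by rewrite !nsum0 ?big_ord0 ?scaler0 ?addr0// => i; rewrite big_ord0 ?al0 scaler0.
have e (G : nat -> int -> V -> V) : fsum N.+1 G = fadd (fsum N G) (G N) by apply/funext => n; apply/funext => v; rewrite /fsum big_ord_recr.
by rewrite !e (noD al_lin al_ev0)// ?IHN//; exact: fsum_field.
Qed.

Lemma no_ext (S : V -> Prop) a F G : (forall i v, S v -> S (al i v)) ->
  (forall n v, S v -> F n v = G n v) -> forall n v, S v -> no a F n v = no a G n v.
Proof.
move=> Sal FG n v Sv; rewrite /no /fadd /fscale /nop /non; congr (_ + _ *: _).
  by apply: eq_nsum => i; rewrite FG.
by apply: eq_nsum => i; rewrite FG//; exact: Sal.
Qed.

Lemma nsum_delta (c : nat -> K) (X : nat -> V) k :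
  nsum (fun i => (if i == k then c i else 0) *: X i) = c k *: X k.
Proof. by rewrite (@nsum1 _ _ k) ?eqxx// => i /negPf ->; rewrite scale0r. Qed.

(** For m > a the central term comes from the creation half, for m < 0 from the annihilation half.
    Both are values of the single polynomial (a+1) binom(m, a+1), which vanishes for 0 <= m <= a. *)
Lemma no_central m a n (F : int -> V) :
  nsum (fun i => (if m == (a + i).+1%:Z then cb a i * (kap * m%:~R) else 0) *: F (n + i%:Z)) -
  (-1) ^+ a *: nsum (fun i => (if m == - i%:Z then cb a i * (- (kap * m%:~R)) else 0) *: F (n - (a + i).+1%:Z)) =
  (kap * a.+1%:R * gb m%:~R a.+1) *: F (m + n - a.+1%:Z).
Proof.
apply/esym; rewrite -mulrA; set T1 := nsum _; set T3 := nsum _; case: m @T1 @T3 => [m|m] T1 T3.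
    have -> : T3 = 0.
      apply: nsum0 => i; case: eqP => [e|_]; last by rewrite scale0r.
      have -> : m = 0%N by lia.
      by rewrite mulr0 oppr0 mulr0 scale0r.
    rewrite scaler0 subr0 -[m%:~R]/(m%:R : K) /T1 gb_nat; have [ma|am] := leqP m a.
      rewrite bin_small ?mulr0 ?scale0r ?nsum0// => i; rewrite ifF ?scale0r//; apply/eqP; lia.
    rewrite (@nsum1 _ _ (m - a.+1)%N) => [|i im]; last first.
      by rewrite ifF ?scale0r//; apply/eqP; lia.
    rewrite ifT; last by apply/eqP; lia.
    congr (_ *: F _); last by lia.
    rewrite -gb_nat gbSl mulrCA [RHS]mulrC mulrA; congr (_ * _); first by rewrite mulrC.
    have -> : m%:R - 1 = (m - 1)%N%:R :> K by rewrite natrB//; lia.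
    rewrite gb_nat; congr (_%:R); rewrite (_ : (m - 1 = a + (m - a.+1))%N); last by lia.
    by rewrite -(bin_sub (leq_addr (m - a.+1)%N a)) addKn.
  have -> : T1 = 0 by apply: nsum0 => i; rewrite scale0r.
  rewrite sub0r /T3 (@nsum1 _ _ m.+1) => [|i im]; last first.
    by rewrite ifF ?scale0r//; apply/eqP; lia.
  rewrite ifT; last by rewrite NegzE.
  rewrite -scaleNr scalerA; congr (_ *: F _); last by lia.
  have e : gb ((Negz m)%:~R - 1 : K) a = (-1) ^+ a * cb a m.+1.
    have -> : (Negz m)%:~R - 1 = - (m.+2)%:R :> K by rewrite NegzE mulrNz -opprD natr1.
    rewrite gbN; congr (_ * _); have -> : m.+2%:R + a%:R - 1 = (m.+1 + a)%:R :> K by rewrite -natr1 !natrD; ring.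
    rewrite gb_nat; congr (_%:R); by rewrite addnC -(bin_sub (leq_addr m.+1 a)) addKn.
  rewrite gbSl e; ring.
Qed.

Lemma al_no m a F n v : field F ->
  al m (no a F n v) - no a F n (al m v) =
  no a (fun n v => al m (F n v) - F n (al m v)) n v +
  (kap * a.+1%:R * gb m%:~R a.+1) *: F (m + n - a.+1%:Z) v.
Proof.
move=> fF; set DF := fun n v => _.
have fDF : field DF.
  split => [k|k w].
    apply: lin_sub; first by apply: lin_comp => //; exact: field_lin.
    by apply: lin_comp => //; exact: field_lin.
  have [N FN] := field_ev k w fF; have [N' FN'] := field_ev k (al m w) fF.
  by exists (maxn N N') => i; rewrite geq_max => /andP[/FN e /FN' e']; rewrite /DF e e' al0 subr0.
have e1 : al m (nop a F n v) = nop a (fun n v => al m (F n v)) n v +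
    nsum (fun i => (if m == (a + i).+1%:Z then cb a i * (kap * m%:~R) else 0) *: F (n + i%:Z) v).
  rewrite /nop (lin_nsum (al_lin _)); last exact: (nop_ev al_lin).
  have fG : field (fun n v => al m (F n v)).
    split => [k|k w]; first by apply: lin_comp => //; exact: field_lin.
    by have [N FN] := field_ev k w fF; exists N => i /FN ->; rewrite al0.
  rewrite -nsumD; first last.
  - by have [N FN] := field_ev n v fF; exists N => i /FN ->; rewrite scaler0.
  - exact: (nop_ev al_lin a n v fG).
  apply: eq_nsum => i; rewrite alZ al_heis scalerDr scalerA; congr (_ + _ *: _).
  rewrite NegzE subr_eq0; case: eqP => // _; by rewrite mulr0.
have e2 : al m (non a F n v) = non a (fun n v => al m (F n v)) n v.
  rewrite /non (lin_nsum (al_lin _)); last exact: (non_ev al_ev0).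
  by apply: eq_nsum => i; rewrite alZ.
have e3 : non a F n (al m v) = non a (fun n v => F n (al m v)) n v +
    nsum (fun i => (if m == - i%:Z then cb a i * (- (kap * m%:~R)) else 0) *: F (n - (a + i).+1%:Z) v).
  have fG : field (fun n v => F n (al m v)).
    split => [k|k w]; first by apply: lin_comp => //; exact: field_lin.
    exact: field_ev.
  rewrite /non -nsumD; first last.
  - by exists `|m|.+1%N => i mi; rewrite ifF ?scale0r//; apply/eqP; lia.
  - exact: (non_ev al_ev0 a n v fG).
  apply: eq_nsum => i; rewrite al_heis fieldD// fieldZ// scalerDr scalerA; congr (_ + _ *: _).
  have -> : (i%:Z + m == 0) = (m == - i%:Z) by lia.
  case: eqP => [->|_]; last by rewrite mulr0.
  by rewrite mulrNz; ring.
have fG1 : field (fun n v => al m (F n v)).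
  split => [k|k w]; first by apply: lin_comp => //; exact: field_lin.
  by have [N FN] := field_ev k w fF; exists N => i /FN ->; rewrite al0.
have fG2 : field (fun n v => F n (al m v)).
  split => [k|k w]; first by apply: lin_comp => //; exact: field_lin.
  exact: field_ev.
have eD : DF = fadd (fun n v => al m (F n v)) (fscale (-1) (fun n v => F n (al m v))).
  by apply/funext => k; apply/funext => w; rewrite /DF /fadd /fscale scaleN1r.
have fG2' := fscale_field (-1) fG2.
rewrite eD (noD al_lin al_ev0)// (noZ al_lin al_ev0)// /no /fadd /fscale alD alZ e1 e2 e3.
rewrite -(no_central m a n (F ^~ v)); set T1 := nsum _; set T3 := nsum _.
rewrite scaleN1r !scalerDr -[nop a (fun n v => F n (al m v)) n v]/(nop a F n (al m v)).
lmod.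
Qed.

Variables (Y : V -> int -> V -> V) (I : Type) (es : I -> V) (rho : I -> K).
Hypothesis Y_lin : forall n v, linear (fun u => Y u n v).
Hypothesis Y_field : forall u, field (Y u).
Hypothesis Y_al : forall a u, Y (al (Negz a) u) = no a (Y u).
Hypothesis V_ind : forall P : V -> Prop, P 0 ->
  (forall (c : K) u v, P u -> P v -> P (c *: u + v)) -> (forall s, P (es s)) ->
  (forall k v, P v -> P (al (Negz k) v)) -> forall v, P v.
Hypothesis Y_es : forall s k n v, al k (Y (es s) n v) =
  Y (es s) n (al k v) + (kap * rho s) *: Y (es s) (n + k) v.
Hypothesis al_es : forall s, al 0 (es s) = (kap * rho s) *: es s.
Hypothesis al_esP : forall s k, al k.+1 (es s) = 0.

Lemma Y_ev (c : nat -> K) (f : nat -> V) (d : nat -> int) v : ev0 f ->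
  ev0 (fun i => c i *: Y (f i) (d i) v).
Proof. by move=> [N fN]; exists N => i /fN ->; rewrite (lin0 (Y_lin _ _)) scaler0. Qed.

(** The commutator formula for the current, by induction on the creation operators in u. The central
    term of alpha(i) against alpha(-a-1) occurs only at i = a+1 and matches the one computed in
    [no_central]. *)
Lemma al_Y m u n v : al m (Y u n v) = Y u n (al m v) +
  nsum (fun i => gb (m%:~R : K) i *: Y (al i%:Z u) (m + n - i%:Z) v).
Proof.
elim/V_ind: u m n v => [m n v|c u w IHu IHw m n v|s m n v|a u IHu m n v].
- rewrite !(lin0 (Y_lin _ _)) al0 nsum0 ?addr0// => i.
  by rewrite al0 (lin0 (Y_lin _ _)) scaler0.
- rewrite !(lin_elim (Y_lin _ _)) alD alZ IHu IHw.
  rewrite [X in _ = _ + X](eq_nsum (G := fun i => c *: (gb (m%:~R : K) i *: Y (al i%:Z u) (m + n - i%:Z) v) + gb (m%:~R : K) i *: Y (al i%:Z w) (m + n - i%:Z) v)); last first.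
    by move=> i; rewrite alD alZ (lin_elim (Y_lin _ _)); lmod.
  have ev x : ev0 (fun i => gb (m%:~R : K) i *: Y (al i%:Z x) (m + n - i%:Z) v).
    exact: (Y_ev (fun i => gb m%:~R i) (fun i => m + n - i%:Z) v (al_ev0 x)).
  rewrite (nsumD (ev0Z c (ev u)) (ev w)) (nsumZ c (ev u)).
  lmod.
- rewrite (@nsum1 _ _ 0%N) => [|[//|i] _]; last by rewrite al_esP (lin0 (Y_lin _ _)) scaler0.
  by rewrite gb0 scale1r al_es (linZ (Y_lin _ _)) Y_es subr0 addrC [in m + n]addrC addrC.
have [N uN] := al_ev0 u.
have := al_no m a n v (Y_field u).
pose Fs i := fscale (gb (m%:~R : K) i) (fshift (m - i%:Z) (Y (al i%:Z u))).
have fFs i : field (Fs i) by apply: fscale_field; exact: fshift_field.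
have -> : (fun n v => al m (Y u n v) - Y u n (al m v)) = fsum N Fs.
  apply/funext => k; apply/funext => w; rewrite IHu addrAC subrr add0r.
  rewrite (@nsumE _ _ N) => [|i Ni]; last by rewrite uN// (lin0 (Y_lin _ _)) scaler0.
  apply: eq_bigr => i _; rewrite /Fs /fscale /fshift; congr (_ *: Y _ _ _); lia.
rewrite no_sum// Y_al => /eqP; rewrite subr_eq => /eqP ->; rewrite addrC; congr (_ + _).
rewrite (eq_nsum (G := fun i => gb (m%:~R : K) i *: Y (al (Negz a) (al i%:Z u)) (m + n - i%:Z) v +
   (if i == a.+1 then kap * i%:R * gb (m%:~R : K) i else 0) *: Y u (m + n - i%:Z) v)); last first.
  move=> i; rewrite al_heis (linD (Y_lin _ _)) (linZ (Y_lin _ _)) scalerDr scalerA.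
  congr (_ + _ *: _); rewrite NegzE; have -> : (i%:Z - a.+1%:Z == 0) = (i == a.+1) by lia.
  by case: eqP => _; rewrite ?mulr0// mulrC.
rewrite nsumD; first last.
- by exists a.+2 => i ai; rewrite gtn_eqF// scale0r.
- by apply: Y_ev; exists N => i /uN ->; rewrite al0.
rewrite nsum_delta; congr (_ + _).
rewrite (@nsumE _ _ N) => [|i Ni]; last by rewrite uN// al0 (lin0 (Y_lin _ _)) scaler0.
apply: eq_bigr => i _; rewrite Y_al (noZ al_lin al_ev0); last exact: fshift_field.
by rewrite no_shift /fscale /fshift (addrC m n) addrA.
Qed.

Variables (E : int -> V -> V) (r : K).
Hypothesis E_field : field E.
Hypothesis E_al : forall k n v, al k (E n v) = E n (al k v) + (kap * r) *: E (n + k) v.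

Local Notation sg k i := ((-1) ^+ i * gb (k%:~R : K) i).

Definition bor1 (m k : int) F : int -> V -> V :=
  fun n v => nsum (fun i => sg k i *: E (m + k - i%:Z) (F (n + i%:Z) v)).
Definition bor2 (m k : int) F : int -> V -> V :=
  fun n v => nsum (fun i => sg k i *: F (n + k - i%:Z) (E (m + i%:Z) v)).
(** The left side of the Borcherds identity for the fields E and F with parameters m, k, n; [sg k i]
    is the coefficient of x^i in (1 - x)^k. *)
Definition bor (m k : int) F : int -> V -> V :=
  fadd (bor1 m k F) (fscale (- (-1) ^+ `|k|%N) (bor2 m k F)).

Let E0 n : E n 0 = 0. Proof. exact: field0 n E_field. Qed.
Let ED n u v : E n (u + v) = E n u + E n v. Proof. exact: fieldD n u v E_field. Qed.
Let EZ n (c : K) v : E n (c *: v) = c *: E n v. Proof. exact: fieldZ n c v E_field. Qed.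

(** (1 - x)^k (1 - x)^(-a-1) = (1 - x)^(k-a-1), coefficient by coefficient. *)
Lemma sg_cb (k : int) a t :
  \sum_(i < t.+1) sg k i * cb a (t - i)%N = sg (k - a.+1%:Z) t.
Proof.
rewrite (_ : (k - a.+1%:Z)%:~R = k%:~R + (- a.+1%:R) :> K); last by rewrite rmorphB.
rewrite -vandermonde mulr_sumr; apply: eq_bigr => -[i it] _ /=.
rewrite binN mulrACA -exprD subnKC// -ltnS; exact: it.
Qed.

Lemma bor1_ev m k F n v : field F ->
  ev0 (fun i => sg k i *: E (m + k - i%:Z) (F (n + i%:Z) v)).
Proof. by move=> fF; have [N FN] := field_ev n v fF; exists N => i /FN ->; rewrite E0 scaler0. Qed.

Lemma bor2_ev m k F n v : field F ->
  ev0 (fun i => sg k i *: F (n + k - i%:Z) (E (m + i%:Z) v)).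
Proof. by move=> fF; have [N FN] := field_ev m v E_field; exists N => i /FN ->; rewrite field0// scaler0. Qed.

Lemma bor1_field m k F : field F -> field (bor1 m k F).
Proof.
move=> fF; split => [n|n v].
  apply: lin_intro => c u v; rewrite /bor1 -(nsumZ _ (bor1_ev _ _ _ _ fF)).
  rewrite -(nsumD (ev0Z _ (bor1_ev _ _ _ _ fF)) (bor1_ev _ _ _ _ fF)).
  by apply: eq_nsum => i; rewrite fieldD// fieldZ// ED EZ; lmod.
have [N FN] := field_ev n v fF; exists N => i Ni; apply: nsum0 => j.
by rewrite -(addrA n) -PoszD FN ?E0 ?scaler0// (leq_trans Ni)// leq_addr.
Qed.

Lemma bor2_field m k F : field F -> field (bor2 m k F).
Proof.
move=> fF; split => [n|n v].
  apply: lin_intro => c u v; rewrite /bor2 -(nsumZ _ (bor2_ev _ _ _ _ fF)).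
  rewrite -(nsumD (ev0Z _ (bor2_ev _ _ _ _ fF)) (bor2_ev _ _ _ _ fF)).
  by apply: eq_nsum => i; rewrite ED EZ fieldD// fieldZ//; lmod.
have [J aJ] := field_ev m v E_field.
have [M FM] : exists M, forall i j, (M <= i)%N -> (j < J)%N -> F (n + i%:Z + k - j%:Z) (E (m + j%:Z) v) = 0.
  elim: J {aJ} => [|J [M FM]]; first by exists 0%N.
  have [L FL] := field_ev (n + k - J%:Z) (E (m + J%:Z) v) fF.
  exists (maxn L M) => i j; rewrite geq_max => /andP[Li Mi]; rewrite ltnS leq_eqVlt => jJ.
  case/orP: jJ => [/eqP ->|jJ]; last exact: FM.
  by rewrite (_ : n + i%:Z + k - J%:Z = n + k - J%:Z + i%:Z) ?FL//; ring.
exists M => i Mi; apply: nsum0 => j.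
have [Jj|jJ] := leqP J j; first by rewrite aJ// field0// scaler0.
by rewrite FM// scaler0.
Qed.

Lemma nsum_cb (k : int) a (X : nat -> V) : ev0 X ->
  nsum (fun i => nsum (fun j => (sg k i * cb a j) *: X (i + j)%N)) =
  nsum (fun t => sg (k - a.+1%:Z) t *: X t).
Proof.
move=> [N XN]; rewrite nsum_conv; last by exists N => i q /XN ->; rewrite scaler0.
apply: eq_nsum => t; rewrite -sg_cb scaler_suml; apply: eq_bigr => -[i it] _ /=.
by rewrite subnKC// -ltnS.
Qed.

Lemma bor1_nop m k a F n v : field F ->
  bor1 m k (nop a F) n v = nop a (bor1 m k F) n v - (kap * r) *: bor1 m (k - a.+1%:Z) F n v.
Proof.
move=> fF; rewrite /bor1 /nop.
have [N FN] := field_ev n v fF.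
pose G i j := (sg k i * cb a j) *: al (Negz (a + j)) (E (m + k - i%:Z) (F (n + i%:Z + j%:Z) v)).
pose X t := - (kap * r) *: E (m + (k - a.+1%:Z) - t%:Z) (F (n + t%:Z) v).
have XN : ev0 X by exists N => i /FN e; rewrite /X e E0 scaler0.
transitivity (nsum (fun i => nsum (fun j => G i j)) + nsum (fun i => nsum (fun j => (sg k i * cb a j) *: X (i + j)%N))).
  have evG i : ev0 (fun j => G i j).
    exists N => j Nj; rewrite /G -(addrA n) -PoszD FN ?E0 ?al0 ?scaler0//; lia.
  have evX i : ev0 (fun j => (sg k i * cb a j) *: X (i + j)%N).
    have [M XM] := XN; exists M => j Mj; rewrite XM ?scaler0//; lia.
  rewrite -nsumD; first last.
  - have [M XM] := XN; exists M => i Mi; apply: nsum0 => j; rewrite XM ?scaler0//; lia.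
  - exists N => i Ni; apply: nsum0 => j; rewrite /G -(addrA n) -PoszD FN ?E0 ?al0 ?scaler0//; lia.
  apply: eq_nsum => i; rewrite -nsumD// (lin_nsum (field_lin _ E_field)); last exact: (nop_ev al_lin).
  rewrite -nsumZ; last by apply: ev0_lin (E0 _) _; exact: (nop_ev al_lin).
  apply: eq_nsum => j; rewrite EZ /G /X E_al -(addrA n i%:Z) -PoszD.
  have -> : m + k - i%:Z + Negz (a + j) = m + (k - a.+1%:Z) - (i + j)%N%:Z by rewrite NegzE; lia.
  lmodu.
rewrite nsum_exch; first last.
- by move=> j; exists N => i Ni; rewrite /G -(addrA n) -PoszD FN ?E0 ?al0 ?scaler0//; lia.
- by exists N => i j Nj; rewrite /G -(addrA n) -PoszD FN ?E0 ?al0 ?scaler0//; lia.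
rewrite nsum_cb//; congr (_ + _).
  apply: eq_nsum => j; rewrite (lin_nsum (al_lin _)); last exact: bor1_ev.
  rewrite -nsumZ; last by apply: ev0_lin (al0 _) _; exact: bor1_ev.
  by apply: eq_nsum => i; rewrite alZ scalerA mulrC /G (addrAC n).
rewrite -scaleNr -nsumZ; last exact: bor1_ev.
by apply: eq_nsum => t; rewrite /X; lmod.
Qed.

Lemma bor1_non m k a F n v : field F -> bor1 m k (non a F) n v = non a (bor1 m k F) n v.
Proof.
move=> fF; rewrite /bor1 /non.
pose G i j := (sg k i * cb a j) *: E (m + k - i%:Z) (F (n + i%:Z - (a + j).+1%:Z) (al j%:Z v)).
transitivity (nsum (fun i => nsum (fun j => G i j))).
  apply: eq_nsum => i; rewrite (lin_nsum (field_lin _ E_field)); last exact: (non_ev al_ev0).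
  rewrite -nsumZ; last by apply: ev0_lin (E0 _) _; exact: (non_ev al_ev0).
  by apply: eq_nsum => j; rewrite EZ scalerA.
rewrite nsum_exch; first last.
- move=> j; have [N FN] := field_ev (n - (a + j).+1%:Z) (al j%:Z v) fF.
  by exists N => i /FN e; rewrite /G (addrAC n) e E0 scaler0.
- by have [J aJ] := al_ev0 v; exists J => i j /aJ e; rewrite /G e field0// E0 scaler0.
apply: eq_nsum => j; rewrite -nsumZ; last exact: bor1_ev.
by apply: eq_nsum => i; rewrite /G scalerA mulrC (addrAC n).
Qed.

Lemma bor2_nop m k a F n v : field F -> bor2 m k (nop a F) n v = nop a (bor2 m k F) n v.
Proof.
move=> fF; rewrite /bor2 /nop.
pose G i j := (sg k i * cb a j) *: al (Negz (a + j)) (F (n + k - i%:Z + j%:Z) (E (m + i%:Z) v)).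
transitivity (nsum (fun i => nsum (fun j => G i j))).
  apply: eq_nsum => i; rewrite -nsumZ; last exact: (nop_ev al_lin).
  by apply: eq_nsum => j; rewrite scalerA.
have [N EN] := field_ev m v E_field.
transitivity (nsum (fun j => nsum (fun i => G i j))).
  apply/esym/nsum_exch; first by exists N => j i /EN e; rewrite /G e field0// al0 scaler0.
  move=> i; have [M FM] := field_ev (n + k - i%:Z) (E (m + i%:Z) v) fF.
  by exists M => j /FM e; rewrite /G e al0 scaler0.
apply: eq_nsum => j; rewrite (lin_nsum (al_lin _)); last exact: bor2_ev.
rewrite -nsumZ; last by apply: ev0_lin (al0 _) _; exact: bor2_ev.
apply: eq_nsum => i; rewrite alZ scalerA /G mulrC.
congr (_ *: al _ (F _ _)); ring.
Qed.

Lemma bor2_non m k a F n v : field F ->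
  bor2 m k (non a F) n v = non a (bor2 m k F) n v + (kap * r) *: bor2 m (k - a.+1%:Z) F n v.
Proof.
move=> fF; rewrite /bor2 /non.
have [N EN] := field_ev m v E_field; have [J aJ] := al_ev0 v.
pose G i j := (sg k i * cb a j) *: F (n + k - i%:Z - (a + j).+1%:Z) (E (m + i%:Z) (al j%:Z v)).
pose X t := (kap * r) *: F (n + (k - a.+1%:Z) - t%:Z) (E (m + t%:Z) v).
have XN : ev0 X by exists N => i /EN e; rewrite /X e field0// scaler0.
have [M EM] : exists M, forall i j, (M <= i)%N -> E (m + i%:Z) (al j%:Z v) = 0.
  suff [M EM] : exists M, forall i j, (j < J)%N -> (M <= i)%N -> E (m + i%:Z) (al j%:Z v) = 0.
    by exists M => i j Mi; have [/aJ ->|jJ] := leqP J j; [exact: E0|exact: EM].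
  elim: J {aJ} => [|J [M EM]]; first by exists 0%N.
  have [L EL] := field_ev m (al J%:Z v) E_field.
  exists (maxn L M) => i j; rewrite ltnS leq_eqVlt => jJ; rewrite geq_max => /andP[Li Mi].
  by case/orP: jJ => [/eqP ->|jJ]; [exact: EL|exact: EM].
transitivity (nsum (fun i => nsum (fun j => G i j)) + nsum (fun i => nsum (fun j => (sg k i * cb a j) *: X (i + j)%N))).
  have evG i : ev0 (fun j => G i j) by exists J => j /aJ e; rewrite /G e E0 field0// scaler0.
  have evX i : ev0 (fun j => (sg k i * cb a j) *: X (i + j)%N).
    have [M' XM] := XN; exists M' => j Mj; rewrite XM ?scaler0//; lia.
  rewrite -nsumD; first last.
  - have [M' XM] := XN; exists M' => i Mi; apply: nsum0 => j; rewrite XM ?scaler0//; lia.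
  - by exists M => i Mi; apply: nsum0 => j; rewrite /G EM// field0// scaler0.
  apply: eq_nsum => i; rewrite -nsumD// -nsumZ; last exact: (non_ev al_ev0).
  apply: eq_nsum => j; rewrite /G /X E_al fieldD// fieldZ// -(addrA m i%:Z) -PoszD.
  have -> : n + k - i%:Z - (a + j).+1%:Z = n + (k - a.+1%:Z) - (i + j)%N%:Z by lia.
  lmodu.
rewrite nsum_exch; first last.
- by move=> j; exists M => i Mi; rewrite /G EM// field0// scaler0.
- by exists J => i j /aJ e; rewrite /G e E0 field0// scaler0.
rewrite nsum_cb//; congr (_ + _).
  apply: eq_nsum => j; rewrite -nsumZ; last exact: bor2_ev.
  by apply: eq_nsum => i; rewrite scalerA mulrC /G; congr (_ *: F _ _); ring.
rewrite -nsumZ; last exact: bor2_ev.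
by apply: eq_nsum => t; rewrite /X; lmod.
Qed.

(** Commuting E past the current costs a term with k lowered by a+1. On the right side of the
    identity, moving E past alpha(-a-1) inside u costs the same term, so the identity passes from u
    to alpha(-a-1) u as long as it is known for all k at once. *)
Lemma bor_no m k a F n v : field F ->
  bor m k (no a F) n v = no a (bor m k F) n v - (kap * r) *: bor m (k - a.+1%:Z) F n v.
Proof.
move=> fF.
have f1 := bor1_field m k fF; have f2 := bor2_field m k fF.
have fp := nop_field al_lin a fF; have fn : field (non a F) by exact: non_field.
have b1 : bor1 m k (no a F) n v = bor1 m k (nop a F) n v + (-1) ^+ a *: bor1 m k (non a F) n v.
  rewrite /bor1 -nsumZ; last exact: bor1_ev.
  rewrite -nsumD; [|exact: bor1_ev|exact/ev0Z/bor1_ev].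
  by apply: eq_nsum => i; rewrite /no /fadd /fscale ED EZ; lmod.
have b2 : bor2 m k (no a F) n v = bor2 m k (nop a F) n v + (-1) ^+ a *: bor2 m k (non a F) n v.
  rewrite /bor2 -nsumZ; last exact: bor2_ev.
  rewrite -nsumD; [|exact: bor2_ev|exact/ev0Z/bor2_ev].
  by apply: eq_nsum => i; rewrite /no /fadd /fscale; lmod.
rewrite /bor (noD al_lin al_ev0)//; last exact: fscale_field.
rewrite (noZ al_lin al_ev0)// /no /fadd /fscale b1 b2 bor1_nop// bor1_non// bor2_nop// bor2_non//.
have -> : (-1) ^+ `|(k - a.+1%:Z)%R|%N = - ((-1) ^+ `|k|%N * (-1) ^+ a) :> K.
  rewrite -exprD -[RHS]mulN1r -exprS -signr_odd -[RHS]signr_odd; congr (_ ^+ _).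
  by congr nat_of_bool; lia.
lmod.
Qed.

Variable S : V -> Prop.
Hypothesis S_al : forall i v, S v -> S (al i v).

(** The identity is only claimed on a sector S, later a fixed charge, because the exponents of z are
    integers only there. *)
Definition borcherds (u : V) := forall m k n v, S v ->
  bor m k (Y u) n v = nsum (fun i => gb (m%:~R : K) i *: Y (E (k + i%:Z) u) (m + n - i%:Z) v).

Lemma borcherds_al a u : borcherds u -> borcherds (al (Negz a) u).
Proof.
move=> Bu m k n v Sv; rewrite Y_al bor_no// Bu//.
have [N EN] := field_ev k u E_field.
pose Fs i := fscale (gb (m%:~R : K) i) (fshift (m - i%:Z) (Y (E (k + i%:Z) u))).
have fFs i : field (Fs i) by apply: fscale_field; exact: fshift_field.
rewrite (@no_ext S a _ (fsum N Fs))//; last first.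
  move=> n' w Sw; rewrite Bu// (@nsumE _ _ N) => [|i Ni]; last by rewrite EN// (lin0 (Y_lin _ _)) scaler0.
  by apply: eq_bigr => i _; rewrite /Fs /fscale /fshift (addrC m n') addrA.
rewrite no_sum//.
rewrite [RHS](eq_nsum (G := fun i => gb (m%:~R : K) i *: Y (al (Negz a) (E (k + i%:Z) u)) (m + n - i%:Z) v +
   - (kap * r) *: (gb (m%:~R : K) i *: Y (E (k - a.+1%:Z + i%:Z) u) (m + n - i%:Z) v))); last first.
  move=> i; rewrite E_al (linD (Y_lin _ _)) (linZ (Y_lin _ _)) (_ : k + i%:Z + Negz a = k - a.+1%:Z + i%:Z); first by lmod.
  by rewrite NegzE addrAC.
have evk k' : ev0 (fun i => gb (m%:~R : K) i *: Y (E (k' + i%:Z) u) (m + n - i%:Z) v).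
  have [M EM] := field_ev k' u E_field; exists M => i /EM ->; by rewrite (lin0 (Y_lin _ _)) scaler0.
rewrite nsumD; first last.
- exact/ev0Z/evk.
- by exists N => i /EN ->; rewrite al0 (lin0 (Y_lin _ _)) scaler0.
rewrite nsumZ; last exact: evk.
rewrite -scaleNr; congr (_ + _).
rewrite (@nsumE _ _ N) => [|i Ni]; last by rewrite EN// al0 (lin0 (Y_lin _ _)) scaler0.
apply: eq_bigr => i _; rewrite Y_al (noZ al_lin al_ev0); last exact: fshift_field.
by rewrite no_shift /fscale /fshift (addrC m n) addrA.
Qed.

Lemma borcherds_lin (c : K) u w : borcherds u -> borcherds w -> borcherds (c *: u + w).
Proof.
move=> Bu Bw m k n v Sv.
have evk x : ev0 (fun i => gb (m%:~R : K) i *: Y (E (k + i%:Z) x) (m + n - i%:Z) v).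
  have [M EM] := field_ev k x E_field; exists M => i /EM ->; by rewrite (lin0 (Y_lin _ _)) scaler0.
rewrite [RHS](eq_nsum (G := fun i => c *: (gb (m%:~R : K) i *: Y (E (k + i%:Z) u) (m + n - i%:Z) v) + gb (m%:~R : K) i *: Y (E (k + i%:Z) w) (m + n - i%:Z) v)); last first.
  by move=> i; rewrite ED EZ (lin_elim (Y_lin _ _)); lmod.
rewrite (nsumD (ev0Z c (evk u)) (evk w)) (nsumZ c (evk u)) -Bu// -Bw//.
rewrite /bor /fadd /fscale.
have -> : bor1 m k (Y (c *: u + w)) n v = c *: bor1 m k (Y u) n v + bor1 m k (Y w) n v.
  rewrite /bor1 -nsumZ; last exact: bor1_ev.
  rewrite -nsumD; [|exact/ev0Z/bor1_ev|exact: bor1_ev].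
  by apply: eq_nsum => i; rewrite (lin_elim (Y_lin _ _)) ED EZ; lmod.
have -> : bor2 m k (Y (c *: u + w)) n v = c *: bor2 m k (Y u) n v + bor2 m k (Y w) n v.
  rewrite /bor2 -nsumZ; last exact: bor2_ev.
  rewrite -nsumD; [|exact/ev0Z/bor2_ev|exact: bor2_ev].
  by apply: eq_nsum => i; rewrite (lin_elim (Y_lin _ _)); lmod.
lmod.
Qed.

Lemma borcherds_comm u m n v : borcherds u -> S v ->
  E m (Y u n v) - Y u n (E m v) =
  nsum (fun i => gb (m%:~R : K) i *: Y (E i%:Z u) (m + n - i%:Z) v).
Proof.
move=> Bu Sv; have gb0S i : gb (0%:~R : K) i.+1 = 0 by rewrite -[0%:~R]/(0%:R) gb_nat bin0n.
rewrite (eq_nsum (G := fun i => gb (m%:~R : K) i *: Y (E (0 + i%:Z) u) (m + n - i%:Z) v)); last first.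
  by move=> i; rewrite add0r.
rewrite -Bu// /bor /fadd /fscale /bor1 /bor2.
rewrite (@nsum1 _ _ 0%N) => [|[//|i] _]; last by rewrite gb0S mulr0 scale0r.
rewrite (@nsum1 _ _ 0%N) => [|[//|i] _]; last by rewrite gb0S mulr0 scale0r.
have e0 (k : int) : k + 0 - 0%:Z = k by lia.
have e1 (k : int) : k + 0%:Z = k by lia.
by rewrite expr0 gb0 mulr1 !e0 !e1 scaleN1r !scale1r.
Qed.

Section BorcherdsExp.
Variables (F : int -> V -> V) (l : K).
Hypothesis F_field : field F.
Hypothesis F_al : forall k n v, al k (F n v) = F n (al k v) + (kap * l) *: F (n + k) v.

Lemma al_bor j m k n v : al j (bor m k F n v) = bor m k F n (al j v) +
  (kap * r) *: bor (m + j) k F n v + (kap * l) *: bor m k F (n + j) v.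
Proof.
have e1 : al j (bor1 m k F n v) = bor1 m k F n (al j v) +
    ((kap * r) *: bor1 (m + j) k F n v + (kap * l) *: bor1 m k F (n + j) v).
  rewrite /bor1 (lin_nsum (al_lin _)); last exact: bor1_ev.
  rewrite -!nsumZ; [|exact: bor1_ev|exact: bor1_ev].
  rewrite -!nsumD; [|exact: bor1_ev|apply: ev0D; apply: ev0Z; exact: bor1_ev|apply: ev0Z; exact: bor1_ev|apply: ev0Z; exact: bor1_ev].
  apply: eq_nsum => i; rewrite alZ E_al F_al ED EZ (addrAC m j) (addrAC n j) (addrAC (m + k)).
  lmodu.
have e2 : al j (bor2 m k F n v) = bor2 m k F n (al j v) +
    ((kap * r) *: bor2 (m + j) k F n v + (kap * l) *: bor2 m k F (n + j) v).
  rewrite /bor2 (lin_nsum (al_lin _)); last exact: bor2_ev.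
  rewrite -!nsumZ; [|exact: bor2_ev|exact: bor2_ev].
  rewrite -!nsumD; [|exact: bor2_ev|apply: ev0D; apply: ev0Z; exact: bor2_ev|apply: ev0Z; exact: bor2_ev|apply: ev0Z; exact: bor2_ev].
  apply: eq_nsum => i; rewrite alZ F_al E_al fieldD// fieldZ// (addrAC m j) (addrAC n j) (addrAC (n + k)).
  lmodu.
rewrite /bor /fadd /fscale alD alZ e1 e2; lmodu.
Qed.

Definition borR (m k : int) u n v :=
  nsum (fun i => gb (m%:~R : K) i *: Y (E (k + i%:Z) u) (m + n - i%:Z) v).

Lemma borR_ev m k u (d : nat -> int) v : ev0 (fun i => gb (m%:~R : K) i *: Y (E (k + i%:Z) u) (d i) v).
Proof.
have [M EM] := field_ev k u E_field; exists M => i /EM ->.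
by rewrite (lin0 (Y_lin _ _)) scaler0.
Qed.

Lemma borR_lin m k u n : linear (borR m k u n).
Proof.
apply: lin_intro => c x y; rewrite /borR -nsumZ; last exact: borR_ev.
rewrite -nsumD; [|apply: ev0Z; exact: borR_ev|exact: borR_ev].
by apply: eq_nsum => i; rewrite (lin_elim (field_lin _ (Y_field _))); lmodu.
Qed.

Variable s0 : I.
Hypothesis s0l : rho s0 = l.

(** The right side has the same commutators with the Heisenberg algebra as the left side in
    [al_bor]. Their difference is therefore a family to which the Stone-von Neumann principle
    applies. The shift from m to m + j is Vandermonde for binom(m + j, i). *)
Lemma al_borR j m k n v : al j (borR m k (es s0) n v) = borR m k (es s0) n (al j v) +
  (kap * r) *: borR (m + j) k (es s0) n v + (kap * l) *: borR m k (es s0) (n + j) v.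
Proof.
set u := es s0.
have [N EN] := field_ev k u E_field.
pose G i q := (gb (m%:~R : K) i * gb (j%:~R : K) q) *: Y (E (k + (i + q)%N%:Z) u) (m + j + n - (i + q)%N%:Z) v.
have evG i : ev0 (fun q => G i q).
  exists N => q Nq; rewrite /G EN ?(lin0 (Y_lin _ _)) ?scaler0//; lia.
rewrite /borR (lin_nsum (al_lin _)); last exact: borR_ev.
rewrite -[(kap * l) *: _]nsumZ; last exact: borR_ev.
have -> : nsum (fun i => gb ((m + j)%:~R : K) i *: Y (E (k + i%:Z) u) (m + j + n - i%:Z) v) =
    nsum (fun i => nsum (fun q => G i q)).
  rewrite nsum_conv; last first.
    by exists N => i q Nq; rewrite /G EN ?(lin0 (Y_lin _ _)) ?scaler0.
  apply: eq_nsum => t; rewrite rmorphD/= -vandermonde scaler_suml; apply: eq_bigr => -[i it] _ /=.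
  by rewrite /G subnKC// -ltnS.
rewrite -nsumZ; last first.
  exists N => i Ni; apply: nsum0 => q; rewrite /G EN ?(lin0 (Y_lin _ _)) ?scaler0//; lia.
rewrite -!nsumD; first last.
- by apply: ev0Z; exists N => i Ni; apply: nsum0 => q; rewrite /G EN ?(lin0 (Y_lin _ _)) ?scaler0//; lia.
- exact: borR_ev.
- by apply: ev0Z; exact: borR_ev.
- apply: ev0D; first exact: borR_ev.
  by apply: ev0Z; exists N => i Ni; apply: nsum0 => q; rewrite /G EN ?(lin0 (Y_lin _ _)) ?scaler0//; lia.
apply: eq_nsum => i; rewrite alZ al_Y.
rewrite (eq_nsum (G := fun q => (if q == 0%N then kap * l else 0) *: Y (E (k + i%:Z) u) (m + n - i%:Z + j) v + (kap * r) *: (gb (j%:~R : K) q *: Y (E (k + (i + q)%N%:Z) u) (m + j + n - (i + q)%N%:Z) v))); last first.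
  move=> q; rewrite E_al; have -> : k + i%:Z + q%:Z = k + (i + q)%N%:Z by lia.
  have -> : j + (m + n - i%:Z) - q%:Z = m + j + n - (i + q)%N%:Z by lia.
  case: q => [|q]; last by rewrite al_esP E0 add0r (linZ (Y_lin _ _)) /= scale0r add0r; lmodu.
  rewrite al_es EZ gb0 eqxx addn0 (linD (Y_lin _ _)) !(linZ (Y_lin _ _)) s0l.
  have -> : m + j + n - i%:Z = m + n - i%:Z + j by lia.
  lmodu.
have evq : ev0 (fun q => gb (j%:~R : K) q *: Y (E (k + (i + q)%N%:Z) u) (m + j + n - (i + q)%N%:Z) v).
  exists N => q Nq; rewrite EN ?(lin0 (Y_lin _ _)) ?scaler0//; lia.
rewrite nsumD; [|by exists 1%N => -[|q]//= _; rewrite scale0r|exact: ev0Z].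
rewrite nsum_delta (nsumZ _ evq).
have -> : nsum (fun q => G i q) = gb (m%:~R : K) i *: nsum (fun q => gb (j%:~R : K) q *: Y (E (k + (i + q)%N%:Z) u) (m + j + n - (i + q)%N%:Z) v).
  by rewrite -nsumZ//; apply: eq_nsum => q; rewrite /G scalerA.
have -> : m + (n + j) - i%:Z = m + n - i%:Z + j by lia.
lmodu.
Qed.

End BorcherdsExp.

End Borcherds.

(** * The Virasoro operators *)

Section AbstractVirasoro.
Context {K : numFieldType} {V : lmodType K}.
Variables (al : int -> V -> V) (kap b : K).
Hypothesis kap0 : kap != 0.
Hypothesis al_lin : forall n, linear (al n).
Hypothesis al_heis : forall m n v, al m (al n v) =
  al n (al m v) + (if m + n == 0 then kap * m%:~R else 0) *: v.
Variables (Y : V -> int -> V -> V) (vac : V).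
Hypothesis Y_lin : forall n v, linear (fun u => Y u n v).
Hypothesis Y_al : forall a u, Y (al (Negz a) u) = no al a (Y u).
Hypothesis Y_vac : forall n v, Y vac n v = if n == -1 then v else 0.
Hypothesis al_vac : forall k : nat, al k%:Z vac = 0.
Hypothesis al_Y : forall m u n v, al m (Y u n v) = Y u n (al m v) +
  nsum (fun i => gb (m%:~R : K) i *: Y (al i%:Z u) (m + n - i%:Z) v).

Let al0 n : al n 0 = 0. Proof. exact: lin0. Qed.
Let alD n u v : al n (u + v) = al n u + al n v. Proof. exact: linD. Qed.
Let alZ n (c : K) v : al n (c *: v) = c *: al n v. Proof. exact: linZ. Qed.

Lemma Y_vac0 n v : n != -1 -> Y vac n v = 0.
Proof. by rewrite Y_vac => /negPf ->. Qed.

Lemma Y_al1 n v : Y (al (Negz 0) vac) n v = al n v.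
Proof.
rewrite Y_al /no /fadd /fscale /nop /non expr0 scale1r.
case: n => n.
  rewrite nsum0 ?add0r => [|i]; last by rewrite Y_vac0 ?al0 ?scaler0//; lia.
  rewrite (@nsum1 _ _ n) => [|i ni]; last by rewrite Y_vac0 ?scaler0//; lia.
  by rewrite Y_vac (_ : (_ == -1)) ?add0n ?binn ?scale1r//; lia.
rewrite [X in _ + X]nsum0 ?addr0 => [|i]; last by rewrite Y_vac0 ?scaler0//; lia.
rewrite (@nsum1 _ _ n) => [|i ni]; last by rewrite Y_vac0 ?al0 ?scaler0//; lia.
by rewrite Y_vac (_ : (_ == -1)) ?add0n ?binn ?scale1r//; lia.
Qed.

Lemma Y_al2 n v : Y (al (Negz 1) vac) n v = - (n%:~R : K) *: al (n - 1) v.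
Proof.
rewrite Y_al /no /fadd /fscale /nop /non expr1.
case: n => [[|n]|n].
- rewrite !nsum0 ?scaler0 ?addr0 ?oppr0 ?scale0r// => i; rewrite Y_vac0 ?al0 ?scaler0//; lia.
- rewrite nsum0 ?add0r => [|i]; last by rewrite Y_vac0 ?al0 ?scaler0//; lia.
  rewrite (@nsum1 _ _ n) => [|i ni]; last by rewrite Y_vac0 ?scaler0//; lia.
  rewrite Y_vac (_ : (_ == -1)); last by lia.
  rewrite add1n binSn scalerA mulN1r (_ : n.+1%:Z - 1 = n)//; lia.
rewrite [X in _ + _ *: X]nsum0 ?scaler0 ?addr0 => [|i]; last by rewrite Y_vac0 ?scaler0//; lia.
rewrite (@nsum1 _ _ n) => [|i ni]; last by rewrite Y_vac0 ?al0 ?scaler0//; lia.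
rewrite Y_vac (_ : (_ == -1)); last by lia.
have -> : (Negz n)%:~R = - n.+1%:R :> K by rewrite NegzE mulrNz.
rewrite add1n binSn opprK (_ : Negz n - 1 = Negz n.+1)//; lia.
Qed.

(** The conformal vector with the substitutions kap = 2p and b = p - 1. *)
Definition aom := (kap * 2)^-1 *: al (Negz 0) (al (Negz 0) vac) + (b / kap) *: al (Negz 1) vac.
Definition aL n := Y aom (n + 1).

Lemma aL_exp n v : aL n v = (kap * 2)^-1 *:
    (nsum (fun i => al (Negz i) (al (n + 1 + i%:Z) v)) +
     nsum (fun i => al (n - i%:Z) (al i%:Z v)))
  - (b / kap * (n + 1)%:~R) *: al n v.
Proof.
rewrite /aL /aom (linD (Y_lin _ _)) !(linZ (Y_lin _ _)) Y_al2 Y_al.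
rewrite /no /fadd /fscale /nop /non expr0 scale1r.
rewrite [X in _ *: (X + _)](eq_nsum (G := fun i => al (Negz i) (al (n + 1 + i%:Z) v))); last first.
  by move=> i; rewrite add0n binn scale1r Y_al1.
rewrite [X in _ *: (_ + X)](eq_nsum (G := fun i => al (n - i%:Z) (al i%:Z v))); last first.
  by move=> i; rewrite add0n binn scale1r Y_al1 (_ : n + 1 - i.+1%:Z = n - i%:Z)//; lia.
by rewrite addrK; lmod.
Qed.

Lemma al_aom (i : nat) : al i%:Z aom =
  if i == 1%N then al (Negz 0) vac else if i == 2%N then (2 * b) *: vac else 0.
Proof.
have n2 : 2%:R != 0 :> K by rewrite pnatr_eq0.
have h1 : al i%:Z (al (Negz 0) vac) = (if i == 1%N then kap else 0) *: vac.
  rewrite al_heis al_vac al0 add0r; congr (_ *: _).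
  have -> : (i%:Z + Negz 0 == 0) = (i == 1%N) by lia.
  by case: eqP => // ->; rewrite mulr1.
have h2 : al i%:Z (al (Negz 1) vac) = (if i == 2%N then kap * 2 else 0) *: vac.
  rewrite al_heis al_vac al0 add0r; congr (_ *: _).
  have -> : (i%:Z + Negz 1 == 0) = (i == 2%N) by lia.
  by case: eqP => // ->.
have h3 : al i%:Z (al (Negz 0) (al (Negz 0) vac)) = (if i == 1%N then kap * 2 else 0) *: al (Negz 0) vac.
  rewrite al_heis h1 alZ -scalerDl; congr (_ *: _).
  have -> : (i%:Z + Negz 0 == 0) = (i == 1%N) by lia.
  by case: eqP => [->|_]; [rewrite mulr1 mulr_natr|rewrite addr0].
rewrite /aom alD !alZ h3 h2 !scalerA.
case: i {h1 h2 h3} => [|[|[|i]]] /=; rewrite ?mulr0 ?scale0r ?addr0 ?add0r//.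
  by rewrite mulVf ?scale1r// mulf_neq0.
by congr (_ *: _); rewrite mulrA divfK// mulrC.
Qed.

Lemma al_aL m n v : al m (aL n v) = aL n (al m v) + ((m%:~R : K) *: al (m + n) v +
  (if m + n == 0 then b * (m%:~R * (m%:~R - 1)) else 0) *: v).
Proof.
rewrite /aL al_Y; congr (_ + _).
rewrite (@nsumE _ _ 3); last by move=> [|[|[|i]]]// _; rewrite al_aom (lin0 (Y_lin _ _)) scaler0.
rewrite !big_ord_recr big_ord0/= !al_aom /= (lin0 (Y_lin _ _)) scaler0 !add0r gb1 Y_al1.
rewrite (_ : m + (n + 1) - 1 = m + n); last by lia.
rewrite (linZ (Y_lin _ _)) Y_vac scalerA; congr (_ + _).
have -> : (m + (n + 1) - 2%:Z == -1) = (m + n == 0) by lia.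
case: eqP => _; last by rewrite scaler0 scale0r.
congr (_ *: _); rewrite mulrA mulrC; congr (_ * _).
have := gbS (m%:~R : K) 1; rewrite gb1 mulrC => ->.
by rewrite mulrC.
Qed.

Section Primary.
Variables (E : int -> V -> V) (r : K) (e : V).
Hypothesis E_lin : forall n, linear (E n).
Hypothesis E_al : forall k n v, al k (E n v) = E n (al k v) + (kap * r) *: E (n + k) v.
Hypothesis E_vac0 : forall n : nat, E n%:Z vac = 0.
Hypothesis E_vac1 : E (-1) vac = e.
Hypothesis E_vac2 : E (-2) vac = r *: al (Negz 0) e.

Definition ah := kap / 2 * r ^+ 2 - b * r.

Lemma E_aom (i : nat) : E i%:Z aom =
  if i == 0%N then ((ah - 1) * r) *: al (Negz 0) e else if i == 1%N then ah *: e else 0.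
Proof.
have n2 : 2%:R != 0 :> K by rewrite pnatr_eq0.
have Eal k n v : E n (al k v) = al k (E n v) - (kap * r) *: E (n + k) v by rewrite E_al addrK.
have e1 (n : int) : n + Negz 0 = n - 1 by lia.
have e2 (n : int) : n + Negz 1 = n - 2 by lia.
rewrite /aom (linD (E_lin _)) !(linZ (E_lin _)) !Eal !alD -!scaleN1r !alZ.
rewrite !e1 !e2 E_vac0 !al0.
case: i => [|[|i]] /=.
- rewrite (_ : 0%:Z - 1 = -1)// (_ : 0%:Z - 2 = -2)// (_ : -1 - 1 = -2 :> int)// E_vac1 E_vac2 /ah.
  by lmod_with msame; field.
- rewrite (_ : 1%:Z - 1 = 0%:Z)// (_ : 1%:Z - 2 = -1)// (_ : 0%:Z - 1 = -1)// E_vac0 E_vac1 al0 /ah.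
  by lmod_with msame; field.
- rewrite (_ : i.+2%:Z - 1 = i.+1%:Z); last by lia.
  rewrite (_ : i.+1%:Z - 1 = i%:Z); last by lia.
  rewrite (_ : i.+2%:Z - 2 = i%:Z); last by lia.
  by rewrite !E_vac0 al0; lmod.
Qed.

Hypothesis al_e : al 0 e = (kap * r) *: e.
Hypothesis al_eP : forall k : nat, al k.+1 e = 0.
Hypothesis Y_e : forall k v, Y e k v = E k v.

(** The failure of the derivative property Y(L(-1) e, z) = d/dz Y(e, z), written with L(-1) e = r
    alpha(-1) e. It commutes with the Heisenberg algebra like a vertex operator, which lets
    [em_derivative] conclude that it vanishes. *)
Definition der k v := r *: Y (al (Negz 0) e) k v + (k%:~R : K) *: E (k - 1) v.

Lemma al_der j k v : al j (der k v) = der k (al j v) + (kap * r) *: der (k + j) v.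
Proof.
have a0 : al 0%:Z (al (Negz 0) e) = (kap * r) *: al (Negz 0) e.
  by rewrite al_heis al_e alZ scale0r addr0.
have a1 : al 1%:Z (al (Negz 0) e) = kap *: e.
  by rewrite al_heis al_eP al0 add0r mulr1.
have a2 (i : nat) : al i.+2%:Z (al (Negz 0) e) = 0.
  by rewrite al_heis al_eP al0 add0r scale0r.
rewrite /der alD !alZ al_Y E_al.
rewrite (@nsumE _ _ 2) => [|[|[|i]]// _]; last by rewrite a2 (lin0 (Y_lin _ _)) scaler0.
rewrite big_ord_recr big_ord1/= a0 a1 !(linZ (Y_lin _ _)) gb0 gb1 scale1r Y_e.
rewrite subr0 (addrC j) (addrAC k (-1)) rmorphD/=.
lmodu.
Qed.

Lemma E_aL m n v :
  E m (aL n v) - aL n (E m v) = nsum (fun i => gb (m%:~R : K) i *: Y (E i%:Z aom) (m + (n + 1) - i%:Z) v) ->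
  (forall k, r *: Y (al (Negz 0) e) k v = - (k%:~R : K) *: E (k - 1) v) ->
  (forall k, Y e k v = E k v) ->
  aL n (E m v) = E m (aL n v) + ((ah - 1) * (n + 1)%:~R - m%:~R) *: E (m + n) v.
Proof.
move=> h der Ye; have -> : aL n (E m v) = E m (aL n v) - (E m (aL n v) - aL n (E m v)).
  by rewrite opprB addrC subrK.
rewrite h; congr (_ + _).
rewrite (@nsumE _ _ 2); last by move=> [|[|i]]// _; rewrite E_aom (lin0 (Y_lin _ _)) scaler0.
rewrite !big_ord_recr big_ord0/= !E_aom /= add0r gb0 gb1 !(linZ (Y_lin _ _)) scale1r -scalerA der Ye.
rewrite subr0 (_ : m + (n + 1) - 1%:Z = m + n); last by lia.
rewrite -scaleN1r !rmorphD/=; lmodu.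
Qed.

End Primary.

Hypothesis aL_lin : forall n, linear (aL n).

(** The defect of the Virasoro relation commutes with every alpha(k), whatever the scalar z. It is
    thus fixed by one ground coefficient, and z will be chosen to cancel it. *)
Lemma al_aLL k m n (z : K) v :
  let X v := aL m (aL n v) - aL n (aL m v) - ((m%:~R - n%:~R) *: aL (m + n) v + z *: v) in
  al k (X v) = X (al k v).
Proof.
cbn zeta beta.
rewrite -!scaleN1r !(alD, alZ).
rewrite (al_aL k m (aL n v)) (al_aL k n (aL m v)) (al_aL k n v) (al_aL k m v) (al_aL k (m + n) v).
rewrite !(linD (aL_lin _)) !(linZ (aL_lin _)).
rewrite (al_aL (k + m) n v) (al_aL (k + n) m v).
rewrite (_ : k + n + m = k + m + n); last by lia.
rewrite (_ : k + (m + n) = k + m + n); last by lia.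
rewrite !rmorphD/=.
case: (eqVneq (k + m + n) 0) => [e|_]; last by lmod.
have -> : (m%:~R : K) = - k%:~R - n%:~R by rewrite -rmorphN -rmorphB; congr (_%:~R); lia.
lmod.
Qed.

End AbstractVirasoro.

(** * Modes *)

Section Modes.
Context {R : realType} (p : nat).
Local Notation C := R[i].
Local Notation V := (fock R).
Local Notation alpha := (@al R p).
Local Notation pp := (@pp R p).
Local Notation es := (@es R).

Lemma mode_sig : {f : V -> int -> V -> V | f = @Defs.mode R p}.
Proof. by eexists. Qed.
Definition md := sval mode_sig.
Lemma modeE : @Defs.mode R p = md. Proof. by rewrite /md (svalP mode_sig). Qed.
Local Notation mode := md.
Local Notation em := (@em R p).

Lemma wh_ev0 (f : nat -> V -> V) (g : rat -> rat) (h : rat -> rat) : (forall i, linear (f i)) ->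
  (forall i s w v, wh p s w v -> wh p (g s) (w + h s - i%:R) (f i v)) ->
  forall v, ev0 (fun i => f i v).
Proof.
move=> lf wf; apply: (wh_ind (p := p)) => [|c u v [N uN] [M vM]|s w v wv].
- by exists 0%N => i _; rewrite (lin0 (lf i)).
- exists (maxn N M) => i; rewrite geq_max => /andP[/uN eu /vM ev].
  by rewrite (lin_elim (lf i)) eu ev scaler0 addr0.
have [N Nw] : exists N : nat, w + h s - N%:R < hw p (g s).
  exists (Num.bound `|w + h s - hw p (g s)|); rewrite ltrBlDl -ltrBlDr.
  exact: (le_lt_trans (ler_norm _) (archi_boundP (normr_ge0 _))).
exists N => i Ni; apply: (wh_lt0 (wf i _ _ _ wv)).
by apply: le_lt_trans Nw; rewrite lerD2l lerN2 ler_nat.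
Qed.

Lemma alpha_ev0 (v : V) : ev0 (fun i => alpha i%:Z v).
Proof.
apply: (wh_ev0 (f := fun i v => alpha i%:Z v) (g := id) (h := fun _ => 0)).
  by move=> i; exact: alpha_lin.
by move=> i s w u wu; rewrite addr0; exact: (alpha_wh (n := i%:Z) wu).
Qed.

Lemma exp_mode_field r : field (em r).
Proof.
split=> [n|n v]; first exact: exp_mode_lin.
apply: (wh_ev0 (f := fun i v => em r (n + i%:Z) v) (g := fun s => r + s) (h := fun s => hw p r - n%:~R - 1)).
  by move=> i; exact: exp_mode_lin.
move=> i s w u wu; have := exp_mode_wh (r := r) (n := n + i%:Z) wu.
by congr (wh p _ _ _); rewrite rmorphD/= -[i%:~R]/(i%:R); ring.
Qed.

Lemma normal_orderE a (F : int -> V -> V) : normal_order p a F = no alpha a F.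
Proof.
apply/funext => n; apply/funext => v.
rewrite /normal_order alphaE /no /fadd /fscale /nop /non /nsum.
by congr (_ + _); apply: eq_fsbigr => i _; rewrite NegzE.
Qed.

Lemma mode_bs A r : mode (bs (A, r)) = foldr (no alpha) (em r) (enum_mset A).
Proof.
rewrite -modeE -exp_modeE0; apply/funext => n; apply/funext => v.
transitivity (foldr (normal_order p) (@Defs.exp_mode R p r) (enum_mset A) n v); first exact: lin_extU.
have E : forall l, foldr (normal_order p) (@Defs.exp_mode R p r) l = foldr (no alpha) (@Defs.exp_mode R p r) l.
  elim=> [|a l IHl]; cbn [foldr]; first exact: erefl.
  by rewrite normal_orderE; exact: (congr1 (no alpha a) IHl).
exact: (congr1 (fun f => f n v) (E (enum_mset A))).
Qed.

Lemma mode_lin n (v : V) : linear (fun u => mode u n v).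
Proof. rewrite -modeE; exact: lin_ext_is_linear. Qed.

Lemma mode_fieldU b : field (mode (bs b)).
Proof.
case: b => A r; rewrite mode_bs; apply: foldr_no_field; last exact: exp_mode_field.
- exact: alpha_lin.
- exact: alpha_ev0.
Qed.

Lemma mode_field u : field (mode u).
Proof.
split=> [n|n v].
  apply: (fock_ind (P := fun u => linear (mode u n))) => [|c u' w lu lw|b _].
  - apply: lin_intro => c x y; rewrite !(lin0 (mode_lin _ _)); lmod.
  - apply: lin_intro => d x y; rewrite !(lin_elim (mode_lin _ _)) (lin_elim lu) (lin_elim lw); lmod.
  - exact: field_lin (mode_fieldU b).
apply: (fock_ind (P := fun u => ev0 (fun i => mode u (n + i%:Z) v))) => [|c u' w [N uN] [M wM]|b _].
- by exists 0%N => i _; rewrite (lin0 (mode_lin _ _)).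
- exists (maxn N M) => i; rewrite geq_max => /andP[/uN eu /wM ew].
  by rewrite (lin_elim (mode_lin _ _)) eu ew scaler0 addr0.
- exact: field_ev (mode_fieldU b).
Qed.

Lemma mode_al a u : mode (alpha (Negz a) u) = no alpha a (mode u).
Proof.
have fF := mode_field; have aL := @alpha_lin R p; have aE := alpha_ev0.
apply/funext => n; apply/funext => v.
apply: (fock_ind (P := fun u => mode (alpha (Negz a) u) n v = no alpha a (mode u) n v)) => [|c x y ex ey|[A r] _].
- have e : mode 0 = fscale 0 (mode 0).
    by apply/funext => k; apply/funext => w; rewrite (lin0 (mode_lin _ _)) /fscale scale0r.
  rewrite alpha0 [in RHS]e (noZ aL aE)// /fscale scale0r; exact: lin0 (mode_lin n v).
- rewrite alphaD alphaZ (lin_elim (mode_lin _ _)) ex ey.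
  have -> : mode (c *: x + y) = fadd (fscale c (mode x)) (mode y).
    by apply/funext => k; apply/funext => w; rewrite (lin_elim (mode_lin _ _)).
  rewrite (noD aL aE)//; last exact: fscale_field.
  by rewrite (noZ aL aE).
rewrite alphaNU !mode_bs; congr (_ n v).
rewrite (foldr_no_perm aL (@heis R p) aE (exp_mode_field r) (enum_msetD1 a A)).
by [].
Qed.

Lemma mode_es r : mode (es r) = em r.
Proof. by rewrite e_E mode_bs enum_mset0. Qed.

Lemma fock_al_ind (P : V -> Prop) : P 0 ->
  (forall (c : C) u v, P u -> P v -> P (c *: u + v)) -> (forall s, P (es s)) ->
  (forall k v, P v -> P (alpha (Negz k) v)) -> forall v, P v.
Proof.
move=> P0 Pl Pe Pa v; apply: fock_ind => // -[A s] _.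
by apply: (bs_ind (p := p)).
Qed.

Lemma alpha_es s : alpha 0 (es s) = (pp * ratr s) *: es s.
Proof. by apply: alpha0_chg; exact: chg_e. Qed.

Lemma alpha_esP s k : alpha k.+1 (es s) = 0.
Proof. by rewrite e_E alphaPU mset0E muln0 scale0r. Qed.

Lemma mode_es_al s k n v : alpha k (mode (es s) n v) =
  mode (es s) n (alpha k v) + (pp * ratr s) *: mode (es s) (n + k) v.
Proof. by rewrite mode_es; exact: alpha_exp_mode. Qed.

Lemma al_mode m u n v : alpha m (mode u n v) = mode u n (alpha m v) +
  nsum (fun i => gb (m%:~R : C) i *: mode (alpha i%:Z u) (m + n - i%:Z) v).
Proof.
exact: (al_Y (@alpha_lin R p) (@heis R p) alpha_ev0 mode_lin mode_field mode_al fock_al_ind mode_es_al alpha_es alpha_esP).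
Qed.

End Modes.

Lemma sum2 (W : zmodType) I (a b : I) (F : I -> W) :
  \sum_(x <- [:: a; b]) F x = F a + F b.
Proof. by rewrite !big_cons big_nil addr0. Qed.

Lemma sub_comb (K : pzRingType) (W : lmodType K) (c d : K) (x y a a' b b' e e' : W) :
  x = a + c *: b + d *: e -> y = a' + c *: b' + d *: e' ->
  x - y = a - a' + (c *: (b - b') + d *: (e - e')).
Proof. by move=> -> ->; rewrite !scalerBr !opprD addrACA [X in X + _]addrACA -addrA. Qed.

Section ModeWeights.
Context {R : realType} (p : nat).
Local Notation C := R[i].
Local Notation V := (fock R).
Local Notation alpha := (@al R p).
Local Notation pp := (@pp R p).
Local Notation es := (@es R).
Local Notation mode := (@md R p).
Local Notation em := (@em R p).
Local Notation shift := (@sh R).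
Local Notation wh := (@wh R p).
Implicit Types (r s t l : rat) (v : V).

Lemma eq_sign (F : pzRingType) a b : odd a = odd b -> (-1) ^+ a = (-1) ^+ b :> F.
Proof. by move=> ab; rewrite -signr_odd ab signr_odd. Qed.

Definition fwh r x (F : int -> V -> V) := forall n s w v, wh s w v ->
  wh (r + s) (w + x - n%:~R - 1) (F n v).

Lemma no_wh a r x F : fwh r x F -> fwh r (x + a.+1%:R) (no alpha a F).
Proof.
move=> fF n s w v wv; rewrite /no /fadd /fscale /nop /non.
apply: supp_inD; last apply: supp_inZ; apply: supp_in_nsum => i; apply: supp_inZ.
  have := alpha_wh (n := Negz (a + i)) (fF (n + i%:Z) _ _ _ wv).
  congr (wh _ _ _); rewrite NegzE rmorphD rmorphN/= -[i%:~R]/(i%:R) -[_.+1%:~R]/((a + i).+1%:R).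
  rewrite -addSn natrD; ring.
have := fF (n - (a + i).+1%:Z) _ _ _ (alpha_wh (n := i%:Z) wv).
congr (wh _ _ _); rewrite rmorphB/= -[i%:~R]/(i%:R) -[_.+1%:~R]/((a + i).+1%:R).
rewrite -addSn natrD; ring.
Qed.

Lemma mode_wh r x u : wh r x u -> fwh r x (mode u).
Proof.
move=> ux n s w v wv; move: u ux.
apply: (supp_in_lin (f := fun u => mode u n v)); first exact: mode_lin.
move=> [A t] /= [-> <-]; rewrite mode_bs; move: n s w v wv.
rewrite -[forall n, _]/(fwh r ((lev A)%:R + hw p r) _) /lev.
elim: (enum_mset A) => [|a l IHl] /=.
  by rewrite big_nil add0r => n s w v wv; exact: exp_mode_wh.
rewrite big_cons natrD (_ : _ + _ = (\sum_(k <- l) k.+1)%:R + hw p r + a.+1%:R); last by ring.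
exact: no_wh.
Qed.

Lemma mode_chg r u n s (v : V) : chg r u -> chg s v -> chg (r + s) (mode u n v).
Proof.
move=> cu cv; move: u cu; apply: (supp_in_lin (f := fun u => mode u n v)); first exact: mode_lin.
move=> [A t] /= ->; apply: (@wh_to_chg R p (fun v => mode (bs (A, r)) n v) s (r + s) _ _ v cv).
  exact: (field_lin n (mode_field p _)).
move=> w u wu; exists (w + ((lev A)%:R + hw p r) - n%:~R - 1).
by apply: mode_wh wu; exact: supp_inU.
Qed.

Lemma gr_sig : {f : rat -> V -> C | forall s v, f s v = v@_(mset0, s)}.
Proof. by exists (fun s v => v@_(mset0, s)). Qed.
Definition gr := sval gr_sig.
Lemma grE s v : gr s v = v@_(mset0, s). Proof. exact: (svalP gr_sig). Qed.

Lemma gr_lin s (c : C) u v : gr s (c *: u + v) = c * gr s u + gr s v.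
Proof. by rewrite !grE mcoeffD mcoeffZ. Qed.
Lemma gr0 s : gr s 0 = 0. Proof. by rewrite grE mcoeff0. Qed.
Lemma grD s u v : gr s (u + v) = gr s u + gr s v. Proof. by rewrite !grE mcoeffD. Qed.
Lemma grZ s (c : C) v : gr s (c *: v) = c * gr s v. Proof. by rewrite !grE mcoeffZ. Qed.
Lemma gr_sum s I (r : seq I) (P : pred I) (F : I -> V) :
  gr s (\sum_(i <- r | P i) F i) = \sum_(i <- r | P i) gr s (F i).
Proof. by apply: (big_morph (gr s)); [exact: grD|exact: gr0]. Qed.
Lemma gr_nsum s (F : nat -> V) : ev0 F -> gr s (nsum F) = nsum (fun i => gr s (F i)).
Proof. by move=> eF; apply: nsum_lin => //; [exact: gr0|exact: grD]. Qed.
Lemma gr_es s : gr s (es s) = 1. Proof. by rewrite grE e_E mcoeff_bs eqxx. Qed.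
Lemma gr_alphaN s k v : gr s (alpha (Negz k) v) = 0.
Proof. by rewrite grE mcoeff_alphaN mset0E. Qed.
Lemma gr_wh s w v : wh s w v -> w != hw p s -> gr s v = 0.
Proof.
move=> wv; apply: contraNeq; rewrite grE => /wv/= [_ <-].
by rewrite lev0 add0r.
Qed.

(** The Euler operator of the Fock space. The bound N grows with the monomials of v, so the sum is
    stated for all sufficiently large cutoffs. *)
Lemma level_op s w v : wh s w v -> exists N, forall M, (N <= M)%N ->
  \sum_(i < M) alpha (Negz i) (alpha i.+1 v) = (pp * ratr (w - hw p s)) *: v.
Proof.
move=> wv; apply: (fock_ind (P := fun v => exists N, forall M, (N <= M)%N ->
  \sum_(i < M) alpha (Negz i) (alpha i.+1 v) = (pp * ratr (w - hw p s)) *: v)).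
- by exists 0%N => M _; rewrite big1 ?scaler0// => i _; rewrite !alpha0.
- move=> c x y [N xN] [L yL]; exists (maxn N L) => M; rewrite geq_max => /andP[/xN ex /yL ey].
  under eq_bigr do rewrite !alphaD !alphaZ.
  rewrite big_split/= -scaler_sumr ex ey; lmod.
move=> [A t] /wv /= [-> <-]; rewrite addrK ratr_nat.
have [N AN] : exists N, forall M, (N <= M)%N -> (\sum_(i < M) i.+1 * A i)%N = lev A.
  elim/mset_ind: A {wv} => [|k A [N AN]].
    by exists 0%N => M _; rewrite lev0 big1// => i _; rewrite mset0E muln0.
  exists (maxn N k.+1) => M; rewrite geq_max => /andP[NM kM].
  under eq_bigr do rewrite mset1DE mulnDr.
  rewrite big_split/= AN// levD; congr (_ + _)%N.
  rewrite (bigD1 (Ordinal kM))//= eqxx muln1 big1 ?addn0// => i.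
  by rewrite -val_eqE/= => /negPf ->; rewrite muln0.
exists N => M /AN <-; rewrite natr_sum mulr_sumr scaler_suml; apply: eq_bigr => -[i /= _] _.
rewrite alphaPU alphaZ alphaNU /=; case: (posnP (A i)) => Ai.
  by rewrite Ai !muln0 mulr0 !scale0r.
have -> : (i +` (A `\ i))%mset = A by rewrite msetB1K// -mset_gt0.
have -> : pp * (i.+1 * A i)%N%:R = (2 * p * i.+1 * A i)%N%:R by rewrite /pp -natrM !mulnA.
exact: erefl.
Qed.

Local Notation Ep r := (@exp_creation R p r).
Local Notation Em r := (@exp_annihilation R p r).
Hypothesis p0 : (0 < p)%N.

Lemma pp0 : pp != 0.
Proof. by rewrite pnatr_eq0 muln_eq0/= -lt0n. Qed.

(** Newton's recursion for the coefficients of the creation exponential, obtained by evaluating the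
    Euler operator on a vector of level k. *)
Lemma Ep_rec l k t : k%:R *: Ep l k (es t) =
  \sum_(i < k) ratr l *: alpha (Negz i) (Ep l (k - i.+1)%N (es t)).
Proof.
have wE := Ep_wh (r := l) (k := k) (@wh_e R p t).
have [N LN] := level_op wE.
apply: (scalerI pp0); rewrite scalerA.
have := LN (maxn N k) (leq_maxl _ _); rewrite addrC addKr ratr_nat => <-.
rewrite -(@big_ord_widen0 _ (fun i => alpha (Negz i) (alpha i.+1 (Ep l k (es t)))) k); first last.
- move=> i ki; rewrite alphaP_Ep alpha_esP (lin0 (Ep_lin _ _ _)) add0r ltnNge ki/=.
  exact: alpha0.
- exact: leq_maxr.
rewrite scaler_sumr; apply: eq_bigr => -[i ik] _ /=.
by rewrite alphaP_Ep alpha_esP (lin0 (Ep_lin _ _ _)) add0r ik alphaZ scalerA.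
Qed.

Lemma gr_Ep r k s v : gr s (Ep r k v) = if k == 0%N then gr s v else 0.
Proof.
case: eqP => [->|/eqP k0]; first by rewrite Ep_0.
rewrite EpE /op_series_exp gr_sum big1// => -[j /= _] _; rewrite grZ.
case: j => [|j] /=; first by rewrite /op_series1 (negPf k0) gr0 mulr0.
rewrite /op_series_mul gr_sum big1 ?mulr0// => -[[|i] _] _ /=.
  by rewrite invr0 mulr0 scale0r gr0.
by rewrite grZ gr_alphaN mulr0.
Qed.

Definition gEm r l k t := gr t (Em r k (Ep l k (es t))).

(** The recursion is z f' = x z f / (1 - z), whose normalized solution is (1 - z)^(-x). *)
Lemma sum_gb (f : nat -> C) (x : C) : f 0%N = 1 ->
  (forall k, k%:R * f k = \sum_(i < k) x * f (k - i.+1)%N) ->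
  forall k, f k = (-1) ^+ k * gb (- x) k.
Proof.
move=> f0 fS k.
have h j : (-1) ^+ j * f j = gb (- x) j.
  move: j; apply: gb_ind => [|j]; first by rewrite mul1r.
  have e : \sum_(i < j) x * f (j - i.+1)%N = j%:R * f j by rewrite fS.
  have := fS j.+1; rewrite big_ord_recl/= subSS subn0.
  under eq_bigr do rewrite /bump/= add1n subSS.
  rewrite e => e'; rewrite exprS mulrCA e'; ring.
by rewrite -h mulrA -exprD addnn -mul2n mulnC exprM sqrr_sign mul1r.
Qed.

(** The contraction of two exponentials: the coefficient of x^k in (1 - x)^(2 p r l). *)
Lemma gEmE r l k t : gEm r l k t = (-1) ^+ k * gb (ratr (2 * p%:R * r * l)) k.
Proof.
have -> : ratr (2 * p%:R * r * l) = - (- (pp * ratr r * ratr l)) :> C.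
  by rewrite opprK !rmorphM/= !ratr_nat /pp natrM.
move: k; apply: sum_gb => [|k]; first by rewrite /gEm Em_0 Ep_0 gr_es.
rewrite /gEm -grZ -(linZ (Em_lin _ _ _)) Ep_rec (lin_big (Em_lin _ _ _)) gr_sum.
apply: eq_bigr => -[i ik] _ /=; rewrite (linZ (Em_lin _ _ _)) grZ.
have := alphaN_Em p r i k (Ep l (k - i.+1)%N (es t)); rewrite ik -NegzE => e.
have -> : Em r k (alpha (Negz i) (Ep l (k - i.+1)%N (es t))) =
   alpha (Negz i) (Em r k (Ep l (k - i.+1)%N (es t))) - (pp * ratr r) *: Em r (k - i.+1)%N (Ep l (k - i.+1)%N (es t)).
  by rewrite e addrK.
rewrite grD -scaleNr grZ gr_alphaN; ring.
Qed.

Lemma shift_Ep r l k v : shift r (Ep l k v) = Ep l k (shift r v).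
Proof.
have Hc k' (v' : V) : shift r ((ratr l / k'%:R : C) *: alpha (- k'%:Z) v') =
    (ratr l / k'%:R : C) *: alpha (- k'%:Z) (shift r v') + (if k' == 1%N then 0 else 0) *: shift r v'.
  rewrite if_same scale0r addr0 (linZ (shift_lin r)).
  case: k' => [|k']; first by rewrite invr0 mulr0 !scale0r.
  by rewrite alpha_shift.
have la k' : linear (fun v : V => (ratr l / k'%:R : C) *: alpha (- k'%:Z) v).
  by apply: lin_scale; exact: alpha_lin.
have Hc' k' (v' : V) : shift r ((ratr l / k'%:R : C) *: alpha (- k'%:Z) v') =
    (ratr l / k'%:R : C) *: alpha (- k'%:Z) (shift r v') + (if k' == 1%N then 0 else 0) *: v'.
  by rewrite Hc !if_same !scale0r.
have a0 (v' : V) : (ratr l / 0%:R : C) *: alpha (- 0%:Z) v' = 0 by rewrite invr0 mulr0 scale0r.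
by rewrite EpE (exp_comm la a0 (shift_lin r) (m := 1%N) isT Hc') scale0r if_same addr0.
Qed.

Lemma Ep_chg r k s v : chg s v -> chg s (Ep r k v).
Proof.
by move=> cv; have := @Ez_Em_chg R p r k%:Z 0 s v cv; rewrite Em_0.
Qed.

Lemma Em_es r k t : Em r k (es t) = if k == 0%N then es t else 0.
Proof.
case: eqP => [->|/eqP k0]; first by rewrite Em_0.
by rewrite e_E Em_big// lev0 lt0n.
Qed.

Lemma shift_es r s : shift r (es s) = es (r + s).
Proof. by rewrite !e_E shiftU. Qed.

Lemma gr_shift r s v : chg s v -> gr (r + s) (shift r v) = gr s v.
Proof.
move=> cv; apply: (fock_ind (P := fun v => gr (r + s) (shift r v) = gr s v)).
- by rewrite (lin0 (shift_lin r)) !gr0.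
- by move=> c u w eu ew; rewrite (lin_elim (shift_lin r)) (gr_lin (r + s)) eu ew gr_lin.
move=> [A t] /cv /= ->; rewrite shiftU !grE !mcoeff_bs !xpair_eqE.
by rewrite (inj_eq (addrI r)).
Qed.

Lemma exp_mode_es r n s (c : int) : - n%:~R - 1 - 2 * p%:R * r * s = c%:~R :> rat ->
  em r n (es s) = Ez p r c (es (r + s)).
Proof.
move=> e; rewrite (exp_modeE (@chg_e R s) e) (@nsum1 _ _ 0%N) => [|i /negPf i0].
  rewrite Em_0 add0r; case: c e => c _ /=; last exact: lin0 (shift_lin r).
  by rewrite shift_Ep shift_es.
by rewrite Em_es i0 (lin0 (Ez_lin _ _ _)) (lin0 (shift_lin r)).
Qed.

Lemma gr_exp_mode r n s (c : int) v : chg s v -> - n%:~R - 1 - 2 * p%:R * r * s = - c%:~R :> rat ->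
  gr (r + s) (em r n v) = if c is Posz k then gr s (Em r k v) else 0.
Proof.
move=> cv e'; have e : - n%:~R - 1 - 2 * p%:R * r * s = (- c)%:~R :> rat by rewrite mulrNz.
rewrite (exp_modeE cv e).
have ev : ev0 (fun k => shift r (Ez p r (k%:Z - c) (Em r k v))).
  have [N vN] := Em_ev0 p r v; exists N => i /vN ->.
  by rewrite (lin0 (Ez_lin _ _ _)) (lin0 (shift_lin _)).
rewrite (gr_nsum _ ev); have g k : gr (r + s) (shift r (Ez p r (k%:Z - c) (Em r k v))) =
    if k%:Z == c then gr s (Em r k v) else 0.
  rewrite gr_shift; last exact: Ez_Em_chg.
  have [<-|kc] := eqVneq k%:Z c; first by rewrite subrr /= Ep_0.
  case E: (k%:Z - c) => [[|j]|j] /=; last exact: gr0.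
    by move: kc; rewrite -subr_eq0 E.
  by rewrite gr_Ep.
rewrite (eq_nsum g); case: c {e e' ev g} => c.
  rewrite (@nsum1 _ _ c) ?eqxx// => i ic; rewrite ifF//; apply/eqP => -[] /eqP.
  by rewrite (negPf ic).
by rewrite nsum0.
Qed.

(** The a-th coefficient of (1 + x)^(2 p r s). Each creation factor alpha(-i-1) of the state
    contributes at ground level only through alpha(0) on [es s], so [Ep_rec] turns into the
    recursion of [sum_gb]. *)
Lemma gr_Ep_mode r t a s (n0 : int) : - n0%:~R - 1 = 2 * p%:R * t * s :> rat ->
  gr (t + s) (mode (Ep r a (es t)) (n0 + a%:Z) (es s)) = gb (ratr (2 * p%:R * r * s)) a.
Proof.
move=> e; pose y a := gr (t + s) (mode (Ep r a (es t)) (n0 + a%:Z) (es s)).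
rewrite -/(y a).
suff h k : k%:R * y k = \sum_(i < k) - (pp * ratr r * ratr s) * ((-1) ^+ i.+1 * y (k - i.+1)%N).
  have y0 : y 0%N = 1.
    rewrite /y Ep_0 addr0 mode_es (@exp_mode_es t n0 s 0); first by rewrite /= Ep_0 gr_es.
    by rewrite -e subrr.
  have := @sum_gb (fun k => (-1) ^+ k * y k) (- (pp * ratr r * ratr s)).
  rewrite mul1r => /(_ y0) H; have := H _ a; rewrite opprK.
  have -> : ratr (2 * p%:R * r * s) = pp * ratr r * ratr s :> C.
    by rewrite !rmorphM/= !ratr_nat /pp natrM.
  move=> HH; have s1 : (-1) ^+ a != 0 :> C by rewrite signr_eq0.
  apply: (mulfI s1); apply: HH => k; rewrite mulrCA h mulr_sumr.
  apply: eq_bigr => -[i ik] _ /=; rewrite mulrCA; congr (_ * _).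
  rewrite mulrA -exprD; congr (_ * _); apply: eq_sign.
  by rewrite oddD oddB.
rewrite /y -grZ -(linZ (mode_lin _ _ _)) Ep_rec (lin_big (mode_lin _ _ _)) gr_sum.
apply: eq_bigr => -[i ik] _ /=; rewrite (linZ (mode_lin _ _ _)) grZ mode_al.
rewrite /no /fadd /fscale grD grZ {1}/nop /nsum gr_sum big1 => [|j _]; last by rewrite grZ gr_alphaN mulr0.
rewrite add0r -/(nsum _).
rewrite /non (@nsum1 _ _ 0%N) => [|[//|j] _]; last first.
  by rewrite alpha_esP (lin0 (field_lin _ (mode_field _ _))) scaler0.
rewrite addn0 bin0 scale1r alpha_es (linZ (field_lin _ (mode_field _ _))) grZ.
rewrite (_ : n0 + k%:Z - i.+1%:Z = n0 + (k - i.+1)%N%:Z); last by lia.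
rewrite exprS; ring.
Qed.

End ModeWeights.

Section ScalarBorcherds.
Context {F : numFieldType}.
Implicit Types (g x : int).

Definition gbz (x : F) (c : int) : F := if c is Posz k then gb x k else 0.
Definition sgz' (c : int) : F := (-1) ^+ `|c|%N.

Lemma gb_refl (x : int) (G : nat) : 0 <= x -> gb (x%:~R : F) G = gbz x%:~R (x - G%:Z).
Proof.
case: x => // x _; rewrite -[x%:~R]/(x%:R : F); have [Gx|xG] := leqP G x.
  rewrite (_ : x%:Z - G%:Z = (x - G)%N) /=; last by lia.
  by rewrite !gb_nat bin_sub.
rewrite (_ : x%:Z - G%:Z = Negz (G - x).-1) /=; last by lia.
by rewrite gb_nat bin_small.
Qed.

Lemma gb_negz (x : F) (c : nat) : sgz' c * gb x c = gb (c%:R - x - 1) c.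
Proof. by rewrite -[x]opprK gbN /sgz' /= mulrA -exprD addnn -mul2n exprM sqrrN !expr1n mul1r opprK; congr gb; ring. Qed.

(* The identity between ground coefficients in the Borcherds identity for two
   exponentials. *)
Lemma gb_borcherds g x :
  sgz' (x + g + 1) * gbz g%:~R (x + g + 1) - sgz' (g + x + 1) * gbz g%:~R (- x - 1) =
  gbz x%:~R (- g - 1) :> F.
Proof.
rewrite (addrC x g) -mulrBr.
(* For g >= 0 the right side is 0 and the left side cancels by the symmetry of binomial
   coefficients. For g < 0 at most one of the two terms on the left survives, and it equals the
   right side by the reflection of the upper argument. *)
case: g => g.
  have -> : - g%:Z - 1 = Negz g by lia.
  rewrite /= -[g%:~R]/(g%:R : F); apply/eqP; rewrite mulf_eq0 subr_eq0; apply/orP; right; apply/eqP.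
  have [gx|xg] := ltrP (g%:Z + x + 1) 0.
    have [j ->] : exists j, g%:Z + x + 1 = Negz j by case: (g%:Z + x + 1) gx => // j _; exists j.
    rewrite /=; case E: (- x - 1) => [c|//] /=; rewrite gb_nat bin_small//; lia.
  have [j ej] : exists j : nat, g%:Z + x + 1 = j by case: (g%:Z + x + 1) xg => // j _; exists j.
  rewrite ej /= gb_nat; case E: (- x - 1) => [c|c] /=; last by rewrite bin_small//; lia.
  rewrite gb_nat -bin_sub; last by lia.
  by congr (_%:R); congr binomial; lia.
have -> : - Negz g - 1 = g by lia.
rewrite [gbz _ g]/=.
have [x0|x0] := lerP 0 x.
  have -> : - x - 1 = Negz `|x|%N by lia.
  rewrite [gbz _ (Negz _)]/= subr0 (gb_refl g)//.
  case E: (Negz g + x + 1) => [c|c].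
    have -> : x - g%:Z = c by lia.
    rewrite [gbz _ _]/= gb_negz /=; congr gb.
    have -> : x = g%:Z + c by lia.
    by rewrite NegzE rmorphN rmorphD/= -[g.+1%:~R]/(g.+1%:R : F) -natr1 -[c%:~R]/(c%:R:F); ring.
  have -> : x - g%:Z = Negz c by lia.
  by rewrite /= mulr0.
have -> : Negz g + x + 1 = Negz (`|x|%N + g - 1)%N by lia.
rewrite [gbz _ (Negz (_ - _)%N)]/= sub0r.
have [c ec] : exists c : nat, - x - 1 = c by exists (`|x|.-1)%N; lia.
rewrite ec [gbz _ _]/= mulrN.
have -> : sgz' (Negz (`|x| + g - 1)) = - (sgz' g * sgz' c) :> F.
  rewrite /sgz' -exprD -[RHS]mulN1r -exprS; apply: eq_sign; congr odd; lia.
rewrite mulNr opprK -mulrA gb_negz.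
have -> : c%:R - (Negz g)%:~R - 1 = (g + c)%:R :> F.
  by rewrite NegzE rmorphN/= -[g.+1%:~R]/(g.+1%:R : F) -natr1 natrD; ring.
have -> : x = - c.+1%:Z by lia.
rewrite rmorphN/= -[c.+1%:~R]/(c.+1%:R : F) gbN /sgz' /=; congr (_ * _).
rewrite (_ : c.+1%:R + g%:R - 1 = (g + c)%:R); last by rewrite -natr1 natrD; ring.
by rewrite !gb_nat -(bin_sub (leq_addr c g)) addKn.
Qed.

End ScalarBorcherds.

(** * The Borcherds identity for the modes of exponentials *)

Section ExpBorcherds.
Context {R : realType} (p : nat).
Local Notation C := R[i].
Local Notation V := (fock R).
Local Notation alpha := (@al R p).
Local Notation pp := (@pp R p).
Local Notation es := (@es R).
Local Notation mode := (@md R p).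
Local Notation wh := (@wh R p).
Local Notation em := (@em R p).
Hypothesis p0 : (0 < p)%N.
Variables (r l s : rat) (q sg tau : int).
Hypothesis hq : 2 * p%:R * r * l = (q + q)%:~R.
Hypothesis hsg : 2 * p%:R * r * s = sg%:~R.
Hypothesis htau : 2 * p%:R * l * s = tau%:~R.

Let ef : field (em r). Proof. exact: exp_mode_field. Qed.
Let mf : field (mode (es l)). Proof. exact: mode_field. Qed.

(** The condition on m, k, n is conservation of weight. Under it every term is a product of two
    binomial coefficients, one from the identity and one from the contraction, and Vandermonde adds
    their upper arguments. *)
Lemma gr_bor1 m k n : m + k + n + 2 + sg + tau + q + q = 0 ->
  gr (r + (l + s)) (bor1 (em r) m k (mode (es l)) n (es s)) =
  sgz' (m + k + 1 + sg + q + q) * gbz (k + q + q)%:~R (m + k + 1 + sg + q + q).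
Proof.
move=> e; rewrite /bor1 (gr_nsum _ (bor1_ev ef m k n _ mf)).
pose c0 := m + k + 1 + sg + q + q.
have g (i : nat) : gr (r + (l + s)) (((-1) ^+ i * gb (k%:~R : C) i) *: em r (m + k - i%:Z) (mode (es l) (n + i%:Z) (es s))) =
   if c0 - i%:Z is Posz c then sgz' c0 * (gb (k%:~R : C) i * gb ((q + q)%:~R : C) c) else 0.
  have e1 : - (n + i%:Z)%:~R - 1 - 2 * p%:R * l * s = (c0 - i%:Z)%:~R :> rat.
    rewrite htau /c0 -rmorphN -[1]/(1%:~R : rat) -!rmorphB/=; congr (_%:~R); lia.
  rewrite grZ mode_es (exp_mode_es e1).
  case E: (c0 - i%:Z) => [c|c] /=; last by rewrite (lin0 (exp_mode_lin p r _)) gr0 mulr0.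
  have ce : chg (l + s) (exp_creation p l c (es (l + s))).
    by apply: Ep_chg; exact: chg_e.
  have e2 : - (m + k - i%:Z)%:~R - 1 - 2 * p%:R * r * (l + s) = - (Posz c)%:~R :> rat.
    rewrite mulrDr hq hsg -E /c0 -!rmorphN -[1]/(1%:~R : rat) -!rmorphB/= -!rmorphD/= -!rmorphB/=; congr (_%:~R); lia.
  rewrite (gr_exp_mode ce e2) -/(gEm p r l c (l + s)) gEmE// hq ratr_int.
  have -> : sgz' c0 = (-1) ^+ i * (-1) ^+ c :> C.
    rewrite -exprD /sgz'; apply: eq_sign; congr odd; lia.
  ring.
rewrite (eq_nsum g) -/c0; case: c0 g => [c|c] g.
  rewrite (@nsumE _ _ c.+1) => [|i ci]; last first.
    by rewrite (_ : Posz c - i%:Z = Negz (i - c.+1)%N) //; lia.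
  have -> : (k + q + q)%:~R = k%:~R + (q + q)%:~R :> C by rewrite -rmorphD addrA.
  rewrite /= -vandermonde mulr_sumr; apply: eq_bigr => -[i ic] _ /=.
  by rewrite (_ : Posz c - i%:Z = Posz (c - i)%N) //; lia.
rewrite /= mulr0 nsum0// => i; rewrite (_ : Negz c - i%:Z = Negz (c + i)%N) //; lia.
Qed.

Lemma gr_bor2 m k n : m + k + n + 2 + sg + tau + q + q = 0 ->
  gr (r + (l + s)) (bor2 (em r) m k (mode (es l)) n (es s)) =
  sgz' (- m - 1 - sg) * gbz (k + q + q)%:~R (- m - 1 - sg).
Proof.
move=> e; rewrite /bor2 (gr_nsum _ (bor2_ev ef m k n _ mf)).
pose c0 := - m - 1 - sg.
have hq' : 2 * p%:R * l * r = (q + q)%:~R :> rat by rewrite -hq; ring.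
have g (i : nat) : gr (r + (l + s)) (((-1) ^+ i * gb (k%:~R : C) i) *: mode (es l) (n + k - i%:Z) (em r (m + i%:Z) (es s))) =
   if c0 - i%:Z is Posz c then sgz' c0 * (gb (k%:~R : C) i * gb ((q + q)%:~R : C) c) else 0.
  have e1 : - (m + i%:Z)%:~R - 1 - 2 * p%:R * r * s = (c0 - i%:Z)%:~R :> rat.
    rewrite hsg /c0 -rmorphN -[1]/(1%:~R : rat) -!rmorphB/=; congr (_%:~R); lia.
  rewrite grZ mode_es (exp_mode_es e1).
  case E: (c0 - i%:Z) => [c|c] /=; last by rewrite (lin0 (exp_mode_lin p l _)) gr0 mulr0.
  have ce : chg (r + s) (exp_creation p r c (es (r + s))).
    by apply: Ep_chg; exact: chg_e.
  have e2 : - (n + k - i%:Z)%:~R - 1 - 2 * p%:R * l * (r + s) = - (Posz c)%:~R :> rat.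
    rewrite mulrDr hq' htau -E /c0 -!rmorphN -[1]/(1%:~R : rat) -!rmorphB/= -!rmorphD/= -!rmorphB/=; congr (_%:~R); lia.
  rewrite (addrCA r l s) (gr_exp_mode ce e2) -/(gEm p l r c (r + s)) gEmE// hq' ratr_int.
  have -> : sgz' c0 = (-1) ^+ i * (-1) ^+ c :> C.
    rewrite -exprD /sgz'; apply: eq_sign; congr odd; lia.
  ring.
rewrite (eq_nsum g) -/c0; case: c0 g => [c|c] g.
  rewrite (@nsumE _ _ c.+1) => [|i ci]; last first.
    by rewrite (_ : Posz c - i%:Z = Negz (i - c.+1)%N) //; lia.
  have -> : (k + q + q)%:~R = k%:~R + (q + q)%:~R :> C by rewrite -rmorphD addrA.
  rewrite /= -vandermonde mulr_sumr; apply: eq_bigr => -[i ic] _ /=.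
  by rewrite (_ : Posz c - i%:Z = Posz (c - i)%N) //; lia.
rewrite /= mulr0 nsum0// => i; rewrite (_ : Negz c - i%:Z = Negz (c + i)%N) //; lia.
Qed.

Local Notation borRe := (@borR C V mode (em r)).

Lemma gr_borR m k n : m + k + n + 2 + sg + tau + q + q = 0 ->
  gr (r + (l + s)) (borRe m k (es l) n (es s)) = gbz (m + sg)%:~R (- (k + q + q) - 1).
Proof.
move=> e; rewrite /borR (gr_nsum _ (borR_ev (mode_lin p) ef m k (es l) (fun i => m + n - i%:Z) _)).
pose c0 := - (k + q + q) - 1.
have g (i : nat) : gr (r + (l + s)) (gb (m%:~R : C) i *: mode (em r (k + i%:Z) (es l)) (m + n - i%:Z) (es s)) =
   if c0 - i%:Z is Posz c then gb (m%:~R : C) i * gb (sg%:~R : C) c else 0.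
  have e1 : - (k + i%:Z)%:~R - 1 - 2 * p%:R * r * l = (c0 - i%:Z)%:~R :> rat.
    rewrite hq /c0 -rmorphN -[1]/(1%:~R : rat) -!rmorphB/=; congr (_%:~R); lia.
  rewrite grZ (exp_mode_es e1).
  case E: (c0 - i%:Z) => [c|c] /=; last by rewrite (lin0 (mode_lin p _ _)) gr0 mulr0.
  congr (_ * _); have -> : m + n - i%:Z = - 1 - sg - tau + c by move: E; rewrite /c0; lia.
  rewrite addrA (@gr_Ep_mode R p p0 r (r + l) c s (- 1 - sg - tau)) ?hsg ?ratr_int//.
  rewrite mulrDr mulrDl hsg htau !rmorphB rmorphN1; ring.
rewrite (eq_nsum g) -/c0; case: c0 g => [c|c] g.
  rewrite (@nsumE _ _ c.+1) => [|i ci]; last first.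
    by rewrite (_ : Posz c - i%:Z = Negz (i - c.+1)%N) //; lia.
  rewrite rmorphD/= -vandermonde; apply: eq_bigr => -[i ic] _ /=.
  by rewrite (_ : Posz c - i%:Z = Posz (c - i)%N) //; lia.
rewrite /= nsum0// => i; rewrite (_ : Negz c - i%:Z = Negz (c + i)%N) //; lia.
Qed.

Let wl : fwh p l (hw p l) (mode (es l)). Proof. exact: (@mode_wh R p l (hw p l) (es l) (@wh_e R p l)). Qed.

Lemma bor_wh m k n w (v : V) : wh s w v ->
  wh (r + (l + s)) (w + hw p r + hw p l - (m + k + n + 2)%:~R) (bor (em r) m k (mode (es l)) n v).
Proof.
move=> wv; rewrite /bor /fadd /fscale; apply: supp_inD; last apply: supp_inZ; apply: supp_in_nsum => i; apply: supp_inZ.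
  have := @exp_mode_wh R p r (m + k - i%:Z) _ _ _ (@wl (n + i%:Z) _ _ _ wv).
  by congr (wh _ _ _); rewrite !rmorphD rmorphN/=; ring.
have := @wl (n + k - i%:Z) _ _ _ (@exp_mode_wh R p r (m + i%:Z) _ _ _ wv).
by rewrite addrCA; congr (wh _ _ _); rewrite !rmorphD rmorphN/=; ring.
Qed.

Lemma borR_wh m k n w (v : V) : wh s w v ->
  wh (r + (l + s)) (w + hw p r + hw p l - (m + k + n + 2)%:~R) (borRe m k (es l) n v).
Proof.
move=> wv; apply: supp_in_nsum => i; apply: supp_inZ; rewrite addrA.
have := @mode_wh R p _ _ _ (@exp_mode_wh R p r (k + i%:Z) _ _ _ (@wh_e R p l)) (m + n - i%:Z) _ _ _ wv.
by congr (wh _ _ _); rewrite !rmorphD rmorphN/=; ring.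
Qed.

(** For fixed k the differences of both sides, indexed by (m, n), are closed under commutation with
    the Heisenberg algebra. Only ground coefficients remain: they vanish by weight, or else by the
    scalar identity [gb_borcherds]. *)
Lemma exp_borcherds_es : borcherds mode (em r) (chg s) (es l).
Proof.
move=> m k n v cv.
pose Z (mn : int * int) (v : V) := bor (em r) mn.1 k (mode (es l)) mn.2 v - borRe mn.1 k (es l) mn.2 v.
suff : Z (m, n) v = 0 by move/eqP; rewrite subr_eq0 => /eqP.
have lZ i : linear (Z i).
  apply: lin_sub; last exact: (borR_lin (mode_lin p) (mode_field p) ef).
  apply: field_lin; apply: fadd_field; first exact: bor1_field.
  by apply: fscale_field; exact: bor2_field.
apply: (heis_unique p0 (s := s) (t := r + (l + s))) (m, n) v cv => //.
- move=> [m' n'] v cv; rewrite /Z/=; apply: (@wh_to_chg R p (Z (m', n')) s) => //.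
  move=> w u wu; eexists; apply: supp_inB; [exact: bor_wh wu|exact: borR_wh wu].
- move=> [m' n'] j; exists [:: (pp * ratr r, (m' + j, n')); (pp * ratr l, (m', n' + j))] => v _.
  suff -> : alpha j (Z (m', n') v) = Z (m', n') (alpha j v) +
    ((pp * ratr r) *: Z (m' + j, n') v + (pp * ratr l) *: Z (m', n' + j) v).
    have e := @sum2 V _ (pp * ratr r, (m' + j, n')) (pp * ratr l, (m', n' + j)) (fun x => x.1 *: Z x.2 v).
    cbn [fst snd] in e. rewrite -e. reflexivity.
  rewrite /Z; cbn [fst snd]; rewrite (linB (alpha_lin p j)).
  have e1 := al_bor (@alpha_lin R p) ef (fun k n v => alpha_exp_mode p k r n v) mf (mode_es_al p l) j m' k n' v.
  have e2 := al_borR (@alpha_lin R p) (@heis R p) (@alpha_ev0 R p) (mode_lin p) (mode_field p) (@mode_al R p) (@fock_al_ind R p) (@mode_es_al R p) (@alpha_es R p) (@alpha_esP R p) ef (fun k n v => alpha_exp_mode p k r n v) (erefl (ratr l)) j m' k n' v.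
  exact: (sub_comb e1 e2).
move=> [m' n']; rewrite -grE /Z/=.
have [e|ne] := eqVneq (m' + k + n' + 2 + sg + tau + q + q) 0.
  rewrite -scaleN1r grD grZ gr_borR// /bor /fadd /fscale grD grZ gr_bor1// gr_bor2//.
  have := @gb_borcherds C (k + q + q) (m' + sg).
  have -> : m' + sg + (k + q + q) + 1 = m' + k + 1 + sg + q + q by lia.
  have -> : - (m' + sg) - 1 = - m' - 1 - sg by lia.
  move=> <-; rewrite mulN1r mulNr mulrA.
  (* The evenness of 2 p r l = q + q enters here: the two fields are mutually local with the bosonic
     sign. *)
  have -> : (-1) ^+ `|k|%N * sgz' (- m' - 1 - sg) = sgz' (k + q + q + (m' + sg) + 1) :> C.
    rewrite -exprD /sgz'; apply: eq_sign; rewrite oddD; lia.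
  by rewrite subrr.
have wZ : wh (r + (l + s)) (hw p s + hw p r + hw p l - (m' + k + n' + 2)%:~R) (Z (m', n') (es s)).
  by apply: supp_inB; [apply: bor_wh|apply: borR_wh]; exact: wh_e.
apply: (gr_wh wZ); rewrite (hwD p r) (hwD p l) mulrDr hq hsg htau.
apply: contra ne => /eqP e; rewrite -(intr_eq0 rat) !rmorphD/=; apply/eqP.
move: e; rewrite !rmorphD/=; move: (hw p s) (hw p l) (hw p r) => *; lra.
Qed.

Lemma exp_borcherds u : chg l u -> borcherds mode (em r) (chg s) u.
Proof.
move=> cu; have aS i v : chg s v -> chg s (alpha i v) by exact: alpha_chg.
have Bl := borcherds_lin (mode_lin p) (mode_field p) ef.
move: u cu; apply: (chg_ind (p := p)).
- have := Bl _ (-1) _ _ exp_borcherds_es exp_borcherds_es; by rewrite scaleN1r addNr.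
- by move=> c x y; exact: Bl.
- exact: exp_borcherds_es.
- move=> a u _; exact: (borcherds_al (@alpha_lin R p) (@alpha_ev0 R p) (mode_lin p) (mode_field p) (@mode_al R p) ef (fun k n v => alpha_exp_mode p k r n v) aS).
Qed.

Lemma exp_commutator u m n v : chg l u -> chg s v ->
  em r m (mode u n v) - mode u n (em r m v) =
  nsum (fun i => gb (m%:~R : C) i *: mode (em r i%:Z u) (m + n - i%:Z) v).
Proof.
by move=> cu cv; exact: (borcherds_comm m n (exp_borcherds cu) cv).
Qed.

End ExpBorcherds.

(** * The Virasoro operators *)

Section Virasoro.
Context {R : realType} (p : nat).
Local Notation C := R[i].
Local Notation V := (fock R).
Local Notation alpha := (@al R p).
Local Notation pp := (@pp R p).
Local Notation es := (@es R).
Local Notation mode := (@md R p).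
Local Notation wh := (@wh R p).
Local Notation em := (@em R p).
Hypothesis p0 : (0 < p)%N.
Implicit Types (r s t l : rat) (v : V).

Lemma omega_sig : {w : V | w = @Defs.omega R p}. Proof. by eexists. Qed.
Definition om := sval omega_sig.
Definition bb : C := p%:R - 1.

Lemma omE : om = aom alpha pp bb (es 0).
Proof.
have e1 : (4 * p)%N%:R = pp * 2 :> C by rewrite /pp -natrM; congr (_%:R); lia.
have e2 : (p - 1)%N%:R = p%:R - 1 :> C by rewrite natrB.
by rewrite /om (svalP omega_sig) /Defs.omega /aom alphaE /vac esE e1 e2.
Qed.

Definition L (n : int) : V -> V := mode om (n + 1).

Lemma VirE n : Vir p n = L n.
Proof. by rewrite /Vir modeE /L /om (svalP omega_sig). Qed.

Lemma L_lin n : linear (L n). Proof. exact: field_lin (mode_field p om). Qed.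
Lemma L_D n u v : L n (u + v) = L n u + L n v. Proof. exact: linD (L_lin n) u v. Qed.
Lemma L_Z n (c : C) v : L n (c *: v) = c *: L n v. Proof. exact: linZ (L_lin n) c v. Qed.
Lemma L_0 n : L n 0 = 0. Proof. exact: lin0 (L_lin n). Qed.

Lemma mode_vac n v : mode (es 0) n v = if n == -1 then v else 0.
Proof.
rewrite mode_es; move: v; apply: lin_eq => [||[A s]].
- exact: exp_mode_lin.
- by case: (n == -1); [exact: (@lin_id C V)|exact: (@lin_cst0 C V V)].
have cs : chg s (bs (A, s) : V) by exact: supp_inU.
move: (bs (A, s)) cs => v cv.
have Ep0 k (u : V) : exp_creation p 0 k u = if k == 0%N then u else 0.
  case: eqP => [->|/eqP k0]; first by rewrite Ep_0.
  rewrite EpE /op_series_exp big1// => -[j /= _] _; case: j => [|j] /=.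
    by rewrite /op_series1 (negPf k0) scaler0.
  by rewrite /op_series_mul big1 ?scaler0// => -[i _] _ /=; rewrite rmorph0 mul0r scale0r.
have Em0 k (u : V) : exp_annihilation p 0 k u = if k == 0%N then u else 0.
  case: eqP => [->|/eqP k0]; first by rewrite Em_0.
  rewrite EmE /op_series_exp big1// => -[j /= _] _; case: j => [|j] /=.
    by rewrite /op_series1 (negPf k0) scaler0.
  by rewrite /op_series_mul big1 ?scaler0// => -[i _] _ /=; rewrite rmorph0 mul0r oppr0 scale0r.
have e : - n%:~R - 1 - 2 * p%:R * 0 * s = (- n - 1)%:~R :> rat.
  by rewrite mulr0 mul0r subr0 rmorphB rmorphN.
have sh0 (u : V) : sh 0 u = u.
  move: u; apply: lin_eq => [||[B t]]; [exact: shift_lin|exact: lin_id|].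
  by rewrite shiftU add0r.
rewrite (exp_modeE cv e) (@nsum1 _ _ 0%N) => [|i /negPf i0]; last first.
  by rewrite Em0 i0 (lin0 (Ez_lin _ _ _)) (lin0 (shift_lin _)).
rewrite Em0 eqxx add0r sh0.
have -> : (n == -1) = (- n - 1 == 0) by lia.
case: (- n - 1) => k //=; by rewrite Ep0; case: k.
Qed.

Lemma alpha_vac (k : nat) : alpha k%:Z (es 0) = 0.
Proof.
case: k => [|k]; last exact: alpha_esP.
by rewrite alpha_es rmorph0 mulr0 scale0r.
Qed.

Lemma L_aL n v : L n v = aL alpha pp bb mode (es 0) n v.
Proof. by rewrite /L omE. Qed.

Lemma L_exp n v : L n v = (pp * 2)^-1 *:
    (nsum (fun i => alpha (Negz i) (alpha (n + 1 + i%:Z) v)) +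
     nsum (fun i => alpha (n - i%:Z) (alpha i%:Z v)))
  - (bb / pp * (n + 1)%:~R) *: alpha n v.
Proof. by rewrite L_aL; exact: (aL_exp _ (@pp0 R p p0) (@alpha_lin R p) (mode_lin p) (@mode_al R p) mode_vac). Qed.

Lemma alpha_L m n v : alpha m (L n v) = L n (alpha m v) + ((m%:~R : C) *: alpha (m + n) v +
  (if m + n == 0 then bb * (m%:~R * (m%:~R - 1)) else 0) *: v).
Proof.
rewrite !L_aL.
exact: (al_aL _ (@pp0 R p p0) (@alpha_lin R p) (@heis R p) (mode_lin p) (@mode_al R p) mode_vac alpha_vac (@al_mode R p)).
Qed.

Lemma L_chg n s v : chg s v -> chg s (L n v).
Proof.
move=> cv; rewrite -[s]add0r; apply: (mode_chg (p := p)) cv.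
by rewrite omE /aom; apply: supp_inD; apply: supp_inZ; do ?apply: alpha_chg; exact: chg_e.
Qed.

Lemma om_wh : wh 0 2 om.
Proof.
have h0 : hw p 0 = 0 by rewrite /hw expr0n !mulr0 subrr.
have w0 : wh 0 0 (es 0) by have := @wh_e R p 0; rewrite h0.
rewrite omE /aom; apply: supp_inD; apply: supp_inZ.
  have := alpha_wh (n := Negz 0) (alpha_wh (n := Negz 0) w0).
  by congr (wh _ _ _); rewrite NegzE; ring.
have := alpha_wh (n := Negz 1) w0.
by congr (wh _ _ _); rewrite NegzE; ring.
Qed.

Lemma L_wh n s w v : wh s w v -> wh s (w - n%:~R) (L n v).
Proof.
move=> wv; have := @mode_wh R p _ _ _ om_wh (n + 1) _ _ _ wv.
by rewrite add0r; congr (wh _ _ _); rewrite rmorphD/=; ring.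
Qed.

Lemma L0_es s : L 0 (es s) = ratr (hw p s) *: es s.
Proof.
have P0 := @pp0 R p p0.
rewrite L_exp nsum0 => [|i]; last by rewrite (_ : 0 + 1 + i%:Z = i.+1%:Z) ?alpha_esP ?alpha0//; lia.
rewrite (@nsum1 _ _ 0%N) => [|[//|i] _]; last by rewrite alpha_esP alpha0.
rewrite subr0 alpha_es alphaZ alpha_es add0r add0r mulr1 !scalerA -scalerBl; congr (_ *: _).
have -> : ratr (hw p s) = p%:R * ratr s ^+ 2 - bb * ratr s :> C.
  by rewrite /hw !expr2 rmorphB !rmorphM/= rmorphB/= !ratr_nat rmorph1.
have n2 : 2%:R != 0 :> C by rewrite pnatr_eq0.
have e : pp = 2%:R * p%:R :> C by rewrite /pp natrM.
have q0 : p%:R != 0 :> C by rewrite pnatr_eq0 -lt0n.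
by rewrite e; field.
Qed.

(** The central scalar is taken to be the ground coefficient of the defect of the relation; by
    [al_aLL] and Stone-von Neumann the corrected defect is then 0 on the whole charge sector. *)
Lemma L_comm s m n : exists z : C, forall v, chg s v ->
  L m (L n v) = L n (L m v) + ((m%:~R - n%:~R : C) *: L (m + n) v + (if m + n == 0 then z else 0) *: v).
Proof.
pose D v := L m (L n v) - L n (L m v) - (m%:~R - n%:~R : C) *: L (m + n) v.
pose z := if m + n == 0 then gr s (D (es s)) else 0.
exists (gr s (D (es s))) => v cv.
pose X v := L m (L n v) - L n (L m v) - ((m%:~R - n%:~R : C) *: L (m + n) v + z *: v).
suff : X v = 0.
  rewrite /X -/z => /eqP; rewrite subr_eq0 subr_eq => /eqP ->; by rewrite addrC.
have lX : linear X.
  apply: lin_sub.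
    by apply: lin_sub; apply: lin_comp; exact: L_lin.
  by apply: lin_add; apply: lin_scale; [exact: L_lin|exact: (@lin_id C V)].
apply: (heis_unique p0 (Z := fun _ : unit => X) (s := s) (t := s)) tt v cv => //.
- move=> _ v cv; rewrite /X; apply: supp_inB.
    by apply: supp_inB; do 2!apply: L_chg.
  by apply: supp_inD; apply: supp_inZ => //; exact: L_chg.
- move=> _ k; exists [::] => v _; rewrite big_nil addr0 /X !L_aL.
  have aLl n' : linear (aL alpha pp bb mode (es 0) n') by rewrite /aL -omE; exact: L_lin.
  exact (al_aLL (b := bb) (@pp0 R p p0) (@alpha_lin R p) (@heis R p) (mode_lin p) (@mode_al R p) mode_vac alpha_vac (@al_mode R p) aLl k m n z v).
move=> _; rewrite -grE /X /z; case: eqP => [mn|/eqP mn].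
  rewrite opprD addrA -/(D _) -scaleN1r grD !grZ gr_es; ring.
rewrite scale0r addr0; apply: (gr_wh (p := p) (w := hw p s - (m + n)%:~R)); last first.
  by rewrite -subr_eq0 addrC addKr oppr_eq0 intr_eq0.
have e := @wh_e R p s.
apply: supp_inB; last by apply: supp_inZ; exact: (@L_wh (m + n) _ _ _ e).
apply: supp_inB.
  by have := @L_wh m _ _ _ (@L_wh n _ _ _ e); congr (wh _ _ _); rewrite rmorphD/=; ring.
by have := @L_wh n _ _ _ (@L_wh m _ _ _ e); congr (wh _ _ _); rewrite rmorphD/=; ring.
Qed.

Lemma Ep1_es r t : exp_creation p r 1%N (es t) = ratr r *: alpha (Negz 0) (es t).
Proof.
have e := @Ep_rec R p p0 r 1%N t; rewrite big_ord_recl big_ord0 addr0 /= Ep_0 in e.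
by rewrite -e; exact: (esym (scale1r _)).
Qed.

(** The defect [der] can have a non-zero ground coefficient only at k = -sg, for weight reasons, and
    there the two terms sg and k cancel. *)
Lemma em_derivative r k s (v : V) (sg : int) : 2 * p%:R * r * s = sg%:~R -> chg s v ->
  ratr r *: mode (alpha (Negz 0) (es r)) k v = - (k%:~R : C) *: em r (k - 1) v.
Proof.
move=> hsg cv.
pose Z k v := ratr r *: mode (alpha (Negz 0) (es r)) k v + (k%:~R : C) *: em r (k - 1) v.
suff : Z k v = 0 by rewrite /Z => /eqP; rewrite addr_eq0 scaleNr => /eqP.
have lm k' : linear (mode (alpha (Negz 0) (es r)) k') by exact: field_lin (mode_field p _).
have wZ k' w (u : V) : wh s w u -> wh (r + s) (w + hw p r + 1 - k'%:~R - 1) (Z k' u).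
  move=> wu; apply: supp_inD; apply: supp_inZ.
    have := @mode_wh R p _ _ _ (alpha_wh (n := Negz 0) (@wh_e R p r)) k' _ _ _ wu.
    by congr (wh _ _ _); rewrite NegzE; ring.
  by have := @exp_mode_wh R p r (k' - 1) _ _ _ wu; congr (wh _ _ _); rewrite rmorphB/=; ring.
have lZ k' : linear (Z k').
  by apply: lin_add; apply: lin_scale; [exact: lm|exact: exp_mode_lin].
apply: (heis_unique p0 (Z := Z) (s := s) (t := r + s)) k v cv => //.
- move=> k' v cv; apply: (@wh_to_chg R p (Z k') s) => //.
  move=> w u wu; eexists; exact: wZ wu.
- move=> k' j; exists [:: (pp * ratr r, k' + j)] => v _.
  have -> : \sum_(x <- [:: (pp * ratr r, k' + j)]) x.1 *: Z x.2 v = (pp * ratr r) *: Z (k' + j) v.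
    exact: big_seq1.
  exact: (al_der (@alpha_lin R p) (@heis R p) (mode_lin p) (@al_mode R p) (fun k n v => alpha_exp_mode p k r n v) (alpha_es p r) (alpha_esP p r) (fun k v => congr1 (fun f => f k v) (mode_es p r)) j k' v).
move=> k'; rewrite -grE.
have [e|ne] := eqVneq k' (- sg).
  have e1 : - (k' - 1)%:~R - 1 = 2 * p%:R * r * s :> rat by rewrite hsg e rmorphB rmorphN/=; ring.
  have := @gr_Ep_mode R p p0 r r 1%N s (k' - 1) e1; rewrite Ep1_es (linZ (mode_lin _ _ _)) gb1 hsg ratr_int subrK.
  rewrite /Z grD => ->; rewrite grZ (@exp_mode_es R p r (k' - 1) s 0); last by rewrite e1 subrr.
  by rewrite /= Ep_0 gr_es mulr1 e rmorphN addrN.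
apply: (gr_wh (wZ k' _ _ (@wh_e R p s))); rewrite hwD hsg.
apply: contra ne => /eqP e; rewrite -subr_eq0 opprK -(intr_eq0 rat) rmorphD/=; apply/eqP.
move: e; move: (hw p s) (hw p r) => *; lra.
Qed.

Lemma L_em m n r s (v : V) (sg : int) : 2 * p%:R * r * s = sg%:~R -> chg s v ->
  L n (em r m v) = em r m (L n v) + (ratr (hw p r - 1) * (n + 1)%:~R - m%:~R : C) *: em r (m + n) v.
Proof.
move=> hsg cv; rewrite !L_aL.
have co : chg 0 om.
  by rewrite omE /aom; apply: supp_inD; apply: supp_inZ; do ?apply: alpha_chg; exact: chg_e.
have hq : 2 * p%:R * r * 0 = (0 + 0)%:~R :> rat by rewrite mulr0.
have htau : 2 * p%:R * 0 * s = 0%:~R :> rat by rewrite mulr0 mul0r.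
have h := exp_commutator p0 hq hsg htau m (n + 1) co cv.
have Ev (k : int) : - k%:~R - 1 - 2 * p%:R * r * 0 = (- k - 1)%:~R :> rat.
  by rewrite mulr0 subr0 rmorphB rmorphN.
have Ev0 (k : nat) : em r k%:Z (es 0) = 0.
  by rewrite (exp_mode_es (Ev _)) (_ : - k%:Z - 1 = Negz k)//; lia.
have Ev1 : em r (-1) (es 0) = es r.
  by rewrite (exp_mode_es (Ev _)) /= Ep_0 addr0.
have Ev2 : em r (-2) (es 0) = ratr r *: alpha (Negz 0) (es r).
  by rewrite (exp_mode_es (Ev _)) /= Ep1_es addr0.
have ehw : ratr (hw p r - 1) = ah pp bb (ratr r) - 1 :> C.
  rewrite /hw /ah !expr2 !rmorphB/= !rmorphM/= rmorphB/= !ratr_nat rmorph1; congr (_ * _ - _ - _).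
  by rewrite /pp natrM mulrC mulKf// pnatr_eq0.
rewrite ehw.
rewrite omE in h.
apply: (E_aL (@pp0 R p p0) (@alpha_lin R p) (mode_lin p) (exp_mode_lin p r) (fun k n v => alpha_exp_mode p k r n v) Ev0 Ev1 Ev2 h).
- by move=> k; exact: (em_derivative k hsg cv).
- by move=> k; rewrite mode_es.
Qed.

End Virasoro.

(** * Words in the Virasoro operators *)

Section Words.
Context {K : numFieldType} {V : lmodType K}.
Variables (L : int -> V -> V) (S : V -> Prop) (z : int -> K).
Hypothesis L_lin : forall n, linear (L n).
Hypothesis S0 : S 0.
Hypothesis S_lin : forall (c : K) u v, S u -> S v -> S (c *: u + v).
Hypothesis S_L : forall n v, S v -> S (L n v).
Hypothesis LL : forall m n v, S v -> L m (L n v) =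
  L n (L m v) + ((m%:~R - n%:~R) *: L (m + n) v + (if m + n == 0 then z m else 0) *: v).

Definition op (J : seq int) (v : V) : V := foldr L v J.
Definition tr (J : seq int) : seq int := rev (map -%R J).
Definition fm := seq (K * seq int).
Definition ev (X : fm) v := \sum_(x <- X) x.1 *: op x.2 v.
Definition evt (X : fm) v := \sum_(x <- X) x.1 *: op (tr x.2) v.

Lemma op_lin J : linear (op J).
Proof. by elim: J => [|n J IHJ]; [exact: lin_id|exact: (lin_comp (L_lin n) IHJ)]. Qed.

Lemma op_cat J J' v : op (J ++ J') v = op J (op J' v).
Proof. exact: foldr_cat. Qed.

Lemma S_op J v : S v -> S (op J v).
Proof. by move=> Sv; elim: J => //= n J; exact: S_L. Qed.

Lemma tr_cat J J' : tr (J ++ J') = tr J' ++ tr J.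
Proof. by rewrite /tr map_cat rev_cat. Qed.

Lemma trK : involutive tr.
Proof. by move=> J; rewrite /tr map_rev revK -map_comp map_id_in// => x _ /=; rewrite opprK. Qed.

(** One formal combination of words evaluated twice: f with the words themselves and g with their
    transposes, under L(n) -> L(-n) and reversal. Carrying both through every rewriting makes each
    Virasoro identity come with its adjoint. *)
Definition spn (P : seq int -> Prop) (f g : V -> V) := exists X : fm,
  (forall x, x \in X -> P x.2) /\ (forall v, S v -> f v = ev X v /\ g v = evt X v).

Lemma spn_word (P : seq int -> Prop) J : P J -> spn P (op J) (op (tr J)).
Proof.
move=> PJ; exists [:: (1, J)]; split => [x|v Sv]; first by rewrite inE => /eqP ->.
by rewrite /ev /evt !big_seq1 !scale1r.
Qed.

Lemma spn0 (P : seq int -> Prop) : spn P (fun=> 0) (fun=> 0).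
Proof. by exists [::]; split => // v _; rewrite /ev /evt !big_nil. Qed.

Lemma spn_add (P : seq int -> Prop) f g f' g' (c : K) : spn P f g -> spn P f' g' ->
  spn P (fun v => c *: f v + f' v) (fun v => c *: g v + g' v).
Proof.
move=> [X [PX eX]] [Y [PY eY]]; exists ([seq (c * x.1, x.2) | x <- X] ++ Y); split.
  by move=> x; rewrite mem_cat => /orP[/mapP[y /PX Py ->]|/PY].
move=> v Sv; have [-> ->] := eX v Sv; have [-> ->] := eY v Sv.
rewrite /ev /evt !big_cat !big_map /= !scaler_sumr.
by split; congr (_ + _); apply: eq_bigr => x _; rewrite scalerA.
Qed.

Lemma spn_ext (P : seq int -> Prop) f g f' g' : spn P f g ->
  (forall v, S v -> f' v = f v) -> (forall v, S v -> g' v = g v) -> spn P f' g'.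
Proof.
move=> [X [PX eX]] ef eg; exists X; split => // v Sv.
by rewrite ef// eg//; exact: eX.
Qed.

Lemma spn_trans (P Q : seq int -> Prop) f g : spn P f g ->
  (forall J, P J -> spn Q (op J) (op (tr J))) -> spn Q f g.
Proof.
move=> [X [PX eX]] PQ.
suff : spn Q (ev X) (evt X) by move/spn_ext; apply => v Sv; case: (eX v Sv).
elim: X PX {eX} => [|[c J] X IHX] PX.
  by apply: (spn_ext (spn0 Q)) => v _; rewrite /ev /evt big_nil.
have PJ : P J by have := PX (c, J); rewrite mem_head => /(_ isT).
have IH : spn Q (ev X) (evt X) by apply: IHX => x xX; apply: PX; rewrite inE xX orbT.
by apply: (spn_ext (spn_add c (PQ J PJ) IH)) => v _; rewrite /ev /evt big_cons.
Qed.

Definition closed_words (P : seq int -> Prop) := forall J m n J',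
  P (J ++ m :: n :: J') -> [/\ P (J ++ n :: m :: J'), P (J ++ (m + n) :: J') &
    (m + n = 0 -> P (J ++ J'))].

Section Straighten.
Variable P : seq int -> Prop.
Hypothesis cP : closed_words P.
Let less n J := P J /\ (size J < n)%N.

Lemma op_swap J m n J' v : S v -> op (J ++ m :: n :: J') v = op (J ++ n :: m :: J') v +
  ((m%:~R - n%:~R) *: op (J ++ (m + n) :: J') v + (if m + n == 0 then z m else 0) *: op (J ++ J') v).
Proof.
move=> Sv; rewrite !op_cat /= LL; last exact: S_op.
by rewrite !(linD (op_lin J)) !(linZ (op_lin J)).
Qed.

Lemma spn_swap J m n J' : P (J ++ m :: n :: J') ->
  spn (less (size (J ++ m :: n :: J')))
    (fun v => op (J ++ m :: n :: J') v - op (J ++ n :: m :: J') v)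
    (fun v => op (tr (J ++ m :: n :: J')) v - op (tr (J ++ n :: m :: J')) v).
Proof.
move=> /cP[_ P1 P2].
have trc a b : tr (J ++ a :: b :: J') = tr J' ++ (- b) :: (- a) :: tr J.
  by rewrite tr_cat /tr /= !rev_cons -!cats1 -!catA.
have tr1 a : tr (J ++ a :: J') = tr J' ++ (- a) :: tr J.
  by rewrite tr_cat /tr /= !rev_cons -!cats1 -!catA.
pose Q := less (size (J ++ m :: n :: J')).
have s1 : spn Q (op (J ++ (m + n) :: J')) (op (tr (J ++ (m + n) :: J'))).
  by apply: spn_word; split => //; rewrite !size_cat /= !addnS.
have s2 : spn Q (fun v => (if m + n == 0 then z m else 0) *: op (J ++ J') v + 0)
    (fun v => (if m + n == 0 then z m else 0) *: op (tr (J ++ J')) v + 0).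
  case: eqP => [/P2 P2'|_].
    apply: spn_add (spn0 _); apply: spn_word; split => //.
    by rewrite !size_cat /= !addnS; lia.
  by apply: (spn_ext (spn0 Q)) => v _; rewrite scale0r addr0.
apply: (spn_ext (spn_add (m%:~R - n%:~R) s1 s2)) => v Sv.
  by rewrite op_swap// addrAC subrr add0r addr0.
rewrite !trc tr1 tr_cat (op_swap (tr J') (- n) (- m))// addrAC subrr add0r addr0.
have -> : - n + - m = - (m + n) by rewrite opprD addrC.
rewrite oppr_eq0 !rmorphN/= opprK (addrC (- n%:~R)); congr (_ + _ *: _).
by case: eqP => // /eqP; rewrite addr_eq0 => /eqP ->.
Qed.

Lemma spn_minus_trans Q (f f' f'' g g' g'' : V -> V) :
  spn Q (fun v => f v - f' v) (fun v => g v - g' v) ->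
  spn Q (fun v => f' v - f'' v) (fun v => g' v - g'' v) ->
  spn Q (fun v => f v - f'' v) (fun v => g v - g'' v).
Proof.
move=> h1 h2; apply: (spn_ext (spn_add 1 h1 h2)) => v _.
  by rewrite scale1r addrA subrK.
by rewrite scale1r addrA subrK.
Qed.

Lemma spn_mid l1 a l2 J : P (J ++ a :: l1 ++ l2) -> P (J ++ l1 ++ a :: l2) /\
  spn (less (size (J ++ a :: l1 ++ l2)))
    (fun v => op (J ++ a :: l1 ++ l2) v - op (J ++ l1 ++ a :: l2) v)
    (fun v => op (tr (J ++ a :: l1 ++ l2)) v - op (tr (J ++ l1 ++ a :: l2)) v).
Proof.
elim: l1 J => [|b l1 IHl] J PJ.
  by split => //; apply: (spn_ext (spn0 _)) => v _; rewrite subrr.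
have s1 := spn_swap PJ; have [P1 _ _] := cP PJ.
have := IHl (rcons J b); rewrite !cat_rcons => /(_ P1) [P2 s2]; split => //.
apply: spn_minus_trans s1 _; move: s2.
by rewrite !size_cat.
Qed.

Lemma spn_perm J l l' : perm_eq l l' -> P (J ++ l) -> P (J ++ l') /\
  spn (less (size (J ++ l))) (fun v => op (J ++ l) v - op (J ++ l') v)
    (fun v => op (tr (J ++ l)) v - op (tr (J ++ l')) v).
Proof.
elim: l l' J => [|a l IHl] l' J ll' PJ.
  have /perm_nilP -> : perm_eq l' [::] by rewrite perm_sym.
  by split => //; apply: (spn_ext (spn0 _)) => v _; rewrite subrr.
have al' : a \in l' by rewrite -(perm_mem ll') mem_head.
move: ll'; case/splitPr: al' => l1 l2 ll'.
have p' : perm_eq l (l1 ++ l2) by rewrite -(perm_cons a) (perm_trans ll')// -cat1s perm_catCA.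
have := IHl _ (rcons J a) p'; rewrite !cat_rcons => /(_ PJ) [P1 s1].
have [P2 s2] := spn_mid P1; split => //.
apply: spn_minus_trans s1 _; move: s2.
by rewrite !size_cat /= (perm_size p') !size_cat.
Qed.

(** Poincare-Birkhoff-Witt straightening: a permutation of the letters changes a word only by
    shorter words, so induction on the length reaches sorted words. *)
Lemma spn_straight J : P J ->
  spn (fun J => P J /\ sorted <=%R J) (op J) (op (tr J)).
Proof.
elim: {J}_.+1 {-2}J (ltnSn (size J)) => // n IHn J Jn PJ.
have pJ : perm_eq J (sort <=%R J) by rewrite perm_sym perm_sort.
have [P' s'] := @spn_perm [::] _ _ pJ PJ.
have h : spn (fun J => P J /\ sorted <=%R J) (fun v => op J v - op (sort <=%R J) v)
    (fun v => op (tr J) v - op (tr (sort <=%R J)) v).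
  apply: (spn_trans s') => I [PI sI]; apply: IHn => //.
  by apply: leq_trans sI _; rewrite -ltnS.
have hs : spn (fun J => P J /\ sorted <=%R J) (op (sort <=%R J)) (op (tr (sort <=%R J))).
  by apply: spn_word; split => //; apply: sort_sorted; exact: le_total.
by apply: (spn_ext (spn_add 1 h hs)) => v _; rewrite scale1r subrK.
Qed.

End Straighten.

(** * The contravariant form on a module generated by a highest weight vector *)

Section HighestWeight.
Variables (v : V) (h : K).
Hypothesis Sv : S v.
Hypothesis v0 : L 0 v = h *: v.
Hypothesis vP : forall n : nat, L n.+1 v = 0.

Definition wsum (J : seq int) : int := \sum_(n <- J) n.

Lemma wsum_cat J J' : wsum (J ++ J') = wsum J + wsum J'.
Proof. exact: big_cat. Qed.
Lemma wsum_cons n J : wsum (n :: J) = n + wsum J.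
Proof. exact: big_cons. Qed.
Lemma wsum_tr J : wsum (tr J) = - wsum J.
Proof.
rewrite /wsum /tr (perm_big (map -%R J)); last by rewrite perm_rev perm_refl.
by rewrite big_map sumrN.
Qed.

Lemma wsum_closed s : closed_words (fun J => wsum J = s).
Proof.
move=> J m n J'; rewrite !wsum_cat !wsum_cons => <-; split=> [||mn].
- by rewrite (addrCA n).
- by rewrite -(addrA m).
- by rewrite (addrA m) mn add0r.
Qed.

Definition neg (J : seq int) := all (fun n : int => n < 0) J.

Lemma op_sorted J : sorted <=%R J ->
  op J v = (if has (fun n : int => 0 < n) J then 0 else h ^+ count (pred1 (0 : int)) J) *:
    op [seq n <- J | n < 0] v.
Proof.
elim: J => [|n J IHJ] /=; first by rewrite expr0 scale1r.
move=> pJ; have sJ := path_sorted pJ; rewrite IHJ// (linZ (L_lin n)).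
have nJ : all (fun k => n <= k) J by apply: (order_path_min _ pJ); exact: le_trans.
case: (ltgtP n 0) => n0 /=; rewrite ?add0n//.
  case: J nJ {IHJ pJ sJ} => [_|k J /= /andP[nk _]] /=.
    by case: n n0 => // -[//|k] _; rewrite vP scaler0 scale0r.
  by rewrite (lt_le_trans n0 nk) /= !scale0r.
rewrite n0 add1n exprS; have eJ : [seq n <- J | n < 0] = [::].
  apply/eqP; rewrite -size_eq0 size_filter -leqn0 leqNgt -has_count -all_predC.
  by apply: sub_all nJ => k /=; rewrite n0 -leNgt.
rewrite eJ /= v0; case: ifP => _; first by rewrite !scale0r.
by rewrite scalerA mulrC.
Qed.

(* The contravariant form is symmetric. *)
Lemma gram_sym J : wsum J = 0 -> op J v = op (tr J) v.
Proof.
move=> J0; have [X [PX eX]] := spn_straight (@wsum_closed 0) J0.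
have [-> ->] := eX v Sv; rewrite /ev /evt !big_seq; apply: eq_bigr => -[c I] /PX/= [I0 sI].
congr (_ *: _); have sI' : sorted <=%R (tr I).
  rewrite /tr rev_sorted sorted_map; apply: sub_sorted sI => x y xy /=.
  by rewrite lerN2.
rewrite (op_sorted sI) (op_sorted sI'); have pI : perm_eq (tr I) (map -%R I) by rewrite perm_rev.
(* A sorted word of total weight 0 either has both a positive and a negative letter, so that it and
   its transpose kill v, or consists of zeros and equals its transpose. *)
have [hI|hI] := boolP (has (fun n : int => 0 < n) I).
  suff hI' : has (fun n : int => n < 0) I.
    have -> : has (fun n : int => 0 < n) (tr I).
      by rewrite (perm_has _ pI) has_map; apply: sub_has hI' => k /=; rewrite oppr_gt0.
    by rewrite !scale0r.
  apply/contraT => /hasPn h0; move: hI => /hasP[k kI k0].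
  have : 0 < wsum I.
    rewrite /wsum (perm_big _ (perm_to_rem kI)) big_cons ltr_pwDl//.
    by rewrite big_seq; apply: sumr_ge0 => i /mem_rem /h0; rewrite leNgt.
  by rewrite I0 ltxx.
have hI0 : all (fun n : int => n == 0) I.
  apply/allP => k kI; apply/contraT => k0.
  have kl : k < 0.
    by move/hasPn: hI => /(_ k kI); rewrite -leNgt le_eqVlt (negPf k0).
  have : wsum I < 0.
    rewrite /wsum (perm_big _ (perm_to_rem kI)) big_cons ltr_nwDl//.
    by rewrite big_seq; apply: sumr_le0 => i /mem_rem; move/hasPn: hI => hI /hI; rewrite -leNgt.
  by rewrite I0 ltxx.
have -> : I = nseq (size I) 0 by apply/all_pred1P.
rewrite /tr map_nseq rev_nseq oppr0.
have -> : has (fun n : int => 0 < n) (nseq (size I) 0) = false by rewrite has_nseq ltxx andbF.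
by [].
Qed.

Definition negw (D : int) J := neg J /\ wsum J = - D.
Definition Mod (D : nat) u := exists X : fm, (forall x, x \in X -> negw D x.2) /\ u = ev X v.

Lemma ev_cat X Y u : ev (X ++ Y) u = ev X u + ev Y u. Proof. exact: big_cat. Qed.
Lemma evt_cat X Y u : evt (X ++ Y) u = evt X u + evt Y u. Proof. exact: big_cat. Qed.

Lemma ev_lin X : linear (ev X).
Proof. by apply: lin_sum => x; apply: lin_scale; exact: op_lin. Qed.

Lemma evt_lin X : linear (evt X).
Proof. by apply: lin_sum => x; apply: lin_scale; exact: op_lin. Qed.

Definition fscal (c : K) (X : fm) : fm := [seq (c * x.1, x.2) | x <- X].

Lemma ev_scal c X u : ev (fscal c X) u = c *: ev X u.
Proof. by rewrite /ev big_map scaler_sumr; apply: eq_bigr => x _; rewrite scalerA. Qed.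

Lemma evt_scal c X u : evt (fscal c X) u = c *: evt X u.
Proof. by rewrite /evt big_map scaler_sumr; apply: eq_bigr => x _; rewrite scalerA. Qed.

Lemma mem_fscal (P : seq int -> Prop) c X : (forall x, x \in X -> P x.2) ->
  forall x, x \in fscal c X -> P x.2.
Proof. by move=> PX x /mapP[y /PX Py ->]. Qed.

Lemma mem_fcat (P : seq int -> Prop) X Y : (forall x, x \in X -> P x.2) ->
  (forall x, x \in Y -> P x.2) -> forall x : K * seq int, x \in X ++ Y -> P x.2.
Proof. by move=> PX PY x; rewrite mem_cat => /orP[/PX|/PY]. Qed.

Lemma Mod0 D : Mod D 0.
Proof. by exists [::]; split => //; rewrite /ev big_nil. Qed.

Lemma ModP D (c : K) u u' : Mod D u -> Mod D u' -> Mod D (c *: u + u').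
Proof.
move=> [X [PX ->]] [Y [PY ->]]; exists (fscal c X ++ Y); split.
  exact: mem_fcat (mem_fscal PX) PY.
by rewrite ev_cat ev_scal.
Qed.

Lemma ModZ D (c : K) u : Mod D u -> Mod D (c *: u).
Proof. by move=> Mu; rewrite -[_ *: _]addr0; exact: ModP Mu (Mod0 D). Qed.

Lemma Mod_sum D (X : fm) (F : seq int -> V) : (forall x, x \in X -> Mod D (F x.2)) ->
  Mod D (\sum_(x <- X) x.1 *: F x.2).
Proof.
elim: X => [|x X IHX] MX; first by rewrite big_nil; exact: Mod0.
rewrite big_cons; apply: ModP; first by apply: MX; rewrite mem_head.
by apply: IHX => y yX; apply: MX; rewrite inE yX orbT.
Qed.

Lemma Mod_word (D : nat) J : negw D J -> Mod D (op J v).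
Proof.
move=> nJ; exists [:: (1, J)]; split => [x|]; first by rewrite inE => /eqP ->.
by rewrite /ev big_seq1 scale1r.
Qed.

Lemma neg_wsum J : neg J -> wsum J <= 0.
Proof.
by move=> /allP nJ; rewrite /wsum big_seq; apply: sumr_le0 => i /nJ; exact: ltW.
Qed.

Lemma neg_wsum0 J : neg J -> wsum J = 0 -> J = [::].
Proof.
case: J => // n J /= /andP[n0 nJ]; rewrite wsum_cons => h0.
by have := neg_wsum nJ; move: n0 h0 => /=; lia.
Qed.

Lemma wsum_filter I : ~~ has (fun n : int => 0 < n) I -> wsum [seq n <- I | n < 0] = wsum I.
Proof.
elim: I => // n I IHI /=; rewrite negb_or -leNgt le_eqVlt => /andP[/orP[/eqP ->|n0] hI].
  by rewrite ltxx wsum_cons add0r IHI.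
by rewrite n0 !wsum_cons IHI.
Qed.

Lemma op_mod J : (forall D : nat, wsum J = - D%:Z -> Mod D (op J v)) /\
  (0 < wsum J -> op J v = 0).
Proof.
have [X [PX eX]] := spn_straight (@wsum_closed (wsum J)) (erefl (wsum J)).
have [e1 _] := eX v Sv; split=> [D JD|Jp].
  rewrite e1; have: forall x, x \in X -> Mod D (op x.2 v).
    move=> x /PX [xJ sx]; rewrite (op_sorted sx); case: ifPn => hx.
      by rewrite scale0r; exact: Mod0.
    apply: ModZ; apply: Mod_word; split; first exact: filter_all.
    by rewrite wsum_filter// xJ.
  exact: (@Mod_sum D X (fun J => op J v)).
rewrite e1 /ev big_seq big1// => x /PX [xJ sx]; rewrite (op_sorted sx).
case: ifPn => hx; first by rewrite scale0r scaler0.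
have := neg_wsum (filter_all (fun n : int => n < 0) x.2).
by rewrite wsum_filter// xJ leNgt Jp.
Qed.

Lemma Mod_op D D' J u : Mod D u -> wsum J = D%:Z - D'%:Z -> Mod D' (op J u).
Proof.
move=> [X [PX ->]] JD; rewrite /ev (lin_big (op_lin J)).
have : forall x, x \in X -> Mod D' (op J (op x.2 v)).
  move=> x /PX [_ xD]; rewrite -op_cat; apply: (op_mod _).1.
  by rewrite wsum_cat xD JD; lia.
move/(@Mod_sum D' X (fun I => op J (op I v))); congr Mod.
by apply: eq_bigr => x _; rewrite (linZ (op_lin J)).
Qed.

Lemma Mod_opn D J u : Mod D u -> D%:Z < wsum J -> op J u = 0.
Proof.
move=> [X [PX ->]] JD; rewrite /ev (lin_big (op_lin J)) big_seq big1// => x /PX [_ xD].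
rewrite (linZ (op_lin J)) -op_cat (op_mod _).2 ?scaler0//.
by rewrite wsum_cat xD; lia.
Qed.

Lemma Mod_00 u : Mod 0 u -> exists c : K, u = c *: v.
Proof.
move=> [X [PX ->]]; exists (\sum_(x <- X) x.1); rewrite /ev scaler_suml.
rewrite !big_seq; apply: eq_bigr => x /PX [nx x0].
by rewrite (neg_wsum0 nx) //= x0 oppr0.
Qed.

Lemma tr_cons n J u : op (tr (n :: J)) u = op (tr J) (L (- n) u).
Proof. by rewrite -cat1s tr_cat op_cat. Qed.

Lemma gram_symw J J' : wsum J = wsum J' -> op (tr J) (op J' v) = op (tr J') (op J v).
Proof.
by move=> JJ; rewrite -!op_cat gram_sym ?tr_cat ?trK// wsum_cat wsum_tr JJ addNr.
Qed.

(** A relation between words on v lies in the kernel of the Gram matrix; by symmetry its transpose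
    pairs to 0 with every vector of that level of the module. *)
Lemma evt_kill (D : nat) (X : fm) u : (forall x, x \in X -> negw D x.2) -> ev X v = 0 ->
  Mod D u -> evt X u = 0.
Proof.
move=> PX X0 [Y [PY ->]]; rewrite /ev (lin_big (evt_lin X)) big_seq big1// => y /PY [ny yD].
rewrite (linZ (evt_lin X)) /evt.
transitivity (y.1 *: op (tr y.2) (ev X v)); last by rewrite X0 (lin0 (op_lin _)) scaler0.
rewrite /ev (lin_big (op_lin _)) !big_seq; congr (_ *: _); apply: eq_bigr => x /PX [nx xD].
by rewrite (linZ (op_lin _)) gram_symw// xD.
Qed.

Hypothesis irr : forall (D : nat) u, Mod D.+1 u -> (forall n : nat, L n.+1 u = 0) -> u = 0.

(** By induction on the level each L(n+1) u is 0, since its pairings are among those of u. So u is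
    singular and [irr] applies. *)
Lemma nondegenerate D u : Mod D u ->
  (forall J, negw D J -> op (tr J) u = 0) -> u = 0.
Proof.
elim: {D}_.+1 {-2}D (ltnSn D) u => // B IHB [|D] DB u Mu h0.
  by rewrite -[u]/(op (tr [::]) u) h0//; split => //; rewrite /wsum big_nil.
apply: (irr Mu) => n; have [nD|nD] := leqP n D; last first.
  by rewrite -[L _ _]/(op [:: n.+1%:Z] u); apply: Mod_opn Mu _; rewrite wsum_cons /wsum big_nil; lia.
apply: (IHB (D - n)%N); first by lia.
  by rewrite -[L _ _]/(op [:: n.+1%:Z] u); apply: Mod_op Mu _; rewrite wsum_cons /wsum big_nil; lia.
move=> J [nJ JD]; rewrite -[n.+1%:Z]/(- Negz n) -tr_cons; apply: h0; split => //.
by rewrite wsum_cons JD NegzE; lia.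
Qed.

(** The finite list of all words with negative letters and total weight -D, that is, the
    compositions of D. B is recursion fuel and suffices when D < B. *)
Fixpoint comps (B D : nat) : seq (seq int) := if B is B'.+1 then
  (if D == 0%N then [:: [::]] else [seq Negz k :: J | k <- iota 0 D, J <- comps B' (D - k.+1)])
  else [::].

Lemma compsP B D J : (D < B)%N -> negw D J <-> J \in comps B D.
Proof.
elim: B D J => // B IHB D J DB /=; case: eqP => D0.
  rewrite D0 inE; split => [[nJ /(neg_wsum0 nJ) ->]//|/eqP ->].
  by split => //; rewrite /wsum big_nil.
split=> [[nJ JD]|/allpairsPdep[k [J' [+ + ->]]]].
  case: J nJ JD => [_|[//|k] J /= nJ]; first by rewrite /wsum big_nil; lia.
  rewrite wsum_cons NegzE => JD; have := neg_wsum nJ => J0.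
  apply: allpairs_f_dep; first by rewrite mem_iota; lia.
  by apply/IHB; [lia|split=> //; lia].
rewrite mem_iota => kD /IHB[|nJ JD]; first by lia.
by split => //; rewrite wsum_cons JD NegzE; lia.
Qed.

(* The Gram matrix of the words of level D is symmetric, so the functional
   J |-> op (tr J) w lies in its row space once it vanishes on its kernel. *)
Lemma correct_by_module D w : v != 0 -> S w ->
  (forall n, (n <= D)%N -> Mod (D - n) (L n.+1 w)) -> (forall n, (D < n)%N -> L n.+1 w = 0) ->
  (forall X : fm, (forall x, x \in X -> negw D.+1 x.2) -> ev X v = 0 -> evt X w = 0) ->
  exists2 u, Mod D.+1 u & forall n : nat, L n.+1 (w - u) = 0.
Proof.
move=> v0' Sw wM w0 ann; pose Js := comps D.+2 D.+1; pose n := size Js.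
have JsP J : negw D.+1 J <-> J \in Js by exact: compsP.
pose J_ (i : 'I_n) := nth [::] Js i.
have JP i : negw D.+1 (J_ i) by apply/JsP; exact: mem_nth.
have JE J : negw D.+1 J -> exists i, J = J_ i.
  by move=> /JsP JJ; exists (Ordinal (etrans (index_mem J Js) JJ)); rewrite /J_ nth_index.
have wJ J : negw D.+1 J -> exists c : K, op (tr J) w = c *: v.
  case: J => [[_]|[k|k] J [//= nJ JD]]; first by rewrite /wsum big_nil.
  have := neg_wsum nJ; move: JD; rewrite wsum_cons NegzE => JD J0.
  rewrite tr_cons; apply: Mod_00; have kD : (k <= D)%N by lia.
  by apply: Mod_op (wM k kD) _; rewrite wsum_tr; lia.
have [r rE] := @boolp.choice _ _ (fun i c => op (tr (J_ i)) w = c *: v) (fun i => wJ _ (JP i)).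
have gJ (ij : 'I_n * 'I_n) : exists c, op (tr (J_ ij.1)) (op (J_ ij.2) v) = c *: v.
  case: ij => i j /=; apply: Mod_00; apply: Mod_op (Mod_word (JP j)) _; rewrite wsum_tr.
  by have [_ ->] := JP i; lia.
have [G GE] := @boolp.choice _ _ (fun ij c => op (tr (J_ ij.1)) (op (J_ ij.2) v) = c *: v) gJ.
have vI : injective (fun c : K => c *: v).
  by move=> c c' /eqP; rewrite -subr_eq0 -scalerBl scaler_eq0 (negPf v0') orbF subr_eq0 => /eqP.
have Gs i j : G (i, j) = G (j, i).
  apply: vI; rewrite /= -(GE (i, j)) -(GE (j, i)) /= gram_symw//.
  by have [_ ->] := JP i; have [_ ->] := JP j.
pose rm : 'rV[K]_n := \row_i r i; pose Gm : 'M[K]_n := \matrix_(i, j) G (i, j).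
(* Membership in the row space is tested on the cokernel. Each of its columns is a combination of
   words that pairs to 0 with the module, hence a relation on v, and [ann] says that its transpose
   kills w. *)
have /submxP[a ra] : (rm <= Gm)%MS.
  rewrite submxE; apply/eqP/rowP => k; rewrite !mxE.
  pose c i := cokermx Gm i k.
  pose X : fm := [seq (c i, J_ i) | i <- enum 'I_n].
  have XP x : x \in X -> negw D.+1 x.2 by move=> /mapP[i _ ->]; exact: JP.
  have evX u : ev X u = \sum_i c i *: op (J_ i) u by rewrite /ev big_map big_enum.
  have evtX u : evt X u = \sum_i c i *: op (tr (J_ i)) u by rewrite /evt big_map big_enum.
  have : evt X w = 0.
    apply: ann => //; apply: (@nondegenerate D.+1); first by exists X.
    move=> J /JE[i ->]; rewrite evX (lin_big (op_lin _)).
    under eq_bigr => j _ do rewrite (linZ (op_lin _)) (GE (i, j)) scalerA.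
    rewrite -scaler_suml; have := mulmx_coker Gm => /matrixP/(_ i k); rewrite !mxE => e0.
    rewrite (_ : \sum_j _ = 0) ?scale0r// -[RHS]e0; apply: eq_bigr => j _.
    by rewrite mxE mulrC.
  rewrite evtX; under eq_bigr => i _ do rewrite rE scalerA.
  rewrite -scaler_suml => /eqP; rewrite scaler_eq0 (negPf v0') orbF => /eqP e0.
  by rewrite -[RHS]e0; apply: eq_bigr => j _; rewrite mxE mulrC.
pose u := \sum_j a 0 j *: op (J_ j) v.
have Mu : Mod D.+1 u.
  exists [seq (a 0 j, J_ j) | j <- enum 'I_n]; split; last by rewrite /ev big_map big_enum.
  by move=> x /mapP[i _ ->]; exact: JP.
exists u => // k.
have kill J : negw D.+1 J -> op (tr J) (w - u) = 0.
  move=> /JE[i ->]; rewrite (linB (op_lin _)) rE /u (lin_big (op_lin _)).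
  under eq_bigr => j _ do rewrite (linZ (op_lin _)) (GE (i, j)) scalerA Gs.
  rewrite -scaler_suml; move/rowP: ra => /(_ i); rewrite !mxE => ->.
  under [X in X *: _ - _]eq_bigr => j _ do rewrite mxE.
  by rewrite subrr.
have [kD|kD] := leqP k D; last first.
  rewrite (linB (L_lin _)) w0// sub0r; apply/eqP; rewrite oppr_eq0; apply/eqP.
  by rewrite -[L _ _]/(op [:: k.+1%:Z] u); apply: Mod_opn Mu _; rewrite wsum_cons /wsum big_nil; lia.
apply: (@nondegenerate (D - k)).
  rewrite (linB (L_lin _)) addrC -scaleN1r; apply: ModP; last exact: wM.
  by rewrite -[L _ _]/(op [:: k.+1%:Z] u); apply: Mod_op Mu _; rewrite wsum_cons /wsum big_nil; lia.
move=> J [nJ JD]; rewrite -[k.+1%:Z]/(- Negz k) -tr_cons; apply: kill; split => //.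
by rewrite wsum_cons JD NegzE; lia.
Qed.

(** * Modules in which L(-1)^N0 v is a combination of words with fewer factors L(-1) *)

Section SingularRelation.
Variables (N0 : nat) (s' : fm).
Definition small J := (count (pred1 (-1 : int)) J < N0)%N.
Definition std D J := [/\ negw D J, sorted <=%R J & small J].
Hypothesis s'P : forall x, x \in s' -> std N0 x.2.
Definition srel : fm := (1, nseq N0 (-1)) :: s'.
Hypothesis srel0 : ev srel v = 0.
Hypothesis indep : forall (D : nat) (Js : seq (seq int)) (c : seq int -> K), uniq Js ->
  (forall J, J \in Js -> std D J) -> \sum_(J <- Js) c J *: op J v = 0 ->
  forall J, J \in Js -> c J = 0.

Lemma srelP x : x \in srel -> negw N0 x.2.
Proof.
rewrite inE => /orP[/eqP -> /=|/s'P[]//]; split; first by rewrite /neg all_nseq orbT.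
by rewrite /wsum; elim: N0 => [|k IHk] /=; rewrite ?big_nil// big_cons IHk; lia.
Qed.

(** Division with remainder by [srel] in the algebra of words: a standard remainder X plus left
    multiples Y of the relation. In the adjoint the factors appear in the opposite order, so the
    transpose of Y acts before that of [srel]. *)
Definition red (D : nat) (f g : V -> V) := exists X Y : fm,
  [/\ forall x, x \in X -> std D x.2, forall y, y \in Y -> negw (D%:Z - N0%:Z) y.2 &
  forall u, S u -> f u = ev X u + ev Y (ev srel u) /\ g u = evt X u + evt srel (evt Y u)].

Lemma red0 D : red D (fun=> 0) (fun=> 0).
Proof.
exists [::], [::]; split => // u _; rewrite /ev /evt !big_nil !add0r.
by split => //; exact: (esym (lin0 (evt_lin srel))).
Qed.

Lemma red_add D f g f' g' (c : K) : red D f g -> red D f' g' ->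
  red D (fun u => c *: f u + f' u) (fun u => c *: g u + g' u).
Proof.
move=> [X [Y [PX PY e]]] [X' [Y' [PX' PY' e']]].
exists (fscal c X ++ X'), (fscal c Y ++ Y'); split.
- exact: (mem_fcat (P := std D) (mem_fscal PX) PX').
- exact: (mem_fcat (P := negw (D%:Z - N0%:Z)) (mem_fscal PY) PY').
move=> u Su; have [-> ->] := e u Su; have [-> ->] := e' u Su.
by rewrite !ev_cat !evt_cat !ev_scal !evt_scal !(linD (evt_lin _)) !(linZ (evt_lin _)); split; lmod.
Qed.

Lemma red_ext D f g f' g' : red D f g ->
  (forall u, S u -> f' u = f u) -> (forall u, S u -> g' u = g u) -> red D f' g'.
Proof.
move=> [X [Y [PX PY e]]] ef eg; exists X, Y; split => // u Su.
by rewrite ef// eg//; exact: e.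
Qed.

Lemma red_spn D (P : seq int -> Prop) f g : spn P f g ->
  (forall J, P J -> red D (op J) (op (tr J))) -> red D f g.
Proof.
move=> [X [PX eX]] Pr.
suff : red D (ev X) (evt X) by move/red_ext; apply => u Su; case: (eX u Su).
elim: X PX {eX} => [|[c J] X IHX] PX.
  by apply: (red_ext (red0 D)) => u _; rewrite /ev /evt big_nil.
have PJ : P J by have := PX (c, J); rewrite mem_head => /(_ isT).
have IH : red D (ev X) (evt X) by apply: IHX => x xX; apply: PX; rewrite inE xX orbT.
by apply: (red_ext (red_add c (Pr J PJ) IH)) => u _; rewrite /ev /evt big_cons.
Qed.

Lemma neg_count_closed (D : int) k :
  closed_words (fun J => negw D J /\ (count (pred1 (-1 : int)) J < k)%N).
Proof.
move=> J m n J' [[nJ wJ] cJ]; move: nJ wJ cJ; rewrite /negw /neg !all_cat /= !wsum_cat !wsum_cons !count_cat /=.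
case/and4P => nJ m0 n0 nJ' wJ cJ; split.
- by rewrite nJ m0 n0 nJ'; split; [split=> //; lia|lia].
- rewrite nJ nJ' (_ : m + n < 0)/=; last by lia.
  by split; [split=> //; lia|rewrite (_ : m + n == -1 = false) /=; lia].
- by lia.
Qed.

(** Induction on the number of letters -1. A sorted word with at least N0 of them ends in L(-1)^N0,
    because -1 is the largest negative letter, and the relation replaces this ending by words with
    fewer such letters. *)
Lemma red_word (D : nat) J : negw D J -> red D (op J) (op (tr J)).
Proof.
move=> nJ; have [k] : exists k, (count (pred1 (-1 : int)) J < k)%N by eexists; exact: ltnSn.
elim: k J nJ => // k IHk J nJ cJ.
have := spn_straight (@neg_count_closed D k.+1) (conj nJ cJ).
move/red_spn; apply => {nJ cJ} I [[nI cI] sI].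
have [cN|cN] := ltnP (count (pred1 (-1 : int)) I) N0.
  exists [:: (1, I)], [::]; split => // [x|u _].
    by rewrite inE => /eqP ->.
  rewrite /ev /evt !big_seq1 !big_nil !scale1r !addr0.
  by split => //; have := lin0 (evt_lin srel); rewrite {1}/evt => ->; rewrite addr0.
have [I' eI] : exists I', I = I' ++ nseq N0 (-1).
  exists (take (size I - N0) I); rewrite -{1}(cat_take_drop (size I - N0) I); congr (_ ++ _).
  have szI : (N0 <= size I)%N by apply: leq_trans cN (count_size _ _).
  pose T := take (size I - N0) I; set E := drop _ _.
  have sE : size E = N0 by rewrite size_drop subKn.
  suff : all (pred1 (-1 : int)) E by move/all_pred1P; rewrite sE.
  have eTE : T ++ E = I by exact: cat_take_drop.
  have [/hasP[x xE x1]|] := boolP (has (predC (pred1 (-1 : int))) E); last by rewrite has_predC negbK.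
  have x2 : x <= -2.
    have : x < 0 by case: nI => /allP nI _; apply: nI; rewrite -eTE mem_cat xE orbT.
    by move: x1 => /=; lia.
  have cT : count (pred1 (-1 : int)) T = 0%N.
    apply/eqP; rewrite -leqn0 leqNgt -has_count; apply/hasPn => y yT.
    have : y <= x.
      have : pairwise <=%R (T ++ E) by rewrite eTE -sorted_pairwise//; exact: le_trans.
      by rewrite pairwise_cat => /and3P[/allrelP/(_ _ _ yT xE)].
    by rewrite /=; lia.
  have : (count (pred1 (-1 : int)) E < N0)%N.
    rewrite -sE -(count_predC (pred1 (-1 : int)) E) -addn1 leq_add2l -has_count.
    by apply/hasP; exists x.
  have := count_cat (pred1 (-1 : int)) T E; rewrite eTE cT add0n => e1 cE.
  by rewrite e1 leqNgt cE in cN.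
have [nI' wI'] : negw (D%:Z - N0%:Z) I'.
  have [+ wN] := @srelP (1, nseq N0 (-1)) (mem_head _ _).
  move: nI; rewrite eI /negw /neg all_cat wsum_cat => -[/andP[nI' _] wI] _.
  by split => //; move: wN => /= wN; rewrite wN in wI; lia.
have r' : red D (fun u => ev [seq (x.1, I' ++ x.2) | x <- s'] u)
    (fun u => evt [seq (x.1, I' ++ x.2) | x <- s'] u).
  apply: (@red_spn D (fun J => negw D J /\ (count (pred1 (-1 : int)) J < k)%N)); last first.
    by move=> J' [nJ' cJ']; exact: IHk.
  exists [seq (x.1, I' ++ x.2) | x <- s']; split => // x /mapP[y /s'P[[ny wy] _ cy] ->] /=.
  split; first by split; [rewrite /neg all_cat; apply/andP|rewrite wsum_cat wI' wy; lia].
  move: cI cy; rewrite eI /small !count_cat; rewrite count_nseq /=; lia.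
have s1 : red D (fun u => op I' (ev srel u)) (fun u => evt srel (op (tr I') u)).
  exists [::], [:: (1, I')]; split => // [x|u _]; first by rewrite inE => /eqP ->.
  by rewrite /ev /evt !big_seq1 !big_nil !scale1r !add0r.
apply: (red_ext (red_add (-1) r' s1)) => u Su; rewrite scaleN1r eI.
  rewrite /ev big_cons big_map scale1r (linD (op_lin _)) -op_cat (lin_big (op_lin _)).
  rewrite addrC -addrA [X in _ + X](_ : _ = 0) ?addr0//; apply/eqP; rewrite subr_eq0; apply/eqP.
  by apply: eq_bigr => x _; rewrite op_cat (linZ (op_lin _)).
rewrite /evt big_cons big_map scale1r tr_cat op_cat addrC -addrA.
rewrite [X in _ + X](_ : _ = 0) ?addr0//; apply/eqP; rewrite subr_eq0; apply/eqP.
by apply: eq_bigr => x _; rewrite tr_cat op_cat.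
Qed.

(** After collecting equal words, independence on v makes every coefficient 0, so the transposed
    combination vanishes on any vector whatsoever. *)
Lemma std_kernel (D : nat) (X : fm) w : (forall x, x \in X -> std D x.2) -> ev X v = 0 -> evt X w = 0.
Proof.
move=> PX; pose Js := undup [seq x.2 | x <- X]; pose c J := \sum_(x <- X | x.2 == J) x.1.
have group (F : seq int -> V) : \sum_(x <- X) x.1 *: F x.2 = \sum_(J <- Js) c J *: F J.
  rewrite /c.
  under [RHS]eq_bigr => J _ do rewrite scaler_suml.
  rewrite [RHS](exchange_big_dep xpredT)//= big_seq [RHS]big_seq; apply: eq_bigr => x xX.
  rewrite (big_rem x.2) /=; last by rewrite mem_undup map_f.
  rewrite eqxx big1_seq ?addr0// => J /andP[/eqP <-].
  by rewrite mem_rem_uniqF ?undup_uniq.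
have PJ J : J \in Js -> std D J by rewrite mem_undup => /mapP[x /PX Px ->].
rewrite /ev group => /(indep (undup_uniq _) PJ) c0.
by rewrite /evt (group (fun J => op (tr J) w)) big_seq big1// => J /c0 ->; rewrite scale0r.
Qed.

(** Division by [srel] reduces the annihilation condition of [correct_by_module] to the single
    relation itself, at the level where D+1 = N0. At other levels a non-empty word of Y first sends
    w into the module, where [evt_kill] disposes of [srel]. *)
Lemma correct_by_relation D w : v != 0 -> S w ->
  (forall n, (n <= D)%N -> Mod (D - n) (L n.+1 w)) -> (forall n, (D < n)%N -> L n.+1 w = 0) ->
  (D.+1 = N0 -> evt srel w = 0) ->
  exists2 u, Mod D.+1 u & forall n : nat, L n.+1 (w - u) = 0.
Proof.
move=> v0' Sw wM w0 sw; apply: correct_by_module => // X PX X0.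
have : red D.+1 (ev X) (evt X).
  by apply: (@red_spn D.+1 (negw D.+1)); [exists X|move=> J; exact: red_word].
move=> [X' [Y [PX' PY e]]].
have [e1 _] := e v Sv; have [_ ->] := e w Sw.
rewrite (@std_kernel D.+1 X' w)//; last by move: e1; rewrite X0 srel0 (lin0 (ev_lin Y)) addr0.
rewrite add0r [evt Y w]/evt (lin_big (evt_lin srel)) big_seq big1// => -[c J] /PY/= [nJ wJ].
rewrite (linZ (evt_lin _)); case: J nJ wJ => [|[k|k] J] nJ //.
  by rewrite /wsum big_nil => h1; rewrite [evt srel _]sw ?scaler0//; lia.
move: nJ => /= nJ; rewrite wsum_cons NegzE tr_cons => wJ.
have := neg_wsum nJ => J0.
rewrite (@evt_kill N0 srel) ?scaler0//; first exact: srelP.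
have kD : (k <= D)%N by lia.
by apply: Mod_op (wM k kD) _; rewrite wsum_tr; lia.
Qed.

End SingularRelation.

End HighestWeight.
End Words.

(** * Weights of singular vectors *)

Lemma nsum_split (V : zmodType) (F : nat -> V) n : ev0 F ->
  nsum F = \sum_(i < n) F i + nsum (fun i => F (n + i)%N).
Proof.
elim: n F => [|n IHn] F eF; first by rewrite big_ord0 add0r; apply: eq_nsum.
have eF' : ev0 (fun i => F i.+1) by case: eF => N FN; exists N => i Ni; apply: FN; exact: leqW.
rewrite nsumS// IHn// big_ord_recl addrA; congr (_ + _).
Qed.

Section Linkage.
Context {K : numFieldType} {V : lmodType K}.
Variables (al L : int -> V -> V) (b kap : K).
Hypothesis kapE : kap = b *+ 2 + 2.
Hypothesis kap0 : kap != 0.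
Hypothesis al_lin : forall n, linear (al n).
Hypothesis al_heis : forall m n v, al m (al n v) =
  al n (al m v) + (if m + n == 0 then kap * m%:~R else 0) *: v.
Hypothesis al_ev0 : forall v, ev0 (fun i => al i%:Z v).
Hypothesis L_exp : forall n v, L n v = (kap * 2)^-1 *:
    (nsum (fun i => al (Negz i) (al (n + 1 + i%:Z) v)) +
     nsum (fun i => al (n - i%:Z) (al i%:Z v)))
  - (b / kap * (n + 1)%:~R) *: al n v.

Let al0 n : al n 0 = 0. Proof. exact: lin0. Qed.
Let alZ n (c : K) v : al n (c *: v) = c *: al n v. Proof. exact: linZ. Qed.

Lemma L_expP (j : nat) v : kap *: L j v = nsum (fun i => al (Negz i) (al (j%:Z + 1 + i%:Z) v)) +
  (2^-1 *: (\sum_(i < j.+1) al (j%:Z - i%:Z) (al i%:Z v)) - (b * j.+1%:R) *: al j v).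
Proof.
rewrite L_exp (@nsum_split _ (fun i : nat => al (j%:Z - i%:Z) (al i%:Z v)) j.+1); last first.
  by case: (al_ev0 v) => N vN; exists N => i Ni; rewrite vN.
rewrite [X in _ *: (_ + (_ + X))](eq_nsum (G := fun i => al (Negz i) (al (j%:Z + 1 + i%:Z) v))).
  rewrite (_ : (j%:Z + 1)%:~R = j.+1%:R :> K); last by rewrite addrC -intS.
  have n2 : 2 != 0 :> K by rewrite pnatr_eq0.
  by lmod_with ltac:(fun x y => unify x y); field; rewrite ?kap0 ?n2.
move=> i; rewrite (_ : j%:Z - (j.+1 + i)%N%:Z = Negz i); last by lia.
by congr (al _ (al _ _)); lia.
Qed.

Lemma L_expN (m : nat) v : L (Negz m) v =
  (kap * 2)^-1 *: (\sum_(i < m) al (Negz i) (al (Negz (m - i.+1)) v)) +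
  (kap^-1 *: nsum (fun i => al (Negz (m + i)) (al i%:Z v)) + (b / kap * m%:R) *: al (Negz m) v).
Proof.
have e0 (g : nat -> int) : ev0 (fun i => al (g i) (al i%:Z v)).
  by case: (al_ev0 v) => N vN; exists N => i /vN ->.
rewrite L_exp (@nsum_split _ (fun i => al (Negz i) (al (Negz m + 1 + i%:Z) v)) m); last first.
  case: (al_ev0 v) => N vN; exists (N + m)%N => i Ni.
  by rewrite (_ : Negz m + 1 + i%:Z = (i - m)%N) ?vN//; lia.
rewrite (eq_nsum (G := fun i => al (Negz (m + i)) (al i%:Z v))) => [|i]; last first.
  by congr (al _ (al _ _)); lia.
rewrite [X in _ *: (_ + X)](eq_nsum (G := fun i => al (Negz (m + i)) (al i%:Z v))) => [|i]; last first.
  by congr (al _ (al _ _)); lia.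
rewrite (_ : \sum_(i < m) _ = \sum_(i < m) al (Negz i) (al (Negz (m - i.+1)) v)); last first.
  by apply: eq_bigr => i _; congr (al _ (al _ _)); have := ltn_ord i; lia.
rewrite (_ : Negz m + 1 = - m%:Z); last by rewrite NegzE; lia.
have n2 : 2 != 0 :> K by rewrite pnatr_eq0.
rewrite mulrNz -pmulrn; by lmod_with msame; field; rewrite ?kap0 ?n2.
Qed.

Variable E : nat -> V -> V.
Hypothesis E_lin : forall k, linear (E k).
Hypothesis E_0 : forall v, E 0 v = v.
Hypothesis E_P : forall (m k : nat) v, al m%:Z (E k v) = E k (al m%:Z v).
Hypothesis E_N : forall (m k : nat) v, al (Negz m) (E k v) =
  E k (al (Negz m) v) + (if (m < k)%N then E (k - m.+1)%N v else 0).
Variables (f : V) (l rho : K).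
Hypothesis f0 : f != 0.
Hypothesis f_chg : al 0 f = (kap * l) *: f.
Hypothesis f_L0 : L 0 f = rho *: f.
Hypothesis f_LP : forall n : nat, L n.+1 f = 0.
Hypothesis E_L0 : forall k, L 0 (E k f) = (rho - k%:R) *: E k f.
Hypothesis E_ev : ev0 (fun k => E k f).

Definition phi (c : int) : V := if c is Posz k then E k f else 0.

Lemma phi_neg c : c < 0 -> phi c = 0. Proof. by case: c. Qed.

Lemma phi_chg c : al 0 (phi c) = (kap * l) *: phi c.
Proof. by case: c => k /=; rewrite ?al0 ?scaler0// E_P f_chg (linZ (E_lin k)). Qed.

Lemma phi_ev (g : nat -> V -> V) (c : int) : (forall i, g i 0 = 0) -> ev0 (fun n => g n (phi (c - n.+1%:Z))).
Proof. by move=> g0; exists (`|c|%N) => i ci; rewrite phi_neg ?g0//; lia. Qed.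

Lemma phi_L (j : nat) c : kap *: L j (phi c) = (if j == 0%N then kap * rho else 0) *: phi c +
  nsum (fun n => al (j%:Z + 1 + n%:Z) (phi (c - n.+1%:Z))).
Proof.
case: c => k; last first.
  rewrite L_expP /= !al0 scaler0 subr0 !nsum0 ?scaler0 ?add0r => [|i|i].
  - by rewrite big1 ?scaler0// => i _; rewrite !al0.
  - by rewrite ?phi_neg ?al0//; lia.
  - by rewrite !al0.
transitivity (E k (kap *: L j f) + nsum (fun n => al (j%:Z + 1 + n%:Z) (phi (k%:Z - n.+1%:Z)))).
  rewrite -[phi k]/(E k f) L_expP L_expP !(linD (E_lin k)) (linN (E_lin k)) !(linZ (E_lin k)) -E_P.
  rewrite (lin_nsum (E_lin k)); last first.
    by case: (al_ev0 f) => N fN; exists N => i Ni; rewrite (_ : j%:Z + 1 + i%:Z = (j.+1 + i)%N) ?fN ?al0//; lia.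
  rewrite addrAC; congr (_ + _); last first.
    rewrite (lin_big (E_lin k)); congr (_ *: _ - _); apply: eq_bigr => i _; rewrite E_P.
    by rewrite (_ : j%:Z - i%:Z = (j - i)%N) ?E_P//; have := ltn_ord i; lia.
  rewrite -nsumD; first last.
  - by apply: (@phi_ev (fun n => al (j%:Z + 1 + n%:Z)) k) => n.
  - case: (al_ev0 f) => N fN; exists N => i Ni.
    by rewrite (_ : j%:Z + 1 + i%:Z = (j.+1 + i)%N) ?fN ?al0 ?(lin0 (E_lin k))//; lia.
  apply: eq_nsum => i; rewrite (_ : j%:Z + 1 + i%:Z = (j.+1 + i)%N); last by lia.
  rewrite E_P E_N; congr (_ + _); case: ltnP => ik.
    by rewrite (_ : k%:Z - i.+1%:Z = (k - i.+1)%N) ?E_P//; lia.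
  by rewrite phi_neg ?al0//; lia.
congr (_ + _); case: j => [|j]; first by rewrite f_L0 !(linZ (E_lin k)) scalerA.
by rewrite f_LP scaler0 (lin0 (E_lin k)) scale0r.
Qed.

Lemma phi_rec c : nsum (fun n => al n.+1 (phi (c - n.+1%:Z))) = - (kap * c%:~R) *: phi c.
Proof.
case: c => k; last by rewrite nsum0 ?scaler0// => n; rewrite phi_neg ?al0//; lia.
have e : nsum (fun n => al n.+1 (phi (k%:Z - n.+1%:Z))) =
    kap *: ((rho - k%:R) *: phi k) - (kap * rho) *: phi k.
  have := phi_L 0 k; rewrite [L _ _]E_L0 -/(phi k) /= => ->; rewrite addrAC subrr add0r.
  by apply: eq_nsum => n; congr (al _ _); lia.
by rewrite e; lmod.
Qed.

(** Let C be the last index with E_C f <> 0. The sum over j of kap L(j+1) E_(C-j-1) f is computed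
    once by commuting L through E, and once from the quadratic expression of L. Everything becomes a
    multiple of E_C f except a sum X; its coefficients agree because kap / 2 - b = 1, and comparing
    the rest gives the weight. *)
Lemma linkage : exists c : nat, rho = (b + 1) * (l - c%:R) ^+ 2 - b * (l - c%:R).
Proof.
have [C [C0 Cmax]] : exists C : nat, phi C != 0 /\ forall c : int, C%:Z < c -> phi c = 0.
  have [N EN] := E_ev; have ex : exists k, (k < N)%N && (E k f != 0).
    by exists 0%N; rewrite E_0 f0 andbT ltnNge; apply: contra f0 => /EN; rewrite E_0 => ->.
  have ub i : (i < N)%N && (E i f != 0) -> (i <= N)%N by move=> /andP[/ltnW].
  case: (ex_maxnP ex ub) => C /andP[CN C0] Cm; exists C; split => // -[k|//] Ck.
  have [kN|/EN//] := ltnP k N; apply/eqP/contraT => k0.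
  by have := Cm k; rewrite kN k0 => /(_ isT); lia.
exists C; pose T (j : nat) := al j.+1 (phi (C%:Z - j.+1%:Z)).
have T0 i : (C <= i)%N -> T i = 0 by move=> Ci; rewrite /T phi_neg ?al0//; lia.
have eT (c : nat -> K) : ev0 (fun j => c j *: T j) by exists C => i /T0 ->; rewrite scaler0.
pose A := nsum T; have AE : A = - (kap * C%:R) *: phi C by rewrite -(phi_rec C).
pose X := nsum (fun j => j%:R *: T j).
pose Z := nsum (fun i => al (Negz i) (al i.+1 (phi C))).
have ZE : Z = (kap * (rho - C%:R) - kap * ((b + 1) * l ^+ 2 - b * l)) *: phi C.
  have := L_expP 0 (phi C); rewrite {1}/phi E_L0 -/(phi C) big_ord1 subr0 !phi_chg alZ phi_chg.
  rewrite (eq_nsum (G := fun i => al (Negz i) (al i.+1 (phi C)))); last by move=> i; congr (al _ (al _ _)); lia.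
  rewrite -/Z => e; have n2 : 2 != 0 :> K by rewrite pnatr_eq0.
  have -> : Z = kap *: ((rho - C%:R) *: phi C) -
      (2^-1 *: ((kap * l) *: ((kap * l) *: phi C)) - (b * 1%:R) *: ((kap * l) *: phi C)) by rewrite e addrK.
  by rewrite kapE; lmod_with msame; field.
pose Q (j : nat) := \sum_(i < j) al (j%:Z - i%:Z) (al i.+1 (phi (C%:Z - j.+1%:Z))).
have Q0 i : (C <= i)%N -> Q i = 0.
  by move=> Ci; rewrite /Q big1// => k _; rewrite phi_neg ?al0//; lia.
have QE : nsum Q = (- (kap * (C%:R - 1))) *: A + kap *: X.
  rewrite nsumS; last by exists C.
  rewrite {1}/Q big_ord0 add0r.
  transitivity (nsum (fun t => \sum_(i < t.+1)
      (fun i q : nat => al q.+1 (al i.+1 (phi (C%:Z - i.+1%:Z - q.+1%:Z)))) i (t - i)%N)).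
    apply: eq_nsum => t; apply: eq_bigr => i _; have := ltn_ord i => it.
    by congr (al _ (al _ (phi _))); lia.
  rewrite -(nsum_conv (G := fun i q : nat => al q.+1 (al i.+1 (phi (C%:Z - i.+1%:Z - q.+1%:Z))))); last first.
    by exists C => i q iq; rewrite phi_neg ?al0//; lia.
  transitivity (nsum (fun i => (- (kap * (C%:R - 1))) *: T i + kap *: (i%:R *: T i))).
    apply: eq_nsum => i; pose g q := al q.+1 (phi (C%:Z - i.+1%:Z - q.+1%:Z)).
    rewrite (eq_nsum (G := fun q => al i.+1 (g q))); last by move=> q; rewrite /g al_heis (_ : (_ == _) = false) ?scale0r ?addr0//; lia.
    rewrite -(lin_nsum (al_lin i.+1)); last by exists C => q Cq; rewrite /g phi_neg ?al0//; lia.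
    rewrite phi_rec alZ -/(T i) rmorphB/= -!pmulrn (natrD _ 1 i) /=.
    by lmod.
  by rewrite nsumD ?nsumZ//; try (by exists C => i /T0 ->; rewrite ?scaler0).
have RE : nsum (fun j => kap *: L j.+1 (phi (C%:Z - j.+1%:Z))) = X.
  transitivity (nsum (fun j => nsum (fun n => al (j + n).+2 (phi (C%:Z - (j + n).+2%:Z))))).
    apply: eq_nsum => j; rewrite phi_L scale0r add0r; apply: eq_nsum => n.
    by congr (al _ (phi _)); lia.
  rewrite (nsum_conv (G := fun j n => al (j + n).+2 (phi (C%:Z - (j + n).+2%:Z)))); last first.
    by exists C => i q iq; rewrite phi_neg ?al0//; lia.
  rewrite /X [RHS]nsumS ?scale0r ?add0r; last exact: eT.
  apply: eq_nsum => t; transitivity (\sum_(i < t.+1) T t.+1); last by rewrite sumr_const card_ord scaler_nat.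
  by apply: eq_bigr => i _; have := ltn_ord i => it; rewrite subnKC.
pose M (j : nat) := nsum (fun i => al (Negz i) (al (j + i).+2 (phi (C%:Z - j.+1%:Z)))).
have M0 j : (C <= j)%N -> M j = 0.
  by move=> Cj; rewrite /M nsum0// => i; rewrite phi_neg ?al0//; lia.
(* Here the maximality of C is used: the recursion at index C + i + 1 has right side 0, which
   expresses the deeper sum through alpha(i+1) on the top component. *)
have ME : nsum M = - Z.
  have gB B : exists N, forall j i, (j <= B)%N -> (N <= i)%N -> al i%:Z (phi (C%:Z - j%:Z)) = 0.
    elim: B => [|c [N gN]]; first by have [N gN] := al_ev0 (phi (C%:Z - 0%N%:Z)); exists N => -[|//] i _; exact: gN.
    have [N' gN'] := al_ev0 (phi (C%:Z - c.+1%:Z)); exists (maxn N N') => j i.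
    rewrite leq_eqVlt geq_max => /orP[/eqP ->|jc] /andP[Ni Ni']; first exact: gN'.
    exact: gN.
  have ex : exists N, forall j i, (N <= i)%N -> al (Negz i) (al (j + i).+2 (phi (C%:Z - j.+1%:Z))) = 0.
    have [N gN] := gB C; exists N => j i Ni.
    have [Cj|jC] := leqP C j; first by rewrite phi_neg ?al0//; lia.
    by rewrite gN ?al0//; lia.
  rewrite /M nsum_exch => [|//|i]; last by exists C => j Cj; rewrite phi_neg ?al0//; lia.
  transitivity (nsum (fun i => - al (Negz i) (al i.+1 (phi C)))); last first.
    rewrite -[RHS]/(- Z) /Z -scaleN1r -nsumZ; first by apply: eq_nsum => i; rewrite scaleN1r.
    by have [N vN] := al_ev0 (phi C); exists N => i Ni; rewrite vN ?al0//; lia.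
  apply: eq_nsum => i; rewrite -(lin_nsum (al_lin (Negz i))); last first.
    by apply: (@phi_ev (fun j => al (j + i).+2) C) => n.
  rewrite -(linN (al_lin (Negz i))); congr (al _ _).
  have := phi_rec (C + i.+1)%N; rewrite (Cmax (C + i.+1)%N)//; last by lia.
  rewrite scaler0 (@nsum_split _ _ i.+1); last by apply: (@phi_ev (fun j => al j.+1) (C + i.+1)%N) => n.
  rewrite big_ord_recr /= big1 ?add0r => [|k _]; last by rewrite Cmax ?al0//; have := ltn_ord k; lia.
  rewrite (_ : (C + i.+1)%N%:Z - i.+1%:Z = C); last by lia.
  move=> /eqP; rewrite addrC addr_eq0 => /eqP <-; apply: eq_nsum => j.
  by congr (al _ (phi _)); lia.
have : nsum (fun j => kap *: L j.+1 (phi (C%:Z - j.+1%:Z))) =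
    nsum M + (2^-1 *: nsum Q + (kap * l - b * 2) *: A - b *: X).
  transitivity (nsum (fun j => M j + (2^-1 *: Q j + (kap * l - b * 2) *: T j - b *: (j%:R *: T j)))).
    apply: eq_nsum => j; rewrite L_expP; congr (_ + _).
      by apply: eq_nsum => i; congr (al _ (al _ _)); lia.
    rewrite big_ord_recl big_ord_recr subrr !phi_chg alZ.
    rewrite (_ : \sum_(i < j) _ = Q j); last first.
      by apply: eq_bigr => i _; congr (al _ (al _ _)); rewrite ?lift0 /=; lia.
    rewrite /= /bump /= add1n subr0 al_heis (_ : (_ == _) = false) ?scale0r ?addr0; last by lia.
    rewrite phi_chg alZ -/(T j) -[j.+2%:R]natr1 -[j.+1%:R]natr1.
    have n2 : 2 != 0 :> K by rewrite pnatr_eq0.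
    by lmod_with msame; field.
  have ev W : (forall i, (C <= i)%N -> W i = 0 :> V) -> ev0 W by move=> W0; exists C.
  rewrite nsumD; [|exact: ev|by apply: ev => i Ci; rewrite Q0 ?T0 ?scaler0 ?addr0 ?subr0].
  rewrite nsumB; [|by apply: ev => i Ci; rewrite Q0 ?T0 ?scaler0 ?addr0|by apply: ev => i Ci; rewrite T0 ?scaler0].
  by rewrite nsumD ?nsumZ//; apply: ev => i Ci; rewrite ?Q0 ?T0 ?scaler0.
rewrite RE ME QE ZE AE => e.
have : kap *: ((rho - ((b + 1) * (l - C%:R) ^+ 2 - b * (l - C%:R))) *: phi C) = 0.
  move/eqP: e; rewrite eq_sym -subr_eq0 => /eqP e; rewrite -[RHS]oppr0 -[in RHS]e kapE.
  have n2 : 2 != 0 :> K by rewrite pnatr_eq0.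
  by lmod_with msame; field.
move/eqP; rewrite !scaler_eq0 (negPf kap0) (negPf C0) orbF /= subr_eq0 => /eqP.
by [].
Qed.

End Linkage.

(** * Singular vectors in Fock modules *)

Lemma seq_argmax (T : eqType) (F : T -> nat) (s : seq T) : s != [::] ->
  exists2 x, x \in s & forall y, y \in s -> (F y <= F x)%N.
Proof.
elim: s => // a s IHs _; have [->|s0] := eqVneq s [::].
  by exists a; rewrite ?mem_head// => y; rewrite inE => /eqP ->.
have [x xs xm] := IHs s0; have [ax|xa] := leqP (F a) (F x).
  by exists x; rewrite ?inE ?xs ?orbT// => y; rewrite inE => /orP[/eqP ->//|/xm].
exists a; rewrite ?mem_head// => y; rewrite inE => /orP[/eqP ->//|/xm yx].
exact: leq_trans yx (ltnW xa).
Qed.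

Section Singular.
Context {R : realType} (p : nat).
Local Notation C := R[i].
Local Notation V := (fock R).
Local Notation alpha := (@al R p).
Local Notation pp := (@pp R p).
Local Notation es := (@es R).
Local Notation wh := (@wh R p).
Local Notation L := (@L R p).
Local Notation bb := (@bb R p).
Local Notation Em := (@exp_annihilation R p).
Hypothesis p0 : (0 < p)%N.

Lemma L0_wh s w v : wh s w v -> L 0 v = ratr w *: v.
Proof.
have L0U A : L 0 (bs (A, s)) = ratr ((lev A)%:R + hw p s) *: bs (A, s) :> V.
  elim/mset_ind: A => [|k A IHA]; first by rewrite -e_E lev0 add0r (@L0_es R p p0).
  rewrite -(alphaNU p k (A, s)); have := @alpha_L R p p0 (Negz k) 0 (bs (A, s)).
  rewrite IHA alphaZ addr0 scale0r addr0 levD => e.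
  apply: (addIr ((Negz k)%:~R *: alpha (Negz k) (bs (A, s)))); rewrite -e -scalerDl; congr (_ *: _).
  by rewrite natrD !rmorphD/= !ratr_nat NegzE mulrNz; ring.
move=> wv; rewrite [in LHS](fockE v) (lin_big (L_lin p 0)) [in RHS](fockE v) scaler_sumr.
rewrite !big_seq; apply: eq_bigr => -[A t]; rewrite -mcoeff_neq0 => vA; have [/= ts tw] := wv _ vA.
by rewrite (linZ (L_lin p 0)) ts L0U tw !scalerA mulrC.
Qed.

Lemma hwE (s : rat) : ratr (hw p s) = p%:R * ratr s ^+ 2 - bb * ratr s :> C.
Proof. by rewrite /hw !expr2 rmorphB !rmorphM/= rmorphB/= !ratr_nat rmorph1. Qed.

Definition singular (f : V) := forall n : nat, L n.+1 f = 0.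

Lemma alpha_heis_al m n (v : V) : alpha m (alpha n v) = alpha n (alpha m v) +
  (if m + n == 0 then pp * m%:~R else 0) *: v.
Proof. exact: heis. Qed.

(** [linkage] is applied to the annihilation exponential with r = 1/(2p), so that its commutators
    with the negative modes have coefficient 1. *)
Lemma singular_weight l w f : wh l w f -> singular f -> f != 0 ->
  exists c : nat, w = hw p (l - c%:R).
Proof.
move=> wf sf f0; pose r : rat := (2 * p%:R)^-1.
have r1 : pp * ratr r = 1.
  by rewrite /r fmorphV rmorphM/= !ratr_nat -natrM mulfV// (@pp0 R p p0).
have kE : pp = bb *+ 2 + 2 by rewrite /pp /bb natrM; ring.
have EN m k v : alpha (Negz m) (Em r k v) = Em r k (alpha (Negz m) v) +
    (if (m < k)%N then Em r (k - m.+1)%N v else 0).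
  by rewrite NegzE alphaN_Em r1 scale1r.
have EL k : L 0 (Em r k f) = (ratr w - k%:R) *: Em r k f.
  by rewrite (L0_wh (@Em_wh R p r k _ _ _ wf)) rmorphB/= ratr_nat.
have [c e] := @linkage _ _ alpha L bb pp kE (@pp0 R p p0) (@alpha_lin R p) (@alpha_heis_al)
  (@alpha_ev0 R p) (@L_exp R p p0) (Em r) (Em_lin p r) (Em_0 p r) (alphaP_Em p r) EN f (ratr l) (ratr w)
  f0 (alpha0_chg p (wh_chg wf)) (L0_wh wf) sf EL (Em_ev0 p r f).
have : ratr w = ratr (hw p (l - c%:R)) :> C by rewrite e hwE rmorphB/= ratr_nat /bb; ring.
by move/fmorph_inj; exists c.
Qed.

Section Filtration.
Variable g : nat -> nat.

Definition ms (A : {mset nat}%mset) : nat := (\sum_(k <- enum_mset A) g k)%N.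

Lemma ms0 : ms mset0 = 0%N.
Proof. by rewrite /ms enum_mset0 big_nil. Qed.

Lemma msD k A : ms (k +` A)%mset = (g k + ms A)%N.
Proof. by rewrite /ms (perm_big _ (enum_msetD1 k A)) big_cons. Qed.

Variant ble (x : int) (v : V) : Prop := Ble of supp_in (fun b => (ms b.1)%:Z <= x) v.

Lemma ble_le x y v : x <= y -> ble x v -> ble y v.
Proof. by move=> xy [xv]; split; apply: supp_in_sub xv => b /le_trans; apply. Qed.

Lemma ble0 x : ble x 0. Proof. by split; exact: supp_in0. Qed.
Lemma bleD x u v : ble x u -> ble x v -> ble x (u + v).
Proof. by move=> [xu] [xv]; split; exact: supp_inD. Qed.
Lemma bleZ x (c : C) v : ble x v -> ble x (c *: v).
Proof. by move=> [xv]; split; exact: supp_inZ. Qed.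
Lemma bleB x u v : ble x u -> ble x v -> ble x (u - v).
Proof. by move=> [xu] [xv]; split; exact: supp_inB. Qed.
Lemma ble_sum x n (F : 'I_n -> V) : (forall i, ble x (F i)) -> ble x (\sum_i F i).
Proof. by move=> xF; split; apply: supp_in_sum => i _; case: (xF i). Qed.
Lemma ble_nsum x (F : nat -> V) : (forall i, ble x (F i)) -> ble x (nsum F).
Proof. by move=> xF; split; apply: supp_in_nsum => i; case: (xF i). Qed.

(** The change of filtration degree under alpha(a), when alpha(-k-1) is given degree [g k]. *)
Definition ga (a : int) : int :=
  match a with Negz k => g k | Posz 0 => 0 | Posz k.+1 => - (g k)%:Z end.

Lemma ble_alpha a x v : ble x v -> ble (x + ga a) (alpha a v).
Proof.
move=> [xv]; split; apply: (supp_in_lin (alpha_lin p a) _ xv) => -[A t] /= At.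
case: a => [[|k]|k] /=.
- by rewrite alpha0U addr0; apply: supp_inZ; exact: supp_inU.
- rewrite alphaPU /=; have [->|Ak] := posnP (A k).
    by rewrite muln0 scale0r; exact: supp_in0.
  have Ak' : k \in (A : {mset nat}%mset) by rewrite -mset_gt0.
  by apply: supp_inZ; apply: supp_inU => /=; move: At; rewrite -{1}(msetB1K Ak') msD; lia.
- by rewrite alphaNU; apply: supp_inU => /=; rewrite msD; lia.
Qed.

Lemma ble_alpha2 a a' x y v : ble x v -> x + ga a' + ga a <= y -> ble y (alpha a (alpha a' v)).
Proof. by move=> xv h; apply: ble_le h _; apply: ble_alpha; exact: ble_alpha. Qed.

Lemma ble_coeff x v A t : ble x v -> x < ms A -> v@_(A, t) = 0.
Proof.
move=> [xv] xA; apply/eqP/contraT => vA; have /= := xv (A, t) vA.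
by rewrite leNgt xA.
Qed.

End Filtration.

(** The multiset of alpha(-1)^d, since index 0 encodes the mode -1. *)
Fixpoint zs (d : nat) : {mset nat}%mset := if d is d'.+1 then (0%N +` zs d')%mset else mset0.

Lemma lev_zs d : lev (zs d) = d.
Proof. by elim: d => [|d IHd] /=; rewrite ?lev0// levD IHd. Qed.

Lemma zsP (A : {mset nat}%mset) : (forall k, A k.+1 = 0%N) -> A = zs (A 0%N).
Proof.
elim/mset_ind: A => [|k A IHA] A0; first by rewrite mset0E.
case: k A0 => [|k] A0; last by have := A0 k; rewrite mset1DE eqxx.
rewrite mset1DE eqxx /= -IHA// => k; have := A0 k.
by rewrite mset1DE.
Qed.

Lemma L_expP_fock (j : nat) v : pp *: L j v = nsum (fun i => alpha (Negz i) (alpha (j%:Z + 1 + i%:Z) v)) +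
  (2^-1 *: (\sum_(i < j.+1) alpha (j%:Z - i%:Z) (alpha i%:Z v)) - (bb * j.+1%:R) *: alpha j v).
Proof. by apply: L_expP; first [exact: pp0|exact: alpha_lin|exact: L_exp|exact: alpha_ev0]. Qed.

(** Take a monomial of f with the highest power of alpha(-1). If it contained some alpha(-k-2), then
    alpha(-1) alpha(k+2), a term of L(k+1), would produce a monomial with one more alpha(-1), which
    no other term of L(k+1) f can cancel. *)
Lemma singular_lead l w f : wh l w f -> singular f -> f != 0 ->
  exists d : nat, w = d%:R + hw p l /\ f@_(zs d, l) != 0.
Proof.
move=> wf sf f0; have : msupp f != [::] :> seq _.
  apply: contra f0 => /eqP f0; rewrite (fockE f) f0 big_nil//.
move=> /(seq_argmax (fun b : fock_basis => b.1 0%N))[[A t] fA Am].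
have fA' := fA; rewrite -mcoeff_neq0 in fA'; have [/= tl Aw] := wf _ fA'; subst t.
suff A0 : forall k, A k.+1 = 0%N.
  exists (A 0%N); split; first by rewrite -Aw {1}(zsP A0) lev_zs.
  by rewrite -(zsP A0).
move=> k; apply/eqP; rewrite -leqn0 leqNgt; apply/negP => Ak.
pose g (i : nat) : nat := i == 0%N.
have msE B : ms g B = B 0%N.
  elim/mset_ind: B => [|i B IHB]; first by rewrite ms0 mset0E.
  by rewrite msD IHB mset1DE /g eq_sym.
have fb : ble g (A 0%N)%:Z f by split=> b; rewrite mcoeff_neq0 => /Am; rewrite msE.
have pos n : ga g n%:Z <= 0 by case: n => //= n; rewrite oppr_le0.
have neg2 i : ga g (Negz i.+1) = 0 by [].
have := L_expP_fock k.+1 f; rewrite sf scaler0 nsumS; last first.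
  have [N fN] := alpha_ev0 p f; exists N => i Ni.
  by rewrite (_ : k.+1%:Z + 1 + i%:Z = (k.+2 + i)%N) ?fN ?alpha0//; lia.
rewrite addr0 -addrA => e; pose B := (0%N +` (A `\ k.+1))%mset.
have B0 : B 0%N = (A 0%N).+1 by rewrite /B mset1DE eqxx msetB1E/= subn0.
have : (alpha (Negz 0) (alpha (k.+1%:Z + 1) f))@_(B, l) = 0.
  move/eqP: e; rewrite eq_sym addr_eq0 => /eqP ->; rewrite mcoeffN.
  rewrite (@ble_coeff g (A 0%N)%:Z) ?oppr0//; last by rewrite msE B0; lia.
  apply: bleD.
    apply: ble_nsum => i; apply: (ble_alpha2 fb).
    rewrite (_ : k.+1%:Z + 1 + i.+1%:Z = (k.+3 + i)%N); last by lia.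
    by have := pos (k.+3 + i)%N; rewrite neg2; lia.
  apply: bleB; apply: bleZ; last first.
    by apply: (ble_le _ (ble_alpha k.+1%:Z fb)); have := pos k.+1; lia.
  apply: ble_sum => i; apply: (ble_alpha2 fb).
  rewrite (_ : k.+1%:Z - (nat_of_ord i)%:Z = (k.+1 - i)%N); last by have := ltn_ord i; lia.
  by have := pos (k.+1 - i)%N; have := pos i; lia.
rewrite mcoeff_alphaN B0 /= (_ : (B `\ 0%N)%mset = (A `\ k.+1)%mset); last by rewrite /B msetD1K.
rewrite (_ : k.+1%:Z + 1 = k.+2%:Z); last by lia.
rewrite mcoeff_alphaP msetB1K -?mset_gt0// => /eqP; rewrite mulf_eq0 pnatr_eq0 !muln_eq0 /=.
rewrite (gtn_eqF p0) /= => /eqP fA0; move: fA'; rewrite fA0 eqxx.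
by [].
Qed.

(** Subtracting a multiple makes the coefficient of alpha(-1)^d vanish, and [singular_lead] then
    forces the difference to be 0. *)
Lemma singular_unique l w f f' : wh l w f -> wh l w f' -> singular f -> singular f' -> f != 0 ->
  exists c, f' = c *: f.
Proof.
move=> wf wf' sf sf' f0; have [d [wd fd]] := singular_lead wf sf f0.
pose c := f'@_(zs d, l) / f@_(zs d, l); exists c.
apply/eqP; rewrite -subr_eq0; apply/contraT => g0.
have [|n|d' [wd' + ]] := @singular_lead l w (f' - c *: f) _ _ g0.
- by apply: supp_inB => //; exact: supp_inZ.
- by rewrite (linB (L_lin p _)) (linZ (L_lin p _)) sf sf' scaler0 subr0.
have -> : d' = d by apply/eqP; rewrite -(eqr_nat rat) -(can_eq (addrK (hw p l))) -wd -wd'.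
by rewrite mcoeffB mcoeffZ /c divfK// subrr eqxx.
Qed.

End Singular.

(** * Independence of Virasoro words *)

Section LeadArith.
Context {K : numFieldType} {V : lmodType K}.
Variables (q c : K) (A S T B : V).

Lemma lead_arith1 : A + S - A = S.
Proof. by rewrite addrAC subrr add0r. Qed.

Lemma lead_arith2 : q != 0 -> (q * 2)^-1 *: (A + (S + A)) + (q^-1 *: T + c *: B) - q^-1 *: A =
  (q * 2)^-1 *: S + (q^-1 *: T + c *: B).
Proof. by move=> q0; have n2 : 2 != 0 :> K by [rewrite pnatr_eq0]; lmod_with msame; field. Qed.
End LeadArith.

Section Independence.
Context {R : realType} (p : nat).
Local Notation C := R[i].
Local Notation V := (fock R).
Local Notation alpha := (@al R p).
Local Notation pp := (@pp R p).
Local Notation es := (@es R).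
Local Notation wh := (@wh R p).
Local Notation L := (@L R p).
Local Notation bb := (@bb R p).
Hypothesis p0 : (0 < p)%N.

Lemma L_expN_fock (m : nat) v : L (Negz m) v =
  (pp * 2)^-1 *: (\sum_(i < m) alpha (Negz i) (alpha (Negz (m - i.+1)) v)) +
  (pp^-1 *: nsum (fun i => alpha (Negz (m + i)) (alpha i%:Z v)) + (bb / pp * m%:R) *: alpha (Negz m) v).
Proof. by apply: L_expN; first [exact: pp0|exact: alpha_lin|exact: L_exp|exact: alpha_ev0]. Qed.

(** Degree 3 for alpha(-1) and 2 for the deeper modes. With these values each L(n), n < 0, has a
    single term of top degree, namely one with a factor alpha(-1). *)
Definition mval (k : nat) : nat := (2 + (k == 0))%N.
Lemma mval0 : mval 0 = 3%N. Proof. by []. Qed.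
Lemma mvalS k : mval k.+1 = 2%N. Proof. by []. Qed.
Local Notation ble := (@ble R mval).

(** The top degrees of alpha(-1) alpha(0), alpha(-1)^2 and alpha(-1) alpha(n+1), the leading terms
    of L(-1), L(-2) and L(n) for n <= -3. In [topc], the leading coefficient of L(-1) is the
    charge. *)
Definition tau (n : int) : int :=
  match n with Negz 0 => 3 | Negz 1 => 6 | Negz _ => 5 | Posz _ => 0 end.

Definition topc (l : C) (n : int) : C :=
  match n with Negz 0 => l | Negz 1 => (pp * 2)^-1 | Negz _ => pp^-1 | Posz _ => 1 end.

Definition top (n : int) (v : V) : V :=
  match n with Negz 0 => alpha (Negz 0) v | Negz 1 => alpha (Negz 0) (alpha (Negz 0) v)
  | Negz k.+1 => alpha (Negz 0) (alpha (Negz k) v) | Posz _ => v end.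

Definition madd (n : int) (A : {mset nat}%mset) : {mset nat}%mset :=
  (match n with Negz 0 => 0%N +` A | Negz 1 => 0%N +` (0%N +` A)
  | Negz k.+1 => 0%N +` (k +` A) | Posz _ => A end)%mset.

Lemma top_lin n : linear (top n).
Proof.
case: n => [n|[|[|k]]]; [exact: lin_id|exact: alpha_lin| |];
  by apply: lin_comp; exact: alpha_lin.
Qed.

Lemma topU n A s : top n (bs (A, s)) = bs (madd n A, s).
Proof. by case: n => [n|[|[|k]]] //=; rewrite !alphaNU. Qed.

Lemma ms_madd n A : (ms mval (madd n A))%:Z = (ms mval A)%:Z + tau n.
Proof. by case: n => [n|[|[|k]]] /=; rewrite ?msD /mval /=; lia. Qed.

Lemma ble_top n x v : ble x v -> ble (x + tau n) (top n v).
Proof.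
move=> xv; case: n => [n|[|[|k]]] /=; first by rewrite addr0.
- by apply: (ble_le _ (ble_alpha p0 (Negz 0) xv)); rewrite /ga /mval; lia.
- by apply: (ble_alpha2 p0 xv); rewrite /ga /mval; lia.
- by apply: (ble_alpha2 p0 xv); rewrite /ga /mval; lia.
Qed.

Lemma top_chg n l v : chg l v -> chg l (top n v).
Proof. by move=> lv; case: n => [n|[|[|k]]] //=; do ?apply: alpha_chg. Qed.

Lemma ble_tail (m : nat) x v : ble x v ->
  ble (x + 2) (nsum (fun i => alpha (Negz (m + i).+1) (alpha i%:Z v))).
Proof.
move=> xv; apply: ble_nsum => i; apply: (ble_alpha2 p0 xv).
by case: i => [|i]; rewrite /ga /mval /=; lia.
Qed.

Lemma L_top l x v n : chg l v -> ble x v -> n < 0 ->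
  ble (x + tau n - 1) (L n v - topc (ratr l) n *: top n v).
Proof.
move=> lv xv; case: n => // m _; rewrite L_expN_fock.
have n2 : 2 != 0 :> C by rewrite pnatr_eq0.
have P0 := @pp0 R p p0.
case: m => [|[|k]] /=.
- rewrite big_ord0 scaler0 add0r mulr0 scale0r addr0 nsumS; last first.
    by case: (alpha_ev0 p v) => N vN; exists N => i /vN ->; rewrite alpha0.
  rewrite add0n (alpha0_chg p lv) alphaZ; set N := nsum _; set A := alpha (Negz 0) v.
  have -> : pp^-1 *: ((pp * ratr l) *: A + N) - ratr l *: A = pp^-1 *: N.
    by rewrite scalerDr scalerA mulrA mulVf// mul1r addrAC subrr add0r.
  apply: bleZ; apply: ble_nsum => i; apply: (ble_alpha2 p0 xv).
  by case: i => [|i]; rewrite /ga /mval /=; lia.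
- rewrite big_ord1 subnn -[Negz (nat_of_ord ord0)]/(Negz 0); set A := alpha (Negz 0) (alpha _ v); set N := nsum _; set B := alpha _ v.
  have -> : (pp * 2)^-1 *: A + (pp^-1 *: N + (bb / pp * 1) *: B) - (pp * 2)^-1 *: A =
    pp^-1 *: N + (bb / pp * 1) *: B by exact: lead_arith1.
  apply: bleD; apply: bleZ.
    by apply: ble_le (ble_tail 0 xv); lia.
  by apply: (ble_le _ (ble_alpha p0 (Negz 1) xv)); rewrite /ga /mval; lia.
rewrite big_ord_recl big_ord_recr /= subn1 subnn /=.
have -> : alpha (Negz (bump 0 k)) (alpha (Negz 0) v) = alpha (Negz 0) (alpha (Negz k.+1) v).
  by rewrite /bump /= add1n heisC.
set A := alpha (Negz 0) _; set S := \sum_(i < k) _; set T := nsum _; set B := alpha _ v.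
have -> : (pp * 2)^-1 *: (A + (S + A)) + (pp^-1 *: T + (bb / pp * k.+2%:R) *: B) - pp^-1 *: A =
    (pp * 2)^-1 *: S + (pp^-1 *: T + (bb / pp * k.+2%:R) *: B).
  exact: lead_arith2.
apply: bleD; first apply: bleZ.
  apply: ble_sum => i; apply: (ble_alpha2 p0 xv); have := ltn_ord i => ik.
  rewrite /bump /= add1n (_ : (k.+2 - i.+2)%N = (k - i).-1.+1); last by lia.
  by rewrite /ga !mvalS; lia.
apply: bleD; apply: bleZ.
  by apply: ble_le (ble_tail k.+1 xv); lia.
by apply: (ble_le _ (ble_alpha p0 (Negz k.+2) xv)); rewrite /ga /mval; lia.
Qed.

Definition taus (J : seq int) : int := \sum_(n <- J) tau n.
Definition topcs (l : C) (J : seq int) : C := \prod_(n <- J) topc l n.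
Definition tops (J : seq int) (v : V) : V := foldr top v J.
Definition madds (J : seq int) A := foldr madd A J.

Lemma ms_madds J A : (ms mval (madds J A))%:Z = (ms mval A)%:Z + taus J.
Proof.
rewrite /taus; elim: J => [|n J IHJ] /=; first by rewrite big_nil addr0.
by rewrite ms_madd IHJ big_cons -addrA (addrC _ (tau n)).
Qed.

Lemma topsU J A s : tops J (bs (A, s)) = bs (madds J A, s).
Proof. by elim: J => //= n J ->; rewrite topU. Qed.

Lemma tops_lin J : linear (tops J).
Proof. by elim: J => [|n J IHJ]; [exact: lin_id|exact: (lin_comp (top_lin n) IHJ)]. Qed.

Lemma tops_chg J l v : chg l v -> chg l (tops J v).
Proof. by move=> lv; elim: J => //= n J; exact: top_chg. Qed.

Lemma ble_tops J x v : ble x v -> ble (x + taus J) (tops J v).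
Proof.
move=> xv; rewrite /taus; elim: J => [|n J IHJ] /=; first by rewrite big_nil addr0.
by rewrite big_cons (addrC (tau n)) addrA; exact: ble_top.
Qed.

Lemma ble_L n l x v : chg l v -> ble x v -> n < 0 -> ble (x + tau n) (L n v).
Proof.
move=> lv xv n0; rewrite -(subrK (topc (ratr l) n *: top n v) (L n v)); apply: bleD.
  by apply: ble_le (L_top lv xv n0); lia.
by apply: bleZ; exact: ble_top.
Qed.

Lemma op_chg J l v : chg l v -> chg l (op L J v).
Proof. by move=> lv; elim: J => //= n J; exact: L_chg. Qed.

Lemma op_top J l x v : chg l v -> ble x v -> neg J ->
  ble (x + taus J - 1) (op L J v - topcs (ratr l) J *: tops J v).
Proof.
move=> lv xv; rewrite /taus /topcs; elim: J => [_|n J IHJ /= /andP[n0 /IHJ{IHJ} IHJ]] /=.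
  by rewrite !big_nil scale1r subrr; exact: ble0.
rewrite !big_cons; set c := \prod_(j <- J) _ in IHJ *; set S := \sum_(j <- J) _ in IHJ *.
have -> : L n (op L J v) - (topc (ratr l) n * c) *: top n (tops J v) =
    L n (op L J v - c *: tops J v) + c *: (L n (tops J v) - topc (ratr l) n *: top n (tops J v)).
  by rewrite (linB (L_lin p n)) (linZ (L_lin p n)); lmod.
have cJ := @op_chg J _ _ lv; have tJ := @tops_chg J _ _ lv.
apply: bleD.
  have cc : chg l (op L J v - c *: tops J v) by apply: supp_inB => //; exact: supp_inZ.
  by apply: ble_le (ble_L cc IHJ n0); lia.
apply: bleZ; have := L_top tJ (ble_tops J xv) n0.
by apply: ble_le; rewrite -[taus J]/S; lia.
Qed.

Lemma topcs_pow J : neg J -> exists2 r : C, r != 0 &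
  forall l, topcs l J = r * l ^+ count (pred1 (-1 : int)) J.
Proof.
have P0 := @pp0 R p p0; have n2 : 2 != 0 :> C by rewrite pnatr_eq0.
rewrite /topcs; elim: J => [_|n J IHJ /= /andP[n0 /IHJ[r r0 rE]]].
  by exists 1; rewrite ?oner_eq0// => l; rewrite big_nil mul1r.
case: n n0 => // -[|[|k]] _.
- by exists r => // l; rewrite big_cons rE /= exprS mulrCA.
- exists ((pp * 2)^-1 * r) => [|l]; last by rewrite big_cons rE /= mulrA.
  by rewrite mulf_neq0// invr_eq0 mulf_neq0.
- exists (pp^-1 * r) => [|l]; last by rewrite big_cons rE /= mulrA.
  by rewrite mulf_neq0// invr_eq0.
Qed.

Lemma madds_count J A : neg J ->
  (forall k, madds J A k.+1 = (count (pred1 (Negz k.+2)) J + A k.+1)%N) /\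
  madds J A 0%N = (count (pred1 (Negz 1)) J + size J + A 0%N)%N.
Proof.
elim: J => // n J IHJ /= /andP[n0 /IHJ[e1 e2]]; split => [k|].
  by case: n n0 => // -[|[|k']] _ /=; rewrite ?mset1DE ?e1 /=; lia.
by case: n n0 => // -[|[|k']] _ /=; rewrite ?mset1DE ?e2 /=; lia.
Qed.

Lemma size_neg J : neg J -> (size J + count (pred1 (Negz 1)) J =
  count (pred1 (-1 : int)) J + (count (pred1 (Negz 1)) J).*2 + count (fun n : int => (n < -2)%R) J)%N.
Proof.
elim: J => // n J IHJ /andP[n0 /IHJ]; set a := count (pred1 (Negz 1)) J.
set b := count (pred1 (-1 : int)) J; set c := count (fun n : int => (n < -2)%R) J => e.
case: n n0 => // -[|[|k]] _.
- by change ((size J).+1 + (0 + a) = (1 + b) + (0 + a).*2 + (0 + c))%N; lia.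
- by change ((size J).+1 + (1 + a) = (0 + b) + (1 + a).*2 + (0 + c))%N; lia.
by change ((size J).+1 + (0 + a) = (0 + b) + (0 + a).*2 + (1 + c))%N; lia.
Qed.

(** The letters below -2 are counted by the deeper modes of the leading monomial. The power of
    alpha(-1) exceeds that of A by the length plus the number of letters -2, so once the letters -1
    are counted the number of letters -2 follows. *)
Lemma madds_inj J J' A : neg J -> neg J' -> sorted <=%R J -> sorted <=%R J' ->
  madds J A = madds J' A -> count (pred1 (-1 : int)) J = count (pred1 (-1 : int)) J' -> J = J'.
Proof.
move=> nJ nJ' sJ sJ' e e1.
have [f1 f2] := madds_count A nJ; have [f1' f2'] := madds_count A nJ'.
have ck k : count (pred1 (Negz k.+2)) J = count (pred1 (Negz k.+2)) J'.
  by apply/eqP; rewrite -(eqn_add2r (A k.+1)) -f1 -f1' e.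
have pos (I : seq int) n : neg I -> count (pred1 (Posz n)) I = 0%N.
  by move=> /allP nI; apply/eqP; rewrite -leqn0 leqNgt -has_count; apply/hasPn => k /nI /=; lia.
have c3 : count (fun n : int => (n < -2)%R) J = count (fun n : int => (n < -2)%R) J'.
  have ex (I : seq int) : exists N, forall M, (N <= M)%N ->
      count (fun n : int => (n < -2)%R) I = (\sum_(k < M) count (pred1 (Negz k.+2)) I)%N.
    elim: I => [|n I [N IHI]]; first by exists 0%N => M _ /=; rewrite big1.
    exists (maxn N `|n|)%N => M; rewrite geq_max => /andP[NM nM] /=.
    rewrite big_split /= -IHI//; congr (_ + _)%N; case: n nM => [n|[|[|k]]] nM /=.
    - by rewrite big1.
    - by rewrite big1.
    - by rewrite big1.
    have kM : (k < M)%N by move: nM => /=; lia.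
    transitivity (\sum_(i < M | i == Ordinal kM) 1)%N; first by rewrite big_pred1_eq.
    rewrite big_mkcond; apply: eq_bigr => i _; rewrite -val_eqE /=.
    by case: (nat_of_ord i =P k) => [->|ik]; case: eqP => // -[ki]; case: ik.
  have [N eN] := ex J; have [N' eN'] := ex J'.
  rewrite (eN (maxn N N')) ?leq_maxl// (eN' (maxn N N')) ?leq_maxr//.
  by apply: eq_bigr => k _; rewrite ck.
have c2 : count (pred1 (Negz 1)) J = count (pred1 (Negz 1)) J'.
  have := size_neg nJ; have := size_neg nJ'; move: f2 f2'; rewrite e e1 c3 => -> h.
  by move: h; lia.
apply: (sorted_eq le_trans le_anti sJ sJ'); apply/allP => n _ /=; apply/eqP.
case: n => [n|[|[|k]]]; [by rewrite !pos|exact: e1|exact: c2|exact: ck].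
Qed.

(** A factor alpha(-k-1) uses k+1 levels and carries degree at most 3, so among the monomials of
    level d only alpha(-1)^d reaches degree 3d. *)
Lemma lead_ble l d f : wh l (d%:R + hw p l) f -> ble (3 * d%:Z) f /\
  ble (3 * d%:Z - 1) (f - f@_(zs d, l) *: bs (zs d, l)).
Proof.
have msl A : (ms mval A <= 3 * lev A)%N /\ (ms mval A = (3 * lev A)%N -> A = zs (lev A)).
  elim/mset_ind: A => [|k A [IH1 IH2]]; first by rewrite ms0 lev0.
  rewrite msD levD; case: k => [|k]; rewrite ?mval0 ?mvalS; split; try lia.
  by move=> h; rewrite [in LHS]IH2//; lia.
move=> wf; split; [split=> -[A t] fA|split=> -[A t]].
  have [_ /= /addIr /eqP] := wf _ fA; rewrite eqr_nat => /eqP <-.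
  by have [] := msl A; lia.
rewrite mcoeffB mcoeffZ mcoeff_bs => h; rewrite /=.
have [tl|tl] := eqVneq t l; last first.
  move: h; rewrite xpair_eqE [l == t]eq_sym (negPf tl) andbF mulr0 subr0 => /wf[/= tl' _].
  by rewrite tl' eqxx in tl.
have [Ad|Ad] := eqVneq A (zs d).
  by move: h; rewrite Ad tl eqxx mulr1 subrr eqxx.
move: h; rewrite xpair_eqE [zs d == A]eq_sym (negPf Ad) mulr0 subr0 => /wf[/= _ /addIr /eqP].
rewrite eqr_nat => /eqP e; have [h1 h2] := msl A; rewrite e in h1 h2.
by have : ms mval A <> (3 * d)%N by [move=> /h2 h; rewrite h eqxx in Ad]; lia.
Qed.

(** In a relation, look at the leading monomial of a word of maximal degree. Its coefficient on the
    i-th vector is, up to a non-zero factor, a polynomial in the charge l_i, whose exponents count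
    the letters L(-1). The degree is below N0 and there are N0 distinct charges, so the polynomial
    is 0; by [madds_inj] each of its coefficients belongs to one word. *)
Lemma words_independent (N0 : nat) (l : 'I_N0 -> rat) (d : 'I_N0 -> nat) (v : 'I_N0 -> V)
    (Js : seq (seq int)) (c : seq int -> C) : injective l ->
  (forall i, wh (l i) ((d i)%:R + hw p (l i)) (v i)) -> (forall i, (v i)@_(zs (d i), l i) != 0) ->
  uniq Js -> (forall J, J \in Js -> [/\ neg J, sorted <=%R J & (count (pred1 (-1 : int)) J < N0)%N]) ->
  (forall i, \sum_(J <- Js) c J *: op L J (v i) = 0) -> forall J, J \in Js -> c J = 0.
Proof.
move=> li wv v0 uJ PJ rel J1 J1J; apply/eqP/contraT => cJ1.
have : [seq J <- Js | c J != 0] != [::].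
  by rewrite -has_filter; apply/hasP; exists J1.
move=> /(seq_argmax (fun J => `|taus J|%N))[J0]; rewrite mem_filter => /andP[c0 J0J] J0m.
have tau0 J : 0 <= taus J by apply: sumr_ge0 => -[n|[|[|k]]].
have [n0 s0 k0] := PJ _ J0J.
pose K := [seq J <- Js | madds J mset0 == madds J0 mset0].
have [r rE] : exists r : seq int -> C, forall J, J \in Js -> r J != 0 /\
    forall x, topcs x J = r J * x ^+ count (pred1 (-1 : int)) J.
  have h J : exists r : C, J \in Js -> r != 0 /\ forall x, topcs x J = r * x ^+ count (pred1 (-1 : int)) J.
    have [/PJ[nJ _ _]|nJ] := boolP (J \in Js); last by exists 0.
    by have [r r0 rE] := topcs_pow nJ; exists r.
  by have [r rE] := boolp.choice h; exists r.
pose P : {poly C} := \sum_(J <- K) (c J * r J) *: 'X^(count (pred1 (-1 : int)) J).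
have maddsD J A : madds J A = (madds J mset0 `+` A)%mset.
  elim: J => [|n J IHJ] /=; first by apply/msetP => x; rewrite msetE2 mset0E.
  case: n => [n|[|[|k]]] //=; rewrite IHJ; apply/msetP => x;
    by rewrite !(msetE2, mset1DE); lia.
have rootP i : root P (ratr (l i)).
  have [bl tl] := lead_ble (wv i).
  have cv : chg (l i) (v i) by exact: wh_chg (wv i).
  pose g0 := (v i)@_(zs (d i), l i); pose B := madds J0 (zs (d i)).
  have msB : (ms mval B)%:Z = 3 * (d i)%:Z + taus J0.
    rewrite ms_madds; congr (_ + _); elim: (d i) => [|n IHn] /=; first by rewrite ms0.
    by rewrite msD mval0; lia.
  have coef J : J \in Js -> c J != 0 -> (op L J (v i))@_(B, l i) =
      if madds J mset0 == madds J0 mset0 then topcs (ratr (l i)) J * g0 else 0.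
    move=> JJ cJ; have [nJ _ _] := PJ _ JJ.
    have tJ : taus J <= taus J0.
      have := J0m J; rewrite mem_filter cJ JJ => /(_ isT).
      by have := tau0 J; have := tau0 J0; lia.
    have e1 := op_top cv bl nJ.
    have -> : (op L J (v i))@_(B, l i) = (topcs (ratr (l i)) J *: tops J (v i))@_(B, l i).
      apply/eqP; rewrite -subr_eq0 -mcoeffB (ble_coeff (l i) e1)//; first by rewrite msB; lia.
    rewrite mcoeffZ; have -> : (tops J (v i))@_(B, l i) = (g0 *: tops J (bs (zs (d i), l i)))@_(B, l i).
      apply/eqP; rewrite -subr_eq0 -mcoeffB -(linZ (tops_lin J)) -(linB (tops_lin J)).
      by rewrite (ble_coeff (l i) (ble_tops J tl))//; first by rewrite msB; lia.
    rewrite mcoeffZ topsU mcoeff_bs xpair_eqE eqxx andbT.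
    have -> : (madds J (zs (d i)) == B) = (madds J mset0 == madds J0 mset0).
      rewrite /B maddsD (maddsD J0); apply/eqP/eqP => [|->//] /msetP e.
      by apply/msetP => x; apply/eqP; rewrite -(eqn_add2r (zs (d i) x)) -!msetE2 e.
    by case: eqP; rewrite ?mulr1 ?mulr0.
  have : (\sum_(J <- Js) c J *: op L J (v i))@_(B, l i) = 0 by rewrite rel mcoeff0.
  rewrite raddf_sum /= big_seq.
  rewrite (eq_bigr (fun J => if madds J mset0 == madds J0 mset0 then c J * (topcs (ratr (l i)) J * g0) else 0)); last first.
    move=> J JJ; rewrite mcoeffZ; have [->|cJ] := eqVneq (c J) 0; first by rewrite !mul0r if_same.
    by rewrite coef//; case: ifP; rewrite ?mulr0.
  rewrite -big_seq -big_mkcond -big_filter -/K => e.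
  rewrite /root /P horner_sum; apply/eqP; apply: (mulIf (v0 i)); rewrite mul0r -[RHS]e mulr_suml.
  rewrite !big_seq; apply: eq_bigr => J; rewrite mem_filter => /andP[_ /rE[_ rJ]].
  by rewrite hornerZ hornerXn rJ; ring.
have P0 : P = 0.
  apply/eqP/contraT => P0; have sP : (size P <= N0)%N.
    apply: (leq_trans (size_sum _ _ _)); rewrite big_seq; apply: (big_ind (fun x => x <= N0)%N) => //.
      by move=> x y xN yN; rewrite geq_max xN.
    move=> J; rewrite mem_filter => /andP[_ /PJ[_ _ JN]].
    by apply: (leq_trans (size_scale_leq _ _)); rewrite size_polyXn.
  have := max_poly_roots P0 (rs := [seq ratr (l i) | i <- enum 'I_N0]).
  rewrite size_map size_enum_ord map_inj_uniq ?enum_uniq; last by move=> i j /fmorph_inj /li.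
  move=> /(_ _ isT) h; have : (N0 < size P)%N by apply: h; apply/allP => x /mapP[i _ ->].
  by rewrite ltnNge sP.
have : P`_(count (pred1 (-1 : int)) J0) = 0 by rewrite P0 coef0.
rewrite /P coef_sum (bigD1_seq J0) /= ?filter_uniq//; last by rewrite mem_filter eqxx.
rewrite coefZ coefXn eqxx mulr1 big_seq_cond big1 ?addr0 => [/eqP|J].
  by rewrite mulf_eq0 (negPf c0) /=; have [/negPf ->] := rE _ J0J.
rewrite mem_filter => /andP[/andP[/eqP eJ /PJ[nJ sJ _]] JJ0].
rewrite coefZ coefXn; case: eqP => [e|_]; last by rewrite mulr0.
by move: JJ0; rewrite (madds_inj n0 nJ s0 sJ (esym eJ) e) eqxx.
Qed.

End Independence.

(** * Screening operators *)

Lemma scaleAC (K : comPzRingType) (V : lmodType K) (c d : K) (x : V) : c *: (d *: x) = d *: (c *: x).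
Proof. by rewrite !scalerA mulrC. Qed.

Section LinearOn.
Context {K : pzRingType} {V V' : lmodType K} (S : V -> Prop) (f : V -> V').
Hypothesis S0 : S 0.
Hypothesis S_lin : forall (c : K) u v, S u -> S v -> S (c *: u + v).
Hypothesis f_lin : forall (c : K) u v, S u -> S v -> f (c *: u + v) = c *: f u + f v.

Lemma lin_on0 : f 0 = 0.
Proof.
have := f_lin 1 S0 S0; rewrite !scale1r addr0 => e.
by apply: (addrI (f 0)); rewrite -e addr0.
Qed.

Lemma lin_onZ c v : S v -> f (c *: v) = c *: f v.
Proof. by move=> Wv; have := f_lin c Wv S0; rewrite lin_on0 !addr0. Qed.

Lemma lin_on_mem I (r : seq I) (c : I -> K) (F : I -> V) : (forall i, S (F i)) -> S (\sum_(i <- r) c i *: F i).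
Proof.
move=> WF; elim: r => [|i r IHr]; first by rewrite big_nil.
by rewrite big_cons; exact: S_lin.
Qed.

Lemma lin_on_sum I (r : seq I) (c : I -> K) (F : I -> V) : (forall i, S (F i)) ->
  f (\sum_(i <- r) c i *: F i) = \sum_(i <- r) c i *: f (F i).
Proof.
move=> WF; elim: r => [|i r IHr]; first by rewrite !big_nil lin_on0.
by rewrite !big_cons f_lin ?IHr//; exact: lin_on_mem.
Qed.
End LinearOn.

(** * Counting standard words against Fock monomials *)

Section Dimension.
Context {R : realType} (p : nat).
Local Notation C := R[i].
Local Notation V := (fock R).
Local Notation wh := (@wh R p).

Definition stdw (N : nat) : seq (seq int) := undup [seq J <- comps N.+1 N | sorted <=%R J].

Lemma stdwP N J : J \in stdw N <-> negw N J /\ sorted <=%R J.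
Proof.
rewrite mem_undup mem_filter; split=> [/andP[sJ /compsP[]]|[nJ sJ]]; first by rewrite ltnSn.
  by move=> nJ wJ; split.
by rewrite sJ; apply/compsP.
Qed.

Definition idx (n : int) : nat := if n is Negz k then k else 0%N.
Definition mon (J : seq int) : {mset nat}%mset := seq_mset (map idx J).

Lemma mon_surj A : exists2 J, J \in stdw (lev A) & mon J = A.
Proof.
pose J := sort <=%R [seq Negz k | k <- enum_mset A].
have pJ : perm_eq J [seq Negz k | k <- enum_mset A] by rewrite perm_sort.
exists J.
  apply/stdwP; split; last exact: (sort_sorted le_total).
  split; first by rewrite /neg (perm_all _ pJ) all_map; apply/allP.
  rewrite /wsum (perm_big _ pJ) big_map /lev; elim: (enum_mset A : seq nat) => [|k l IHl].
    by rewrite !big_nil.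
  by rewrite !big_cons IHl NegzE PoszD opprD.
rewrite -[RHS]seq_mset_id; apply/eq_seq_msetP.
by rewrite (perm_trans (perm_map idx pJ))// -map_comp map_id_in.
Qed.

(* There are as many standard words of weight N as monomials of level N. *)
Lemma kernel_dependent s N (u : seq int -> V) (chi : V -> C) x :
  (forall J, J \in stdw N -> wh s (N%:R + hw p s) (u J)) ->
  (forall (c : C) y y', chi (c *: y + y') = c * chi y + chi y') ->
  (forall J, J \in stdw N -> chi (u J) = 0) ->
  wh s (N%:R + hw p s) x -> chi x != 0 ->
  exists c : seq int -> C, (exists2 J, J \in stdw N & c J != 0) /\ \sum_(J <- stdw N) c J *: u J = 0.
Proof.
move=> uw chil chiu xw chix; pose Ms := undup (map mon (stdw N)); pose n := size (stdw N).
pose m := size Ms; have mn : (m <= n)%N by rewrite (leq_trans (size_undup _))// size_map.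
pose A_ (j : 'I_m) := nth mset0 Ms j; pose J_ (i : 'I_n) := nth [::] (stdw N) i.
have JP i : J_ i \in stdw N by exact: mem_nth.
have chi0 : chi 0 = 0.
  by have := chil 1 0 0; rewrite scale1r add0r mul1r => e; apply: (addrI (chi 0)); rewrite -e addr0.
have chiZ c y : chi (c *: y) = c * chi y by have := chil c y 0; rewrite chi0 !addr0.
have chiS I (r : seq I) (F : I -> V) : chi (\sum_(i <- r) F i) = \sum_(i <- r) chi (F i).
  elim: r => [|i r IHr]; first by rewrite !big_nil.
  by rewrite !big_cons -IHr -[F i in LHS]scale1r chil mul1r.
have expand v : wh s (N%:R + hw p s) v -> v = \sum_j v@_(A_ j, s) *: bs (A_ j, s).
  move=> vw; apply/malgP => -[B t]; rewrite raddf_sum /=.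
  under eq_bigr => j _ do rewrite mcoeffZ mcoeff_bs xpair_eqE.
  have [vB|vB] := eqVneq (v@_(B, t)) 0.
    rewrite vB big1// => j _; case: (A_ j =P B) => [->|_]; last by rewrite mulr0.
    by case: (s =P t) => [->|_]; rewrite ?mulr0// vB mul0r.
  have [/= ts /addIr /eqP] := vw _ vB; rewrite eqr_nat => /eqP lB; subst t.
  have [J JN eJ] := mon_surj B; have BM : B \in Ms by rewrite mem_undup -eJ map_f// -lB.
  have Bm : (index B Ms < m)%N by rewrite index_mem.
  rewrite (bigD1 (Ordinal Bm)) //= /A_ nth_index// !eqxx mulr1 big1 ?addr0// => j.
  rewrite -val_eqE /= => jB; rewrite andbT; case: eqP => [e|_]; last by rewrite mulr0.
  by move: jB; rewrite -e index_uniq ?undup_uniq// eqxx.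
pose U : 'M[C]_(n, m) := \matrix_(i, j) (u (J_ i))@_(A_ j, s).
pose X : 'cV[C]_m := \col_j chi (bs (A_ j, s)).
have UX : U *m X = 0.
  apply/colP => i; rewrite !mxE; transitivity (chi (u (J_ i))); last exact: chiu.
  rewrite [in RHS](expand _ (uw _ (JP i))) chiS.
  by apply: eq_bigr => j _; rewrite !mxE chiZ.
have nU : ~~ row_free U.
  (* Since there are at least as many words as monomials, independent rows would give full column
     rank, and then chi would vanish on every vector of that charge and level. *)
  apply: contra chix => fU; have rU : row_full U.
    rewrite /row_full eqn_leq rank_leq_col /=; move: fU; rewrite /row_free => /eqP ->.
    by [].
  have X0 : X = 0 by apply: (row_full_inj rU); rewrite mulmx0.
  rewrite (expand _ xw) chiS big1// => j _; rewrite chiZ.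
  by move/colP: X0 => /(_ j); rewrite !mxE => ->; rewrite mulr0.
have : kermx U != 0 by rewrite kermx_eq0.
move=> /rowV0Pn[c /sub_kermxP cU c0]; pose cc J := if insub (index J (stdw N)) is Some i then c 0 i else 0.
have ccE i : cc (J_ i) = c 0 i.
  by rewrite /cc /J_ index_uniq ?undup_uniq// valK.
exists cc; split.
  move: c0; rewrite -[c != 0]negbK negbK => c0; apply: contrapT => h; move: c0; apply/negP; rewrite negbK.
  by apply/eqP/rowP => i; rewrite mxE; apply/eqP/contraT => ci; case: h; exists (J_ i); rewrite ?ccE.
rewrite (big_nth [::]) big_mkord; under eq_bigr => i _ do rewrite -/(J_ i) ccE (expand _ (uw _ (JP i))) scaler_sumr.
rewrite exchange_big /= big1// => j _; under eq_bigr => i _ do rewrite scalerA.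
rewrite -scaler_suml; move/rowP: cU => /(_ j); rewrite !mxE => e.
rewrite (_ : \sum_i _ = 0) ?scale0r// -[RHS]e; apply: eq_bigr => i _.
by rewrite !mxE.
Qed.

End Dimension.

(** * Projections onto the components of a grading of the Fock basis *)

Section Projections.
Context {R : realType} {T : eqType} (key : fock_basis -> T).
Local Notation C := R[i].
Local Notation V := (fock R).

Definition khom (x : T) : V -> Prop := supp_in (fun b => key b = x).

Definition kp (x : T) (v : V) : V := lin_ext (fun b : fock_basis => if key b == x then bs b else 0) v.

Lemma kp_lin x : linear (kp x).
Proof. exact: lin_ext_is_linear. Qed.

Lemma kpU x b : kp x (bs b) = if key b == x then bs b else 0.
Proof. by rewrite /kp lin_extU. Qed.

Lemma kp_khom x v : khom x (kp x v).
Proof.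
apply: (fock_ind (P := fun v => khom x (kp x v))) => [|c u u' hu hu'|b _].
- by rewrite (lin0 (kp_lin _)); exact: supp_in0.
- have -> : kp x (c *: u + u') = c *: kp x u + kp x u' by exact: (lin_elim (kp_lin _)).
  exact: (supp_inP hu hu').
rewrite kpU; case: eqP => [e|_]; last exact: supp_in0.
exact: supp_inU.
Qed.

Lemma kp_id x v : khom x v -> kp x v = v.
Proof.
move=> vw; rewrite [in LHS](fockE v) [RHS](fockE v) (lin_big (kp_lin _)) !big_seq.
apply: eq_bigr => b; rewrite -mcoeff_neq0 => /vw e.
by rewrite (linZ (kp_lin _)) kpU e eqxx.
Qed.

Lemma kp_neq y x v : khom y v -> x != y -> kp x v = 0.
Proof.
move=> vw xn; rewrite (fockE v) (lin_big (kp_lin _)) big_seq big1// => b.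
rewrite -mcoeff_neq0 => /vw e; rewrite (linZ (kp_lin _)) kpU e eq_sym (negPf xn).
by rewrite scaler0.
Qed.

Lemma kp_sum v : exists2 r : seq T, uniq r &
  v = \sum_(x <- r) kp x v /\ forall x, x \notin r -> kp x v = 0.
Proof.
pose r := undup [seq key b | b <- msupp v]; exists r; first exact: undup_uniq.
have kpE x : kp x v = \sum_(b <- msupp v) v@_b *: (if key b == x then bs b else 0).
  by rewrite {1}(fockE v) (lin_big (kp_lin _)); apply: eq_bigr => b _; rewrite (linZ (kp_lin _)) kpU.
split=> [|x xr].
  rewrite [LHS](fockE v); under [RHS]eq_bigr => x _ do rewrite kpE.
  rewrite exchange_big /= !big_seq; apply: eq_bigr => b bv.
  rewrite (bigD1_seq (key b)) ?undup_uniq//=; last by rewrite mem_undup; apply/mapP; exists b.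
  by rewrite eqxx big1 ?addr0// => x /negPf xb; rewrite eq_sym xb scaler0.
rewrite kpE big_seq big1// => b bv; case: eqP => [e|_]; last by rewrite scaler0.
by move: xr; rewrite -e mem_undup => /mapP[]; exists b.
Qed.

Lemma kp_comm (F : V -> V) (f : T -> T) : linear F -> injective f ->
  (forall x v, khom x v -> khom (f x) (F v)) -> forall x v, F (kp x v) = kp (f x) (F v).
Proof.
move=> lF fI Fk x0 v; have [r ur [e h]] := kp_sum v.
rewrite [in RHS]e (lin_big lF) (lin_big (kp_lin _)).
have e1 x : kp (f x0) (F (kp x v)) = if x == x0 then F (kp x v) else 0.
  have Fx := Fk _ _ (@kp_khom x v); case: eqP => [->|xn].
    by apply: kp_id; exact: Fk (@kp_khom x0 v).
  by apply: (kp_neq Fx); apply/eqP => /fI /esym.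
under eq_bigr => x _ do rewrite e1; rewrite -big_mkcond -big_filter.
have [xr|xr] := boolP (x0 \in r).
  by rewrite big_filter big_mkcond (bigD1_seq x0) //= eqxx big1 ?addr0// => x /negPf ->.
rewrite (h _ xr) (lin0 lF) big_filter big_mkcond big1_seq// => x /andP[_ xr'].
by case: eqP => // e2; move: xr; rewrite -e2 xr'.
Qed.

End Projections.

Section WeightProjections.
Context {R : realType} (p : nat).
Local Notation V := (fock R).
Local Notation wh := (@wh R p).

Definition wkey (b : fock_basis) : rat * rat := (b.2, (lev b.1)%:R + hw p b.2).
Definition wp : rat * rat -> V -> V := kp wkey.

Lemma wh_khom s w v : wh s w v <-> khom wkey (s, w) v.
Proof. split=> vw b /vw; first by case=> e1 e2; rewrite /wkey e1 e2.
by rewrite /wkey => -[<- <-]. Qed.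

Lemma wp_lin x : linear (wp x).
Proof. exact: kp_lin. Qed.

Lemma wp_wh x v : wh x.1 x.2 (wp x v).
Proof. by apply/wh_khom; rewrite -surjective_pairing; exact: kp_khom. Qed.

Lemma wp_id s w v : wh s w v -> wp (s, w) v = v.
Proof. by move/wh_khom; exact: kp_id. Qed.

Lemma wp_neq s w x v : wh s w v -> x != (s, w) -> wp x v = 0.
Proof. by move/wh_khom; exact: kp_neq. Qed.

Lemma wp_sum v : exists2 r : seq (rat * rat), uniq r &
  v = \sum_(x <- r) wp x v /\ forall x, x \notin r -> wp x v = 0.
Proof. exact: kp_sum. Qed.

Lemma wp_comm (T : V -> V) (f : rat * rat -> rat * rat) : linear T -> injective f ->
  (forall s w v, wh s w v -> wh (f (s, w)).1 (f (s, w)).2 (T v)) ->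
  forall x v, T (wp x v) = wp (f x) (T v).
Proof.
move=> lT fI Tw; apply: kp_comm => // -[s w] v /wh_khom /Tw /wh_khom.
by rewrite -surjective_pairing.
Qed.

End WeightProjections.

Lemma fock_neq0 (R : realType) (v : fock R) : v != 0 -> exists b, v@_b != 0.
Proof.
move=> v0; apply: contrapT => h; case/eqP: v0; apply/malgP => b.
by rewrite mcoeff0; apply/eqP/contraT => hb; case: h; exists b.
Qed.

Section Screening.
Context {R : realType} (p : nat).
Local Notation C := R[i].
Local Notation V := (fock R).
Local Notation alpha := (@al R p).
Local Notation pp := (@pp R p).
Local Notation es := (@es R).
Local Notation wh := (@wh R p).
Local Notation L := (@L R p).
Local Notation em := (@em R p).
Local Notation mode := (@md R p).
Hypothesis p2 : (2 <= p)%N.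
Let p0 : (0 < p)%N. Proof. exact: ltnW. Qed.
Let pn0 : p%:R != 0 :> rat. Proof. by rewrite pnatr_eq0 -lt0n. Qed.

Lemma natr_dbl1 (n : nat) : n.*2.+1%:R = 2 * n%:R + 1 :> rat.
Proof. by rewrite -natr1 -mul2n natrM. Qed.

Definition Qo : V -> V := em 1 0.
Definition qt : rat := - p%:R^-1.
Definition Qt : V -> V := em qt 0.

Lemma Qo_lin : linear Qo. Proof. exact: exp_mode_lin. Qed.
Lemma Qt_lin : linear Qt. Proof. exact: exp_mode_lin. Qed.

Lemma hw1 : hw p 1 = 1. Proof. by rewrite /hw; ring. Qed.
Lemma hw_qt : hw p qt = 1. Proof. by rewrite /hw /qt; field. Qed.

Lemma Qo_wh s w v : wh s w v -> wh (1 + s) w (Qo v).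
Proof. by move=> vw; have := @exp_mode_wh R p 1 0 _ _ _ vw; rewrite hw1 subr0 addrK. Qed.

Lemma Qt_wh s w v : wh s w v -> wh (qt + s) w (Qt v).
Proof. by move=> vw; have := @exp_mode_wh R p qt 0 _ _ _ vw; rewrite hw_qt subr0 addrK. Qed.

Lemma Qo_int (s : int) : 2 * p%:R * 1 * s%:~R = (2 * p%:Z * s)%:~R :> rat.
Proof. by rewrite !rmorphM/= mulr1. Qed.

Lemma Qt_int (s : int) : 2 * p%:R * qt * s%:~R = (- 2 * s)%:~R :> rat.
Proof. by rewrite /qt rmorphM/=; field. Qed.

Lemma L_Qo n (s : int) v : chg s%:~R v -> L n (Qo v) = Qo (L n v).
Proof.
move=> sv; have := @L_em R p p0 0 n _ _ _ _ (Qo_int s) sv.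
by rewrite hw1 subrr rmorph0 mul0r subr0 scale0r addr0.
Qed.

Lemma L_Qt n (s : int) v : chg s%:~R v -> L n (Qt v) = Qt (L n v).
Proof.
move=> sv; have := @L_em R p p0 0 n _ _ _ _ (Qt_int s) sv.
by rewrite hw_qt subrr rmorph0 mul0r subr0 scale0r addr0.
Qed.

Lemma Qo_chg (s : int) v : chg s%:~R v -> chg (1 + s)%:~R (Qo v).
Proof. by rewrite rmorphD/=; exact: exp_mode_chg. Qed.

(** The commutator is the zero mode of alpha(-1) e^((1 - 1/p) alpha). This state is a multiple of a
    derivative, whose zero mode is 0; dividing by 1 - 1/p requires p >= 2. *)
Lemma Qo_Qt (s : int) v : chg s%:~R v -> Qo (Qt v) = Qt (Qo v).
Proof.
move=> sv; have hq : 2 * p%:R * 1 * qt = ((-1) + (-1))%:~R :> rat by rewrite /qt; field.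
have := @exp_commutator R p p0 1 qt s%:~R (-1) _ _ hq (Qo_int s) (Qt_int s) (es qt) 0 0 v
  (@chg_e R qt) sv.
rewrite mode_es (@nsum1 _ _ 0%N) => [|[//|i] _]; last first.
  by rewrite [gb _ _](_ : _ = 0) ?scale0r// /gb big_ord_recl subrr mul0r mul0r.
rewrite gb0 scale1r (@exp_mode_es R p 1 0 qt 1); last by rewrite /qt; field.
rewrite /= (@Ep1_es R p p0) rmorph1 scale1r => e; apply/eqP; rewrite -subr_eq0; apply/eqP.
rewrite -[LHS]/(em 1 0 (em qt 0 v) - em qt 0 (em 1 0 v)) e.
have h : 2 * p%:R * (1 + qt) * s%:~R = ((2 * p%:Z - 2) * s)%:~R :> rat.
  by rewrite rmorphM rmorphB rmorphM/= /qt; field.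
have := @em_derivative R p p0 _ 0 _ _ _ h sv; rewrite oppr0 scale0r => /eqP.
rewrite scaler_eq0 => /orP[|/eqP //]; rewrite fmorph_eq0 /qt => /eqP e1.
have : p%:R * (1 - p%:R^-1) = 0 :> rat by rewrite e1 mulr0.
by rewrite mulrBr mulr1 mulfV// => /eqP; rewrite subr_eq0 -[1]/(1%:R) eqr_nat; move: p2; case: (p) => [|[]].
Qed.

Lemma es_neq0 s : es s != 0.
Proof. by apply/eqP => e; have := @gr_es R s; rewrite e gr0 => /esym/eqP; rewrite oner_eq0. Qed.

Lemma es_singular s : singular p (es s).
Proof.
move=> n; apply: (@wh_lt0 R p s (hw p s - n.+1%:~R)); first exact: (@L_wh R p p0 n.+1 _ _ _ (@wh_e R p s)).
by rewrite gtrDl oppr_lt0 ltr0n.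
Qed.

Definition vv (n i : nat) : V := iter i Qo (es (- n%:R)).

Lemma vv_wh n i : wh (i%:R - n%:R) (hw p (- n%:R)) (vv n i).
Proof.
elim: i => [|i IHi] /=; first by rewrite add0r; exact: wh_e.
by have := Qo_wh IHi; rewrite addrA -(natrD _ 1).
Qed.

Lemma vv_chg n i : chg (i%:Z - n%:Z)%:~R (vv n i).
Proof. by rewrite rmorphB/=; exact: (@wh_chg R p _ _ _ (@vv_wh n i)). Qed.

Lemma vv_singular n i : singular p (vv n i).
Proof.
elim: i => [|i IHi] k /=; first exact: es_singular.
by rewrite (L_Qo _ (@vv_chg n i)) IHi (lin0 Qo_lin).
Qed.

Lemma Qt_es n : Qt (es (- n%:R)) = 0.
Proof.
rewrite /Qt (@exp_mode_es R p qt 0 _ (Negz n.*2))//.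
by rewrite NegzE mulrNz -pmulrn natr_dbl1 /qt; field.
Qed.

Lemma Qt_vv n i : Qt (vv n i) = 0.
Proof.
elim: i => [|i IHi] /=; first exact: Qt_es.
by rewrite -(Qo_Qt (@vv_chg n i)) IHi (lin0 Qo_lin).
Qed.

Lemma hw_gap n : hw p (n%:R + 1) = hw p (- n%:R) + (n.*2.+1)%:R.
Proof. by rewrite /hw natr_dbl1; ring. Qed.

Lemma hw_lt_neg (a b : nat) : (a < b)%N -> hw p (- a%:R) < hw p (- b%:R).
Proof.
move=> ab; have -> : hw p (- b%:R) = hw p (- a%:R) + (p * (b - a) * (b + a) + (p - 1) * (b - a))%:R.
  by rewrite /hw natrD !natrM !natrB ?natrD//; [ring|exact: ltnW].
by rewrite ltrDl ltr0n addn_gt0 !muln_gt0 p0 subn_gt0 ab addn_gt0 (leq_ltn_trans (leq0n a) ab).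
Qed.

Lemma hw_lt_pos (a b : nat) : (a < b)%N -> hw p (- a%:R) < hw p b%:R.
Proof.
case: b => // b ab; rewrite -natr1 hw_gap; apply: le_lt_trans (_ : hw p (- b%:R) < _); last first.
  by rewrite ltrDl ltr0n.
by move: ab; rewrite ltnS leq_eqVlt => /orP[/eqP ->//|/hw_lt_neg/ltW].
Qed.

(** Q preserves the weight and raises the charge to n + 1, where the lowest weight is larger by 2n +
    1. *)
Lemma vv_top n : vv n n.*2.+1 = 0.
Proof.
apply: (@wh_lt0 R p _ _ _ (@vv_wh n n.*2.+1)).
by rewrite (_ : n.*2.+1%:R - n%:R = n%:R + 1 :> rat) ?hw_gap ?ltrDl ?ltr0n// natr_dbl1; ring.
Qed.

(** This makes the kernel of Qtilde a proper subspace at level 2n + 1 above e^(-n alpha), which is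
    what drives the dimension count in [small_span]. *)
Lemma Qt_alpha n : Qt (alpha (Negz n.*2) (es (- n%:R))) != 0.
Proof.
have := @alpha_exp_mode R p (Negz n.*2) qt 0 (es (- n%:R)); rewrite -/Qt Qt_es alpha0 add0r.
rewrite (@exp_mode_es R p qt _ _ 0); last first.
  by rewrite NegzE mulrNz -pmulrn natr_dbl1 /qt; field.
move=> /eqP; rewrite eq_sym addr_eq0 => /eqP ->; rewrite oppr_eq0 scaler_eq0 /= Ep_0.
rewrite mulf_eq0 (negPf (@pp0 R p p0)) fmorph_eq0 /qt oppr_eq0 invr_eq0 (negPf pn0) /=.
exact: es_neq0.
Qed.

End Screening.

(** * The triplet algebra is generated by the vectors Q^i e^(-n alpha) over the Virasoro algebra *)

Section Classification.
Context {R : realType} (p : nat).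
Local Notation C := R[i].
Local Notation V := (fock R).
Local Notation alpha := (@al R p).
Local Notation pp := (@pp R p).
Local Notation es := (@es R).
Local Notation wh := (@wh R p).
Local Notation L := (@L R p).
Local Notation vv := (@vv R p).
Local Notation Qo := (@Qo R p).
Local Notation Qt := (@Qt R p).
Hypothesis p2 : (2 <= p)%N.
Let p0 : (0 < p)%N. Proof. exact: ltnW. Qed.
Let pn0 : p%:R != 0 :> rat. Proof. by rewrite pnatr_eq0 -lt0n. Qed.

Lemma LL_scalar s : exists z : int -> C, forall m n v, chg s v ->
  L m (L n v) = L n (L m v) + ((m%:~R - n%:~R : C) *: L (m + n) v + (if m + n == 0 then z m else 0) *: v).
Proof.
have [z zP] := boolp.choice (fun m => @L_comm R p p0 s m (- m)).
exists z => m n v sv; have [mn|mn] := eqVneq (m + n) 0.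
  have -> : n = - m by apply/eqP; rewrite -addr_eq0 addrC mn.
  by rewrite (zP m v sv) subrr eqxx.
have [z' zP'] := @L_comm R p p0 s m n; have := zP' v sv; rewrite (negPf mn).
by [].
Qed.

Lemma op_wh J s w v : wh s w v -> wh s (w - (wsum J)%:~R) (op L J v).
Proof.
move=> vw; elim: J => [|n J IHJ] /=; first by rewrite /wsum big_nil subr0.
have := @L_wh R p p0 n _ _ _ IHJ; rewrite wsum_cons rmorphD/= opprD addrA addrAC.
by [].
Qed.

Lemma negw_wh (D : nat) J s w v : negw D J -> wh s w v -> wh s (w + D%:R) (op L J v).
Proof. by move=> [_ JD] vw; have := @op_wh J _ _ _ vw; rewrite JD rmorphN opprK. Qed.

Lemma Mod_wh D v u s w : wh s w v -> Mod L v D u -> wh s (w + D%:R) u.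
Proof.
move=> vw [X [PX ->]]; rewrite /ev big_seq; apply: supp_in_sum => x /PX xD.
by apply: supp_inZ; exact: (@negw_wh D _ _ _ _ xD vw).
Qed.

Lemma op_Qo J (s : int) v : chg s%:~R v -> op L J (Qo v) = Qo (op L J v).
Proof.
move=> sv; elim: J => //= n J ->; rewrite (@L_Qo R p p2 n s)//; exact: op_chg.
Qed.

Lemma op_Qt J (s : int) v : chg s%:~R v -> op L J (Qt v) = Qt (op L J v).
Proof.
move=> sv; elim: J => //= n J ->; rewrite (@L_Qt R p p2 n s)//; exact: op_chg.
Qed.

Lemma iter_Qo_lin k : linear (iter k Qo).
Proof. by elim: k => [|k IHk]; [exact: lin_id|exact: (lin_comp (Qo_lin p) IHk)]. Qed.

Lemma iter_Qo_wh k s w v : wh s w v -> wh (k%:R + s) w (iter k Qo v).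
Proof.
move=> vw; elim: k => [|k IHk] /=; first by rewrite add0r.
by have := @Qo_wh R p _ _ _ IHk; rewrite addrA -(natrD _ 1).
Qed.

Lemma op_iter_Qo k J (s : int) v : chg s%:~R v -> op L J (iter k Qo v) = iter k Qo (op L J v).
Proof.
elim: k s v => //= k IHk s v sv; rewrite -iterS iterSr (IHk (1 + s)); last exact: Qo_chg.
by rewrite (@op_Qo J s)// -iterSr.
Qed.

Lemma Qo_kernel_top n : Qo (vv n n.*2) = 0.
Proof. exact: vv_top. Qed.

Lemma hw_lt_pos2 (a b : nat) : (0 < a)%N -> (a < b)%N -> hw p a%:R < hw p b%:R.
Proof.
move=> a0 ab; have -> : hw p b%:R = hw p a%:R + ((b - a) * (p * (a + b - 1) + 1))%:R.
  rewrite /hw !(natrM, natrD) (natrB _ (ltnW ab)) natrB; last by lia.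
  by rewrite natrD; ring.
by rewrite ltrDl ltr0n muln_gt0 subn_gt0 ab addn1.
Qed.

Lemma Qt_es_pos (b : nat) : Qt (es b.+1%:R) != 0.
Proof.
rewrite /Qt (@exp_mode_es R p (qt p) 0 _ b.*2.+1); last by rewrite -pmulrn natr_dbl1 /qt -natr1; field.
apply/eqP => /= e; have := @alphaP_Ep R p (qt p) b.*2 b.*2.+1 (es (qt p + b.+1%:R)).
rewrite e alpha0 alpha_esP (lin0 (Ep_lin _ _ _)) add0r ltnSn subnn Ep_0 => /esym/eqP.
rewrite scaler_eq0 mulf_eq0 (negPf (@pp0 R p p0)) fmorph_eq0 /qt oppr_eq0 invr_eq0 (negPf pn0) /=.
by rewrite (negPf (@es_neq0 R _)).
Qed.

Hypothesis vv_neq0 : forall n i, (i <= n.*2)%N -> vv n i != 0.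

(** The weight is [hw] at b - c. If b - c > 0, the weight bound forces c = 0, so f is a multiple of
    e^(b alpha), which Qtilde does not kill. Otherwise b - c = -n, uniqueness makes f a multiple of
    some [vv n i], and Q f = 0 forces i = 2n. *)
Lemma singular_classification (b : int) w f : wh b%:~R w f -> singular p f -> Qo f = 0 -> Qt f = 0 ->
  f != 0 -> exists n : nat, [/\ b = n, w = hw p (- n%:R) & exists c : C, f = c *: vv n n.*2].
Proof.
move=> wf sf Qf Qtf f0; have [c wc] := @singular_weight R p p0 _ _ _ wf sf f0.
have wb : hw p b%:~R <= w by rewrite leNgt; apply/negP => /(@wh_lt0 R p _ _ _ wf) e; rewrite e eqxx in f0.
have [bc|bc] := leP (b - c%:Z) 0; last first.
  have [[a ea] eb] : (exists a : nat, b - c%:Z = a.+1) /\ b = (b - c%:Z) + c%:Z by split; [exists (`|b - c%:Z|.-1)%N|]; lia.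
  have wE : w = hw p a.+1%:R by rewrite wc -[c%:R]/(c%:~R) -rmorphB/= ea.
  case: c wc ea eb bc => [|c] wc ea eb bc; last first.
    have : hw p a.+1%:R < hw p b%:~R.
      rewrite eb ea -[(_ + _)%:~R]/((a.+1 + c.+1)%N%:R); apply: hw_lt_pos2 => //.
      by rewrite -addn1 leq_add.
    by rewrite ltNge -wE wb.
  have eb' : b = a.+1 by rewrite eb ea addr0.
  rewrite eb' in wf *; have h1 : wh a.+1%:~R w (es a.+1%:R) by rewrite wE; exact: wh_e.
  have [k fk] := @singular_unique R p p0 _ _ _ _ h1 wf (@es_singular R p p2 _) sf (@es_neq0 R _).
  move: Qtf; rewrite fk (linZ (Qt_lin p)) => /eqP; rewrite scaler_eq0 (negPf (Qt_es_pos a)) orbF => /eqP k0.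
  by move: f0; rewrite fk k0 scale0r eqxx.
pose n := `|b - c%:Z|%N; have en : b - c%:Z = - n%:Z by rewrite /n; lia.
have wE : w = hw p (- n%:R) by rewrite wc -[c%:R]/(c%:~R) -rmorphB/= en rmorphN.
have [b1 b2] : - n%:Z <= b /\ b <= n.
  split; rewrite leNgt; apply/negP => h; move: wb; rewrite wE leNgt => /negP; apply.
    have -> : b = - (`|b|%N : int) by lia.
    by rewrite rmorphN; apply: hw_lt_neg => //; lia.
  have -> : b = (`|b|%N : int) by lia.
  by apply: hw_lt_pos => //; lia.
pose i := absz (b + n%:Z); have ei : b%:~R = i%:R - n%:R :> rat.
  by rewrite -[i%:R]/(i%:~R) -[n%:R]/(n%:~R) -rmorphB/=; congr (_%:~R); rewrite /i; lia.
have i2 : (i <= n.*2)%N by rewrite /i; lia.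
have h1 : wh b%:~R w (vv n i) by rewrite ei wE; exact: vv_wh.
have [k fk] := @singular_unique R p p0 _ _ _ _ h1 wf (@vv_singular R p p2 n i) sf (vv_neq0 i2).
have k0 : k != 0 by apply: contra f0 => /eqP k0; rewrite fk k0 scale0r.
have in2 : i = n.*2.
  apply/eqP; rewrite eqn_leq i2 leqNgt; apply/negP => /vv_neq0; move: Qf.
  by rewrite fk (linZ (Qo_lin p)) => /eqP; rewrite scaler_eq0 (negPf k0) => /eqP /= ->; rewrite eqxx.
exists n; split => //; first by move: in2; rewrite /i; lia.
by exists k; rewrite -in2.
Qed.

Lemma evt_wh X s w v (D : int) : (forall x : C * seq int, x \in X -> wsum x.2 = - D) -> wh s w v ->
  wh s (w - D%:~R) (evt L X v).
Proof.
move=> XD vw; rewrite /evt big_seq; apply: supp_in_sum => x /XD xD; apply: supp_inZ.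
by have := @op_wh (tr x.2) _ _ _ vw; rewrite wsum_tr xD opprK.
Qed.

Section Psi.
Variable Psi : V -> V.
Definition inW (v : V) := supp_in (fun b => b.2 \is a Num.int) v /\ Qt v = 0.
Hypothesis psi_lin : forall (c : C) u v, inW u -> inW v -> Psi (c *: u + v) = c *: Psi u + Psi v.
Hypothesis psi_W : forall v, inW v -> inW (Psi v).
Hypothesis psi_L : forall n v, inW v -> Psi (L n v) = L n (Psi v).
Hypothesis psi_vv : forall n i, (i <= n.*2)%N -> exists2 c : C, c != 0 & Psi (vv n i) = c *: vv n (n.*2 - i).

Lemma inW0 : inW 0.
Proof. by split=> [b|]; [rewrite mcoeff0 eqxx|exact: (lin0 (Qt_lin p))]. Qed.

Lemma inWP (c : C) u v : inW u -> inW v -> inW (c *: u + v).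
Proof.
move=> [iu qu] [iv qv]; split; last by rewrite (lin_elim (Qt_lin p)) qu qv scaler0 addr0.
exact: (supp_inP iu iv).
Qed.

Lemma inW_hom (s : int) w v : wh s%:~R w v -> Qt v = 0 -> inW v.
Proof. by move=> vw qv; split => // b /vw[-> _]; exact: intr_int. Qed.

Lemma inW_wp v x : inW v -> inW (wp p x v).
Proof.
move=> [iv qv]; split; last first.
  pose f (y : rat * rat) := (qt p + y.1, y.2).
  rewrite (@wp_comm R p Qt f (Qt_lin p)) ?qv ?(lin0 (wp_lin _ _))//.
    by move=> [a b] [a' b'] [/addrI -> ->].
  by move=> s w u uw /=; exact: Qt_wh.
have [/hasP[b bv /eqP e]|/hasPn h] := boolP (has (fun b => wkey p b == x) (msupp v)).
  move=> b' /(@wp_wh R p x v)[-> _]; rewrite -e /=; apply: iv.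
  by rewrite mcoeff_neq0.
suff -> : wp p x v = 0 by move=> b; rewrite mcoeff0 eqxx.
rewrite (fockE v) (lin_big (wp_lin _ _)) big_seq big1// => b /h; rewrite (linZ (wp_lin _ _)) /wp kpU.
by move=> /negPf ->; rewrite scaler0.
Qed.

Lemma inW_ind (P : V -> Prop) : P 0 -> (forall (c : C) u v, inW u -> inW v -> P u -> P v -> P (c *: u + v)) ->
  (forall (s : int) w v, wh s%:~R w v -> Qt v = 0 -> P v) -> forall v, inW v -> P v.
Proof.
move=> P0 Pl Ph v Wv; have [r _ [-> _]] := wp_sum p v.
suff [] : P (\sum_(x <- r) wp p x v) /\ inW (\sum_(x <- r) wp p x v) by [].
elim: r => [|x r [IH1 IH2]]; first by rewrite big_nil; split => //; exact: inW0.
have Wx := inW_wp x Wv; rewrite big_cons -[wp p x v]scale1r.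
split; last exact: inWP.
apply: Pl => //; have [/eqP ->//|x0] := boolP (wp p x v == 0).
have := fock_neq0 x0.
move=> [b hb]; have := Wx.1 b hb; have [-> _] := @wp_wh R p x v b hb.
move=> /intrP[s es]; apply: (Ph s x.2); last by case: Wx.
by rewrite -es; exact: wp_wh.
Qed.

Lemma inW_L n v : inW v -> inW (L n v).
Proof.
move: v; apply: inW_ind => [|c u v _ _ hu hv|s w v vw qv].
- by rewrite L_0; exact: inW0.
- by rewrite (lin_elim (L_lin p n)); exact: inWP.
apply: (@inW_hom s (w - n%:~R)); first exact: (@L_wh R p p0 n _ _ _ vw).
by rewrite -(@L_Qt R p p2 n s _ (@wh_chg R p _ _ _ vw)) qv L_0.
Qed.

Lemma inW_Qo v : inW v -> inW (Qo v).
Proof.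
move: v; apply: inW_ind => [|c u v _ _ hu hv|s w v vw qv].
- by rewrite (lin0 (Qo_lin p)); exact: inW0.
- by rewrite (lin_elim (Qo_lin p)); exact: inWP.
apply: (@inW_hom (1 + s) w); first by rewrite rmorphD/=; exact: (@Qo_wh R p _ _ _ vw).
by rewrite -(@Qo_Qt R p p2 s _ (@wh_chg R p _ _ _ vw)) qv (lin0 (Qo_lin p)).
Qed.

Lemma inW_op J v : inW v -> inW (op L J v).
Proof. by move=> Wv; elim: J => //= n J; exact: inW_L. Qed.

Lemma inW_vv n i : inW (vv n i).
Proof.
apply: (@inW_hom (i%:Z - n%:Z) (hw p (- n%:R))); last exact: Qt_vv.
by rewrite rmorphB/=; exact: vv_wh.
Qed.

Lemma inW_sum I (r : seq I) (c : I -> C) (F : I -> V) : (forall i, inW (F i)) -> inW (\sum_(i <- r) c i *: F i).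
Proof. exact: (lin_on_mem inW0 inWP). Qed.

Lemma psi0 : Psi 0 = 0.
Proof. exact: (lin_on0 inW0 psi_lin). Qed.

Lemma psiZ c v : inW v -> Psi (c *: v) = c *: Psi v.
Proof. exact: (lin_onZ inW0 psi_lin). Qed.

Lemma psi_sum I (r : seq I) (c : I -> C) (F : I -> V) : (forall i, inW (F i)) ->
  Psi (\sum_(i <- r) c i *: F i) = \sum_(i <- r) c i *: Psi (F i).
Proof. exact: (lin_on_sum inW0 inWP psi_lin). Qed.

Lemma psi_op J v : inW v -> Psi (op L J v) = op L J (Psi v).
Proof. by move=> Wv; elim: J => //= n J <-; rewrite psi_L//; exact: inW_op. Qed.

(** Powers of Q and one application of Psi carry a relation on one [vv n i] to all of them. These
    are 2n + 1 singular vectors of distinct charges, as many as [words_independent] asks for. *)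
Lemma indep_vv n i (Js : seq (seq int)) (c : seq int -> C) : (i <= n.*2)%N -> uniq Js ->
  (forall J, J \in Js -> [/\ neg J, sorted <=%R J & (count (pred1 (-1 : int)) J < n.*2.+1)%N]) ->
  \sum_(J <- Js) c J *: op L J (vv n i) = 0 -> forall J, J \in Js -> c J = 0.
Proof.
move=> i2 uJ PJ rel.
have up k j : \sum_(J <- Js) c J *: op L J (vv n j) = 0 -> \sum_(J <- Js) c J *: op L J (vv n (k + j)) = 0.
  move=> e; rewrite -[RHS](lin0 (iter_Qo_lin k)) -[in RHS]e (lin_big (iter_Qo_lin k)).
  apply: eq_bigr => J _; rewrite (linZ (iter_Qo_lin k)) -(@op_iter_Qo k J _ _ (@vv_chg R p n j)).
  by rewrite /vv iterD.
have flip j : (j <= n.*2)%N -> \sum_(J <- Js) c J *: op L J (vv n j) = 0 ->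
    \sum_(J <- Js) c J *: op L J (vv n (n.*2 - j)) = 0.
  move=> j2 e; have [d d0 dE] := psi_vv j2.
  have : Psi (\sum_(J <- Js) c J *: op L J (vv n j)) = 0 by rewrite e psi0.
  rewrite psi_sum => [e'|J]; last by apply: inW_op; exact: inW_vv.
  apply/eqP; have : d *: \sum_(J <- Js) c J *: op L J (vv n (n.*2 - j)) == 0.
    apply/eqP; rewrite -[RHS]e' scaler_sumr; apply: eq_bigr => J _.
    rewrite psi_op; last exact: inW_vv.
    by rewrite dE (linZ (op_lin (L_lin p) J)); exact: scaleAC.
  by rewrite scaler_eq0 (negPf d0).
have rel0 : \sum_(J <- Js) c J *: op L J (vv n 0) = 0.
  have := flip _ (leqnn n.*2); rewrite subnn; apply.
  by rewrite -(subnK i2); exact: up.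
have rk (k : nat) : (k < n.*2.+1)%N -> \sum_(J <- Js) c J *: op L J (vv n k) = 0.
  by move=> _; rewrite -[k]addn0; exact: up.
have lead (k : 'I_n.*2.+1) : exists d : nat, hw p (- n%:R) = d%:R + hw p (k%:R - n%:R) /\
    (vv n k)@_(zs d, k%:R - n%:R) != 0.
  have kn : (k <= n.*2)%N by rewrite -ltnS.
  exact: (@singular_lead R p p0 _ _ _ (@vv_wh R p n k) (@vv_singular R p p2 n k) (vv_neq0 kn)).
have [d dP] := boolp.choice lead.
apply: (@words_independent R p p0 n.*2.+1 (fun k => k%:R - n%:R) d (fun k => vv n k) Js c _ _ _ uJ PJ).
- by move=> k k' /addIr /eqP; rewrite eqr_nat => /eqP /val_inj.
- by move=> k; have [e _] := dP k; rewrite -e; exact: vv_wh.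
- by move=> k; have [_ e] := dP k.
by move=> k; apply: rk.
Qed.

Lemma wsum_size J : neg J -> (size J)%:Z + wsum J <= 0.
Proof.
elim: J => [|a J IHJ] /=; first by rewrite /wsum big_nil.
by move=> /andP[a0 /IHJ]; rewrite wsum_cons; lia.
Qed.

Lemma small_words (N : nat) J : negw N J -> (count (pred1 (-1 : int)) J < N)%N \/ J = nseq N (-1).
Proof.
move=> [nJ wJ]; have [cJ|cJ] := ltnP (count (pred1 (-1 : int)) J) N; [by left|right].
have sJ : (size J <= N)%N by have := wsum_size nJ; lia.
have e : size J = N by apply/eqP; rewrite eqn_leq sJ (leq_trans cJ)// count_size.
have : all (pred1 (-1 : int)) J by rewrite all_count eqn_leq count_size e.
by move=> /all_pred1P; rewrite e.
Qed.

(** Replace L(-1)^(2n+1) e^(-n alpha) by y in the list of standard words. All entries lie in the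
    kernel of Qtilde, which is proper at this level, so they are dependent; by [indep_vv] the
    coefficient of y is not 0. *)
Lemma small_span n y : wh (- n%:R) (n.*2.+1%:R + hw p (- n%:R)) y -> Qt y = 0 ->
  exists c : seq int -> C,
    y = \sum_(J <- stdw n.*2.+1 | J != nseq n.*2.+1 (-1)) c J *: op L J (vv n 0).
Proof.
move=> yw qy; pose N0 := n.*2.+1; pose o1 : seq int := nseq N0 (-1).
pose u J := if J == o1 then y else op L J (vv n 0).
pose x := alpha (Negz n.*2) (es (- n%:R)).
have [b hb] : exists b, (Qt x)@_b != 0.
  by apply: fock_neq0; exact: Qt_alpha.
have uw J : J \in stdw N0 -> wh (- n%:R) (N0%:R + hw p (- n%:R)) (u J).
  move=> /stdwP[nJ _]; rewrite /u; case: eqP => // _; rewrite addrC.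
  exact: (@negw_wh _ _ _ _ _ nJ (@wh_e R p _)).
have chil (c : C) v v' : (Qt (c *: v + v'))@_b = c * (Qt v)@_b + (Qt v')@_b.
  by rewrite (lin_elim (Qt_lin p)) mcoeffD mcoeffZ.
have chiu J : J \in stdw N0 -> (Qt (u J))@_b = 0.
  move=> JN; rewrite /u; case: eqP => _; first by rewrite qy mcoeff0.
  rewrite -(@op_Qt J _ _ (@vv_chg R p n 0)) (@Qt_vv R p p2) (lin0 (op_lin (L_lin p) _)).
  by rewrite mcoeff0.
have xw : wh (- n%:R) (N0%:R + hw p (- n%:R)) x.
  have := @alpha_wh R p (Negz n.*2) _ _ _ (@wh_e R p (- n%:R)); rewrite -/x.
  by rewrite NegzE rmorphN opprK addrC.
have [c [[J0 J0N c0] rel]] := @kernel_dependent R p (- n%:R) N0 u (fun y => (Qt y)@_b) x uw chil chiu xw hb.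
have e1 : c o1 *: y + \sum_(J <- stdw N0 | J != o1) c J *: op L J (vv n 0) = 0.
  rewrite -[RHS]rel [RHS](bigID (pred1 o1)) /=; congr (_ + _); last first.
    by apply: eq_bigr => J /negPf Jo; rewrite /u Jo.
  have o1N : o1 \in stdw N0.
    apply/stdwP; split; first split.
    - by rewrite /neg all_nseq orbT.
    - by rewrite /wsum /o1; elim: (N0) => [|k IHk] /=; rewrite ?big_nil// big_cons IHk; lia.
    by rewrite /o1; elim: (N0) => // -[|k] //= ->; rewrite lexx.
  rewrite big_mkcond (bigD1_seq o1) ?undup_uniq//= /u !eqxx big1 ?addr0// => J /negPf Jo.
  by rewrite Jo.
have c1 : c o1 != 0.
  apply: contraTneq c0 => c1; rewrite negbK; have [->|Jo] := eqVneq J0 o1; first exact/eqP.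
  have PJ J : J \in [seq J <- stdw N0 | J != o1] ->
      [/\ neg J, sorted <=%R J & (count (pred1 (-1 : int)) J < n.*2.+1)%N].
    rewrite mem_filter => /andP[Jo1 /stdwP[nJ sJ]]; split=> //; first by case: nJ.
    by case: (small_words nJ) => // e; rewrite e eqxx in Jo1.
  have uF : uniq [seq J <- stdw N0 | J != o1] by rewrite filter_uniq ?undup_uniq.
  have e2 : \sum_(J <- [seq J <- stdw N0 | J != o1]) c J *: op L J (vv n 0) = 0.
    by rewrite big_filter -[RHS]e1 c1 scale0r add0r.
  by apply/eqP; apply: (indep_vv (leq0n _) uF PJ e2); rewrite mem_filter Jo.
exists (fun J => - (c o1)^-1 * c J).
transitivity (- (c o1)^-1 *: \sum_(J <- stdw N0 | J != o1) c J *: op L J (vv n 0)); last first.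
  by rewrite scaler_sumr; apply: eq_bigr => J _; rewrite scalerA.
move/eqP: e1; rewrite addrC addr_eq0 => /eqP ->.
by rewrite scalerN scaleNr opprK scalerA mulVf// scale1r.
Qed.

(** [small_span] applied to y = L(-1)^(2n+1) e^(-n alpha). Powers of Q, which commute with the
    Virasoro algebra, transport the relation to every [vv n i]. *)
Lemma singular_relation n : exists s' : seq (C * seq int),
  (forall x, x \in s' -> std n.*2.+1 n.*2.+1 x.2) /\
  forall i, (i <= n.*2)%N -> ev L (srel n.*2.+1 s') (vv n i) = 0.
Proof.
pose N0 := n.*2.+1; pose o1 : seq int := nseq N0 (-1).
have no1 : negw N0 o1.
  split; first by rewrite /neg all_nseq orbT.
  by rewrite /wsum /o1; elim: (N0) => [|k IHk] /=; rewrite ?big_nil// big_cons IHk; lia.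
have w1 : wh (- n%:R) (N0%:R + hw p (- n%:R)) (op L o1 (vv n 0)).
  by rewrite addrC; exact: (@negw_wh _ _ _ _ _ no1 (@wh_e R p _)).
have q1 : Qt (op L o1 (vv n 0)) = 0.
  by rewrite -(@op_Qt _ _ _ (@vv_chg R p n 0)) (@Qt_vv R p p2) (lin0 (op_lin (L_lin p) _)).
have [c e] := small_span w1 q1.
exists [seq (- c J, J) | J <- stdw N0 & J != o1]; split.
  move=> x /mapP[J]; rewrite mem_filter => /andP[Jo /stdwP[nJ sJ]] ->; split => //.
  by case: (small_words nJ) => // e1; rewrite e1 eqxx in Jo.
have r0 : ev L (srel N0 [seq (- c J, J) | J <- stdw N0 & J != o1]) (vv n 0) = 0.
  rewrite /ev big_cons big_map big_filter /= scale1r [X in X + _]e -big_split /= big1// => J _.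
  by rewrite scaleNr subrr.
move=> i i2; rewrite -[RHS](lin0 (iter_Qo_lin i)) -[in RHS]r0 /ev (lin_big (iter_Qo_lin i)).
apply: eq_bigr => x _; rewrite (linZ (iter_Qo_lin i)) -(@op_iter_Qo i _ _ _ (@vv_chg R p n 0)).
by [].
Qed.

Lemma top_wh (n : nat) : wh n%:~R (hw p (- n%:R)) (vv n n.*2).
Proof.
by have := @vv_wh R p n n.*2; rewrite -addnn natrD addrK.
Qed.

Lemma top_chg_int (n : nat) : chg n%:~R (vv n n.*2). Proof. exact: (@wh_chg R p _ _ _ (@top_wh n)). Qed.

Lemma L0_vv n i : L 0 (vv n i) = ratr (hw p (- n%:R)) *: vv n i.
Proof. exact: (L0_wh p0 (@vv_wh R p n i)). Qed.

Lemma Mod_Qo n D u : Mod L (vv n n.*2) D u -> Qo u = 0.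
Proof.
move=> [X [_ ->]]; rewrite /ev (lin_big (Qo_lin p)) big1// => x _; rewrite (linZ (Qo_lin p)).
by rewrite -(@op_Qo x.2 n _ (@top_chg_int n)) Qo_kernel_top (lin0 (op_lin (L_lin p) _)) scaler0.
Qed.

Lemma Mod_Qt n i D u : Mod L (vv n i) D u -> Qt u = 0.
Proof.
move=> [X [_ ->]]; rewrite /ev (lin_big (Qt_lin p)) big1// => x _; rewrite (linZ (Qt_lin p)).
by rewrite -(@op_Qt x.2 _ _ (@vv_chg R p n i)) (@Qt_vv R p p2 n i) (lin0 (op_lin (@L_lin R p) x.2)) scaler0.
Qed.

(** A singular vector of positive level would have charge n, and by the classification also the
    weight of the generator. *)
Lemma irr_vv n D u : Mod L (vv n n.*2) D.+1 u -> (forall k : nat, L k.+1 u = 0) -> u = 0.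
Proof.
move=> Mu su; apply/eqP/contraT => u0.
have uw : wh n%:~R (hw p (- n%:R) + D.+1%:R) u by exact: (@Mod_wh _ _ _ _ _ (@top_wh n) Mu).
have [n' [[nn'] /eqP + _]] := singular_classification uw su (Mod_Qo Mu) (Mod_Qt Mu) u0.
by rewrite -nn' -subr_eq0 addrAC subrr add0r pnatr_eq0.
Qed.

Section Kill.
Variables (n : nat) (s' : seq (C * seq int)).
Hypothesis s'P : forall x, x \in s' -> std n.*2.+1 n.*2.+1 x.2.
Hypothesis srel0 : forall i, (i <= n.*2)%N -> ev L (srel n.*2.+1 s') (vv n i) = 0.
Local Notation N0 := n.*2.+1.

(** The left side is kap times [vv n (2n)]. Psi, followed by projection to charge -n, carries w into
    the span of words on e^(-n alpha), where the transposed relation acts as 0; but there it must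
    also give a non-zero multiple of kap e^(-n alpha). *)
Lemma relation_kills w : wh n%:~R (N0%:R + hw p (- n%:R)) w -> Qt w = 0 ->
  (forall k, (k <= n.*2)%N -> Mod L (vv n n.*2) (n.*2 - k) (L k.+1 w)) ->
  evt L (srel N0 s') w = 0.
Proof.
move=> ww qw wM; have Ww : inW w by exact: (inW_hom ww qw).
have sP x : x \in srel N0 s' -> negw N0 x.2 by exact: srelP s'P x.
have [z LLz] := LL_scalar n%:~R.
have [z' LLz'] := LL_scalar ((0%:Z - n%:Z)%:~R).
have M0 : Mod L (vv n n.*2) 0 (evt L (srel N0 s') w).
  apply: (@Mod_sum _ _ L (vv n n.*2) 0 (srel N0 s') (fun J => op L (tr J) w)) => -[c J] /sP [/= nJ wJ].
  case: J nJ wJ => [_|[//|k] J /= nJ]; first by rewrite /wsum big_nil.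
  rewrite wsum_cons NegzE tr_cons => wJ; have := neg_wsum nJ => J0.
  have kn : (k <= n.*2)%N by lia.
  apply: (Mod_op (L_lin p) (fun n => @L_chg R p p0 n _) LLz (@top_chg_int n) (L0_vv n n.*2)
    (@vv_singular R p p2 n n.*2) (wM k kn)).
  by rewrite wsum_tr; lia.
have [kap kapE] := Mod_00 M0.
have [k0|kap0] := eqVneq kap 0; first by rewrite kapE k0 scale0r.
have [c0 c00 c0E] := psi_vv (leqnn n.*2); rewrite subnn in c0E.
pose hv := hw p (- n%:R).
pose w' := wp p (- n%:R, N0%:R + hv) (Psi w).
have e1 : evt L (srel N0 s') w' = (kap * c0) *: vv n 0.
  pose f (x : rat * rat) := (x.1, x.2 - N0%:R).
  have := @wp_comm R p (evt L (srel N0 s')) f (evt_lin (L_lin p) _) _ _ (- n%:R, N0%:R + hv) (Psi w).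
  rewrite -/w' => ->; first last.
  - by move=> s x v vw /=; apply: (@evt_wh _ _ _ _ N0) vw => y /sP[].
  - by move=> [a b] [a' b'] [-> /addIr ->].
  rewrite /f /= addrAC subrr add0r.
  have -> : evt L (srel N0 s') (Psi w) = Psi (evt L (srel N0 s') w).
    rewrite /evt (psi_sum _ _ (F := fun x : C * seq int => op L (tr x.2) w)) => [|x]; last exact: inW_op.
    by apply: eq_bigr => x _; congr (_ *: _); exact: (esym (psi_op _ Ww)).
  rewrite kapE psiZ; last exact: inW_vv.
  have ew : wp p (- n%:R, hv) (vv n 0) = vv n 0 := wp_id (@wh_e R p (- n%:R)).
  rewrite c0E scalerA; apply: eq_trans (linZ (@wp_lin R p (- n%:R, hv)) _ _) _.
  exact: congr1 ew.
have [||c e2] := @small_span n w'; first exact: (@wp_wh R p (- n%:R, N0%:R + hv)).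
  by case: (inW_wp (- n%:R, N0%:R + hv) (psi_W Ww)).
have : evt L (srel N0 s') w' = 0.
  rewrite e2 (lin_big (evt_lin (L_lin p) _)) big_seq_cond big1// => J /andP[/stdwP[nJ _] _].
  rewrite (linZ (evt_lin (L_lin p) _)).
  have Mw : Mod L (vv n 0) N0 (op L J (vv n 0)) by exact: Mod_word.
  have kill := @evt_kill _ _ L _ z' (L_lin p) (fun n => @L_chg R p p0 n _) LLz' _ _ (@vv_chg R p n 0) (L0_vv n 0)
    (@vv_singular R p p2 n 0).
  by rewrite (kill N0 _ _ sP (@srel0 0%N isT) Mw) scaler0.
move/eqP; rewrite e1 scaler_eq0 mulf_eq0 (negPf kap0) (negPf c00) /= => /eqP e3.
by have h := @vv_neq0 n 0 isT; case/eqP: h; exact: e3.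
Qed.
End Kill.

(** By induction on the level all L(k+1) w lie in the module of [vv n (2n)]. A vector u of that
    module with the same images exists by [correct_by_relation], and w - u is a singular vector
    whose weight the classification excludes. *)
Lemma kernel_structure N (b : int) w : wh b%:~R (N%:R + hw p b%:~R) w -> Qo w = 0 -> Qt w = 0 ->
  w != 0 -> exists n D : nat, [/\ b = n, N%:R + hw p b%:~R = hw p (- n%:R) + D%:R & Mod L (vv n n.*2) D w].
Proof.
elim: {N}_.+1 {-2}N (ltnSn N) b w => // B IHB N NB b w ww qw qtw w0.
have [sw|] := pselect (singular p w).
  have [n [-> -> [c ->]]] := singular_classification ww sw qw qtw w0.
  have h : Mod L (vv n n.*2) 0 (op L [::] (vv n n.*2)).
    by apply: Mod_word; split; rewrite // /wsum big_nil.
  exists n, 0%N; split; [by []|by rewrite addr0|exact: (ModZ c h)].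
have cw : chg b%:~R w := @wh_chg R p _ _ _ ww.
have Lw (k : nat) : wh b%:~R (N%:R + hw p b%:~R - k.+1%:R) (L k.+1 w).
  exact: (@L_wh R p p0 k.+1 _ _ _ ww).
have QLw k : Qo (L k w) = 0 by rewrite -(@L_Qo R p p2 k b w cw) qw L_0.
have QtLw k : Qt (L k w) = 0 by rewrite -(@L_Qt R p p2 k b w cw) qtw L_0.
have step (k : nat) : L k.+1 w != 0 -> exists n D : nat, [/\ b = n,
    N%:R + hw p b%:~R = hw p (- n%:R) + (D + k.+1)%:R & Mod L (vv n n.*2) D (L k.+1 w)].
  move=> k0; have kN : (k < N)%N.
    rewrite ltnNge; apply/negP => Nk; move: k0; rewrite (@wh_lt0 R p _ _ _ (Lw k)) ?eqxx//.
    by rewrite addrAC gtrDr subr_lt0 ltr_nat.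
  have e : N%:R + hw p b%:~R - k.+1%:R = (N - k.+1)%N%:R + hw p b%:~R by rewrite natrB// addrAC.
  have lt : (N - k.+1 < B)%N by lia.
  have wk : wh b%:~R ((N - k.+1)%N%:R + hw p b%:~R) (L k.+1 w) by rewrite -e; exact: Lw.
  have [n [D [bn wE M]]] := IHB _ lt b _ wk (QLw _) (QtLw _) k0.
  exists n, D; split; [exact: bn| |exact: M].
  by rewrite natrD [RHS]addrA -wE -e subrK.
move=> nsw; have [k0 k0P] : exists k : nat, L k.+1 w != 0.
  apply: contrapT => h; apply: nsw => k; apply/eqP/contraT => hk; case: h; by exists k.
have [n [D0 [bn wE _]]] := step k0 k0P.
pose D := (D0 + k0)%N; have DE : N%:R + hw p b%:~R = hw p (- n%:R) + D.+1%:R by rewrite wE addnS.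
have same (n' : nat) (D' k : nat) : b = n' -> N%:R + hw p b%:~R = hw p (- n'%:R) + (D' + k.+1)%:R ->
    n' = n /\ D = (D' + k)%N.
  rewrite bn => -[<-]; rewrite -bn DE => /addrI /eqP; rewrite eqr_nat addnS eqSS => /eqP ->.
  by [].
have [s' [s'P srel0]] := singular_relation n.
have [z LLz] := LL_scalar n%:~R.
rewrite bn in ww cw.
have wM k : (k <= D)%N -> Mod L (vv n n.*2) (D - k) (L k.+1 w).
  move=> kD; have [->|k1] := eqVneq (L k.+1 w) 0; first exact: Mod0.
  have [n' [D' [e1 e2]]] := step k k1; have [-> ->] := same _ _ _ e1 e2.
  by rewrite addnK.
have wM0 k : (D < k)%N -> L k.+1 w = 0.
  move=> kD; apply/eqP/contraT => k1; have [n' [D' [e1 e2 _]]] := step k k1.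
  by have [_] := same _ _ _ e1 e2; move: kD; lia.
have sw : D.+1 = n.*2.+1 -> evt L (srel n.*2.+1 s') w = 0.
  move=> [DN]; apply: relation_kills => //; first by rewrite addrC -DN -DE bn.
  by move=> k; have := wM k; rewrite DN; apply.
have idp (D' : nat) (Js : seq (seq int)) (c : seq int -> C) : uniq Js ->
    (forall J, J \in Js -> std n.*2.+1 D' J) -> \sum_(J <- Js) c J *: op L J (vv n n.*2) = 0 ->
    forall J, J \in Js -> c J = 0.
  move=> uJ PJ; apply: indep_vv => // J /PJ[[nJ _] sJ cJ]; by split.
have [u Mu su] := correct_by_relation (L_lin p) (fun n => @L_chg R p p0 n _) LLz (@top_chg_int n)
  (L0_vv n n.*2) (@vv_singular R p p2 n n.*2) (@irr_vv n) s'P (srel0 _ (leqnn _)) idp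
  (vv_neq0 (leqnn n.*2)) cw wM wM0 sw.
exists n, D.+1; split => //; suff -> : w = u by [].
apply/eqP; rewrite -subr_eq0; apply/contraT => wu.
have wuw : wh n%:~R (N%:R + hw p b%:~R) (w - u).
  by apply: supp_inB => //; [rewrite bn|rewrite DE; exact: (@Mod_wh _ _ _ _ _ (@top_wh n) Mu)].
have [||n' [[nn'] + _]] := singular_classification wuw su _ _ wu.
- by rewrite (linB (Qo_lin p)) qw (Mod_Qo Mu) subr0.
- by rewrite (linB (Qt_lin p)) qtw (Mod_Qt Mu) subr0.
by rewrite DE -nn' => /eqP; rewrite -subr_eq0 addrAC subrr add0r pnatr_eq0.
Qed.

Inductive gen : V -> Prop :=
| gen0 : gen 0
| gen_cons (c : C) J n i u : neg J -> (i <= n.*2)%N -> gen u -> gen (c *: op L J (vv n i) + u).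

Lemma gen_add u v : gen u -> gen v -> gen (u + v).
Proof.
elim=> [|c J n i {}u nJ i2 _ IHu] gv; first by rewrite add0r.
by rewrite -addrA; apply: gen_cons => //; exact: IHu.
Qed.

Lemma gen_scale (c : C) u : gen u -> gen (c *: u).
Proof.
elim=> [|d J n i {}u nJ i2 _ IHu]; first by rewrite scaler0; exact: gen0.
by rewrite scalerDr scalerA; exact: gen_cons.
Qed.

Lemma gen_Mod n i D u : (i <= n.*2)%N -> Mod L (vv n i) D u -> gen u.
Proof.
move=> i2 [X [PX ->]]; rewrite /ev; elim: X PX => [|x X IHX] PX; first by rewrite big_nil; exact: gen0.
rewrite big_cons; apply: gen_cons => //; first by have [] := PX x (mem_head _ _).
by apply: IHX => y yX; apply: PX; rewrite inE yX orbT.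
Qed.

(** Q keeps the weight, while the lowest weight grows quadratically with the charge. *)
Lemma Qo_nilpotent (s : int) w v : wh s%:~R w v -> exists k, iter k Qo v = 0.
Proof.
move=> vw; pose m := (`|s| + (Num.bound `|w|) + 2)%N; pose k := absz (m%:Z - s).
exists k; apply: (@wh_lt0 R p _ _ _ (@iter_Qo_wh k _ _ _ vw)).
have -> : k%:R + s%:~R = m%:R :> rat.
  by rewrite -[k%:R]/(k%:~R) -rmorphD/= -[m%:R]/(m%:~R); congr (_%:~R); rewrite /k /m; lia.
have h1 : w < m%:R.
  apply: (le_lt_trans (ler_norm w)); apply: (lt_le_trans (archi_boundP (normr_ge0 w))).
  by rewrite ler_nat /m -addnA addnCA leq_addr.
apply: (lt_le_trans h1); have -> : hw p m%:R = (m * (p * m.-1 + 1))%:R.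
  by rewrite /hw natrM natrD natrM -subn1 natrB; [ring|rewrite /m; lia].
by rewrite ler_nat leq_pmulr// addn1.
Qed.

(** Induction on the exponent k with Q^k v = 0. If Q^(k+1) v = 0, then Q^k v is described by words
    on [vv n (2n)]; the same words on [vv n (2n-k)] give a generated vector u with Q^k u = Q^k v,
    and the induction applies to v - u. *)
Lemma triplet_generated v : inW v -> gen v.
Proof.
move: v; apply: inW_ind => [|c u v _ _ gu gv|s w v vw qv]; first exact: gen0.
  by apply: gen_add => //; exact: gen_scale.
have [k] := Qo_nilpotent vw; elim: k v vw qv => [|k IHk] v vw qv; first by move=> /= ->; exact: gen0.
move=> kv; have [k0|k0] := eqVneq (iter k Qo v) 0; first exact: IHk k0.
pose b : int := k%:Z + s; pose y := iter k Qo v.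
have yw : wh b%:~R w y by rewrite /b rmorphD/=; exact: iter_Qo_wh.
have qy : Qt y = 0.
  have : inW y by rewrite /y; elim: (k) => [|j IHj]; [exact: (inW_hom vw qv)|exact: inW_Qo].
  by case.
have [N wN] : exists N : nat, w = N%:R + hw p b%:~R.
  by have [B hB] := fock_neq0 k0; have [_ <-] := yw B hB; exists (lev B.1).
rewrite wN in yw; have [n [D [bn wE My]]] := kernel_structure yw kv qy k0.
have cv : chg s%:~R v := @wh_chg R p _ _ _ vw.
(* For k > 2n the charge of v is below -n, where the lowest weight exceeds that of [vv n (2n)]. All
   pairings of Q^k v then vanish, so Q^k v = 0. *)
have [kn|nk] := leqP k n.*2; last first.
  have [z LLz] := LL_scalar n%:~R; case/eqP: k0.
  apply: (nondegenerate (L_lin p) (fun n => @L_chg R p p0 n _) LLz (@top_chg_int n)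
    (L0_vv n n.*2) (@vv_singular R p p2 n n.*2) (@irr_vv n) My) => J [nJ wJ].
  rewrite (@op_iter_Qo k _ s v cv).
  have := @op_wh (tr J) _ _ _ vw; rewrite wsum_tr wJ opprK wN wE -[D%:~R]/(D%:R) addrK => /(@wh_lt0 R p).
  have -> : s = - (k - n)%N%:Z by move: bn; rewrite /b; lia.
  by rewrite rmorphN => ->; [exact: (lin0 (iter_Qo_lin k))|apply: hw_lt_neg => //; lia].
have [X [PX yX]] := My; pose u := ev L X (vv n (n.*2 - k)).
have Mu : Mod L (vv n (n.*2 - k)) D u by exact: (ex_intro _ X (conj PX erefl)).
have uy : iter k Qo u = y.
  rewrite yX /u /ev (lin_big (iter_Qo_lin k)); apply: eq_bigr => x _; rewrite (linZ (iter_Qo_lin k)).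
  rewrite -(@op_iter_Qo k _ _ _ (@vv_chg R p n (n.*2 - k))); congr (_ *: op L _ _).
  by rewrite /vv -iterD subnKC.
have uw : wh s%:~R w u.
  have -> : s%:~R = (n.*2 - k)%N%:R - n%:R :> rat.
    have -> : s = n%:Z - k%:Z by move: bn; rewrite /b; lia.
    by rewrite rmorphB/= -!pmulrn natrB// -addnn natrD; ring.
  by rewrite wN wE; exact: (@Mod_wh _ _ _ _ _ (@vv_wh R p n _) Mu).
rewrite -(subrK u v); apply: gen_add; last by apply: (gen_Mod _ Mu); lia.
apply: IHk; first exact: supp_inB.
  by rewrite (linB (Qt_lin p)) qv (Mod_Qt Mu) subr0.
by rewrite (linB (iter_Qo_lin k)) uy subrr.
Qed.

End Psi.
End Classification.

(** * Spans and exponential sums *)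

Section Span.
Context {K : pzRingType} {V : lmodType K}.

Inductive lspan (G : V -> Prop) : V -> Prop :=
| lspan0 : lspan G 0
| lspan_cons (c : K) g u : G g -> lspan G u -> lspan G (c *: g + u).

Lemma lspan_gen G g : G g -> lspan G g.
Proof. by move=> Gg; rewrite -[g]addr0 -[g]scale1r; apply: lspan_cons => //; exact: lspan0. Qed.

Lemma lspan_add G u v : lspan G u -> lspan G v -> lspan G (u + v).
Proof.
by elim=> [|c g {}u Gg _ IHu] Gv; rewrite ?add0r// -addrA; apply: lspan_cons => //; exact: IHu.
Qed.

Lemma lspan_scale G (c : K) u : lspan G u -> lspan G (c *: u).
Proof.
elim=> [|d g {}u Gg _ IHu]; first by rewrite scaler0; exact: lspan0.
by rewrite scalerDr scalerA; exact: lspan_cons.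
Qed.

Lemma lspan_lin G (c : K) u v : lspan G u -> lspan G v -> lspan G (c *: u + v).
Proof. by move=> Gu Gv; apply: lspan_add => //; exact: lspan_scale. Qed.

Lemma lspan_sub G u v : lspan G u -> lspan G v -> lspan G (u - v).
Proof. by move=> Gu Gv; rewrite addrC -scaleN1r; exact: lspan_lin. Qed.

Lemma lspan_closed G (P : V -> Prop) : P 0 -> (forall (c : K) u v, P u -> P v -> P (c *: u + v)) ->
  (forall g, G g -> P g) -> forall v, lspan G v -> P v.
Proof. by move=> P0 Pl PG v; elim=> // c g u /PG Pg _ Pu; exact: Pl. Qed.

Lemma lspan_trans G G' v : (forall g, G g -> lspan G' g) -> lspan G v -> lspan G' v.
Proof. by move=> GG'; apply: lspan_closed => //; [exact: lspan0|move=> c u w; exact: lspan_lin]. Qed.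

End Span.

Lemma lspan_map (K : pzRingType) (V V' : lmodType K) (G : V -> Prop) (G' : V' -> Prop) (S : V -> Prop)
    (f : V -> V') v : S 0 -> (forall (c : K) u v, S u -> S v -> S (c *: u + v)) ->
  (forall (c : K) u v, S u -> S v -> f (c *: u + v) = c *: f u + f v) ->
  (forall g, G g -> S g /\ lspan G' (f g)) -> lspan G v -> S v /\ lspan G' (f v).
Proof.
move=> S0 Sl fl Gf; elim=> [|c g u Gg _ [Su fu]].
  by split => //; rewrite (lin_on0 S0 fl); exact: lspan0.
have [Sg fg] := Gf _ Gg; split; first exact: Sl.
by rewrite fl//; exact: lspan_lin.
Qed.

Section Separation.
Context {K : numFieldType} {Y : lmodType K}.
Implicit Types f : nat -> Y.

(** The difference operator that annihilates k^N; on k^N times a polynomial in N it lowers the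
    degree of the polynomial. *)
Definition Dl (k : K) f : nat -> Y := fun N => f N.+1 - k *: f N.

Lemma Dl_comm k k' f : Dl k (Dl k' f) = Dl k' (Dl k f).
Proof. by apply/funext => N; rewrite /Dl; lmod. Qed.

Lemma Dl_iterC k k' n f : iter n (Dl k) (Dl k' f) = Dl k' (iter n (Dl k) f).
Proof. by elim: n => //= n ->; rewrite Dl_comm. Qed.

Lemma Dl_iter_iter k k' n m f : iter n (Dl k) (iter m (Dl k') f) = iter m (Dl k') (iter n (Dl k) f).
Proof. by elim: m => //= m IHm; rewrite Dl_iterC IHm. Qed.

Lemma Dl_sum k I (r : seq I) (F : I -> nat -> Y) :
  Dl k (fun N => \sum_(i <- r) F i N) = fun N => \sum_(i <- r) Dl k (F i) N.
Proof. by apply/funext => N; rewrite /Dl scaler_sumr sumrB. Qed.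

Lemma Dl_iter_sum k n I (r : seq I) (F : I -> nat -> Y) :
  iter n (Dl k) (fun N => \sum_(i <- r) F i N) = fun N => \sum_(i <- r) iter n (Dl k) (F i) N.
Proof. by elim: n => //= n ->; rewrite Dl_sum. Qed.

Lemma Dl_iter0 k n : iter n (Dl k) (fun=> 0) = fun=> 0.
Proof. by elim: n => //= n ->; apply/funext => N; rewrite /Dl scaler0 subr0. Qed.

Lemma Dl_pow k k' c (y : Y) : Dl k (fun N => (c * k' ^+ N) *: y) = fun N => (c * (k' - k) * k' ^+ N) *: y.
Proof. by apply/funext => N; rewrite /Dl exprS; lmod. Qed.

Lemma Dl_iter_pow k k' n c (y : Y) :
  iter n (Dl k) (fun N => (c * k' ^+ N) *: y) = fun N => (c * (k' - k) ^+ n * k' ^+ N) *: y.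
Proof.
elim: n => [|n IHn] /=; first by rewrite expr0 mulr1.
by rewrite IHn Dl_pow exprSr mulrA.
Qed.

Lemma Dl_ffact k (B q : nat) c (y : Y) :
  Dl k (fun N => (c * k ^+ N.+1 * ((N.+1 + B) ^_ q.+1)%:R) *: y) =
  fun N => (c * k * q.+1%:R * k ^+ N.+1 * ((N.+1 + B) ^_ q)%:R) *: y.
Proof.
apply/funext => N; have e : ((N.+2 + B) ^_ q.+1 = (N.+1 + B) ^_ q.+1 + q.+1 * (N.+1 + B) ^_ q)%N.
  rewrite addSn ffactSS ffactnSr; set x := (N.+1 + B)%N.
  have [qx|xq] := leqP q x; last by rewrite ffact_small// !muln0.
  by rewrite -[x in x.+1](subnK qx); set z := (x - q)%N; set f := x ^_ q; lia.
rewrite /Dl e natrD natrM !exprS; set a := k ^+ N; set f := (_ ^_ q.+1)%:R; set g := (_ ^_ q)%:R.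
by set h := q.+1%:R; lmod.
Qed.

Lemma Dl_iter_ffact k (B q : nat) c (y : Y) :
  iter q (Dl k) (fun N => (c * k ^+ N.+1 * ((N.+1 + B) ^_ q)%:R) *: y) =
  fun N => (c * k ^+ q * q`!%:R * k ^+ N.+1) *: y.
Proof.
elim: q c => [|q IHq] c; first by apply/funext => N /=; rewrite ffactn0 !mulr1.
rewrite iterSr Dl_ffact IHq; apply/funext => N; rewrite factS natrM !exprS; congr (_ *: _).
by set a := k ^+ N; set f := q`!%:R; set g := q.+1%:R; set b := k ^+ q; ring.
Qed.

Lemma Dl_kill_ffact k (B q n : nat) c (y : Y) : (q < n)%N ->
  iter n (Dl k) (fun N => (c * k ^+ N.+1 * ((N.+1 + B) ^_ q)%:R) *: y) = fun=> 0.
Proof.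
move=> qn; rewrite (_ : n = (n - q.+1) + q.+1)%N; last by rewrite subnK.
rewrite iterD iterS Dl_iter_ffact.
rewrite (_ : (fun N => _) = fun N => (c * k ^+ q * q`!%:R * k * k ^+ N) *: y); last first.
  by apply/funext => N; rewrite exprS mulrA.
rewrite Dl_pow subrr (_ : (fun N => _) = fun=> 0) ?Dl_iter0//.
by apply/funext => N; rewrite mulr0 mul0r scale0r.
Qed.

Lemma Dl_mem (S : Y -> Prop) k n f : (forall (c : K) u v, S u -> S v -> S (c *: u + v)) ->
  (forall N, S (f N)) -> forall N, S (iter n (Dl k) f N).
Proof.
move=> Sl Sf; elim: n => // n IHn N /=; rewrite /Dl addrC -scaleNr; exact: Sl.
Qed.

(* The coefficient of z^c in exp (k z). *)
Definition pw (k : K) (c : int) : K := if c is Posz n then k ^+ n / n`!%:R else 0.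

(* The coefficients of a sum of terms z^(-d) e^(k z) Y determine the Y belonging
   to the top exponent: difference operators annihilate the other terms. *)
Lemma exponential_separation (S : Y -> Prop) (ks : seq K) (e : K -> nat) (D : nat) (F : K -> nat -> Y) :
  S 0 -> (forall (c : K) u v, S u -> S v -> S (c *: u + v)) -> uniq ks ->
  (forall N : nat, S (\sum_(k <- ks) \sum_(d < D) pw k (N.+1 + (e k + d))%N *: F k d)) ->
  forall k, k \in ks -> k != 0 -> (0 < D)%N -> S (F k 0%N).
Proof.
move=> S0 Sl uks Sx k0 k0s k00 D0.
pose B := (\sum_(k <- ks) e k + D)%N.
have eB k : k \in ks -> (e k + D <= B)%N.
  by move=> kk; rewrite /B leq_add2r (big_rem k)//= leq_addr.
(* Multiplying by (N + 1 + B)! turns the coefficients of exp (k z) into k^N times falling factorials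
   of degree B - (e k + d). The smallest d has the highest degree. *)
pose T k d : nat -> Y := fun N => (k ^+ (e k + d) * k ^+ N.+1 * ((N.+1 + B) ^_ (B - (e k + d)))%:R) *: F k d.
pose f : nat -> Y := fun N => \sum_(k <- ks) \sum_(d < D) T k d N.
have Sf N : S (f N).
  have -> : f N = ((N.+1 + B)`!%:R) *: \sum_(k <- ks) \sum_(d < D) pw k (N.+1 + (e k + d))%N *: F k d + 0.
    rewrite addr0 scaler_sumr /f !big_seq; apply: eq_bigr => k kk; rewrite scaler_sumr.
    apply: eq_bigr => d _; rewrite /T /pw scalerA; congr (_ *: _).
    have dB : (e k + d <= B)%N by have := eB k kk; have := ltn_ord d; lia.
    have := ffact_fact (n := (N.+1 + B)%N) (m := (B - (e k + d))%N) _.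
    rewrite (_ : (N.+1 + B - (B - (e k + d)))%N = (N.+1 + (e k + d))%N); last by lia.
    move=> <-; last by lia.
    have f0 : (N.+1 + (e k + d))`!%:R != 0 :> K by rewrite pnatr_eq0 -lt0n fact_gt0.
    rewrite natrM [k ^+ (N.+1 + _)]exprD; set x := (_`!)%:R in f0 *; set y := (_ ^_ _)%:R.
    set a := k ^+ N.+1; set b := k ^+ _; rewrite -[RHS]mulrA [x * _]mulrC divfK//; ring.
  exact: Sl.
(* B + 1 differences with exponent k remove all terms belonging to k, and only rescale the part of
   k0 that matters by a power of k0 - k. *)
have step (l : seq K) : k0 \notin l -> uniq l -> {subset l <= ks} -> exists a : K, a != 0 /\
    exists g : nat -> Y, (forall N, S (g N)) /\ exists h : K -> nat -> nat -> Y,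
    [/\ g = (fun N => \sum_(k <- ks | k \notin l) \sum_(d < D) h k d N),
        (forall k d n, iter n (Dl k) (T k d) = (fun=> 0) -> iter n (Dl k) (h k d) = fun=> 0) &
        forall d, iter (B - (e k0 + d)) (Dl k0) (h k0 d) = fun N => a *: iter (B - (e k0 + d)) (Dl k0) (T k0 d) N].
  elim: l => [|k l IHl].
    move=> _ _ _; exists 1; split; first exact: oner_neq0.
    exists f; split => //; exists T; split => // d; apply/funext => N; by rewrite scale1r.
  rewrite inE negb_or => /andP[k0k k0l] /= /andP[kl ul] sl.
  have [|a [a0 [g [Sg [h [gE hk h0]]]]]] := IHl k0l ul; first by move=> x xl; apply: sl; rewrite inE xl orbT.
  have kks : k \in ks by apply: sl; rewrite mem_head.
  exists (a * (k0 - k) ^+ B.+1); split; first by rewrite mulf_neq0// expf_neq0// subr_eq0.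
  exists (iter B.+1 (Dl k) g); split; first exact: Dl_mem.
  exists (fun k' d => iter B.+1 (Dl k) (h k' d)); split.
  - have -> : g = fun N => \sum_(k <- [seq k <- ks | k \notin l]) \sum_(d < D) h k d N.
      by rewrite gE; apply/funext => N; rewrite big_filter.
    rewrite Dl_iter_sum; apply/funext => N.
    have e1 k' : iter B.+1 (Dl k) (fun N => \sum_(d < D) h k' d N) = fun N => \sum_(d < D) iter B.+1 (Dl k) (h k' d) N.
      exact: (Dl_iter_sum k B.+1 (index_enum 'I_D) (fun d : 'I_D => h k' d)).
    rewrite big_filter (bigID (pred1 k)) /= [X in X + _](_ : _ = 0) ?add0r.
      by apply: eq_big => [k'|k' _]; [rewrite inE negb_or andbC|exact: (congr1 (fun g => g N) (e1 k'))].
    rewrite big1// => k' /andP[_ /eqP ->]; apply: eq_trans (congr1 (fun g => g N) (e1 k)) _.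
    rewrite big1// => d _; rewrite (hk k d B.+1)// /T; apply: (@Dl_kill_ffact k B (B - (e k + d)) B.+1 (k ^+ (e k + d))).
    by rewrite ltnS leq_subr.
  - by move=> k' d n hn; rewrite Dl_iter_iter hk// Dl_iter0.
  - move=> d; rewrite Dl_iter_iter h0 (_ : iter (B - (e k0 + d)) _ (T k0 d) =
      fun N => (k0 ^+ (e k0 + d) * k0 ^+ (B - (e k0 + d)) * (B - (e k0 + d))`!%:R * k0 * k0 ^+ N) *: F k0 d); last first.
      by rewrite /T Dl_iter_ffact; apply/funext => N; rewrite exprS mulrA.
    rewrite (_ : (fun N => a *: _) = fun N => (a * (k0 ^+ (e k0 + d) * k0 ^+ (B - (e k0 + d)) *
      (B - (e k0 + d))`!%:R * k0) * k0 ^+ N) *: F k0 d); last by apply/funext => N; rewrite scalerA mulrA.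
    by rewrite Dl_iter_pow; apply/funext => N; rewrite scalerA; congr (_ *: _); ring.
pose l := rem k0 ks.
have [||x|a [a0 [g [Sg [h [gE hk h0]]]]]] := step l.
- by rewrite mem_rem_uniqF.
- exact: rem_uniq.
- exact: mem_rem.
have gE' : g = fun N => \sum_(d < D) h k0 d N.
  rewrite gE; apply/funext => N; rewrite (big_rem k0) //= mem_rem_uniqF//=.
  rewrite -[RHS]addr0; congr (_ + _); rewrite big_seq_cond big1// => k /andP[kl].
  by rewrite kl.
(* This number of differences kills the terms with d > 0, which have lower degree, and leaves a
   non-zero multiple of the term d = 0. *)
have := @Dl_mem S k0 (B - e k0) g Sl Sg 0%N.
rewrite gE' (Dl_iter_sum k0 (B - e k0) (index_enum 'I_D) (fun d : 'I_D => h k0 d)).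
rewrite (bigD1 (Ordinal D0)) //= [X in _ + X]big1 ?addr0 => [|d d0]; last first.
  have dp : (0 < d)%N by rewrite lt0n.
  have dB := eB _ k0s; have dD := ltn_ord d.
  have -> : (B - e k0 = (d.-1 + (B - (e k0 + d))).+1)%N by lia.
  rewrite (hk k0 d)// /T; apply: (@Dl_kill_ffact k0 B (B - (e k0 + d)) _ (k0 ^+ (e k0 + d))).
  by rewrite ltnS leq_addl.
have := h0 0%N; rewrite addn0 => ->; rewrite /T addn0 Dl_iter_ffact scalerA => Sy.
set c := (X in S (X *: _)) in Sy.
have c0 : c != 0.
  by rewrite /c !mulf_neq0 ?expf_neq0// pnatr_eq0 -lt0n fact_gt0.
have := Sl c^-1 _ _ Sy S0; rewrite addr0 scalerA mulVf// scale1r.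
by [].
Qed.

End Separation.

(** * Modes of the triplet algebra *)

Section TripletModes.
Context {R : realType} (p : nat).
Local Notation C := R[i].
Local Notation V := (fock R).
Local Notation alpha := (@al R p).
Local Notation es := (@es R).
Local Notation wh := (@wh R p).
Local Notation L := (@L R p).
Local Notation em := (@em R p).
Local Notation mode := (@md R p).
Local Notation vv := (@vv R p).
Local Notation Qo := (@Qo R p).
Local Notation Qt := (@Qt R p).
Local Notation inW := (@inW R p).
Hypothesis p2 : (2 <= p)%N.
Let p0 : (0 < p)%N. Proof. exact: ltnW. Qed.

Lemma em0_mode r (l s q sg tau : int) u n v : 2 * p%:R * r * l%:~R = (q + q)%:~R :> rat ->
  2 * p%:R * r * s%:~R = sg%:~R :> rat -> 2 * p%:R * l%:~R * s%:~R = tau%:~R :> rat ->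
  chg l%:~R u -> chg s%:~R v -> em r 0 (mode u n v) = mode (em r 0 u) n v + mode u n (em r 0 v).
Proof.
move=> hq hs ht ul vs.
have := @exp_commutator R p p0 r l%:~R s%:~R q sg tau hq hs ht u 0 n v ul vs.
rewrite (@nsum1 _ _ 0%N) => [|[//|i] _]; last first.
  by rewrite [gb _ _](_ : _ = 0) ?scale0r// /gb big_ord_recl subrr mul0r mul0r.
rewrite gb0 scale1r add0r subr0 => e.
by apply/eqP; rewrite -subr_eq; apply/eqP; exact: e.
Qed.

Lemma Qo_mode_hom (l s : int) u n v : chg l%:~R u -> chg s%:~R v ->
  Qo (mode u n v) = mode (Qo u) n v + mode u n (Qo v).
Proof.
move=> ul vs; apply: (@em0_mode 1 l s (p%:Z * l) (2 * p%:Z * s) (2 * p%:Z * l * s)) ul vs.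
- by rewrite rmorphD !rmorphM/=; ring.
- by rewrite !rmorphM/=; ring.
by rewrite !rmorphM/=; ring.
Qed.

Lemma Qt_mode_hom (l s : int) u n v : chg l%:~R u -> chg s%:~R v ->
  Qt (mode u n v) = mode (Qt u) n v + mode u n (Qt v).
Proof.
have pn0 : p%:R != 0 :> rat by rewrite pnatr_eq0 -lt0n.
move=> ul vs; apply: (@em0_mode (qt p) l s (- l) (- 2 * s) (2 * p%:Z * l * s)) ul vs.
- by rewrite rmorphD !rmorphN/= /qt; field.
- by rewrite !rmorphM/= /qt; field.
by rewrite !rmorphM/=; ring.
Qed.

Lemma mode0 n v : mode 0 n v = 0.
Proof. exact: (lin0 (@mode_lin R p n v)). Qed.

Lemma mode_linr u n : linear (mode u n).
Proof. exact: (@mode_field R p u).1. Qed.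

Lemma mode0r u n : mode u n 0 = 0.
Proof. exact: (lin0 (mode_linr u n)). Qed.

Lemma inW_mode u n v : inW u -> inW v -> inW (mode u n v).
Proof.
move=> Wu Wv; move: u Wu; apply: (@inW_ind R p p2 (fun u => inW (mode u n v))) => [|c u u' _ _ hu hu'|l x u ux qu].
- by rewrite mode0; exact: inW0.
- by rewrite (lin_elim (@mode_lin R p n v)); exact: inWP.
move: v Wv; apply: (@inW_ind R p p2 (fun v => inW (mode u n v))) => [|c v v' _ _ hv hv'|s y v vy qv].
- by rewrite mode0r; exact: inW0.
- by rewrite (lin_elim (mode_linr u n)); exact: inWP.
apply: (@inW_hom _ _ (l + s) (y + x - n%:~R - 1)).
  by rewrite rmorphD/=; exact: (mode_wh ux).
by rewrite (@Qt_mode_hom l s _ _ _ (@wh_chg R p _ _ _ ux) (@wh_chg R p _ _ _ vy)) qu qv mode0 mode0r addr0.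
Qed.

Lemma Qo_mode u n v : inW u -> inW v -> Qo (mode u n v) = mode (Qo u) n v + mode u n (Qo v).
Proof.
move=> Wu Wv; move: u Wu; apply: (@inW_ind R p p2 (fun u => Qo (mode u n v) = mode (Qo u) n v + mode u n (Qo v))) => [|c u u' _ _ hu hu'|l x u ux qu].
- by rewrite mode0 (lin0 (Qo_lin p)) !mode0 addr0.
- rewrite (lin_elim (@mode_lin R p n v)) !(lin_elim (Qo_lin p)) hu hu' !(lin_elim (@mode_lin R p n _)).
  by lmod.
move: v Wv; apply: (@inW_ind R p p2 (fun v => Qo (mode u n v) = mode (Qo u) n v + mode u n (Qo v))) => [|c v v' _ _ hv hv'|s y v vy qv].
- by rewrite mode0r !(lin0 (Qo_lin p)) !mode0r addr0.
- rewrite (lin_elim (mode_linr u n)) !(lin_elim (Qo_lin p)) hv hv' !(lin_elim (mode_linr _ n)).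
  by lmod.
exact: (@Qo_mode_hom l s _ _ _ (@wh_chg R p _ _ _ ux) (@wh_chg R p _ _ _ vy)).
Qed.

Lemma L_es_mode r n j v : inW v -> L n (mode (es r%:~R) j v) = mode (es r%:~R) j (L n v) +
  (ratr (hw p r%:~R - 1) * (n + 1)%:~R - j%:~R : C) *: mode (es r%:~R) (j + n) v.
Proof.
move: v; rewrite mode_es; apply: (@inW_ind R p p2 (fun v => L n (em r%:~R j v) = em r%:~R j (L n v) +
  (ratr (hw p r%:~R - 1) * (n + 1)%:~R - j%:~R) *: em r%:~R (j + n) v)) => [|c u v _ _ hu hv|s w v vw _].
- by rewrite !(lin0 (exp_mode_lin p _ _)) L_0 (lin0 (exp_mode_lin p _ _)) scaler0 addr0.
- rewrite !(lin_elim (exp_mode_lin p _ _)) !(lin_elim (L_lin p n)) hu hv !(lin_elim (exp_mode_lin p _ _)).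
  set a := (_ * _ - _); by lmod.
have h : 2 * p%:R * r%:~R * s%:~R = (2 * p%:Z * r * s)%:~R :> rat by rewrite !rmorphM.
exact: (@L_em R p p0 _ _ _ _ _ _ h (@wh_chg R p _ _ _ vw)).
Qed.

Lemma L1_es s : L (-1) (es s) = ratr s *: alpha (-1) (es s).
Proof.
rewrite (@L_expN_fock R p p0 0) big_ord0 scaler0 add0r mulr0 scale0r addr0.
rewrite (@nsum1 _ _ 0%N) => [|[//|i] _]; last by rewrite alpha_esP alpha0.
rewrite alpha_es alphaZ scalerA; congr (_ *: _).
by rewrite mulrA mulVf ?mul1r// (@pp0 R p p0).
Qed.

(** The creation property and its first derivative, by induction on the creation operators in u. The
    third part exhibits L(-1) u as a product u_(-2) of u with the vacuum. *)
Lemma mode_creation u : [/\ forall n : nat, mode u n (es 0) = 0, mode u (-1) (es 0) = u &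
  mode u (-2) (es 0) = L (-1) u].
Proof.
move: u; apply: (@fock_al_ind R p) => [|c u v [hu1 hu2 hu3] [hv1 hv2 hv3]|s|a u [h1 h2 h3]].
- by split=> [n||]; rewrite ?mode0 ?L_0.
- split=> [n||]; rewrite (lin_elim (@mode_lin R p _ _)).
  + by rewrite hu1 hv1 scaler0 addr0.
  + by rewrite hu2 hv2.
  by rewrite hu3 hv3 (lin_elim (L_lin p _)).
- have e (n : int) : - n%:~R - 1 - 2 * p%:R * s * 0 = (- n - 1)%:~R :> rat.
    by rewrite rmorphB rmorphN/=; ring.
  split=> [n||]; rewrite mode_es (@exp_mode_es R p _ _ _ _ (e _)) addr0.
  + by rewrite (_ : - n%:Z - 1 = Negz n)//; lia.
  + by rewrite /= Ep_0.
  by rewrite /= (@Ep1_es R p p0) L1_es.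
have key n : mode (alpha (Negz a) u) n (es 0) =
    nsum (fun i => 'C(a + i, i)%:R *: alpha (Negz (a + i)) (mode u (n + i%:Z) (es 0))).
  rewrite mode_al /no /fadd /fscale /nop /non [X in _ + _ *: X]nsum0 ?scaler0 ?addr0// => i.
  by rewrite alpha_vac mode0r scaler0.
split=> [n||]; rewrite key.
- by rewrite nsum0// => i; rewrite -PoszD h1 alpha0 scaler0.
- rewrite (@nsum1 _ _ 0%N) => [|[//|i] _]; last first.
    by rewrite (_ : -1 + i.+1%:Z = i) ?h1 ?alpha0 ?scaler0//; lia.
  by rewrite addn0 bin0 scale1r addr0 h2.
rewrite (@nsumE _ _ 2) => [|[//|[//|i]] _]; last first.
  by rewrite (_ : -2 + i.+2%:Z = i) ?h1 ?alpha0 ?scaler0//; lia.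
rewrite !big_ord_recl big_ord0 /= addr0 addn0 bin0 scale1r addr0 h3 /bump /= addn1 bin1.
rewrite (_ : -2 + 1%:Z = -1)// h2; have := @alpha_L R p p0 (Negz a) (-1) u.
rewrite (_ : Negz a + -1 = Negz a.+1) ?scale0r ?addr0; last by lia.
move=> ->; rewrite -addrA -scalerDl [X in _ + X *: _](_ : _ = 0) ?scale0r ?addr0//.
by rewrite NegzE rmorphN/= -pmulrn addNr.
Qed.

End TripletModes.

Lemma lspan_image (K : pzRingType) (V V' : lmodType K) (G : V -> Prop) (G' : V' -> Prop) (f : V -> V') v :
  linear f -> (forall g, G g -> lspan G' (f g)) -> lspan G v -> lspan G' (f v).
Proof.
move=> lf Gf; apply: (@lspan_closed K V G (fun v => lspan G' (f v))) => //.
  by rewrite (lin0 lf); exact: lspan0.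
by move=> c u w; rewrite (lin_elim lf); exact: lspan_lin.
Qed.

(** Two steps of length 2m and one of length 4m contradict each other in sign, giving 2 x_i in the
    span whenever i + 4m <= n. The bound 6m <= n lets every other index be reached from such an i by
    a single step. *)
Lemma three_relations (K : numFieldType) (V : lmodType K) (G : V -> Prop) (x : nat -> V) (n m : nat) :
  (6 * m <= n)%N -> (forall i, (i + m.*2 <= n)%N -> lspan G (x i + x (i + m.*2)%N)) ->
  (forall i, (i + m.*2.*2 <= n)%N -> lspan G (x i + x (i + m.*2.*2)%N)) ->
  forall i, (i <= n)%N -> lspan G (x i).
Proof.
move=> mn H1 H2.
have low i : (i + m.*2.*2 <= n)%N -> lspan G (x i).
  move=> i4; have e : (i + m.*2 + m.*2 = i + m.*2.*2)%N by lia.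
  have a1 : lspan G (x i + x (i + m.*2)%N) by apply: H1; lia.
  have a2 : lspan G (x (i + m.*2)%N + x (i + m.*2.*2)%N) by rewrite -e; apply: H1; rewrite e.
  have a3 := H2 i i4; have two0 : 2 != 0 :> K by rewrite pnatr_eq0.
  have -> : x i = 2^-1 *: ((x i + x (i + m.*2)%N) - (x (i + m.*2)%N + x (i + m.*2.*2)%N) +
    (x i + x (i + m.*2.*2)%N)) by lmod_with msame; field.
  by apply: lspan_scale; apply: lspan_add => //; exact: lspan_sub.
move=> i ni; have [/low //|h] := leqP (i + m.*2.*2) n.
have shift k : (k <= i)%N -> (i - k + m.*2.*2 <= n)%N -> lspan G (x (i - k)%N + x i) -> lspan G (x i).
  by move=> ki /low h1 h2; rewrite -[x i](addKr (x (i - k)%N)) addrC; exact: lspan_sub.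
have [h2|h2] := leqP (i + m.*2) n.
  apply: (shift m.*2); [lia|lia|].
  by have := H1 (i - m.*2)%N; rewrite subnK; [apply; lia|lia].
apply: (shift m.*2.*2); [lia|lia|].
by have := H2 (i - m.*2.*2)%N; rewrite subnK; [apply; lia|lia].
Qed.

Section SpanSteps.
Context {K : numFieldType} {V : lmodType K} (G : V -> Prop).
Variables (a b u w x y : V) (c c' k s t : K).

Lemma lspan_cancel : k != 0 -> lspan G (- c *: (- k *: y) + - k *: x) -> lspan G (x - c *: y).
Proof. by move=> k0 h; have := lspan_scale (- k^-1) h; congr lspan; lmod_with msame; field. Qed.

Lemma lspan_unscale : k != 0 -> lspan G (k *: y) -> lspan G y.
Proof. by move=> k0 h; have := lspan_scale k^-1 h; rewrite scalerA mulVf// scale1r. Qed.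

Lemma lspan_diff : c' != c -> lspan G (x - c *: y) -> lspan G (x - c' *: y) -> lspan G y.
Proof.
rewrite -subr_eq0 => cc h h'; have := lspan_scale (c' - c)^-1 (lspan_sub h h'); congr lspan.
by lmod_with msame; field.
Qed.

Lemma lspan_change : lspan G y -> lspan G (x - c' *: y) -> lspan G (x - c *: y).
Proof. by move=> h h'; have := lspan_lin (c' - c) h h'; congr lspan; lmod. Qed.

Lemma lspan_reflect : s * t = 1 -> lspan G (- c *: (t *: b) + w) -> lspan G (u - c *: a) ->
  lspan G (u + s *: w - c *: (a + b)).
Proof.
move=> st h h'; have := lspan_lin s h h'; congr lspan.
have -> : c *: (a + b) = c *: a + (s * t * c) *: b by rewrite st mul1r scalerDr.
by lmod.
Qed.

End SpanSteps.

(** * The sl_2 action, and the reduction of W to finitely many families of powers of L(-2) *)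

Section TripletAutomorphism.
Context {R : realType} (p : nat).
Local Notation C := R[i].
Local Notation V := (fock R).
Local Notation es := (@es R).
Local Notation wh := (@wh R p).
Local Notation L := (@L R p).
Local Notation mode := (@md R p).
Local Notation vv := (@vv R p).
Local Notation Qo := (@Qo R p).
Local Notation inW := (@inW R p).
Hypothesis p2 : (2 <= p)%N.
Let p0 : (0 < p)%N. Proof. exact: ltnW. Qed.
Variable Psi : V -> V.
Hypothesis psi_lin : forall (c : C) u v, inW u -> inW v -> Psi (c *: u + v) = c *: Psi u + Psi v.
Hypothesis psi_W : forall v, inW v -> inW (Psi v).
Hypothesis psi_L : forall n v, inW v -> Psi (L n v) = L n (Psi v).
Hypothesis psi_mode : forall u n v, inW u -> inW v -> Psi (mode u n v) = mode (Psi u) n (Psi v).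
Hypothesis psiK : forall v, inW v -> Psi (Psi v) = v.
Hypothesis psi_vv : forall n i, (i <= n.*2)%N ->
  Psi (vv n i) = ((-1) ^+ i * i`!%:R / (n.*2 - i)`!%:R) *: vv n (n.*2 - i).

Lemma factC_neq0 n : n`!%:R != 0 :> C.
Proof. by rewrite pnatr_eq0 -lt0n fact_gt0. Qed.

Lemma psi_vv_ex n i : (i <= n.*2)%N -> exists2 c : C, c != 0 & Psi (vv n i) = c *: vv n (n.*2 - i).
Proof.
move=> i2; exists ((-1) ^+ i * i`!%:R / (n.*2 - i)`!%:R); last exact: psi_vv.
by rewrite !mulf_neq0 ?invr_eq0 ?factC_neq0// signr_eq0.
Qed.

Lemma inW_vvW n i : inW (vv n i). Proof. exact: (@inW_vv R p p2 n i). Qed.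

Lemma Psi0 : Psi 0 = 0.
Proof. exact: (psi0 psi_lin). Qed.

Lemma PsiZ c v : inW v -> Psi (c *: v) = c *: Psi v.
Proof. exact: (psiZ psi_lin). Qed.

Lemma PsiD u v : inW u -> inW v -> Psi (u + v) = Psi u + Psi v.
Proof. by move=> Wu Wv; have := psi_lin 1 Wu Wv; rewrite !scale1r. Qed.

Lemma inWZ c v : inW v -> inW (c *: v).
Proof. by move=> Wv; have := inWP c Wv (inW0 p); rewrite addr0. Qed.

Lemma inWD u v : inW u -> inW v -> inW (u + v).
Proof. by move=> Wu Wv; have := inWP 1 Wu Wv; rewrite scale1r. Qed.

(** If some Q^i e^(-n alpha) were 0, so would be the top vector; but Psi maps that to a non-zero
    multiple of e^(-n alpha). *)
Lemma vv_neq0 n i : (i <= n.*2)%N -> vv n i != 0.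
Proof.
move=> i2; apply/eqP => e; have [c c0 ec] := psi_vv_ex (leqnn n.*2).
have top0 : vv n n.*2 = 0.
  by rewrite -(subnK i2) /vv iterD -/(vv n i) e; exact: (lin0 (iter_Qo_lin p _)).
have : Psi (vv n n.*2) = 0 by rewrite top0; exact: Psi0.
rewrite ec subnn => /eqP; rewrite scaler_eq0 (negPf c0) /=.
by move/eqP => e0; case/eqP: (@es_neq0 R (- n%:R)); exact: e0.
Qed.

Lemma W_gen v : inW v -> gen p v.
Proof. exact: (triplet_generated p2 vv_neq0 psi_lin psi_W psi_L psi_vv_ex). Qed.

Lemma W_op J v : inW v -> inW (op L J v).
Proof. by move=> Wv; exact: (@inW_op R p p2 J v Wv). Qed.

Lemma Psi_op J v : inW v -> Psi (op L J v) = op L J (Psi v).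
Proof. exact: (psi_op p2 psi_L). Qed.

(* With this normalization Q, Psi Q Psi and Psi act on the ee n i as e, f and a
   Weyl element act on the binary forms of degree 2n. *)
Definition ee n i : V := (n.*2 - i)`!%:R *: vv n i.

Lemma inW_ee n i : inW (ee n i).
Proof. exact: (inWZ _ (inW_vvW n i)). Qed.

Lemma psi_ee n i : (i <= n.*2)%N -> Psi (ee n i) = (-1) ^+ i *: ee n (n.*2 - i).
Proof.
move=> i2; rewrite /ee (PsiZ _ (inW_vvW n i)) (psi_vv i2) !scalerA subKn//; congr (_ *: _).
by rewrite mulrC divfK ?factC_neq0.
Qed.

Lemma Qo_ee n i : (i <= n.*2)%N -> Qo (ee n i) = (n.*2 - i)%:R *: ee n i.+1.
Proof.
move=> i2; rewrite /ee (linZ (Qo_lin p)) scalerA -[Qo _]/(vv n i.+1).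
move: i2; rewrite leq_eqVlt => /orP[/eqP ->|i2]; first by rewrite (@vv_top R p n) !scaler0.
by rewrite -[(n.*2 - i)%N](@subnSK _ _ i2) factS natrM.
Qed.

Definition Qm v := Psi (Qo (Psi v)).

Lemma inW_QoW v : inW v -> inW (Qo v). Proof. exact: (@inW_Qo R p p2 v). Qed.

Lemma Qm_lin (c : C) u v : inW u -> inW v -> Qm (c *: u + v) = c *: Qm u + Qm v.
Proof.
move=> Wu Wv; rewrite /Qm psi_lin// (lin_elim (Qo_lin p)).
by apply: psi_lin; apply: inW_QoW; exact: psi_W.
Qed.

Lemma QmZ c v : inW v -> Qm (c *: v) = c *: Qm v.
Proof. exact: (lin_onZ (inW0 p) Qm_lin). Qed.

Lemma Qm_ee n i : (i <= n.*2)%N -> Qm (ee n i) = - i%:R *: ee n i.-1.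
Proof.
move=> i2; rewrite /Qm (psi_ee i2) (linZ (Qo_lin p)) Qo_ee ?leq_subr// subKn// scalerA.
rewrite (PsiZ _ (inW_ee _ _)); case: i i2 => [|i] i2; first by rewrite mulr0 oppr0 !scale0r.
rewrite psi_ee; last by lia.
rewrite scalerA (_ : (n.*2 - (n.*2 - i.+1).+1)%N = i); last by lia.
congr (_ *: _); rewrite (_ : (n.*2 - i.+1).+1 = n.*2 - i)%N; last by lia.
rewrite mulrAC -exprD (_ : (i.+1 + (n.*2 - i) = n.*2.+1)%N); last by lia.
by rewrite exprS -mul2n exprM sqrrN expr1n expr1n mulr1 mulN1r.
Qed.

Lemma Qo_L n v : inW v -> Qo (L n v) = L n (Qo v).
Proof.
move: v; apply: (@inW_ind R p p2 (fun v => Qo (L n v) = L n (Qo v))) => [|c u v _ _ hu hv|s w v vw _].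
- by rewrite L_0 (lin0 (Qo_lin p)) L_0.
- by rewrite (lin_elim (L_lin p n)) !(lin_elim (Qo_lin p)) (lin_elim (L_lin p n)) hu hv.
by rewrite (@L_Qo R p p2 n s _ (@wh_chg R p _ _ _ vw)).
Qed.

Lemma W_L n v : inW v -> inW (L n v). Proof. exact: (@inW_L R p p2 n v). Qed.

Lemma Qo_op J v : inW v -> Qo (op L J v) = op L J (Qo v).
Proof. by move=> Wv; elim: J => //= n J <-; rewrite Qo_L//; exact: W_op. Qed.

Lemma Qm_op J v : inW v -> Qm (op L J v) = op L J (Qm v).
Proof.
by move=> Wv; rewrite /Qm Psi_op// Qo_op ?Psi_op//; [apply: inW_QoW|]; exact: psi_W.
Qed.

Lemma Qm_mode u n v : inW u -> inW v -> Qm (mode u n v) = mode (Qm u) n v + mode u n (Qm v).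
Proof.
move=> Wu Wv; have Pu := psi_W Wu; have Pv := psi_W Wv.
have Qu := inW_QoW Pu; have Qv := inW_QoW Pv.
rewrite /Qm psi_mode// (@Qo_mode R p p2)// PsiD; try exact: (@inW_mode R p p2).
by rewrite !psi_mode// !psiK.
Qed.

Lemma vv_ee n i : vv n i = (n.*2 - i)`!%:R^-1 *: ee n i.
Proof. by rewrite scalerA mulVf ?scale1r// factC_neq0. Qed.

Lemma L_comm_neg a b v : inW v -> a + b != 0 ->
  L a (L b v) = L b (L a v) + (a%:~R - b%:~R : C) *: L (a + b) v.
Proof.
move=> Wv ab; move: v Wv; apply: (@inW_ind R p p2 (fun v =>
  L a (L b v) = L b (L a v) + (a%:~R - b%:~R : C) *: L (a + b) v)) => [|c u v _ _ hu hv|s w v vw _].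
- by rewrite !L_0 scaler0 addr0.
- rewrite !(lin_elim (L_lin p _)) hu hv; set d := (_ - _); by lmod.
have [z] := @L_comm R p p0 s%:~R a b; rewrite (negPf ab) => -> //.
  by rewrite scale0r addr0.
exact: (@wh_chg R p _ _ _ vw).
Qed.

Definition Uv (k : nat) : V := es (- k%:R) + Psi (es (- k%:R)).

Lemma inW_es k : inW (es (- k%:R)). Proof. exact: (inW_vvW k 0). Qed.

Lemma inW_Uv k : inW (Uv k).
Proof. by apply: inWD; [|apply: psi_W]; exact: inW_es. Qed.

Lemma psi_Uv k : Psi (Uv k) = Uv k.
Proof.
have a := inW_es k; apply: eq_trans (PsiD a (psi_W a)) _.
by rewrite (psiK a); exact: addrC.
Qed.

Lemma UvE k : Uv k = (k.*2)`!%:R^-1 *: (ee k 0 + ee k k.*2).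
Proof.
have e : Psi (es (- k%:R)) = (k.*2)`!%:R^-1 *: vv k k.*2.
  have := psi_vv (leq0n k.*2); rewrite subn0 expr0 mul1r fact0 mul1r => e0.
  exact: e0.
have f0 := factC_neq0 k.*2; rewrite /Uv e /ee subn0 subnn fact0 scale1r -[es _]/(vv k 0).
set a := vv k 0; set b := vv k _; set f := _`!%:R in f0 *; by lmod_with msame; field.
Qed.

Lemma mode_Uv k j w : inW w -> mode (Uv k) j w =
  mode (es (- k%:R)) j w + Psi (mode (es (- k%:R)) j (Psi w)).
Proof.
move=> Ww; rewrite /Uv (linD (@mode_lin R p j w)); congr (_ + _).
by rewrite psi_mode; [rewrite psiK|exact: inW_es|exact: psi_W].
Qed.

Lemma L_Uv k n j w : inW w -> L n (mode (Uv k) j w) = mode (Uv k) j (L n w) +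
  (ratr (hw p (- k%:R) - 1) * (n + 1)%:~R - j%:~R : C) *: mode (Uv k) (j + n) w.
Proof.
move=> Ww; have Wm x y : inW y -> inW (mode (es (- k%:R)) x y).
  by move=> Wy; apply: (@inW_mode R p p2) => //; exact: inW_es.
have e : - k%:R = (- k%:Z)%:~R :> rat by rewrite rmorphN.
have LE y : inW y -> L n (mode (es (- k%:R)) j y) = mode (es (- k%:R)) j (L n y) +
    (ratr (hw p (- k%:R) - 1) * (n + 1)%:~R - j%:~R : C) *: mode (es (- k%:R)) (j + n) y.
  by rewrite e; exact: (@L_es_mode R p p2).
have Pw := psi_W Ww; have LPw := W_L n Pw.
rewrite (mode_Uv k j Ww) (mode_Uv k j (W_L n Ww)) (mode_Uv k (j + n) Ww).
rewrite (linD (L_lin p n)) (LE w Ww) -(psi_L n (Wm j _ Pw)) (LE _ Pw) (psi_L n Ww).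
rewrite (PsiD (Wm j _ LPw) (inWZ _ (Wm (j + n) _ Pw))) (PsiZ _ (Wm (j + n) _ Pw)).
by set c := (_ * _ - _); set a := mode _ _ _; set b := mode _ _ _; set d := Psi _; set f := Psi _; lmod.
Qed.

Variable m : nat.
Hypothesis m0 : (0 < m)%N.

(* Once projected to the orbifold, these vectors lie in the span of the a_(-2) b. *)
Variant Rgen : V -> Prop :=
| Rgen_L n w of inW w & n < 0 & n != -2 : Rgen (L n w)
| Rgen_U k j w of inW w & (k == m) || (k == m.*2) & j <= -2 : Rgen (mode (Uv k) j w).

Local Notation Rel := (lspan Rgen).

Lemma lspan_W (G : V -> Prop) v : (forall g, G g -> inW g) -> lspan G v -> inW v.
Proof. by move=> GW; apply: lspan_closed => //; [exact: inW0|move=> c x y; exact: inWP]. Qed.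

Lemma Rgen_W g : Rgen g -> inW g.
Proof.
case=> [n w Ww _ _|k j w Ww _ _]; first exact: W_L.
by apply: (@inW_mode R p p2) => //; exact: inW_Uv.
Qed.

(** Only n = -2 is not covered by the definition. Commuting L(-2) with a generator yields again L(k)
    with k < 0 and k <> -2, or a mode of U_M of index at most -2. *)
Lemma Rel_L n u : n < 0 -> Rel u -> Rel (L n u).
Proof.
move=> n0; apply: (lspan_image (L_lin p n)) => g Gg; have Wg := Rgen_W Gg.
have [n2|n2] := eqVneq n (-2); last by apply: lspan_gen; exact: Rgen_L.
rewrite {n0}n2; case: Gg {Wg} => [k w Ww k0 k2|k j w Ww km j2].
  rewrite L_comm_neg//; last by lia.
  apply: lspan_add; last apply: lspan_scale; apply: lspan_gen; apply: Rgen_L => //; try lia.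
  exact: W_L.
rewrite L_Uv//.
apply: lspan_add; last apply: lspan_scale; apply: lspan_gen; apply: Rgen_U => //; try lia.
exact: W_L.
Qed.

Variant lowgen (N : nat) : V -> Prop :=
| Lowgen J n i of neg J & (n < N)%N & (i <= n.*2)%N : lowgen N (op L J (vv n i)).

Variant fingen (N : nat) : V -> Prop :=
| Fingen_rel x of Rgen x : fingen N x
| Fingen_pow b n i of (n < N)%N & (i <= n.*2)%N : fingen N (iter b (L (-2)) (vv n i)).

Lemma Rel_fin N v : Rel v -> lspan (fingen N) v.
Proof. by apply: lspan_trans => g Gg; apply: lspan_gen; exact: Fingen_rel. Qed.

Lemma W_iter b v : inW v -> inW (iter b (L (-2)) v).
Proof. by move=> Wv; elim: b => //= b; exact: W_L. Qed.

Lemma fin_L N n v : n < 0 -> lspan (fingen N) v -> lspan (fingen N) (L n v).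
Proof.
move=> n0; apply: (lspan_image (L_lin p n)) => _ [x Gx|b k i kN ik].
  by apply: Rel_fin; apply: (Rel_L n0); exact: lspan_gen.
have [->|n2] := eqVneq n (-2); first by apply: lspan_gen; exact: (@Fingen_pow N b.+1 k i kN ik).
apply: Rel_fin; apply: lspan_gen; apply: Rgen_L => //; apply: W_iter; exact: inW_vvW.
Qed.

Lemma low_fin N v : lspan (lowgen N) v -> lspan (fingen N) v.
Proof.
apply: lspan_trans => _ [J n i nJ nN i2]; elim: J nJ => [_|k J IHJ /= /andP[k0 /IHJ]].
  by apply: lspan_gen; exact: (@Fingen_pow N 0 n i nN i2).
exact: fin_L.
Qed.

Lemma low_map N (f : V -> V) v : (forall (c : C) x y, inW x -> inW y -> f (c *: x + y) = c *: f x + f y) ->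
  (forall J x, inW x -> f (op L J x) = op L J (f x)) ->
  (forall n i, (i <= n.*2)%N -> f (vv n i) = 0 \/ exists (c : C) k, (k <= n.*2)%N /\ f (vv n i) = c *: vv n k) ->
  lspan (lowgen N) v -> lspan (lowgen N) (f v).
Proof.
move=> fl fop fv lv; apply: (@lspan_map _ _ _ (lowgen N) (lowgen N) inW f v _ _ fl _ lv).2.
- exact: inW0.
- by move=> c x y; exact: inWP.
move=> _ [J n i nJ nN i2]; split; first by apply: W_op; exact: inW_vvW.
rewrite fop; last exact: inW_vvW.
have [->|[c [k [k2 ->]]]] := fv n i i2; first by rewrite (lin0 (op_lin (L_lin p) J)); exact: lspan0.
by rewrite (linZ (op_lin (L_lin p) J)); apply: lspan_scale; apply: lspan_gen; exact: Lowgen.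
Qed.

Lemma low_Psi N v : lspan (lowgen N) v -> lspan (lowgen N) (Psi v).
Proof.
apply: low_map => //; first exact: Psi_op.
move=> n i /psi_vv_ex[c _ ->]; right; exists c, (n.*2 - i)%N; split => //.
exact: leq_subr.
Qed.

Lemma low_Qo N v : lspan (lowgen N) v -> lspan (lowgen N) (Qo v).
Proof.
apply: low_map; [by move=> c x y _ _; exact: (lin_elim (Qo_lin p))|exact: Qo_op|].
move=> n i; rewrite leq_eqVlt => /orP[/eqP ->|i2]; first by left; exact: (@vv_top R p n).
by right; exists 1, i.+1; split => //; rewrite scale1r.
Qed.

Lemma low_Qm N v : lspan (lowgen N) v -> lspan (lowgen N) (Qm v).
Proof.
apply: low_map; [exact: Qm_lin|exact: Qm_op|].
move=> n i i2; right; rewrite vv_ee (QmZ _ (inW_ee _ _)) (Qm_ee i2) /ee !scalerA.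
by eexists; exists i.-1; split; [lia|reflexivity].
Qed.

(** The index is the one at which e^(-M alpha) and e^(-n alpha) multiply to the ground vector
    e^(-(n+M) alpha), since z occurs with exponent 2 p M n. *)
Lemma es_mode_vv M n : mode (es (- M%:R)) (- (2 * p * M * n)%N%:Z - 1) (vv n 0) = vv (n + M) 0.
Proof.
rewrite mode_es /= (@exp_mode_es R p _ _ _ 0) /= ?Ep_0.
  by congr (es _); rewrite natrD; ring.
by rewrite rmorphB rmorphN/= -pmulrn !natrM; ring.
Qed.

(** At the weight of e^(-N alpha), words on [vv n k] with n > N are too heavy, and for n = N only
    the empty word fits. *)
Lemma leading_part N i v : wh (i%:R - N%:R) (hw p (- N%:R)) v -> inW v ->
  exists c : C, lspan (lowgen N) (v - c *: vv N i).
Proof.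
move=> vw /W_gen gv; rewrite -(wp_id vw) => {vw}; set x := (_, _).
elim: gv => [|c J n k u nJ k2 _ [d IHd]].
  by exists 0; rewrite (lin0 (wp_lin _ _)) scale0r subr0; exact: lspan0.
have [d' Hd'] : exists d' : C, lspan (lowgen N) (wp p x (op L J (vv n k)) - d' *: vv N i).
  have ow := @op_wh R p p2 J _ _ _ (@vv_wh R p n k).
  have [ex|nx] := eqVneq x (k%:R - n%:R, hw p (- n%:R) - (wsum J)%:~R); last first.
    by exists 0; rewrite (wp_neq ow nx) scale0r subr0; exact: lspan0.
  rewrite ex (wp_id ow); case: ex => e1 e2.
  have [nN|Nn|nN] := ltngtP n N.
  - by exists 0; rewrite scale0r subr0; apply: lspan_gen; exact: Lowgen.
  - have := @hw_lt_neg p p2 _ _ Nn; rewrite e2 ltNge lerBrDr gerDl => /negP [].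
    by rewrite -[0]/(0%:~R) ler_int; exact: neg_wsum.
  subst n; exists 1; rewrite scale1r; have ik : i = k.
    by move/addIr/eqP: e1; rewrite eqr_nat => /eqP.
  have J0 : J = [::].
    apply: neg_wsum0 => //; have : hw p (- N%:R) - hw p (- N%:R) = - (wsum J)%:~R by rewrite {1}e2; ring.
    by rewrite subrr => /esym/eqP; rewrite oppr_eq0 intr_eq0 => /eqP.
  by rewrite J0 ik subrr; exact: lspan0.
exists (c * d' + d); rewrite (lin_elim (wp_lin _ _)).
rewrite (_ : _ - _ = c *: (wp p x (op L J (vv n k)) - d' *: vv N i) + (wp p x u - d *: vv N i)); last by lmod.
exact: lspan_lin.
Qed.

Section Leading.
Variables (M n : nat).
Let N := (n + M)%N.
Let j : int := - (2 * p * M * n)%N%:Z - 1.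
Let c0 : C := (n.*2)`!%:R / (N.*2)`!%:R.
Local Notation E i := (mode (es (- M%:R)) j (ee n i)).

Lemma inW_E i : inW (E i).
Proof. by apply: (@inW_mode R p p2); [exact: inW_es|exact: inW_ee]. Qed.

Lemma E_wh i : wh (i%:R - N%:R) (hw p (- N%:R)) (E i).
Proof.
have := @mode_wh R p _ _ _ (@wh_e R p (- M%:R)) j _ _ _ (@supp_inZ R _ (n.*2 - i)`!%:R _ (@vv_wh R p n i)).
rewrite (_ : - M%:R + (i%:R - n%:R) = i%:R - N%:R); last by rewrite /N natrD; ring.
rewrite (_ : hw p (- n%:R) + _ - _ - 1 = hw p (- N%:R)) // /hw /j rmorphB rmorphN/= -pmulrn !natrM /N natrD.
ring.
Qed.

(** Induction on i with the lowering operator [Qm], which kills e^(-M alpha) and is a derivation, so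
    it sends the product for i + 1 to a multiple of the product for i. The constant [c0] is the
    normalization at i = 0. *)
Lemma E_leading i : (i <= n.*2)%N -> lspan (lowgen N) (E i - c0 *: ee N i).
Proof.
have nN : (n.*2 <= N.*2)%N by rewrite /N; lia.
elim: i => [_|i IHi i2].
  rewrite /ee subn0 (linZ (mode_linr _ _ _)) es_mode_vv subn0 scalerA /c0 divfK ?factC_neq0// subrr.
  exact: lspan0.
have {IHi}IH : lspan (lowgen N) (E i - c0 *: ee N i) by apply: IHi; exact: ltnW.
have [c] := @leading_part N i.+1 _ (@E_wh i.+1) (inW_E i.+1).
rewrite vv_ee scalerA; set c' := c / _ => Hc.
have i0 : i.+1%:R != 0 :> C by rewrite pnatr_eq0.
have e1 : Qm (E i.+1) = - i.+1%:R *: E i.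
  rewrite (Qm_mode j (inW_es M) (inW_ee n i.+1)) (Qm_ee i2) (_ : Qm (es (- M%:R)) = 0).
    by rewrite mode0 add0r; exact: (linZ (mode_linr _ _ _)).
  rewrite -[es _]/(vv M 0) vv_ee; apply: eq_trans (QmZ _ (inW_ee _ _)) _.
  by rewrite (Qm_ee (leq0n _)) oppr0 scale0r scaler0.
have e2 : Qm (ee N i.+1) = - i.+1%:R *: ee N i by exact: (Qm_ee (leq_trans i2 nN)).
have e3 : Qm (E i.+1 - c' *: ee N i.+1) = - c' *: (- i.+1%:R *: ee N i) + - i.+1%:R *: E i.
  rewrite -e1 -e2 -(Qm_lin (- c') (inW_ee N i.+1) (inW_E i.+1)) addrC scaleNr.
  by [].
have := low_Qm Hc; rewrite e3 => /(lspan_cancel i0) Hi.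
(* If the two coefficients differ, the two congruences make [ee N i] itself low. Then so is its
   image under Q, a non-zero multiple of [ee N i.+1], and the coefficient may be changed to [c0]. *)
have [e|ne] := eqVneq c' c0; first by rewrite -e.
have low_i : lspan (lowgen N) (ee N i) by exact: lspan_diff ne IH Hi.
apply: lspan_change Hc; have := low_Qo low_i; rewrite Qo_ee; last by lia.
have x0 : (N.*2 - i)%:R != 0 :> C by rewrite pnatr_eq0 -lt0n subn_gt0; lia.
exact: (lspan_unscale x0).
Qed.

Lemma U_leading i : (i <= n.*2)%N ->
  lspan (lowgen N) (mode (Uv M) j (ee n i) - c0 *: (ee N i + ee N (i + M.*2)%N)).
Proof.
move=> i2; have Wi := inW_ee n i.
have e1 : mode (es (- M%:R)) j (Psi (ee n i)) = (-1) ^+ i *: E (n.*2 - i)%N.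
  by rewrite (psi_ee i2); exact: (linZ (mode_linr _ _ _)).
rewrite (mode_Uv M j Wi) e1 (PsiZ _ (inW_E _)).
have i2' : (n.*2 - i <= n.*2)%N by exact: leq_subr.
have k2 : (n.*2 - i <= N.*2)%N by rewrite /N; lia.
have e2 : Psi (ee N (n.*2 - i)) = (-1) ^+ (n.*2 - i) *: ee N (i + M.*2).
  rewrite (psi_ee k2) (_ : (N.*2 - (n.*2 - i) = i + M.*2)%N)//.
  by rewrite /N; lia.
have e3 : Psi (E (n.*2 - i)%N - c0 *: ee N (n.*2 - i)) =
    - c0 *: ((-1) ^+ (n.*2 - i) *: ee N (i + M.*2)) + Psi (E (n.*2 - i)%N).
  rewrite -e2 -(psi_lin (- c0) (inW_ee N (n.*2 - i)) (inW_E (n.*2 - i))) addrC scaleNr.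
  by [].
have := low_Psi (E_leading i2'); rewrite e3 => h.
apply: lspan_reflect h (E_leading i2).
by rewrite -exprD subnKC// -mul2n exprM sqrrN expr1n expr1n.
Qed.

End Leading.

(** The bound 4m <= N makes n = N - M positive for M = m and M = 2m, so that the leading mode has
    index at most -2, and it implies the condition 6m <= 2N of [three_relations]. *)
Lemma ee_fin N i : (4 * m <= N)%N -> (i <= N.*2)%N -> lspan (fingen N) (ee N i).
Proof.
move=> mN.
have rel M k : (M == m) || (M == m.*2) -> (k + M.*2 <= N.*2)%N -> lspan (fingen N) (ee N k + ee N (k + M.*2)%N).
  move=> Mm k2; pose n := (N - M)%N; have e : (n + M = N)%N by rewrite /n; lia.
  have k2' : (k <= n.*2)%N by rewrite /n; lia.
  have := @U_leading M n k k2'; rewrite e.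
  set j := (- _ - 1); set c := (_ / _); set u := mode _ _ _; set y := (_ + _) => h.
  have c0 : c != 0 by rewrite mulf_neq0 ?invr_eq0 ?factC_neq0.
  have hu : lspan (fingen N) u.
    apply: lspan_gen; apply: Fingen_rel; apply: Rgen_U => //; first exact: inW_ee.
    have : (0 < 2 * p * M * n)%N by rewrite !muln_gt0 /n; lia.
    by rewrite /j; lia.
  have := lspan_scale c^-1 (lspan_sub hu (low_fin h)); congr lspan.
  by rewrite opprB addrC subrK scalerA mulVf// scale1r.
apply: (@three_relations C V (fingen N) (fun i => ee N i) N.*2 m); first lia.
  by move=> k; apply: rel; rewrite eqxx.
by move=> k; apply: rel; rewrite eqxx orbT.
Qed.

Lemma fin_reduce N v : lspan (fingen N) v -> lspan (fingen (4 * m)) v.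
Proof.
elim: N v => [|N IHN] v.
  by apply: lspan_trans => _ [x Gx|b n i //]; apply: lspan_gen; exact: Fingen_rel.
have [mN|Nm] := leqP (4 * m) N; last first.
  apply: lspan_trans => _ [x Gx|b n i nN i2]; apply: lspan_gen; first exact: Fingen_rel.
  by apply: Fingen_pow => //; exact: leq_trans nN _.
move=> lv; apply: IHN; move: lv; apply: lspan_trans => _ [x Gx|b n i nN i2].
  by apply: lspan_gen; exact: Fingen_rel.
move: nN; rewrite ltnS leq_eqVlt => /orP[/eqP nN|nN]; last by apply: lspan_gen; exact: Fingen_pow.
subst n; elim: b => [|b IHb]; last exact: (@fin_L N (-2)).
rewrite -[iter _ _ _]/(vv N i) vv_ee; apply: lspan_scale; exact: ee_fin.
Qed.

Lemma W_span v : inW v -> lspan (fingen (4 * m)) v.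
Proof.
move=> /W_gen; elim=> [|c J n i u nJ i2 _ IHu]; first exact: lspan0.
apply: lspan_lin => //; apply: (@fin_reduce n.+1); apply: low_fin; apply: lspan_gen.
exact: Lowgen.
Qed.

End TripletAutomorphism.

(** * A functional killing the deep modes *)

Lemma arith_fact (K : fieldType) (a b c f : K) : c != 0 -> f != 0 -> b * (a / f) = c * (b * a / (c * f)).
Proof. by move=> c0 f0; field; rewrite c0 f0. Qed.

Lemma arith_lin (K : comPzRingType) (x c a b : K) : c * (x * a) + x * b = x * (c * a + b).
Proof. by ring. Qed.

Section EpsFunctional.
Context {R : realType} (p : nat).
Local Notation C := R[i].
Local Notation V := (fock R).
Local Notation alpha := (@al R p).
Local Notation pp := (@pp R p).
Local Notation bb := (@bb R p).
Local Notation es := (@es R).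
Local Notation wh := (@wh R p).
Local Notation L := (@L R p).
Local Notation em := (@em R p).
Local Notation mode := (@md R p).
Local Notation Ep r := (@exp_creation R p r).
Local Notation Em r := (@exp_annihilation R p r).
Hypothesis p0 : (0 < p)%N.

(* alpha(-1) acts as 1 and the alpha(-k) with k >= 2 act as 0; thus L(-1) acts as
   the charge, L(-2) as a non-zero scalar and L(-k) as 0 for k >= 3. *)
Lemma eps_sig : {f : V -> C | f = lin_ext (V := C^o) (fun b : fock_basis => (b.1 == zs (b.1 0%N))%:R)}.
Proof. by eexists. Qed.
Definition eps : V -> C := sval eps_sig.

Lemma epsE v : eps v = \sum_(b <- msupp v) v@_b * (b.1 == zs (b.1 0%N))%:R.
Proof. by rewrite /eps (svalP eps_sig). Qed.

Lemma eps_linear : linear (eps : V -> C^o).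
Proof. by rewrite /eps (svalP eps_sig); exact: lin_ext_is_linear. Qed.

Lemma eps_lin (c : C) u v : eps (c *: u + v) = c * eps u + eps v.
Proof. exact: (lin_elim eps_linear). Qed.

Lemma eps0 : eps 0 = 0. Proof. exact: (lin0 eps_linear). Qed.
Lemma epsD u v : eps (u + v) = eps u + eps v. Proof. exact: (linD eps_linear). Qed.
Lemma epsZ (c : C) v : eps (c *: v) = c * eps v. Proof. exact: (linZ eps_linear). Qed.

Lemma eps_sum I (r : seq I) (P : pred I) (F : I -> V) : eps (\sum_(i <- r | P i) F i) = \sum_(i <- r | P i) eps (F i).
Proof. exact: (lin_big eps_linear). Qed.

Lemma eps_nsum (F : nat -> V) : ev0 F -> eps (nsum F) = nsum (fun i => eps (F i)).
Proof. exact: (@lin_nsum C V C^o eps eps_linear F). Qed.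

Lemma epsU A s : eps (bs (A, s)) = (A == zs (A 0%N))%:R.
Proof. by rewrite /eps (svalP eps_sig) lin_extU. Qed.

Lemma eps_es s : eps (es s) = 1.
Proof. by rewrite e_E epsU mset0E eqxx. Qed.

Lemma zs_S d k : zs d k.+1 = 0%N.
Proof. by elim: d => [|d IHd] /=; rewrite ?mset0E// mset1DE IHd. Qed.

Lemma zs_0 d : zs d 0%N = d.
Proof. by elim: d => [|d IHd] /=; rewrite ?mset0E// mset1DE IHd eqxx. Qed.

Lemma zs_eqP (A : {mset nat}%mset) : reflect (forall k, A k.+1 = 0%N) (A == zs (A 0%N)).
Proof.
apply: (iffP eqP) => [e k|]; last exact: zsP.
by rewrite e zs_S.
Qed.

Lemma eps_alpha1 v : eps (alpha (Negz 0) v) = eps v.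
Proof.
apply: (@lin_eq R C^o (fun v => eps (alpha (Negz 0) v)) eps _ eps_linear).
  exact: (lin_comp eps_linear (alpha_lin p _)).
move=> [A s]; rewrite alphaNU !epsU; congr (_%:R); congr nat_of_bool.
by apply/zs_eqP/zs_eqP => h k; have := h k; rewrite mset1DE.
Qed.

Lemma eps_alphaS k v : eps (alpha (Negz k.+1) v) = 0.
Proof.
apply: (@lin_eq R C^o (fun v => eps (alpha (Negz k.+1) v)) (fun=> 0)).
- exact: (lin_comp eps_linear (alpha_lin p _)).
- by apply: lin_intro => c x y; rewrite scaler0 addr0.
move=> [A s]; rewrite alphaNU epsU (_ : (_ == _) = false)//; apply/negP => /zs_eqP /(_ k).
by rewrite mset1DE eqxx.
Qed.

Lemma eps_shift r v : eps (@sh R r v) = eps v.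
Proof.
apply: (@lin_eq R C^o (fun v => eps (@sh R r v)) eps _ eps_linear).
  exact: (lin_comp eps_linear (shift_lin r)).
by move=> [A s]; rewrite shiftU !epsU.
Qed.

(** With alpha(-1) = 1 and the deeper modes 0, the creation exponential becomes exp (r z). *)
Lemma eps_Ep r k v : eps (Ep r k v) = ratr r ^+ k / k`!%:R * eps v.
Proof.
move: v; apply: (@fock_al_ind R p) => [|c u v hu hv|s|a v IHv].
- by rewrite (lin0 (Ep_lin p r k)) eps0 mulr0.
- transitivity (c * eps (Ep r k u) + eps (Ep r k v)).
    by rewrite (lin_elim (Ep_lin p r k)) eps_lin.
  rewrite hu hv eps_lin; move: (eps u) (eps v) (_ / _) => x y z; exact: arith_lin.
- rewrite eps_es mulr1; elim: k => [|k IHk]; first by rewrite Ep_0 eps_es expr0 fact0 invr1 mulr1.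
  have k0 : k.+1%:R != 0 :> C by rewrite pnatr_eq0.
  have f0 : k`!%:R != 0 :> C by rewrite pnatr_eq0 -lt0n fact_gt0.
  have rec : k.+1%:R * eps (Ep r k.+1 (es s)) = ratr r * eps (Ep r k (es s)).
    apply: eq_trans (esym (epsZ _ _)) _; apply: eq_trans (congr1 eps (@Ep_rec R p p0 _ _ _)) _.
    rewrite eps_sum big_ord_recl big1 => [|i _]; last by rewrite epsZ eps_alphaS mulr0.
    by rewrite addr0 epsZ eps_alpha1 subSS subn0.
  apply: (mulfI k0); apply: eq_trans rec _; rewrite IHk factS natrM exprS.
  exact: arith_fact.
have := @alphaN_Ep R p r a.+1 k v; rewrite -NegzE => <-.
by case: a => [|a]; rewrite ?eps_alpha1// !eps_alphaS mulr0.
Qed.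

Lemma eps_Ez r c v : eps (Ez p r c v) = pw (ratr r) c * eps v.
Proof. by case: c => k /=; [exact: eps_Ep|rewrite eps0 mul0r]. Qed.

Lemma eps3 (a b c : C) x y z : eps (a *: x + (b *: y + c *: z)) = a * eps x + (b * eps y + c * eps z).
Proof. by rewrite eps_lin eps_lin epsZ. Qed.

Lemma eps_L m s v : chg s v -> eps (L (Negz m) v) =
  match m with 0%N => ratr s | 1%N => (pp * 2)^-1 | _ => 0 end * eps v.
Proof.
move=> vs; rewrite (@L_expN_fock R p p0 m) eps3 eps_nsum; last first.
  by have [N hN] := alpha_ev0 p v; exists N => i /hN ->; exact: alpha0.
have -> : nsum (fun i => eps (alpha (Negz (m + i)) (alpha i%:Z v)) : C) =
    if m == 0%N then pp * (ratr s * eps v) else 0.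
  rewrite (@nsum1 _ _ 0%N) => [|[//|i] _]; last by rewrite addnS eps_alphaS.
  rewrite addn0; case: m => [|m]; last by rewrite eps_alphaS.
  rewrite eps_alpha1 (alpha0_chg p vs) epsZ; exact: esym (mulrA _ _ _).
have -> : eps (\sum_(i < m) alpha (Negz i) (alpha (Negz (m - i.+1)) v)) = if m == 1%N then eps v else 0.
  rewrite eps_sum; case: m => [|m]; first by rewrite big_ord0.
  rewrite big_ord_recl /= eps_alpha1 subn1 /= big1 ?addr0 => [|i _]; last by rewrite eps_alphaS.
  by case: m => [|m] /=; rewrite ?eps_alphaS// eps_alpha1.
case: m => [|[|m]] /=.
- by rewrite !mulr0 mul0r add0r addr0 mulKf// (@pp0 R p p0).
- by rewrite eps_alphaS !mulr0 !addr0.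
by rewrite eps_alphaS !mulr0 !addr0 mul0r.
Qed.

Lemma eps_off v : supp_in (fun b : fock_basis => b.1 != zs (b.1 0%N)) v -> eps v = 0.
Proof.
move=> h; rewrite epsE big_seq big1// => b; rewrite -mcoeff_neq0 => /h /negPf ->.
by rewrite mulr0.
Qed.

Lemma eps_wh (d : nat) l f : wh l (d%:R + hw p l) f -> eps f = f@_(zs d, l).
Proof.
move=> fw; have -> : f@_(zs d, l) = eps (f@_(zs d, l) *: bs (zs d, l)) by rewrite epsZ epsU zs_0 eqxx mulr1.
apply/eqP; rewrite -subr_eq0 -[X in _ - X]mul1r -mulNr addrC -eps_lin; apply/eqP.
apply: eps_off => -[A s]; rewrite mcoeffD mcoeffZ mcoeffZ mcoeff_bs mulN1r => h /=.
apply/negP => /eqP e; move: h; have [E|/eqP ne] := eqVneq ((zs d, l) : fock_basis) (A, s).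
  by rewrite E mulr1 addNr eqxx.
rewrite mulr0 oppr0 add0r => /fw[/= ss /eqP]; rewrite (inj_eq (addIr _)) eqr_nat => /eqP ld.
case: ne; rewrite ss; congr (_, _); rewrite [RHS]e; congr zs.
by rewrite -ld {1}e lev_zs.
Qed.

(** On a homogeneous vector [eps] reads the coefficient of alpha(-1)^d, which [singular_lead] shows
    to be non-zero. *)
Lemma eps_singular l w f : wh l w f -> singular p f -> f != 0 -> eps f != 0.
Proof.
move=> fw sf f0; have [d [wE fd]] := @singular_lead R p p0 _ _ _ fw sf f0.
by rewrite wE in fw; rewrite (eps_wh fw).
Qed.

Section ExpPolynomials.
Implicit Types (k : C) (P Q : {poly C}) (c : int).

(** The coefficient of z^c in P(1/z) exp (k z). *)
Definition epw k P c : C := \sum_(d < size P) P`_d * pw k (c + d%:Z).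

Lemma epwE B k P c : (size P <= B)%N -> epw k P c = \sum_(d < B) P`_d * pw k (c + d%:Z).
Proof.
move=> sB; apply: (@big_ord_widen0 C^o (fun d => P`_d * pw k (c + d%:Z)) _ _ sB) => i Pi.
by rewrite nth_default// mul0r.
Qed.

Lemma epw0 k c : epw k 0 c = 0.
Proof. by rewrite /epw size_poly0 big_ord0. Qed.

Lemma epw_lin k (a : C) P Q c : epw k (a *: P + Q) c = a * epw k P c + epw k Q c.
Proof.
pose B := maxn (maxn (size P) (size Q)) (size (a *: P + Q)).
rewrite !(@epwE B) ?leq_max ?leqnn ?orbT// mulr_sumr -big_split /=; apply: eq_bigr => d _.
by rewrite coefD coefZ mulrDl mulrA.
Qed.

Lemma epw_sum k n (F : 'I_n -> {poly C}) (a : 'I_n -> C) c :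
  epw k (\sum_i a i *: F i) c = \sum_i a i * epw k (F i) c.
Proof.
elim: n F a => [|n IHn] F a; first by rewrite !big_ord0 epw0.
by rewrite !big_ord_recl epw_lin IHn.
Qed.

Lemma epwX k n P c : epw k ('X^n * P) c = epw k P (c + n%:Z).
Proof.
rewrite (@epwE (n + size P)); last first.
  by rewrite (leq_trans (size_polyMleq _ _))// size_polyXn addSn.
rewrite big_split_ord /= big1 ?add0r => [|i _]; last by rewrite coefXnM ltn_ord mul0r.
apply: eq_bigr => d _; rewrite coefXnM ltnNge leq_addr /= addKn; congr (_ * pw _ _).
by rewrite PoszD addrA.
Qed.

End ExpPolynomials.

(** The creation half gives exp (k z), the annihilation half finitely many negative powers of z, and
    the charges k and -k the factor z^(-2 p k^2). Extra factors alpha(-a-1) in u contribute to the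
    constant term of P only through alpha(-1) acting on the left, hence its value
    [eps u * eps w]. *)
Lemma mode_expansion (k : int) u : chg k%:~R u -> forall w, chg (- k%:~R) w ->
  exists P : {poly C}, P`_0 = eps u * eps w /\
    forall j, eps (mode u j w) = epw (ratr k%:~R) P (- j - 1 + 2 * p%:Z * k ^+ 2).
Proof.
move: u; apply: (@chg_ind R p) => [|c u v hu hv|w wk|a u uk IHu].
- move=> w _; exists 0; rewrite coef0 eps0 mul0r; split=> // j.
  by rewrite mode0 eps0 epw0.
- move=> w wk; have [P [P0 PE]] := hu w wk; have [Q [Q0 QE]] := hv w wk.
  exists (c *: P + Q); rewrite coefD coefZ P0 Q0 eps_lin mulrDl mulrA; split=> // j.
  by rewrite (lin_elim (@mode_lin R p j w)) eps_lin PE QE epw_lin.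
- have [N hN] := Em_ev0 p k%:~R w; exists (\poly_(q < N) eps (Em k%:~R q w)).
  rewrite eps_es mul1r; split.
    by rewrite coef_poly; case: N hN => [|N] hN; rewrite ?Em_0// -[w in RHS](Em_0 p k%:~R w) hN ?eps0.
  move=> j; have e : - j%:~R - 1 - 2 * p%:R * k%:~R * (- k%:~R) = (- j - 1 + 2 * p%:Z * k ^+ 2)%:~R :> rat.
    by rewrite rmorphD rmorphB rmorphN !rmorphM/=; ring.
  rewrite mode_es (@exp_modeE R p _ _ _ _ _ wk e); set c := (_ + 2 * _ * _).
  rewrite (@nsumE _ _ N) => [|i /hN ->]; last by rewrite (lin0 (Ez_lin p _ _)) (lin0 (shift_lin _)).
  rewrite eps_sum (@epwE N) ?size_poly//; apply: eq_bigr => q _.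
  by rewrite eps_shift eps_Ez coef_poly ltn_ord mulrC addrC.
move=> w wk; have [P [P0 PE]] := IHu w wk.
have [N hN] := alpha_ev0 p w.
have [Q QP] := boolp.choice (fun i : nat => IHu _ (@alpha_chg R p i _ _ wk)).
exists ((a == 0%N)%:R *: P + (-1) ^+ a *: \sum_(i < N) 'C(a + i, i)%:R *: ('X^((a + i).+1) * Q i)).
split.
  rewrite coefD !coefZ P0 coef_sum big1 => [|i _]; last by rewrite coefZ coefXnM mulr0.
  by rewrite mulr0 addr0; case: a => [|a]; rewrite ?eps_alpha1 ?eps_alphaS ?mul0r// mul1r.
move=> j; rewrite mode_al /no /fadd /fscale epsD epsZ epw_lin [X in _ + X = _]mulrC.
rewrite -[(-1) ^+ a *: _]addr0 epw_lin epw0 addr0 mulrC; congr (_ + _ * _).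
- rewrite /nop eps_nsum; last exact: (nop_ev (alpha_lin p) a j w (@mode_field R p u)).
  rewrite (@nsum1 _ _ 0%N) => [|[//|i] _]; last by rewrite epsZ addnS eps_alphaS mulr0.
  rewrite addn0 bin0 scale1r addr0; case: a {Q QP} => [|a]; last by rewrite eps_alphaS mul0r.
  by rewrite eps_alpha1 mul1r PE.
rewrite /non (@nsumE _ _ N) => [|i /hN ->]; last by rewrite mode0r scaler0.
rewrite eps_sum epw_sum; apply: eq_bigr => i _; rewrite epsZ (QP i).2 epwX; congr (_ * epw _ _ _).
by lia.
Qed.

End EpsFunctional.

(** * Exponentials of the two screening actions *)

Lemma leibniz_sum (K : pzRingType) (V : lmodType K) (T : nat -> nat -> V) n :
  \sum_(i < n.+1) (i.+1%:R *: T i.+1 (n - i)%N + (n - i).+1%:R *: T i (n - i).+1) =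
  n.+1%:R *: \sum_(i < n.+2) T i (n.+1 - i)%N.
Proof.
rewrite big_split /=; transitivity (\sum_(i < n.+2) i%:R *: T i (n.+1 - i)%N +
  \sum_(i < n.+2) (n.+1 - i)%:R *: T i (n.+1 - i)%N).
  congr (_ + _); first by rewrite [RHS]big_ord_recl scale0r add0r.
  rewrite [RHS]big_ord_recr /= subnn scale0r addr0; apply: eq_bigr => i _.
  by rewrite subSn// -ltnS.
rewrite -big_split scaler_sumr; apply: eq_bigr => i _ /=.
by rewrite -scalerDl -natrD subnKC// -ltnS.
Qed.

Lemma iter_ev0 (W : zmodType) (f : W -> W) v k : f 0 = 0 -> iter k f v = 0 -> ev0 (fun i => iter i f v).
Proof.
move=> f0 vk; exists k => i ki; rewrite -(subnK ki) iterD vk.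
by elim: (i - k)%N => //= j ->.
Qed.

Section BinomialSums.
Context {K : comNzRingType} {V : lmodType K} (E : nat -> V) (N : nat).
Implicit Types (s t : K) (P Q : {poly K}).

Definition polsum P : V := \sum_(l < N.+1) P`_l *: E l.

Lemma polsum_lin c P Q : polsum (c *: P + Q) = c *: polsum P + polsum Q.
Proof.
rewrite /polsum scaler_sumr -big_split /=; apply: eq_bigr => l _.
by rewrite coefD coefZ scalerDl scalerA.
Qed.

Lemma polsum0 : polsum 0 = 0.
Proof. by rewrite /polsum big1// => l _; rewrite coef0 scale0r. Qed.

Lemma polsum_sum n (c : 'I_n -> K) (F : 'I_n -> {poly K}) :
  polsum (\sum_i c i *: F i) = \sum_i c i *: polsum (F i).
Proof.
elim: n c F => [|n IHn] c F; first by rewrite !big_ord0 polsum0.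
by rewrite !big_ord_recl polsum_lin IHn.
Qed.

Lemma polsumX l : (l <= N)%N -> polsum 'X^l = E l.
Proof.
move=> lN; have lN' : (l < N.+1)%N by [].
rewrite /polsum (bigD1 (Ordinal lN')) //= coefXn eqxx scale1r big1 ?addr0// => k.
by rewrite -val_eqE /= coefXn => /negPf ->; rewrite scale0r.
Qed.

Definition spol s : {poly K} := 1 + s *: 'X.

Definition xsum s i : V := \sum_(k < (N - i).+1) (s ^+ k * 'C(N - i, k)%:R) *: E (i + k).

Lemma xsum_polsum s i : (i <= N)%N -> xsum s i = polsum ('X^i * spol s ^+ (N - i)).
Proof.
move=> iN; have -> : 'X^i * spol s ^+ (N - i) =
    \sum_(k < (N - i).+1) (s ^+ k * 'C(N - i, k)%:R) *: 'X^(i + k) :> {poly K}.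
  rewrite /spol exprDn mulr_sumr; apply: eq_bigr => k _.
  by rewrite expr1n mul1r exprZn -scaler_nat scalerA -scalerAr -exprD mulrC.
rewrite polsum_sum; apply: eq_bigr => k _; rewrite polsumX//.
by have := ltn_ord k; lia.
Qed.

(* The image of X^i under exp (s e) exp (t f), for binary forms of degree N
   written in one variable. *)
Definition pol s t i : {poly K} := ('X - t *: spol s) ^+ i * spol s ^+ (N - i).

Lemma binomial_sum s t i : (i <= N)%N ->
  \sum_(k < i.+1) ((- t) ^+ k * 'C(i, k)%:R) *: xsum s (i - k) = polsum (pol s t i).
Proof.
move=> iN; have -> : pol s t i =
    \sum_(k < i.+1) ((- t) ^+ k * 'C(i, k)%:R) *: ('X^(i - k) * spol s ^+ (N - (i - k))).
  rewrite /pol -scaleNr exprDn mulr_suml; apply: eq_bigr => k _; have ki := ltn_ord k.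
  rewrite (_ : (N - (i - k) = k + (N - i))%N); last by lia.
  rewrite exprZn exprD -scalerAr -scaler_nat scalerA -scalerAl mulrA [_%:R * _]mulrC.
  by [].
rewrite polsum_sum; apply: eq_bigr => k _; rewrite xsum_polsum//.
by rewrite (leq_trans (leq_subr _ _)).
Qed.

(** Conjugation by the Weyl element turns raising with parameter t into lowering with parameter -t;
    the signs of the reflection combine to (-1)^k. *)
Lemma reflected_sum (F : nat -> V) t i : (i <= N.*2)%N ->
  (forall k, (k <= i)%N -> F (N.*2 - i + k)%N = (-1) ^+ (N.*2 - i + k) *: E (i - k)%N) ->
  (-1) ^+ i *: \sum_(k < (N.*2 - (N.*2 - i)).+1) (t ^+ k * 'C(N.*2 - (N.*2 - i), k)%:R) *: F (N.*2 - i + k)%N =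
  \sum_(k < i.+1) ((- t) ^+ k * 'C(i, k)%:R) *: E (i - k)%N.
Proof.
move=> iN FE; rewrite subKn// scaler_sumr; apply: eq_bigr => k _; have ki := ltn_ord k.
rewrite FE// !scalerA; congr (_ *: _).
rewrite mulrC mulrA -exprD (_ : (N.*2 - i + k + i = k + N.*2)%N); last by lia.
by rewrite exprD -(mul2n N) exprM sqrrN expr1n expr1n mulr1 mulrA -exprMn mulN1r.
Qed.

Lemma scale_exp_split s (x : V) (i j : nat) : (i <= j)%N -> s ^+ i *: (s ^+ (j - i) *: x) = s ^+ j *: x.
Proof. by move=> it; rewrite scalerA -exprD subnKC. Qed.

Lemma binomial_step (a b c d : K) (x : V) : a * b = c * d -> a *: (b *: x) = c *: (d *: x).
Proof. by rewrite !scalerA => ->. Qed.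

End BinomialSums.

(** * Coefficient functions *)

Lemma exponential_separation_fin (K : numFieldType) (Y : lmodType K) (S : Y -> Prop) n (h : 'I_n -> K)
    (e : 'I_n -> nat) (D : nat) (F : 'I_n -> nat -> Y) :
  S 0 -> (forall (c : K) u v, S u -> S v -> S (c *: u + v)) -> injective h ->
  (forall N : nat, S (\sum_a \sum_(d < D) pw (h a) (N.+1 + (e a + d))%N *: F a d)) ->
  forall a, h a != 0 -> (0 < D)%N -> S (F a 0%N).
Proof.
move=> S0 Sl hI Sx a ha D0.
pose inv (T : Type) (x : T) (f : 'I_n -> T) k := if [pick b | h b == k] is Some b then f b else x.
have invE T x f b : inv T x f (h b) = f b.
  rewrite /inv; case: pickP => [b' /eqP /hI -> //|/(_ b)].
  by rewrite eqxx.
have := @exponential_separation K Y S [seq h b | b : 'I_n] (inv _ 0%N e) D (inv _ (fun=> 0) F) S0 Sl.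
move=> /(_ _ _ (h a)); rewrite invE; apply=> //.
- by rewrite map_inj_uniq// enum_uniq.
- move=> N; rewrite big_image; have := Sx N; congr S; apply: eq_bigr => b _.
  by apply: eq_bigr => d _; rewrite !invE.
by rewrite map_f// mem_enum.
Qed.

(** * Spaces of functions of s and t spanned by monomials in 1 - s t, s and -t *)

Section Monomials.
Context {K : numFieldType}.
Local Notation Y := ((K * K)%type -> K^o).

Definition mono (a b c : nat) : Y := fun z => (1 - z.1 * z.2) ^+ a * z.1 ^+ b * (- z.2) ^+ c.

Definition pf N i l : Y := fun z => (pol N z.1 z.2 i)`_l.

Lemma lin_coef (a b : K) i l : ((a *: 'X + b%:P) ^+ i)`_l = 'C(i, l)%:R * a ^+ l * b ^+ (i - l).
Proof.
rewrite addrC exprDn coef_sum.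
have e (k : nat) : ((b%:P ^+ (i - k) * (a *: 'X) ^+ k) *+ 'C(i, k))`_l =
    if l == k then 'C(i, k)%:R * a ^+ k * b ^+ (i - k) else 0.
  rewrite coefMn -polyC_exp exprZn -scalerAr coefZ coefCM coefXn eq_sym.
  by case: eqP => _; rewrite ?mulr0 ?mul0rn// mulr1 -[LHS]mulr_natl mulrA.
under eq_bigr => k _ do rewrite e.
have [li|il] := leqP l i.
  rewrite (bigD1 (Ordinal (li : (l < i.+1)%N))) //= eqxx big1 ?addr0// => k.
  by rewrite -val_eqE /= eq_sym => /negPf ->.
rewrite bin_small// mul0r mul0r big1// => k _; case: eqP => // lk.
by have := ltn_ord k; rewrite -lk ltnS leqNgt il.
Qed.

Lemma pol_coef N s t i l : (pol N s t i)`_l =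
  \sum_(a < l.+1) 'C(i, a)%:R * (1 - s * t) ^+ a * (- t) ^+ (i - a) * ('C(N - i, l - a)%:R * s ^+ (l - a)) :> K.
Proof.
rewrite /pol /spol (_ : 'X - t *: (1 + s *: 'X) = (1 - s * t) *: 'X + (- t)%:P); last first.
  by rewrite scalerDr scalerA scalerBl scale1r polyCN opprD addrA addrAC alg_polyC mulrC.
rewrite (_ : 1 + s *: 'X = s *: 'X + 1%:P); last by rewrite addrC.
rewrite coefM; apply: eq_bigr => a _; rewrite !lin_coef expr1n mulr1.
by [].
Qed.

Lemma pfE N i l : pf N i l = \sum_(a < l.+1) ('C(i, a) * 'C(N - i, l - a))%:R *: mono a (l - a) (i - a).
Proof.
apply/funext => z; rewrite /pf pol_coef fct_sumE; apply: eq_bigr => a _.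
rewrite natrM -[RHS]/(_ * _ * (_ * _ * _)).
set x := 'C(_, _)%:R; set y := 'C(_, _)%:R; set u := _ ^+ a; set v := _ ^+ _; set w := z.1 ^+ _.
by ring.
Qed.

(** This is 1 = (1 - s t) - s (-t). *)
Lemma mono_raise a b c : mono a b c = mono a.+1 b c - mono a b.+1 c.+1.
Proof.
apply/funext => z; rewrite -[RHS]/(_ * _ * _ - _ * _ * _) /mono !exprS.
set x := _ ^+ a; set y := _ ^+ b; set w := _ ^+ c.
by ring.
Qed.

(** Each function [pf] is a combination with non-negative coefficients of monomials x_k of the same
    degree. Consecutive x_k differ, by [mono_raise], by a monomial of lower degree, available by
    induction; so modulo H all x_k agree and [pf] is a positive multiple of any of them. *)
Lemma mono_span (H : Y -> Prop) l e : H 0 -> (forall (c : K) u v, H u -> H v -> H (c *: u + v)) ->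
  (forall j i, (j <= l)%N -> (j <= e)%N -> (i <= (l - j) + (e - j))%N -> H (pf ((l - j) + (e - j)) i (l - j))) ->
  forall a b c, (a + b = l)%N -> (c <= e)%N -> H (mono a b c).
Proof.
move=> H0 Hl; elim: l e => [|l IHl] e Hp a b c abl ce.
  have [-> ->] : a = 0%N /\ b = 0%N by lia.
  have := Hp 0%N c isT isT; rewrite subn0 add0n subn0 => /(_ ce).
  by rewrite pfE big_ord1 /= subnn !bin0 muln1 scale1r subn0.
have lower a' b' c' : (a' + b' = l)%N -> (c' < e)%N -> H (mono a' b' c').
  move=> abl' ce'; apply: (IHl e.-1) => //; last by lia.
  move=> j i jl je ij; have := Hp j.+1 i; rewrite subSS.
  have -> : (e - j.+1 = e.-1 - j)%N by lia.
  apply=> //; lia.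
pose i := (a + c)%N; pose x k := mono k (l.+1 - k) (i - k).
have ok k : (k <= i)%N -> (k <= l.+1)%N -> (i - k <= e)%N -> H (x k - x a).
  have HN u : H u -> H (- u) by move=> Hu; have := Hl (-1) _ _ Hu H0; rewrite scaleN1r addr0.
  have HD u v : H u -> H v -> H (u + v) by move=> Hu Hv; have := Hl 1 _ _ Hu Hv; rewrite scale1r.
  have step q : (q < i)%N -> (q < l.+1)%N -> (i - q <= e)%N -> H (x q.+1 - x q).
    move=> qi ql qe; rewrite /x.
    have -> : (l.+1 - q = (l - q).+1)%N by lia.
    have -> : (i - q = (i - q.+1).+1)%N by lia.
    rewrite subSS -mono_raise; apply: lower; lia.
  have up d q : (q + d <= i)%N -> (q + d <= l.+1)%N -> (i - q <= e)%N -> H (x (q + d)%N - x q).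
    elim: d => [|d IHd] qi ql qe; first by rewrite addn0 subrr.
    rewrite -(subrK (x (q + d)%N) (x _)) -addrA addnS; apply: HD; [apply: step; lia|apply: IHd; lia].
  move=> ki kl ke; have [ak|ka] := leqP a k.
    by rewrite -(subnKC ak); apply: up; lia.
  by rewrite -opprB; apply: HN; rewrite -(subnKC (ltnW ka)); apply: up; lia.
have ie : (i <= l.+1 + e)%N by lia.
have Hpf : H (pf (l.+1 + e) i l.+1) by have := Hp 0%N i isT isT; rewrite !subn0; apply.
pose cf k := ('C(i, k) * 'C(l.+1 + e - i, l.+1 - k))%N.
have al : (a < l.+2)%N by lia.
have cf0 : (\sum_(k < l.+2) cf k)%:R != 0 :> K.
  rewrite pnatr_eq0 -lt0n (bigD1 (Ordinal al)) //= addn_gt0 muln_gt0 !bin_gt0.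
  by apply/orP; left; rewrite /i; lia.
have dH : H (pf (l.+1 + e) i l.+1 - (\sum_(k < l.+2) cf k)%:R *: x a).
  rewrite pfE natr_sum scaler_suml -sumrB.
  elim/big_ind: _ => [//|u v Hu Hv|k _]; first by have := Hl 1 _ _ Hu Hv; rewrite scale1r.
  rewrite -/(cf k) -scalerBr; have [/eqP c0|c0] := boolP (cf k == 0%N); first by rewrite c0 scale0r.
  rewrite -[_ *: _]addr0; apply: Hl => //; have := c0; rewrite muln_eq0 negb_or -!lt0n !bin_gt0 => /andP[k1 k2].
  by have := ltn_ord k => kl; apply: ok; lia.
have -> : mono a b c = (\sum_(k < l.+2) cf k)%:R^-1 *: (-1 *: (pf (l.+1 + e) i l.+1 - (\sum_(k < l.+2) cf k)%:R *: x a)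
    + pf (l.+1 + e) i l.+1) + 0.
  have -> : mono a b c = x a by rewrite /x /i; congr mono; lia.
  move: (x a) (pf _ _ _) (\sum_(k < l.+2) cf k)%:R cf0 => u v g g0.
  by rewrite addr0; lmod_with msame; field.
by apply: (Hl) => //; apply: Hl.
Qed.

(** The premises yield the sums of monomials (1 - s t)^(a+2M) s^b and (1 - s t)^a s^(b+2M), times
    powers of -t. For degree a + b >= 6m, [three_relations] gives every monomial separately;
    [mono_raise] then descends to the smaller degrees. *)
Lemma monos_in (S : Y -> Prop) m : S 0 -> (forall (c : K) u v, S u -> S v -> S (c *: u + v)) ->
  (forall M n i, (M == m) || (M == m.*2) -> (M <= n)%N -> (i <= n.*2)%N ->
    S (fun z => ((1 - z.1 * z.2) ^+ M.*2 + z.1 ^+ M.*2) * pf n.*2 i (n - M) z)) ->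
  forall n i, (i <= n.*2)%N -> S (pf n.*2 i n).
Proof.
move=> S0 Sl Srel.
have rel M q a b c : (M == m) || (M == m.*2) -> (a + b + M.*2 = q)%N -> (c <= q)%N ->
    S (mono (a + M.*2) b c + mono a (b + M.*2) c).
  move=> Mm abq cq; pose n := (a + b + M)%N.
  pose H (y : Y) := S (fun z => ((1 - z.1 * z.2) ^+ M.*2 + z.1 ^+ M.*2) * y z).
  have : H (mono a b c).
    apply: (@mono_span H (n - M) (n + M)).
    - rewrite /H; have := S0; congr S; apply/funext => z; by rewrite mulr0.
    - move=> k u v Hu Hv; have := Sl k _ _ Hu Hv; congr S; apply/funext => z.
      rewrite -[LHS]/(k * (_ * _) + _ * _) -[RHS]/(_ * (k * _ + _)) mulrDr mulrCA.
      by [].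
    - move=> j i jl je ij; have e1 : ((n - M - j) + (n + M - j) = (n - j).*2)%N by lia.
      rewrite e1 in ij *; have -> : (n - M - j = n - j - M)%N by lia.
      by apply: Srel => //; lia.
    - by rewrite /n; lia.
    by rewrite /n; lia.
  rewrite /H; congr S; apply/funext => z.
  rewrite -[RHS]/(_ * _ * _ + _ * _ * _) /mono !exprD.
  set x := _ ^+ a; set y := _ ^+ b; set w := _ ^+ c; set g := _ ^+ M.*2; set g' := _ ^+ M.*2.
  by ring.
have Sspan v : lspan S v -> S v by apply: lspan_closed.
have high q a c : (6 * m <= q)%N -> (a <= q)%N -> (c <= q)%N -> S (mono a (q - a) c).
  move=> mq aq cq; apply: Sspan.
  have r M : (M == m) || (M == m.*2) -> forall k, (k + M.*2 <= q)%N ->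
      lspan S (mono k (q - k) c + mono (k + M.*2) (q - (k + M.*2)) c).
    move=> Mm k kq; apply: lspan_gen; rewrite addrC.
    have -> : (q - k = q - (k + M.*2) + M.*2)%N by lia.
    by apply: (@rel M q k _ c) => //; lia.
  apply: (@three_relations K Y S (fun k => mono k (q - k) c) q m) => //.
    by apply: r; rewrite eqxx.
  by apply: r; rewrite eqxx orbT.
have all d a b c : (6 * m <= d + (a + b))%N -> (c <= a + b)%N -> S (mono a b c).
  elim: d a b c => [|d IHd] a b c mq cq.
    by have := high (a + b)%N a c mq (leq_addr _ _) cq; rewrite addKn.
  rewrite mono_raise -[_ - _]/(_ + _) -scaleN1r addrC; apply: Sl; apply: IHd; lia.
move=> n i i2; rewrite pfE.
elim/big_ind: _ => [//|u v Su Sv|k _]; first by have := Sl 1 _ _ Su Sv; rewrite scale1r.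
rewrite -[_ *: _]addr0; have [/eqP c0|c0] := boolP ('C(i, k) * 'C(n.*2 - i, n - k) == 0)%N.
  by rewrite c0 scale0r addr0.
apply: Sl => //; have := c0; rewrite muln_eq0 negb_or -!lt0n !bin_gt0 => /andP[k1 k2].
by have := ltn_ord k => kl; apply: (all (6 * m)%N); lia.
Qed.

Lemma poly_fun_eq0 (P : {poly K}) : (forall t, P.[t] = 0) -> P = 0.
Proof.
move=> P0; apply/eqP/contraT => Pn0.
pose rs : seq K := [seq k%:R | k <- iota 0 (size P)].
have r1 : all (root P) rs by apply/allP => x _; apply/eqP.
have r2 : uniq rs by rewrite map_inj_uniq ?iota_uniq// => a b /eqP; rewrite eqr_nat => /eqP.
by have := max_poly_roots Pn0 r1 r2; rewrite size_map size_iota ltnn.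
Qed.

Lemma nsum_pow_eq0 (a : nat -> K) : ev0 a -> (forall t, nsum (fun k => t ^+ k * a k) = 0) -> forall k, a k = 0.
Proof.
move=> [N hN] h; have P0 : \poly_(k < N) a k = 0.
  apply: poly_fun_eq0 => t; rewrite horner_poly -[RHS](h t) (@nsumE _ _ N) => [|k /hN ->]; last by rewrite mulr0.
  by apply: eq_bigr => k _; rewrite mulrC.
move=> k; have [/hN //|kN] := leqP N k.
by have := congr1 (fun P : {poly K} => P`_k) P0; rewrite coef_poly kN coef0.
Qed.

End Monomials.
Lemma add_carry (V : zmodType) (a b r s x : V) : a + b = r + s -> a + (x + b) = x + r + s.
Proof. by move=> e; rewrite addrCA e addrA. Qed.

Lemma add_carry2 (K : comPzRingType) (V : lmodType K) (a b r x w l l' : V) (c k : K) :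
  a + b = r + (l' - k *: w) -> a + (c *: (l - k *: x) + b) = r + (c *: l + l' - k *: (c *: x + w)).
Proof. by move=> e; rewrite addrCA e; lmod_with msame; ring. Qed.

Lemma add_zero_split (K : pzRingType) (V : lmodType K) (r l : V) (k : K) : l = 0 -> r + 0 = r + (l - k *: 0).
Proof. by move=> ->; rewrite scaler0 subrr. Qed.

Lemma scaleN1_split (K : pzRingType) (V : lmodType K) (a b r y : V) : -1 *: a + b = r + y -> y = 0 -> b = a + r.
Proof. by move=> e y0; rewrite -[r]addr0 -y0 -e scaleN1r addNKr. Qed.

Lemma scaleN1_cancel (K : pzRingType) (V : lmodType K) (x : V) : -1 *: x + x = 0.
Proof. by rewrite scaleN1r addNr. Qed.

Section PolTop.
Context {K : numFieldType}.

Lemma polsum_functional (V : lmodType K) (E : nat -> V) N (f : V -> K^o) n (x : K) (P : {poly K}) :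
  linear f -> (forall l, f (E l) = if l == n then x else 0) -> (n <= N)%N -> f (polsum E N P) = P`_n * x.
Proof.
move=> lf fE nN; have nN' : (n < N.+1)%N by [].
rewrite /polsum (lin_big lf) (bigD1 (Ordinal nN')) //= (linZ lf) fE eqxx big1 ?addr0// => l.
by rewrite -val_eqE /= => /negPf ln; rewrite (linZ lf) fE ln scaler0.
Qed.

Lemma pol_top0 N (s t : K) : (pol N s t 0)`_N = s ^+ N.
Proof.
rewrite pol_coef big_ord_recl big1 => [|a _]; last by rewrite lift0 bin0n !mul0r.
by rewrite !subn0 binn bin0 !expr0 !mul1r addr0.
Qed.

Lemma pol_topN N (s t : K) : (pol N s t N)`_N = (1 - s * t) ^+ N.
Proof.
rewrite pol_coef big_ord_recr big1 => [|a _] /=; last first.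
  by have := ltn_ord a => al; rewrite subnn bin0n (_ : (N - a == 0)%N = false) ?mul0r ?mulr0//; lia.
by rewrite !subnn !binn !expr0 !mulr1 mul1r add0r.
Qed.

End PolTop.

Section SpanSolve.
Context {K : fieldType} {V : lmodType K} (G : V -> Prop).
Variables (r l a e : V) (k : K).

Lemma lspan_solve : r + (l - k *: a) = 0 -> lspan G r -> lspan G l -> lspan G (k *: a).
Proof.
by rewrite addrA => /eqP; rewrite subr_eq0 => /eqP <-; exact: lspan_add.
Qed.

Lemma lspan_solve_left : r + (l - k *: a) = e -> lspan G r -> lspan G l -> lspan G (e + k *: a).
Proof. by move=> <- hr hl; rewrite addrA subrK; exact: lspan_add. Qed.

Lemma lspan_solve_next d : r + (l - k *: a) = 0 -> lspan G r -> lspan G (e + d *: l) ->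
  lspan G (e + (k * d) *: a).
Proof.
move=> h hr hl; have := lspan_lin d hr hl; congr lspan.
by rewrite addrCA -scalerDr mulrC -scalerA; move: h; rewrite addrA => /eqP; rewrite subr_eq0 => /eqP ->.
Qed.

End SpanSolve.

(** * The functional on W obtained from exp (s Q) exp (t Psi Q Psi), and the nilpotency of L(-2) *)

Section Exponentials.
Context {R : realType} (p : nat).
Local Notation C := R[i].
Local Notation V := (fock R).
Local Notation es := (@es R).
Local Notation pp := (@pp R p).
Local Notation wh := (@wh R p).
Local Notation L := (@L R p).
Local Notation mode := (@md R p).
Local Notation vv := (@vv R p).
Local Notation ee := (@ee R p).
Local Notation Qo := (@Qo R p).
Local Notation inW := (@inW R p).
Hypothesis p2 : (2 <= p)%N.
Let p0 : (0 < p)%N. Proof. exact: ltnW. Qed.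

Definition dQ n v : V := n`!%:R^-1 *: iter n Qo v.

Lemma factR_neq0 n : n`!%:R != 0 :> C.
Proof. by rewrite pnatr_eq0 -lt0n fact_gt0. Qed.

Lemma Qo_dQ n v : Qo (dQ n v) = n.+1%:R *: dQ n.+1 v.
Proof.
rewrite /dQ (linZ (Qo_lin p)) scalerA factS natrM invfM mulrA divff ?mul1r//.
by rewrite pnatr_eq0.
Qed.

Lemma dQ_lin n : linear (dQ n).
Proof. exact: (lin_scale _ (iter_Qo_lin p n)). Qed.

Lemma dQ0 v : dQ 0 v = v.
Proof. by rewrite /dQ fact0 invr1 scale1r. Qed.

Lemma inW_iterQo n v : inW v -> inW (iter n Qo v).
Proof. by move=> Wv; elim: n => //= n; exact: (@inW_Qo R p p2). Qed.

Lemma inW_dQ n v : inW v -> inW (dQ n v).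
Proof. by move=> Wv; exact: (inWZ _ (inW_iterQo n Wv)). Qed.

Lemma dQ_ev0 v : inW v -> ev0 (fun n => dQ n v).
Proof.
move=> Wv; suff [N hN] : ev0 (fun n => iter n Qo v) by exists N => i /hN; rewrite /dQ => ->; rewrite scaler0.
move: v Wv; apply: (@inW_ind R p p2 (fun v => ev0 (fun n => iter n Qo v))) => [|c u v _ _ [N hN] [N' hN']|s w v vw _].
- by exists 0%N => i _; exact: (lin0 (iter_Qo_lin p i)).
- exists (maxn N N') => i; rewrite geq_max => /andP[/hN e /hN' e'].
  by rewrite (lin_elim (iter_Qo_lin p i)) e e' scaler0 addr0.
by have [k] := Qo_nilpotent p2 vw; apply: iter_ev0; exact: (lin0 (Qo_lin p)).
Qed.

Lemma dQ_mode n u j v : inW u -> inW v ->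
  dQ n (mode u j v) = \sum_(i < n.+1) mode (dQ i u) j (dQ (n - i) v).
Proof.
move=> Wu Wv; elim: n => [|n IHn]; first by rewrite big_ord1 !dQ0.
have n0 : n.+1%:R != 0 :> C by rewrite pnatr_eq0.
apply: (scalerI n0); rewrite -Qo_dQ IHn (lin_big (Qo_lin p)).
apply: eq_trans _ (leibniz_sum (fun i q => mode (dQ i u) j (dQ q v)) n); apply: eq_bigr => i _.
rewrite (@Qo_mode R p p2)//; [|exact: inW_dQ|exact: inW_dQ].
rewrite 2!Qo_dQ; congr (_ + _).
  exact: (linZ (@mode_lin R p j _)).
exact: (linZ (@mode_linr R p _ j)).
Qed.

Lemma dQ_L k n v : inW v -> dQ k (L n v) = L n (dQ k v).
Proof.
move=> Wv; rewrite /dQ L_Z; congr (_ *: _); elim: k => //= k ->.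
by rewrite (@Qo_L R p p2)//; exact: inW_iterQo.
Qed.

(** exp (s Q), a finite sum on each vector of W. Since Q is a derivation, this is an automorphism
    ([Xs_mode]). *)
Definition Xs (s : C) v : V := nsum (fun k => s ^+ k *: dQ k v).

Lemma Xs_ev0 s v : inW v -> ev0 (fun k => s ^+ k *: dQ k v).
Proof. by move=> /dQ_ev0[N hN]; exists N => i /hN ->; rewrite scaler0. Qed.

Lemma Xs_lin s (c : C) u v : inW u -> inW v -> Xs s (c *: u + v) = c *: Xs s u + Xs s v.
Proof.
move=> Wu Wv; rewrite /Xs -nsumZ ?[in RHS]nsumD; try (try apply: ev0Z; exact: Xs_ev0).
rewrite -nsumD; [|by apply: ev0Z; exact: Xs_ev0|exact: Xs_ev0].
apply: eq_nsum => k; rewrite (lin_elim (dQ_lin k)); set a := s ^+ k; set x := dQ _ _; set y := dQ _ _.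
by lmod.
Qed.

Lemma Xs_W s v : inW v -> inW (Xs s v).
Proof.
move=> Wv; have [N hN] := Xs_ev0 s Wv; rewrite /Xs (nsumE hN).
by apply: (@inW_sum R p) => i; exact: inW_dQ.
Qed.

Lemma Xs_mode s u j v : inW u -> inW v -> Xs s (mode u j v) = mode (Xs s u) j (Xs s v).
Proof.
move=> Wu Wv; pose G i q := mode (s ^+ i *: dQ i u) j (s ^+ q *: dQ q v).
have -> : Xs s (mode u j v) = nsum (fun t => \sum_(i < t.+1) G i (t - i)%N).
  apply: eq_nsum => t; rewrite dQ_mode// scaler_sumr; apply: eq_bigr => i _.
  have it : (i <= t)%N by rewrite -ltnS.
  apply: esym; apply: eq_trans (linZ (@mode_lin R p j _) _ _) _.
  apply: eq_trans (congr1 (fun x => s ^+ i *: x) (linZ (@mode_linr R p _ j) _ _)) _.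
  exact: scale_exp_split.
have [N hN] := Xs_ev0 s Wu; have [N' hN'] := Xs_ev0 s Wv.
rewrite -nsum_conv; last first.
  exists (N + N')%N => i q iq; rewrite /G; have [Ni|iN] := leqP N i; first by rewrite hN// mode0.
  by rewrite (hN' q) ?mode0r//; lia.
rewrite /Xs (lin_nsum (@mode_lin R p j _)); last by exists N.
by apply: eq_nsum => i; rewrite (lin_nsum (@mode_linr R p _ j))//; exists N'.
Qed.

Lemma Xs_L s n v : inW v -> Xs s (L n v) = L n (Xs s v).
Proof.
move=> Wv; rewrite /Xs (lin_nsum (L_lin p n)); last exact: Xs_ev0.
by apply: eq_nsum => k; rewrite dQ_L// L_Z.
Qed.

Lemma dQ_ee n i k : (i <= n.*2)%N -> dQ k (ee n i) = 'C(n.*2 - i, k)%:R *: ee n (i + k).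
Proof.
move=> i2; elim: k => [|k IHk]; first by rewrite dQ0 bin0 scale1r addn0.
have k0 : k.+1%:R != 0 :> C by rewrite pnatr_eq0.
have e1 : k.+1%:R *: dQ k.+1 (ee n i) = 'C(n.*2 - i, k)%:R *: Qo (ee n (i + k)).
  by rewrite -Qo_dQ IHk; exact: (linZ (Qo_lin p)).
apply: (scalerI k0); apply: eq_trans e1 _.
have [h|h] := leqP (i + k) n.*2; last first.
  by rewrite !bin_small ?scale0r ?scaler0//; lia.
rewrite (@Qo_ee R p n _ h) addnS; apply: binomial_step; rewrite -!natrM mulnC mul_bin_left.
by rewrite subnDA.
Qed.

Lemma Xs_ee s n i : (i <= n.*2)%N -> Xs s (ee n i) = xsum (ee n) n.*2 s i.
Proof.
move=> i2; rewrite /Xs (@nsumE _ _ (n.*2 - i).+1) => [|k hk].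
  by apply: eq_bigr => k _; rewrite (dQ_ee k i2); exact: scalerA.
by rewrite (dQ_ee k i2) bin_small// scale0r scaler0.
Qed.

Definition vphi n : {poly C} -> V := polsum (ee n) n.*2.

Variable Psi : V -> V.
Hypothesis psi_lin : forall (c : C) u v, inW u -> inW v -> Psi (c *: u + v) = c *: Psi u + Psi v.
Hypothesis psi_W : forall v, inW v -> inW (Psi v).
Hypothesis psi_L : forall n v, inW v -> Psi (L n v) = L n (Psi v).
Hypothesis psi_mode : forall u n v, inW u -> inW v -> Psi (mode u n v) = mode (Psi u) n (Psi v).
Hypothesis psi_vv : forall n i, (i <= n.*2)%N ->
  Psi (vv n i) = ((-1) ^+ i * i`!%:R / (n.*2 - i)`!%:R) *: vv n (n.*2 - i).
Hypothesis psiK : forall v, inW v -> Psi (Psi v) = v.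

Definition Ys (t : C) v : V := Psi (Xs t (Psi v)).

Lemma Ys_W t v : inW v -> inW (Ys t v).
Proof. by move=> Wv; apply: psi_W; apply: Xs_W; exact: psi_W. Qed.

Lemma Ys_ee t n i : (i <= n.*2)%N ->
  Ys t (ee n i) = \sum_(k < i.+1) ((- t) ^+ k * 'C(i, k)%:R) *: ee n (i - k).
Proof.
move=> i2; have i2' : (n.*2 - i <= n.*2)%N by exact: leq_subr.
have XZ : Xs t ((-1) ^+ i *: ee n (n.*2 - i)) = (-1) ^+ i *: Xs t (ee n (n.*2 - i)).
  exact: (lin_onZ (inW0 p) (Xs_lin t) _ (inW_ee p2 n (n.*2 - i))).
rewrite /Ys (psi_ee p2 psi_lin psi_vv i2) XZ (Xs_ee t i2').
have PZ c v : inW v -> Psi (c *: v) = c *: Psi v by exact: (lin_onZ (inW0 p) psi_lin).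
rewrite PZ; last by apply: (@inW_sum R p) => k; exact: (inW_ee p2).
rewrite /xsum (psi_sum psi_lin) => [|k]; last exact: (inW_ee p2).
apply: (@reflected_sum _ _ (ee n) n (fun q => Psi (ee n q)) t i i2) => k ki; apply: eq_trans (psi_ee p2 psi_lin psi_vv _) _; first by lia.
have -> : (n.*2 - (n.*2 - i + k) = i - k)%N by lia.
exact: erefl.
Qed.

(* exp (s Q) exp (t Psi Q Psi). *)
Definition gg s t v := Xs s (Ys t v).

Lemma gg_lin s t (c : C) u v : inW u -> inW v -> gg s t (c *: u + v) = c *: gg s t u + gg s t v.
Proof.
move=> Wu Wv; have Pu := psi_W Wu; have Pv := psi_W Wv.
rewrite /gg /Ys (psi_lin c Wu Wv) (Xs_lin t c Pu Pv) (psi_lin c (Xs_W t Pu) (Xs_W t Pv)).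
exact: (Xs_lin s c (Ys_W t Wu) (Ys_W t Wv)).
Qed.

Lemma gg_mode s t u j v : inW u -> inW v -> gg s t (mode u j v) = mode (gg s t u) j (gg s t v).
Proof.
move=> Wu Wv; have Pu := psi_W Wu; have Pv := psi_W Wv.
rewrite /gg /Ys (psi_mode j Wu Wv) (Xs_mode t j Pu Pv) (psi_mode j (Xs_W t Pu) (Xs_W t Pv)).
exact: (Xs_mode s j (Ys_W t Wu) (Ys_W t Wv)).
Qed.

Lemma gg_L s t n v : inW v -> gg s t (L n v) = L n (gg s t v).
Proof.
move=> Wv; have Pv := psi_W Wv.
rewrite /gg /Ys (psi_L n Wv) (Xs_L t n Pv) (psi_L n (Xs_W t Pv)).
exact: (Xs_L s n (Ys_W t Wv)).
Qed.

Lemma gg_ee s t n i : (i <= n.*2)%N -> gg s t (ee n i) = vphi n (pol n.*2 s t i).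
Proof.
move=> i2; rewrite /gg (Ys_ee t i2).
rewrite (lin_on_sum (inW0 p) (@inWP R p) (Xs_lin s)) => [|k]; last exact: (inW_ee p2).
apply: eq_trans _ (binomial_sum (ee n) s t i2); apply: eq_bigr => k _.
by rewrite Xs_ee//; lia.
Qed.

Definition c0part : V -> V := kp (fun b : fock_basis => b.2) 0.

Lemma c0part_chg v : chg 0 (c0part v). Proof. exact: kp_khom. Qed.

Lemma c0part_L n v : c0part (L n v) = L n (c0part v).
Proof.
apply: esym; apply: (@kp_comm R _ (fun b : fock_basis => b.2) (L n) id) => //; first exact: L_lin.
by move=> x u ux; exact: (@L_chg R p p0 n x u ux).
Qed.

Definition hat (w : V) : C * C -> C^o := fun z => eps (c0part (gg z.1 z.2 w)).

Lemma c0part_lin : linear c0part. Proof. exact: kp_lin. Qed.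

Lemma hat_lin (c : C) u v : inW u -> inW v -> hat (c *: u + v) = c *: hat u + hat v.
Proof.
move=> Wu Wv; apply/funext => z; rewrite /hat (gg_lin z.1 z.2 c Wu Wv) (lin_elim c0part_lin).
exact: eps_lin.
Qed.

(** [eps] lets L(-1) act as the charge, which is 0 after projection, and the L(-k) with k >= 3 as
    0. *)
Lemma hat_L n w : inW w -> n < 0 -> n != -2 -> hat (L n w) = 0.
Proof.
move=> Ww n0 n2; apply/funext => z; rewrite /hat (gg_L z.1 z.2 n Ww) c0part_L.
case: n n0 n2 => // k _ k1; rewrite (@eps_L R p p0 k 0 _ (@c0part_chg _)).
by case: k k1 => [|[|k]] _ //; rewrite ?rmorph0 mul0r.
Qed.

Lemma hat_L2 w : inW w -> hat (L (-2) w) = (pp * 2)^-1 *: hat w.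
Proof.
move=> Ww; apply/funext => z; rewrite /hat (gg_L z.1 z.2 (-2) Ww) c0part_L.
exact: (@eps_L R p p0 1 0 _ (@c0part_chg _)).
Qed.

Variable m : nat.
Hypothesis m0 : (0 < m)%N.
Local Notation Rel := (lspan (@Rgen R p Psi m)).
Local Notation Uv := (@Uv R Psi).
Let psiee := @psi_ee R p p2 Psi psi_lin psi_vv.
Let inWe := @inW_ee R p p2.

Lemma ee_wh n l : wh (l%:R - n%:R) (hw p (- n%:R)) (ee n l).
Proof. exact: (@supp_inZ R _ (n.*2 - l)`!%:R _ (@vv_wh R p n l)). Qed.

Lemma ee_chg n l : chg (l%:R - n%:R) (ee n l).
Proof. exact: (@wh_chg R p _ _ _ (@ee_wh n l)). Qed.

Definition ec (v : V) : C^o := eps (c0part v).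

Lemma ec_linear : linear ec.
Proof. exact: (lin_comp (@eps_linear R) c0part_lin). Qed.

Lemma ec_chg x v : chg x v -> ec v = if x == 0 then eps v else 0.
Proof.
move=> vx; rewrite /ec /c0part; have [x0|x0] := eqVneq x 0.
  by rewrite x0 in vx; rewrite (@kp_id _ _ _ _ _ vx).
by rewrite (@kp_neq R _ _ x 0 v) ?eps0// eq_sym.
Qed.

Lemma ec_ee n l : ec (ee n l) = if l == n then eps (ee n n) else 0.
Proof.
rewrite (@ec_chg _ _ (@ee_chg n l)) subr_eq0 eqr_nat.
by case: eqP => [->|].
Qed.

Lemma ec_phi n P : ec (vphi n P) = P`_n * eps (ee n n).
Proof.
apply: (polsum_functional _ ec_linear) => [l|]; first exact: ec_ee.
by lia.
Qed.

Lemma hatE w z : hat w z = ec (gg z.1 z.2 w). Proof. by []. Qed.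

Lemma hat_ee n i : (i <= n.*2)%N -> hat (ee n i) = eps (ee n n) *: pf n.*2 i n.
Proof. by move=> i2; apply/funext => z; rewrite hatE (gg_ee z.1 z.2 i2) ec_phi mulrC. Qed.

Lemma eps_ee_neq0 n l : (l <= n.*2)%N -> eps (ee n l) != 0.
Proof.
move=> l2; rewrite /ee epsZ mulf_neq0 ?factR_neq0//.
exact: (eps_singular p0 (@vv_wh R p n l) (@vv_singular R p p2 n l) (vv_neq0 psi_lin psi_vv l2)).
Qed.

(** Charge zero pairs the a-th basis vector of the first form only with index n + M - a of the
    second. *)
Lemma ec_mode M n P P' j : (M <= n)%N -> ec (mode (vphi M P) j (vphi n P')) =
  \sum_(a < M.*2.+1) (P`_a * P'`_(n + M - a)) * eps (mode (ee M a) j (ee n (n + M - a))).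
Proof.
move=> Mn; rewrite /vphi /polsum (lin_big (@mode_lin R p j _)) (lin_big ec_linear).
apply: eq_bigr => a _; have aM := ltn_ord a.
have e1 : ec (mode (P`_a *: ee M a) j (\sum_(l < n.*2.+1) P'`_l *: ee n l)) =
    P`_a *: ec (mode (ee M a) j (\sum_(l < n.*2.+1) P'`_l *: ee n l)).
  apply: eq_trans (linZ ec_linear _ _); congr ec; exact: (linZ (@mode_lin R p j _)).
rewrite e1 (lin_big (@mode_linr R p _ j)) (lin_big ec_linear).
have e2 l : ec (mode (ee M a) j (P'`_l *: ee n l)) = if l == (n + M - a)%N then P'`_l * eps (mode (ee M a) j (ee n l)) else 0.
  apply: eq_trans (congr1 ec (linZ (@mode_linr R p _ j) _ _)) _.
  apply: eq_trans (linZ ec_linear _ _) _.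
  have := @mode_chg R p _ _ j _ _ (@ee_chg M a) (@ee_chg n l) => cl; rewrite (@ec_chg _ _ cl).
  have -> : (a%:R - M%:R + (l%:R - n%:R) == 0 :> rat) = (l == n + M - a)%N.
    rewrite (_ : a%:R - M%:R + (l%:R - n%:R) = (a + l)%:R - (n + M)%:R); last by rewrite !natrD; ring.
    by rewrite subr_eq0 eqr_nat; apply/eqP/eqP; lia.
  by case: eqP => // _; exact: scaler0.
under eq_bigr => l _ do rewrite e2.
have ln : (n + M - a < n.*2.+1)%N by lia.
rewrite (bigD1 (Ordinal ln)) //= eqxx big1 ?addr0 => [|l]; last by rewrite -val_eqE /= => /negPf ->.
exact: mulrA.
Qed.

Definition Shat (y : C * C -> C^o) := exists2 r, Rel r & hat r = y.

Lemma Rel_W r : Rel r -> inW r.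
Proof. by apply: lspan_W => g; exact: (Rgen_W p2 psi_W). Qed.

Lemma Shat_lin (c : C) u v : Shat u -> Shat v -> Shat (c *: u + v).
Proof.
move=> [r hr <-] [r' hr' <-]; exists (c *: r + r'); first exact: lspan_lin.
by rewrite hat_lin//; exact: Rel_W.
Qed.

Lemma Shat0 : Shat 0.
Proof. by exists 0; [exact: lspan0|exact: (lin_on0 (inW0 p) hat_lin)]. Qed.

Definition PU M (z : C * C) : {poly C} := (M.*2)`!%:R^-1 *: (pol M.*2 z.1 z.2 0 + pol M.*2 z.1 z.2 M.*2).

Lemma gg_Uv M z : gg z.1 z.2 (Uv M) = vphi M (PU M z).
Proof.
rewrite (UvE psi_vv M) (lin_onZ (inW0 p) (gg_lin z.1 z.2)); last exact: (inWD (inWe M 0) (inWe M M.*2)).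
have := gg_lin z.1 z.2 1 (inWe M 0) (inWe M M.*2); rewrite !scale1r => ->.
rewrite (gg_ee _ _ (leq0n _)) (gg_ee _ _ (leqnn _)) /PU.
have := polsum_lin (ee M) M.*2 1 (pol M.*2 z.1 z.2 0) (pol M.*2 z.1 z.2 M.*2); rewrite !scale1r => e.
have e2 := polsum_lin (ee M) M.*2 (M.*2)`!%:R^-1 (pol M.*2 z.1 z.2 0 + pol M.*2 z.1 z.2 M.*2) 0.
by rewrite /vphi -e; move: e2; rewrite polsum0 !addr0.
Qed.

Lemma PU_top M z : (PU M z)`_M.*2 = (M.*2)`!%:R^-1 * ((1 - z.1 * z.2) ^+ M.*2 + z.1 ^+ M.*2).
Proof.
by rewrite /PU coefZ coefD pol_top0 pol_topN [X in _ * X]addrC.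
Qed.

(** The values of [hat] on the vectors (U_M)_j [ee n i], j <= -2, are sums over the charges k = a -
    M of coefficients of exp (k z) times negative powers of z. Separating the exponent k = M, that
    is a = 2M, leaves the top coefficient [PU_top] times [pf]; its scalar is non-zero by
    [eps_ee_neq0]. *)
Lemma Shat_rel M n i : (M == m) || (M == m.*2) -> (M <= n)%N -> (i <= n.*2)%N ->
  Shat (fun z => ((1 - z.1 * z.2) ^+ M.*2 + z.1 ^+ M.*2) * pf n.*2 i (n - M) z).
Proof.
move=> Mm Mn i2; pose k (a : 'I_M.*2.+1) : int := a%:Z - M%:Z.
have kE a : (k a)%:~R = a%:R - M%:R :> rat by rewrite rmorphB.
have kN a : - (k a)%:~R = (n + M - a)%N%:R - n%:R :> rat.
  by have := ltn_ord a => aM; rewrite kE natrB ?natrD; [ring|lia].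
have ex (a : 'I_M.*2.+1) : exists P : {poly C}, P`_0 = eps (ee M a) * eps (ee n (n + M - a)) /\
    forall j, eps (mode (ee M a) j (ee n (n + M - a))) = epw (ratr (k a)%:~R) P (- j - 1 + 2 * p%:Z * k a ^+ 2).
  apply: (mode_expansion p0); first by rewrite kE; exact: ee_chg.
  by rewrite kN; exact: ee_chg.
have [E EP] := boolp.choice ex.
pose D := (\sum_a size (E a)).+1.
have ED a : (size (E a) <= D)%N by rewrite /D (bigD1 a)//= -addnS leq_addr.
pose h (a : 'I_M.*2.+1) : C := ratr (k a)%:~R.
pose e (a : 'I_M.*2.+1) := (2 * p * (`|k a| * `|k a|))%N.
pose F (a : 'I_M.*2.+1) d : C * C -> C^o := (E a)`_d *: (fun z => (PU M z)`_a * pf n.*2 i (n + M - a) z).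
have hI : injective h.
  move=> a b /fmorph_inj/eqP; rewrite eqr_int => /eqP; rewrite /k => ab.
  by apply: val_inj => /=; lia.
have Sx N : Shat (\sum_a \sum_(d < D) pw (h a) (N.+1 + (e a + d))%N *: F a d).
  (* Then -j - 1 = N + 1, and j <= -2 for every N, so all these modes lie in [Rel]. *)
  pose j : int := - N.+2%:Z.
  exists (mode (Uv M) j (ee n i)).
    by apply: lspan_gen; apply: Rgen_U => //; rewrite /j; lia.
  apply/funext => z; rewrite hatE gg_mode; [|exact: (inW_Uv p2 psi_W)|exact: inWe].
  rewrite gg_Uv (gg_ee _ _ i2) (ec_mode _ _ _ Mn) fct_sumE; apply: eq_bigr => a _.
  rewrite (EP a).2 (epwE _ _ (ED a)) mulr_sumr fct_sumE; apply: eq_bigr => d _.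
  rewrite /F -/(h a) -[RHS]/(_ * (_ * (_ * _))).
  have -> : - j - 1 + 2 * p%:Z * k a ^+ 2 + d%:Z = (N.+1 + (e a + d))%N.
    rewrite /j /e !PoszD !PoszM; set q := k a.
    have -> : `|q|%N%:Z * `|q|%N%:Z = q ^+ 2 by rewrite abszE -normrM ger0_norm ?expr2// -expr2 sqr_ge0.
    by set X := q ^+ 2; lia.
  by rewrite mulrC mulrA [_ * pw _ _]mulrC -mulrA.
have am : (M.*2 < M.*2.+1)%N by [].
have := @exponential_separation_fin C _ Shat _ h e D F Shat0 Shat_lin hI Sx (Ordinal am).
rewrite /F /=; set c := (E _)`_0; set y := (fun z => _) => Sy.
have {}Sy : Shat (c *: y).
  apply: Sy => //; rewrite /h fmorph_eq0 intr_eq0 /k /=.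
  by have /orP[/eqP ->|/eqP ->] := Mm; lia.
have c0 : c != 0.
  rewrite /c (EP _).1 mulf_neq0//; apply: eps_ee_neq0 => /=; lia.
have := Shat_lin ((M.*2)`!%:R / c) Sy Shat0; congr Shat; rewrite addr0 scalerA divfK//.
apply/funext => z; rewrite -[LHS]/(_ * (_ * _)) PU_top (_ : (n + M - M.*2 = n - M)%N); last by lia.
by rewrite -mulrA mulrA mulfV ?factR_neq0// mul1r.
Qed.

Lemma Shat_ee n i : (i <= n.*2)%N -> Shat (hat (ee n i)).
Proof.
move=> i2; rewrite (hat_ee i2) -[_ *: _]addr0; apply: Shat_lin; last exact: Shat0.
exact: (monos_in Shat0 Shat_lin Shat_rel i2).
Qed.

Definition dQm k v := Psi (dQ k (Psi v)).

Lemma inW_dQm k v : inW v -> inW (dQm k v).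
Proof. by move=> Wv; apply: psi_W; apply: inW_dQ; exact: psi_W. Qed.

Lemma dQm_lin k (c : C) u v : inW u -> inW v -> dQm k (c *: u + v) = c *: dQm k u + dQm k v.
Proof.
move=> Wu Wv; rewrite /dQm (psi_lin c Wu Wv) (lin_elim (dQ_lin k)).
exact: (psi_lin c (inW_dQ k (psi_W Wu)) (inW_dQ k (psi_W Wv))).
Qed.

Lemma Ys_sum v : inW v -> exists N, (forall k, (N <= k)%N -> dQm k v = 0) /\
  forall t, Ys t v = \sum_(k < N) t ^+ k *: dQm k v.
Proof.
move=> Wv; have Pv := psi_W Wv; have [N hN] := dQ_ev0 Pv; exists N; split=> [k /hN e|t].
  by rewrite /dQm e; exact: (psi0 psi_lin).
rewrite /Ys /Xs (@nsumE _ _ N) => [|k /hN ->]; last by rewrite scaler0.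
by rewrite (psi_sum psi_lin) => [|k]; last exact: inW_dQ.
Qed.

(** The function is polynomial in s and t; its coefficient of s^j t^k is the quantity on the
    right. *)
Lemma hat_eq0 v : inW v -> hat v = 0 -> forall j k, ec (dQ j (dQm k v)) = 0.
Proof.
move=> Wv hv; have [N [hN YE]] := Ys_sum Wv.
have Xz s k : ec (Xs s (dQm k v)) = 0.
  move: k; apply: (@nsum_pow_eq0 C (fun k => ec (Xs s (dQm k v)))) => [|t].
    exists N => k /hN ->; rewrite (lin_on0 (inW0 p) (Xs_lin s)); exact: (lin0 ec_linear).
  rewrite (@nsumE _ _ N) => [|k /hN ->]; last first.
    by rewrite (lin_on0 (inW0 p) (Xs_lin s)) (lin0 ec_linear) mulr0.
  have := congr1 (fun y : C * C -> C^o => y (s, t)) hv; rewrite hatE /= /gg YE.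
  rewrite (lin_on_sum (inW0 p) (@inWP R p) (Xs_lin s)) => [|k]; last exact: inW_dQm.
  by rewrite (lin_big ec_linear) => h; apply: eq_trans _ h; apply: eq_bigr => k _; rewrite (linZ ec_linear).
move=> j k; have Wk := inW_dQm k Wv; move: j; apply: (@nsum_pow_eq0 C (fun j => ec (dQ j (dQm k v)))) => [|s].
  by have [N' hN'] := dQ_ev0 Wk; exists N' => i /hN' ->; exact: (lin0 ec_linear).
have := Xz s k; rewrite /Xs (lin_nsum ec_linear); last exact: Xs_ev0.
move=> h; apply: eq_trans _ h; apply: eq_nsum => i; exact: esym (linZ ec_linear _ _).
Qed.

Lemma dQm_ee_gt n i k : (i <= n.*2)%N -> (i < k)%N -> dQm k (ee n i) = 0.
Proof.
move=> i2 ik; rewrite /dQm (psiee i2) (linZ (dQ_lin k)) dQ_ee ?leq_subr// subKn// bin_small//.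
by rewrite scale0r scaler0; exact: (psi0 psi_lin).
Qed.

Lemma dQm_ee n i : (i <= n.*2)%N -> exists2 c : C, c != 0 & dQm i (ee n i) = c *: ee n 0.
Proof.
move=> i2; exists ((-1) ^+ i * (-1) ^+ n.*2); first by rewrite mulf_neq0 ?signr_eq0.
rewrite /dQm (psiee i2) (linZ (dQ_lin i)) dQ_ee ?leq_subr// subKn// binn subnK// scale1r.
rewrite (psiZ psi_lin); last exact: inWe.
by rewrite (psiee (leqnn _)) subnn scalerA.
Qed.

Variant eeg (I : nat) : V -> Prop :=
| Eeg n i of (i < I)%N & (i <= n.*2)%N : eeg I (ee n i).

Lemma eeg_W I g : eeg I g -> inW g. Proof. by case=> n i _ _; exact: inWe. Qed.

(** The layer i = I is stored as a polynomial whose n-th coefficient multiplies [ee n I]; N is any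
    large enough truncation. *)
Lemma eeg_split I y : lspan (eeg I.+1) y -> exists y' (P : {poly C}) N0, lspan (eeg I) y' /\
  forall N, (N0 <= N)%N -> y = y' + polsum (fun n => if (I <= n.*2)%N then ee n I else 0) N P.
Proof.
pose E n := if (I <= n.*2)%N then ee n I else 0.
elim=> [|c g u Gg _ [y' [P [N0 [hy' yE]]]]].
  by exists 0, 0, 0%N; split; [exact: lspan0|move=> N _; rewrite polsum0 addr0].
case: Gg => n i; rewrite ltnS leq_eqVlt => /orP[/eqP -> i2|iI i2]; last first.
  exists (c *: ee n i + y'), P, N0; split; first by apply: lspan_cons => //; exact: Eeg.
  by move=> N /yE ->; exact: addrA.
exists y', (c *: 'X^n + P), (maxn n N0); split=> // N; rewrite geq_max => /andP[nN /yE ->].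
rewrite polsum_lin polsumX// i2; set a := polsum _ _ _; set b := ee _ _; by lmod.
Qed.

(** Induction on the largest index i = I. The I-th divided lowering kills smaller i and sends
    [ee n I] to a multiple of [ee n 0]; after j raisings only n = j has charge 0, so the
    coefficients of the layer I vanish one by one. *)
Lemma hat_span_eq0 I y : lspan (eeg I) y -> hat y = 0 -> y = 0.
Proof.
elim: I y => [|I IHI] y.
  by move=> ly _; apply: (@lspan_closed _ _ (eeg 0) (fun y => y = 0) erefl _ _ y ly) => [c u v -> ->|g []//];
    rewrite scaler0 addr0.
move=> ly hy; have [y' [P [N0 [ly' yE]]]] := eeg_split ly.
pose E n := if (I <= n.*2)%N then ee n I else 0.
have WE n : inW (E n) by rewrite /E; case: ifP => _; [exact: inWe|exact: inW0].
have Wy' : inW y' by apply: (lspan_W (@eeg_W I) ly').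
have Wy : inW y by apply: (lspan_W (@eeg_W I.+1) ly).
have d0 : dQm I y' = 0.
  suff [] : inW y' /\ dQm I y' = 0 by [].
  apply: (@lspan_closed _ _ (eeg I) (fun y' => inW y' /\ dQm I y' = 0)) ly'.
  - by split; [exact: inW0|exact: (lin_on0 (inW0 p) (dQm_lin I))].
  - move=> c u v [Wu du] [Wv dv]; split; first exact: inWP.
    by rewrite dQm_lin// du dv scaler0 addr0.
  by move=> _ [n i iI i2]; split; [exact: inWe|exact: dQm_ee_gt].
have Pj j : (I <= j.*2)%N -> P`_j = 0.
  move=> Ij; pose N := maxn N0 j; have := hat_eq0 Wy hy j I.
  have WP : inW (polsum E N P) by apply: (@inW_sum R p).
  have := dQm_lin I 1 Wy' WP; rewrite !scale1r -(yE N (leq_maxl _ _)) d0 add0r => ->.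
  rewrite /polsum (lin_on_sum (inW0 p) (@inWP R p) (dQm_lin I))// (lin_big (dQ_lin j)) (lin_big ec_linear).
  have jN : (j < N.+1)%N by rewrite ltnS leq_maxr.
  have dE l : ec (dQ j (P`_l *: dQm I (E l))) = P`_l * ec (dQ j (dQm I (E l))).
    apply: eq_trans (congr1 ec (linZ (dQ_lin j) _ _)) _; exact: (linZ ec_linear).
  under eq_bigr => l _ do rewrite dE.
  rewrite (bigD1 (Ordinal jN)) //= big1 => [|l lj]; last first.
    have [Il|Il] := boolP (I <= l.*2)%N; last first.
      by rewrite /E (negPf Il) (lin_on0 (inW0 p) (dQm_lin I)) (lin0 (dQ_lin j)) (lin0 ec_linear) mulr0.
    have [c _ ce] := dQm_ee Il; rewrite /E Il ce (linZ (dQ_lin j)) (linZ ec_linear) dQ_ee//.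
    rewrite (linZ ec_linear) ec_ee add0n eq_sym.
    by have := lj; rewrite -val_eqE /= => /negPf ->; rewrite !scaler0 mulr0.
  have [c c0 ce] := dQm_ee Ij; rewrite /E Ij ce (linZ (dQ_lin j)) (linZ ec_linear) dQ_ee//.
  rewrite (linZ ec_linear) ec_ee add0n eqxx subn0 addr0 => /eqP.
  rewrite mulf_eq0 => /orP[/eqP //|]; rewrite [_ *: _ == _]mulf_eq0 (negPf c0) /=.
  rewrite [_ == _]mulf_eq0 pnatr_eq0 -leqn0 leqNgt bin_gt0 (negPf (eps_ee_neq0 _)) ?orbF; last by lia.
  by move=> /negP[]; lia.
have yy : y = y'.
  rewrite (yE N0 (leqnn _)) /polsum big1 ?addr0// => l _.
  by case: ifP => [/Pj ->|_]; rewrite ?scale0r ?scaler0.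
have hy' : hat y' = 0 by exact: (eq_trans (congr1 hat (esym yy)) hy).
exact: (eq_trans yy (IHI y' ly' hy')).
Qed.

Let k0 : C := (pp * 2)^-1.

Variant R1gen : V -> Prop :=
| R1_L n w of inW w & n < 0 & n != -2 : R1gen (L n w)
| R1_2 w of inW w : R1gen (L (-2) w - k0 *: w).

Lemma R1_W g : R1gen g -> inW g.
Proof.
case=> [n w Ww _ _|w Ww]; first exact: (W_L p2).
have := inWP (- k0) Ww (W_L p2 (-2) Ww); rewrite addrC scaleNr.
by [].
Qed.

Lemma hat_R1 r : lspan R1gen r -> hat r = 0.
Proof.
move=> lr; suff [] : inW r /\ hat r = 0 by [].
apply: (@lspan_closed _ _ R1gen (fun r => inW r /\ hat r = 0)) lr.
- by split; [exact: inW0|exact: (lin_on0 (inW0 p) hat_lin)].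
- move=> c u v [Wu du] [Wv dv]; split; first exact: inWP.
  by rewrite hat_lin// du dv scaler0 addr0.
move=> g Gg; split; first exact: R1_W.
case: Gg => [n w Ww n0 n2|w Ww]; first exact: hat_L.
have := hat_lin (- k0) Ww (W_L p2 (-2) Ww); rewrite hat_L2// scaleNr addrC => ->.
by rewrite scaleNr addNr.
Qed.

Lemma W_reduce w : inW w -> exists r y I, [/\ lspan R1gen r, lspan (eeg I) y & w = r + y].
Proof.
have eeg_mono I I' y : (I <= I')%N -> lspan (eeg I) y -> lspan (eeg I') y.
  by move=> II; apply: lspan_trans => _ [n i iI i2]; apply: lspan_gen; apply: Eeg => //; exact: leq_trans iI II.
have comb (c : C) u v : (exists r y I, [/\ lspan R1gen r, lspan (eeg I) y & u = r + y]) ->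
    (exists r y I, [/\ lspan R1gen r, lspan (eeg I) y & v = r + y]) ->
    exists r y I, [/\ lspan R1gen r, lspan (eeg I) y & c *: u + v = r + y].
  move=> [r [y [I [hr hy ->]]]] [r' [y' [I' [hr' hy' ->]]]].
  exists (c *: r + r'), (c *: y + y'), (maxn I I'); split; [exact: lspan_lin| |by lmod].
  by apply: lspan_lin; [exact: (eeg_mono I _ _ (leq_maxl _ _))|exact: (eeg_mono I' _ _ (leq_maxr _ _))].
have base r : lspan R1gen r -> exists r' y I, [/\ lspan R1gen r', lspan (eeg I) y & r = r' + y].
  by move=> hr; exists r, 0, 0%N; split; [|exact: lspan0|rewrite addr0].
move=> /(W_gen p2 psi_lin psi_W psi_L psi_vv); elim=> [|c J n i u nJ i2 _ IHu]; first by apply: base; exact: lspan0.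
apply: (comb) => // {u IHu c}; elim: J nJ => [_|k J IHJ /= /andP[kn /IHJ {}IHJ]].
  exists 0, (vv n i), i.+1; split; [exact: lspan0| |by rewrite add0r].
  by rewrite vv_ee; apply: lspan_scale; apply: lspan_gen; exact: Eeg.
have WJ : inW (op L J (vv n i)) by apply: (W_op p2); exact: (inW_vvW p2).
have [->|k2] := eqVneq k (-2); last by apply: base; apply: lspan_gen; exact: R1_L.
rewrite -[L (-2) _](subrK (k0 *: op L J (vv n i))) addrC; apply: (comb k0) => //.
by apply: base; apply: lspan_gen; exact: R1_2.
Qed.

(** By [Shat_ee] some r0 in Rel has the same [hat] as [ee n i]. By [W_reduce] and [hat_span_eq0] the
    difference lies in the span of [R1gen], whose first generators belong to Rel and whose second
    ones add up to (L(-2) - k0) w. *)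
Lemma ee_reduce n i : (i <= n.*2)%N -> exists r w, [/\ Rel r, inW w & ee n i = r + (L (-2) w - k0 *: w)].
Proof.
move=> i2; have [r0 hr0 e0] := Shat_ee i2; have Wr0 := Rel_W hr0.
have Wx : inW (-1 *: r0 + ee n i) by exact: inWP.
have hx : hat (-1 *: r0 + ee n i) = 0 
  by apply: eq_trans (hat_lin (-1) Wr0 (inWe n i)) _; rewrite e0; exact: scaleN1_cancel.
have [r [y [I [hr hy xE]]]] := W_reduce Wx.
have Wr : inW r by apply: (lspan_W R1_W hr).
have Wy : inW y by apply: (lspan_W (@eeg_W I) hy).
have y0 : y = 0.
  apply: (hat_span_eq0 hy); rewrite -hx xE; have := hat_lin 1 Wr Wy; rewrite !scale1r (hat_R1 hr) add0r.
  by move=> ->.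
have {xE}xE : ee n i = r0 + r by exact: scaleN1_split xE y0.
rewrite xE; elim: hr {Wx hx y0 Wr xE} => [|c g u Gg _ [r1 [w [hr1 Ww uE]]]].
  have z0 : r0 + 0 = r0 + (L (-2) 0 - k0 *: 0) by exact: (add_zero_split _ _ (@L_0 R p (-2))).
  exact: (ex_intro _ r0 (ex_intro _ 0 (And3 hr0 (inW0 p) z0))).
case: Gg => [k x Wx kn k2|x Wx].
  have hr2 : Rel (c *: L k x + r1) by exact: (lspan_cons c (@Rgen_L R p Psi m k x Wx kn k2) hr1).
  exact: (ex_intro _ _ (ex_intro _ w (And3 hr2 Ww (add_carry _ uE)))).
have Wxw : inW (c *: x + w) by exact: inWP.
have e : r0 + (c *: (L (-2) x - k0 *: x) + u) = r1 + (L (-2) (c *: x + w) - k0 *: (c *: x + w)).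
  by rewrite (lin_elim (L_lin p (-2))); exact: add_carry2.
exact: (ex_intro _ _ (ex_intro _ _ (And3 hr1 Wxw e))).
Qed.

(** Weight without charge: the vectors U_M mix charges but have a definite weight. *)
Definition wtk (b : fock_basis) : rat := (lev b.1)%:R + hw p b.2.
Local Notation kpw := (kp wtk).

Lemma mcoeff_kp (T : eqType) (key : fock_basis -> T) x (v : V) b : (kp key x v)@_b != 0 -> v@_b != 0.
Proof.
apply: contra_neq => vb.
rewrite {1}(fockE v) (lin_big (kp_lin _ _)) raddf_sum /= big1_seq// => b' /andP[_ b'v].
rewrite (linZ (kp_lin _ _)) mcoeffZ kpU; case: ifP => _; last by rewrite mcoeff0 mulr0.
rewrite mcoeff_bs; case: (b' =P b) => [e|_]; last by rewrite mulr0.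
by rewrite e vb mul0r.
Qed.

Lemma inW_kp (T : eqType) (key : fock_basis -> T) (f : T -> T) x v : injective f ->
  (forall y (u : V), khom key y u -> khom key (f y) (Qt p u)) -> inW v -> inW (kp key x v).
Proof.
move=> fI fk [iv qv]; split; first by move=> b /mcoeff_kp; exact: iv.
by rewrite (kp_comm (Qt_lin p) fI fk) qv (lin0 (kp_lin _ _)).
Qed.

Lemma wtk_hom (f : V -> V) (d : rat) : linear f ->
  (forall s w v, wh s w v -> exists s', wh s' (w + d) (f v)) ->
  forall y v, khom wtk y v -> khom wtk (y + d) (f v).
Proof.
move=> lf fw y; apply: (supp_in_lin lf) => -[A s] /= e.
have bw : wh s y (bs (A, s) : V) by apply: supp_inU.
have [s' h] := fw _ _ _ bw; move=> b /h[e1 e2].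
by rewrite /wtk e1.
Qed.

Lemma L_wtk n y v : khom wtk y v -> khom wtk (y - n%:~R) (L n v).
Proof.
apply: (wtk_hom (L_lin p n)) => s w u uw; exists s; exact: (@L_wh R p p0 n _ _ _ uw).
Qed.

Lemma kpw_L n y v : kpw y (L n v) = L n (kpw (y + n%:~R) v).
Proof.
have := @kp_comm R _ wtk (L n) (fun y => y - n%:~R) (L_lin p n) _ (@L_wtk n) (y + n%:~R) v.
by rewrite addrK => -> // a b; exact: addIr.
Qed.

Lemma inW_kpw y v : inW v -> inW (kpw y v).
Proof.
apply: (@inW_kp _ wtk (fun y => y + 0)) => [a b|]; first by rewrite !addr0.
apply: (wtk_hom (Qt_lin p)) => s w u uw; rewrite addr0; eexists; exact: (@Qt_wh R p p2 _ _ _ uw).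
Qed.

Lemma Uv_wtk M j y v : khom wtk y v -> khom wtk (y + (hw p (- M%:R) - j%:~R - 1)) (mode (Uv M) j v).
Proof.
pose c : C := (-1) ^+ 0 * 0`!%:R / (M.*2 - 0)`!%:R.
have UE : Uv M = es (- M%:R) + c *: vv M M.*2.
  by have := psi_vv (leq0n M.*2); rewrite subn0 => e; rewrite /c subn0; congr (_ + _); exact: e.
move=> yv; rewrite UE (linD (@mode_lin R p j v)); apply: supp_inD.
  apply: (wtk_hom (@mode_linr R p (es (- M%:R)) j)) yv => s w u uw.
  have := @mode_wh R p _ _ _ (@wh_e R p (- M%:R)) j _ _ _ uw; rewrite -!addrA => h.
  by eexists; exact: h.
apply: (wtk_hom (@mode_linr R p (c *: vv M M.*2) j)) yv => s w u uw.
have := @mode_wh R p _ _ _ (@supp_inZ R _ c _ (@vv_wh R p M M.*2)) j _ _ _ uw; rewrite -!addrA => h.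
by eexists; exact: h.
Qed.

Lemma kpw_Rel y v : Rel v -> Rel (kpw y v).
Proof.
apply: (lspan_image (kp_lin _ _)) => _ [n w Ww n0 n2|k j w Ww km j2]; apply: lspan_gen.
  by rewrite kpw_L; apply: Rgen_L => //; exact: inW_kpw.
pose d := hw p (- k%:R) - j%:~R - 1.
have := @kp_comm R _ wtk (mode (Uv k) j) (fun y => y + d) (@mode_linr R p _ j) _ (@Uv_wtk k j) (y - d) w.
rewrite subrK => <-; last by move=> a b; exact: addIr.
by apply: Rgen_U => //; exact: inW_kpw.
Qed.

Lemma RelL2 v : Rel v -> Rel (L (-2) v).
Proof. exact: (Rel_L p2 psi_lin psi_W psi_L psi_mode psiK m0). Qed.

(** Let a_i be the component of w at weight x0 + 2i. Since L(-2) raises the weight by 2, the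
    equation becomes a recursion linking a_i to L(-2) a_(i-1), and a_i = 0 for large |i|. *)
Lemma nilpotent_mod e x0 r w : khom wtk x0 e -> Rel r -> inW w -> e = r + (L (-2) w - k0 *: w) ->
  exists b, Rel (iter b (L (-2)) e).
Proof.
move=> ex hr Ww eE; have [s us [_ hs]] := kp_sum wtk w.
have [D hD] : exists D : nat, forall i : int, (D <= `|i|)%N -> kpw (x0 + 2 * i%:~R) w = 0.
  exists (\sum_(y <- s) Num.bound `|(y - x0)%R|%R)%N => i Di; apply: hs; apply/negP => ys; move: Di; apply/negP.
  rewrite -ltnNge (big_rem _ ys) /= ltn_addr//.
  have := archi_boundP (normr_ge0 (x0 + 2 * i%:~R - x0)); set B := Num.bound _ => hB.
  rewrite -(ltr_nat rat); apply: le_lt_trans hB.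
  by rewrite addrAC subrr add0r normrM natr_absz intr_norm (ger0_norm (ler0n _ 2)) ler_peMl// ler1n.
pose a (i : int) := kpw (x0 + 2 * i%:~R) w.
have aW i : inW (a i) by exact: inW_kpw.
have step i : (if i == 0 then e else 0) = kpw (x0 + 2 * i%:~R) r + (L (-2) (a (i - 1)) - k0 *: a i).
  have := congr1 (kpw (x0 + 2 * i%:~R)) eE.
  have -> : kpw (x0 + 2 * i%:~R) e = if i == 0 then e else 0.
    case: eqP => [->|i0]; first by rewrite mulr0 addr0 (kp_id ex).
    by rewrite (kp_neq ex)// -subr_eq0 addrAC subrr add0r mulf_eq0 intr_eq0 negb_or /=; apply/eqP.
  move=> ->; rewrite (linD (kp_lin _ _)) (linB (kp_lin _ _)) (linZ (kp_lin _ _)) kpw_L /a.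
  have -> : x0 + 2 * i%:~R + (-2)%:~R = x0 + 2 * (i - 1)%:~R :> rat by rewrite rmorphB/=; ring.
  exact: erefl.
have k00 : k0 != 0 by rewrite /k0 invr_eq0 mulf_neq0 ?(@pp0 R p p0)// pnatr_eq0.
(* Starting where the components of w vanish, the recursion puts a_i into Rel for all i up to -1. *)
have low k : (k <= D)%N -> Rel (a (k%:Z - D%:Z - 1)).
  elim: k => [|k IHk] kD; first by rewrite /a hD; [exact: lspan0|lia].
  have := step (k.+1%:Z - D%:Z - 1); rewrite (_ : (_ == 0) = false); last by lia.
  rewrite (_ : k.+1%:Z - D%:Z - 1 - 1 = k%:Z - D%:Z - 1); last by lia.
  move=> st; apply: (lspan_unscale k00); move: st => /esym/lspan_solve; apply.
    exact: kpw_Rel.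
  by apply: RelL2; apply: IHk; exact: ltnW.
(* From i = 0 on, the recursion trades a_k for L(-2)^k e; at k = D the component a_k is 0. *)
have high k : Rel (iter k (L (-2)) e + k0 ^+ k.+1 *: a k%:Z).
  elim: k => [|k IHk].
    have := low D (leqnn D); rewrite subrr add0r => h1; have := step 0; rewrite eqxx sub0r expr1 => st.
    move/esym/lspan_solve_left: st; apply; [exact: kpw_Rel|exact: RelL2].
  have e1 : k.+1%:Z - 1 = k%:Z by lia.
  have st := step k.+1%:Z; rewrite e1 in st.
  have {}st : kpw (x0 + 2 * k.+1%:Z%:~R) r + (L (-2) (a k) - k0 *: a k.+1) = 0 by exact: (esym st).
  have h : Rel (iter k.+1 (L (-2)) e + k0 ^+ k.+1 *: L (-2) (a k)).
    have := RelL2 IHk; congr lspan; apply: eq_trans (L_D _ _ _ _) _; congr (_ + _).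
    exact: (L_Z p (-2)).
  have := lspan_solve_next st (kpw_Rel _ hr) h; rewrite -exprS.
  exact.
exists D; have := high D; rewrite /a hD; last by lia.
by rewrite scaler0 addr0.
Qed.

Lemma vv_nilpotent n i : (i <= n.*2)%N -> exists b, Rel (iter b (L (-2)) (vv n i)).
Proof.
move=> i2; have [r [w [hr Ww e]]] := ee_reduce i2.
have ew : khom wtk (hw p (- n%:R)) (ee n i) by move=> b /(@ee_wh n i)[e1 e2]; rewrite /wtk e1.
have [b hb] := nilpotent_mod ew hr Ww e; exists b.
have il : linear (iter b (L (-2))).
  by elim: b {hb} => [|b IHb]; [exact: lin_id|exact: (lin_comp (L_lin p _) IHb)].
by rewrite vv_ee (linZ il); exact: lspan_scale.
Qed.

Lemma nilpotency_bound N : exists B, forall n i b, (n < N)%N -> (i <= n.*2)%N -> (B <= b)%N ->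
  Rel (iter b (L (-2)) (vv n i)).
Proof.
have step n i b k : Rel (iter b (L (-2)) (vv n i)) -> Rel (iter (k + b) (L (-2)) (vv n i)).
  by move=> h; elim: k => // k IHk; exact: RelL2.
have [f fP] : exists f : nat -> nat -> nat, forall n i, (i <= n.*2)%N -> Rel (iter (f n i) (L (-2)) (vv n i)).
  have ex n : exists g : nat -> nat, forall i, (i <= n.*2)%N -> Rel (iter (g i) (L (-2)) (vv n i)).
    have ex2 i : exists b : nat, (i <= n.*2)%N -> Rel (iter b (L (-2)) (vv n i)).
      have [i2|i2] := leqP i n.*2; last by exists 0%N.
      by have [b hb] := vv_nilpotent i2; exists b.
    by have [g gP] := boolp.choice ex2; exists g.
  by have [f fP] := boolp.choice ex; exists f.
exists (\sum_(n < N) \sum_(i < n.*2.+1) f n i)%N => n i b nN i2 Bb.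
have i2' : (i < n.*2.+1)%N by [].
have fB : (f n i <= b)%N.
  apply: leq_trans Bb; rewrite (bigD1 (Ordinal nN)) //= (bigD1 (Ordinal i2')) //=.
  by rewrite -addnA leq_addr.
by rewrite -(subnK fB); apply: step; exact: fP.
Qed.

Lemma W_finite : exists B, forall v, inW v -> lspan (fun x => Rgen p Psi m x \/
  exists b n i, [/\ (b < B)%N, (n < 4 * m)%N, (i <= n.*2)%N & x = iter b (L (-2)) (vv n i)]) v.
Proof.
have [B hB] := nilpotency_bound (4 * m); exists B => v Wv.
have := W_span p2 psi_lin psi_W psi_L psi_mode psiK psi_vv m0 Wv.
apply: lspan_trans => _ [x Gx|b n i nN i2]; first by apply: lspan_gen; left.
have [bB|Bb] := ltnP b B; first by apply: lspan_gen; right; exists b, n, i.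
by have := hB n i b nN i2 Bb; apply: lspan_trans => g Gg; apply: lspan_gen; left.
Qed.

End Exponentials.

(** * The dihedral orbifold *)

Section Rotation.
Context {R : realType}.
Implicit Types (x : R) (s : int).

Lemma sin2_shift x s : sin (x + s%:~R * pi) ^+ 2 = sin x ^+ 2.
Proof.
have nat_shift (y : R) (n : nat) : sin (y + n%:R * pi) ^+ 2 = sin y ^+ 2.
  elim: n => [|n IHn]; first by rewrite mul0r addr0.
  by rewrite -natr1 mulrDl mul1r addrA sinDpi sqrrN.
case: s => n; first exact: nat_shift.
rewrite -(nat_shift (x + _) n.+1); congr (sin _ ^+ 2); rewrite NegzE rmorphN/=.
by rewrite mulNr subrK.
Qed.

(** Reduce s modulo m: the square of the sine has period pi, and the sine is positive inside (0,
    pi). *)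
Lemma sin_pi_rat (m : nat) s : (0 < m)%N ->
  (sin (pi * s%:~R / m%:R : R) == 0) = ((s%:~R / m%:R : rat) \is a Num.int).
Proof.
move=> m0; have mR : m%:R != 0 :> R by rewrite pnatr_eq0 -lt0n.
have mQ : m%:R != 0 :> rat by rewrite pnatr_eq0 -lt0n.
have e : s = (s %/ m)%Z * m + (s %% m)%Z by exact: divz_eq.
set q := (s %/ m)%Z in e; set r := (s %% m)%Z in e.
have r0 : 0 <= r by rewrite modz_ge0// -lt0n.
have rm : r < m by rewrite /r; apply: ltz_pmod; exact: m0.
have -> : pi * s%:~R / m%:R = pi * r%:~R / m%:R + q%:~R * pi :> R.
  by rewrite {1}e rmorphD rmorphM/=; field.
rewrite -sqrf_eq0 sin2_shift sqrf_eq0.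
have [rE|rn] := eqVneq r 0.
  rewrite rE rmorph0 mulr0 mul0r sin0 eqxx; apply: esym.
  by rewrite e rE addr0 rmorphM/= mulfK// intr_int.
have rp : 0 < r by rewrite lt_def rn.
have h : 0 < sin (pi * r%:~R / m%:R : R).
  apply: sin_gt0_pi; rewrite divr_gt0 ?mulr_gt0 ?pi_gt0 ?ltr0n ?ltr0z//=.
  by rewrite -mulrA gtr_pMr ?pi_gt0// ltr_pdivrMr ?ltr0n// mul1r -[m%:R]/(m%:~R) ltr_int.
rewrite (negPf (lt0r_neq0 h)); apply: esym; apply/negP => /intrP[k ek].
have : s%:~R = (k * m)%:~R :> rat by rewrite rmorphM/= -ek divfK.
move/eqP; rewrite eqr_int => /eqP sE; case/eqP: rn.
by rewrite /r sE modzMl.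
Qed.

Lemma cexp_imaginary (a t : R) : cexp ((0 +i* a) * t%:C) = cos (a * t) +i* sin (a * t).
Proof.
have -> : (0 +i* a) * t%:C = 0 +i* (a * t) :> R[i] by rewrite /real_complex_def; simpc.
by rewrite /cexp exp.expR0 !mul1r.
Qed.

(** The rotation acts on charge s by exp (2 pi i s / m). It is written as a double angle so that it
    is trivial exactly when sin (pi s / m) = 0. *)
Lemma rotation_coeff (p m : nat) s : (0 < p)%N -> (0 < m)%N ->
  cexp ((0 +i* (pi / (m * p)%:R)) * ratr (2 * p%:R * s%:~R)) =
    cos (pi * s%:~R / m%:R + pi * s%:~R / m%:R) +i* sin (pi * s%:~R / m%:R + pi * s%:~R / m%:R) :> R[i].
Proof.
move=> p0 m0; have mR : m%:R != 0 :> R by rewrite pnatr_eq0 -lt0n.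
have pR : p%:R != 0 :> R by rewrite pnatr_eq0 -lt0n.
rewrite -(fmorph_rat (real_complex R)) cexp_imaginary.
suff -> : pi / (m * p)%:R * ratr (2 * p%:R * s%:~R) = pi * s%:~R / m%:R + pi * s%:~R / m%:R :> R by [].
rewrite !rmorphM /= ratr_int !ratr_nat ?natrM; field.
by rewrite mR pR.
Qed.

Lemma cexp_neq0 (z : R[i]) : cexp z != 0.
Proof.
case: z => x y; apply/eqP => -[/eqP + /eqP]; rewrite !mulf_eq0 !(negPf (lt0r_neq0 (exp.expR_gt0 x))) /=.
by move=> /eqP c0 /eqP s0; have := cos2Dsin2 y; rewrite c0 s0 expr0n addr0 => /esym/eqP; rewrite oner_eq0.
Qed.

Lemma cos_double_eq1 x : cos (x + x) = 1 -> sin x = 0.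
Proof.
rewrite cosD -!expr2 cos2sin2 => e; apply/eqP; rewrite -sqrf_eq0.
have : sin x ^+ 2 *+ 2 = 0 by rewrite -[RHS](subrr 1) -[X in _ - X]e; ring.
by move/eqP; rewrite mulrn_eq0.
Qed.

Lemma cis_double_eq1 x : sin x = 0 -> cos (x + x) +i* sin (x + x) = 1 :> R[i].
Proof.
by move=> s0; rewrite cosD sinD s0 !mulr0 mul0r addr0 subr0 -expr2 cos2sin2 s0 expr0n subr0.
Qed.

Lemma mcoeff_diag (c : fock_basis -> R[i]) (v : fock R) b : (lin_ext (fun b => c b *: << b >>) v)@_b = c b * v@_b.
Proof.
apply: (@lin_eq R (R[i])^o (fun v => (lin_ext (fun b => c b *: << b >>) v)@_b) (fun v => c b * v@_b)).
- apply: lin_intro => k x y; rewrite (lin_elim (@lin_ext_is_linear R (fock R) _)) mcoeffD mcoeffZ.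
  by [].
- by apply: lin_intro => k x y; rewrite mcoeffD mcoeffZ mulrDr mulrCA.
move=> b'; rewrite lin_extU mcoeffZ bsE mcoeff_bs; case: eqP => [->//|_].
by rewrite !mulr0.
Qed.

End Rotation.

Lemma lspan_lin_span (R : realType) (V : lmodType R[i]) (G : V -> Prop) v : lspan G v -> lin_span [set x | G x] v.
Proof.
elim=> [|c g u Gg _ [n [d [s [sG ->]]]]].
  by exists 0%N, (fun=> 0), (fun=> 0); split; [case|rewrite big_ord0].
exists n.+1, (fun i => if unlift ord0 i is Some j then d j else c), (fun i => if unlift ord0 i is Some j then s j else g).
split=> [i|]; first by case: (unlift _ _) => [j|]; [exact: sG|exact: Gg].
rewrite big_ord_recl unlift_none; congr (_ + _); apply: eq_bigr => i _.
by rewrite liftK.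
Qed.

Lemma half_lin (K : comPzRingType) (V : lmodType K) (h c : K) (a b a' b' : V) :
  h *: (c *: a + b + (c *: a' + b')) = c *: (h *: (a + a')) + h *: (b + b').
Proof. by lmod_with msame; ring. Qed.

Lemma half_double (K : numFieldType) (V : lmodType K) (x : V) : 2^-1 *: (x + x) = x.
Proof. by rewrite -mulr2n -scaler_nat scalerA mulVf ?scale1r// pnatr_eq0. Qed.

Section Orbifold.
Context {R : realType} (p m : nat) (Psi : fock R -> fock R).
Local Notation C := R[i].
Local Notation V := (fock R).
Local Notation es := (@es R).
Local Notation wh := (@wh R p).
Local Notation L := (@L R p).
Local Notation om := (@om R p).
Local Notation mode := (@md R p).
Local Notation vv := (@vv R p).
Local Notation inW := (@inW R p).
Local Notation Uv := (@Uv R Psi).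
Hypothesis p2 : (2 <= p)%N.
Hypothesis m0 : (0 < m)%N.
Let p0 : (0 < p)%N. Proof. exact: ltnW. Qed.
Hypothesis psi_lin : forall (c : C) u v, inW u -> inW v -> Psi (c *: u + v) = c *: Psi u + Psi v.
Hypothesis psi_W : forall v, inW v -> inW (Psi v).
Hypothesis psi_L : forall n v, inW v -> Psi (L n v) = L n (Psi v).
Hypothesis psi_mode : forall u n v, inW u -> inW v -> Psi (mode u n v) = mode (Psi u) n (Psi v).
Hypothesis psiK : forall v, inW v -> Psi (Psi v) = v.
Hypothesis psi_vv : forall n i, (i <= n.*2)%N ->
  Psi (vv n i) = ((-1) ^+ i * i`!%:R / (n.*2 - i)`!%:R) *: vv n (n.*2 - i).

Definition ckey (b : fock_basis) : bool := (b.2 / m%:R) \is a Num.int.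
Local Notation Pm := (kp ckey true).

Definition Afix v := [/\ inW v, khom ckey true v & Psi v = v].

Lemma ckeyD (s t : rat) : s / m%:R \is a Num.int -> ((s + t) / m%:R \is a Num.int) = (t / m%:R \is a Num.int).
Proof. by move=> sm; rewrite mulrDl rpredDl. Qed.

Lemma chg_ckey s (v : V) : chg s v -> khom ckey (s / m%:R \is a Num.int) v.
Proof. by move=> vs b /vs; rewrite /ckey => ->. Qed.

Lemma mode_ckey (s : rat) u j y v : chg s u -> s / m%:R \is a Num.int -> khom ckey y v -> khom ckey y (mode u j v).
Proof.
move=> us sm; apply: (supp_in_lin (@mode_linr R p u j)) => -[A t] /= bt.
have h : chg t (bs (A, t) : V) by apply: supp_inU.
have h2 := @mode_chg R p _ _ j _ _ us h.
by move=> b /h2 e; rewrite /ckey e ckeyD.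
Qed.

Lemma Afix_mode u j v : Afix u -> Afix v -> Afix (mode u j v).
Proof.
move=> [Wu ku eu] [Wv kv ev]; split; first exact: (@inW_mode R p p2).
  have := @supp_in_lin R _ (fun b => ckey b = true) _ (@mode_lin R p j v) _ u ku; apply.
  move=> [A s] sm; have us : chg s (bs (A, s) : V) by apply: supp_inU.
  exact: (@mode_ckey s (bs (A, s)) j true v us sm kv).
by rewrite psi_mode// eu ev.
Qed.

Lemma Pm_L n v : Pm (L n v) = L n (Pm v).
Proof.
apply: esym; apply: (@kp_comm R _ ckey (L n) id) => //; first exact: L_lin.
move=> y; apply: (supp_in_lin (L_lin p n)) => -[A t] /= bt.
have h : chg t (bs (A, t) : V) by apply: supp_inU.
by have h2 := @L_chg R p p0 n _ _ h; move=> b /h2 e; rewrite /ckey e.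
Qed.

Lemma inW_Pm v : inW v -> inW (Pm v).
Proof.
move: v; apply: (@inW_ind R p p2 (fun v => inW (Pm v))) => [|c u v _ _ hu hv|s w v vw qv].
- by rewrite (lin0 (kp_lin _ _)); exact: inW0.
- by rewrite (lin_elim (kp_lin _ _)); exact: inWP.
have h := @chg_ckey _ _ (@wh_chg R p _ _ _ vw); have [e|e] := boolP ((s%:~R / m%:R : rat) \is a Num.int).
  by rewrite e in h; rewrite (kp_id h); exact: (inW_hom vw qv).
by rewrite (negPf e) in h; rewrite (@kp_neq R _ _ _ _ _ h)//; exact: inW0.
Qed.

(** Checked on generators: Psi exchanges the charges i - n and n - i of the vectors [vv], which
    preserves divisibility by m. *)
Lemma Pm_Psi v : inW v -> Psi (Pm v) = Pm (Psi v).
Proof.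
move=> /(W_gen p2 psi_lin psi_W psi_L psi_vv); elim=> [|c J n i u nJ i2 gu IHu].
  by rewrite (lin0 (kp_lin _ _)) (psi0 psi_lin) (lin0 (kp_lin _ _)).
have Wx : inW (op L J (vv n i)) by apply: (W_op p2); exact: (inW_vvW p2).
have Wu : inW u.
  elim: gu => [|c' J' n' i' u' _ _ _ Wu']; first exact: inW0.
  by apply: inWP => //; apply: (W_op p2); exact: (inW_vvW p2).
rewrite (lin_elim (kp_lin _ _)) (psi_lin c (inW_Pm Wx) (inW_Pm Wu)) (psi_lin c Wx Wu) (lin_elim (kp_lin _ _)) IHu.
have [c' _ ce] := psi_vv_ex psi_vv i2.
have e1 : Psi (op L J (vv n i)) = c' *: op L J (vv n (n.*2 - i)).
  apply: eq_trans (Psi_op p2 psi_L J (inW_vvW p2 n i)) _.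
  apply: eq_trans (congr1 (op L J) ce) _; exact: (linZ (op_lin (L_lin p) J)).
apply: (congr1 (fun x => c *: x + Pm (Psi u))).
have ch k : chg (k%:R - n%:R) (op L J (vv n k)).
  by apply: op_chg => //; exact: (@wh_chg R p _ _ _ (@vv_wh R p n k)).
have k1 := chg_ckey (@ch i); have k2 := chg_ckey (@ch (n.*2 - i)%N).
have e : ((n.*2 - i)%N%:R - n%:R) / m%:R = - ((i%:R - n%:R) / m%:R) :> rat.
  by rewrite natrB// -addnn natrD -mulNr; congr (_ / _); ring.
rewrite e rpredN in k2; rewrite e1 (linZ (kp_lin _ _)).
case: (boolP (_ \is a Num.int)) k1 k2 => _ k1 k2.
  apply: eq_trans (congr1 Psi (kp_id k1)) _; apply: eq_trans e1 _.
  exact: (congr1 (fun x => c' *: x) (esym (kp_id k2))).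
have z1 := @kp_neq R _ ckey false true _ k1 isT; have z2 := @kp_neq R _ ckey false true _ k2 isT.
apply: eq_trans (congr1 Psi z1) _; apply: eq_trans (psi0 psi_lin) _.
by rewrite z2; exact: (esym (scaler0 _ _)).
Qed.

Lemma Uv_ckey M y j v : M%:R / m%:R \is a @Num.int rat -> khom ckey y v -> khom ckey y (mode (Uv M) j v).
Proof.
move=> Mm yv; pose c : C := (-1) ^+ 0 * 0`!%:R / (M.*2 - 0)`!%:R.
have UE : Uv M = es (- M%:R) + c *: vv M M.*2.
  by have := psi_vv (leq0n M.*2); rewrite subn0 => e; rewrite /c subn0; congr (_ + _); exact: e.
rewrite UE (linD (@mode_lin R p j v)); apply: supp_inD.
  have Mn : - M%:R / m%:R \is a @Num.int rat by rewrite mulNr rpredN.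
  exact: (@mode_ckey _ _ j _ _ (@chg_e R (- M%:R)) Mn yv).
have h : chg (M%:R) (c *: vv M M.*2).
  apply: supp_inZ; have := @wh_chg R p _ _ _ (@vv_wh R p M M.*2).
  by rewrite -addnn natrD addrK.
exact: (@mode_ckey _ _ j _ _ h Mm yv).
Qed.

Lemma Pm_Uv M j v : M%:R / m%:R \is a @Num.int rat -> Pm (mode (Uv M) j v) = mode (Uv M) j (Pm v).
Proof.
move=> Mm; apply: esym; apply: (@kp_comm R _ ckey (mode (Uv M) j) id) => //; first exact: mode_linr.
by move=> y u; exact: Uv_ckey.
Qed.

(** The average over the dihedral group: [Pm] selects the invariants of the rotation, then one
    averages with Psi. It commutes with L(n) and with the modes of U_m and U_2m, whose vectors are
    invariant. *)
Definition proj v : V := 2^-1 *: (Pm v + Psi (Pm v)).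

Lemma proj_lin (c : C) u v : inW u -> inW v -> proj (c *: u + v) = c *: proj u + proj v.
Proof.
move=> Wu Wv; rewrite /proj (lin_elim (kp_lin _ _)) (psi_lin c (inW_Pm Wu) (inW_Pm Wv)).
exact: half_lin.
Qed.

Lemma proj_Afix v : inW v -> Afix (proj v).
Proof.
move=> Wv; have WP := inW_Pm Wv; have WPP := psi_W WP.
split; first exact: (inWZ _ (inWD WP WPP)).
  apply: supp_inZ; apply: supp_inD; first exact: kp_khom.
  by rewrite Pm_Psi//; exact: kp_khom.
rewrite /proj (psiZ psi_lin); last exact: inWD.
apply: congr1; apply: eq_trans (PsiD psi_lin WP WPP) _.
by rewrite (psiK WP); exact: addrC.
Qed.

Lemma proj_id v : Afix v -> proj v = v.
Proof.
move=> [Wv kv ev]; rewrite /proj (kp_id kv) ev; exact: half_double.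
Qed.

Lemma proj_L n v : inW v -> proj (L n v) = L n (proj v).
Proof. by move=> Wv; rewrite /proj Pm_L psi_L ?L_Z ?L_D//; exact: inW_Pm. Qed.

Lemma proj_Uv M j v : M%:R / m%:R \is a @Num.int rat -> inW v -> proj (mode (Uv M) j v) = mode (Uv M) j (proj v).
Proof.
move=> Mm Wv; rewrite /proj (Pm_Uv j v Mm) psi_mode; [|exact: (inW_Uv p2 psi_W)|exact: inW_Pm].
rewrite (psi_Uv p2 psi_lin psi_W psiK) (linZ (@mode_linr R p _ j)) (linD (@mode_linr R p _ j)).
by [].
Qed.

Lemma Afix_vac : Afix (es 0).
Proof.
have e0 : vv 0 0 = es 0 by rewrite /vv /= oppr0.
split; first by rewrite -e0; exact: (inW_vvW p2).
  by have := chg_ckey (@chg_e R 0); rewrite mul0r rpred0.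
by rewrite -e0 psi_vv// expr0 fact0 mul1r divr1 scale1r.
Qed.

Lemma Afix_L n v : Afix v -> Afix (L n v).
Proof.
move=> [Wv kv ev]; split; [exact: (W_L p2)| |by rewrite psi_L// ev].
by rewrite -(kp_id kv) -Pm_L; exact: kp_khom.
Qed.

Lemma Afix_om : Afix om.
Proof.
have [_ e _] := mode_creation p2 om; rewrite -e -[mode om (-1) _]/(L (-2) (es 0)).
by apply: Afix_L; exact: Afix_vac.
Qed.

Lemma Afix_Uv M : M%:R / m%:R \is a @Num.int rat -> Afix (Uv M).
Proof.
move=> Mm; split; [exact: (inW_Uv p2 psi_W)| |exact: (psi_Uv p2 psi_lin psi_W psiK)].
have [_ e _] := mode_creation p2 (Uv M); rewrite -e.
by apply: Uv_ckey => //; case: Afix_vac.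
Qed.

Definition C2gen x := exists a b, [/\ Afix a, Afix b & x = mode a (-2) b].

Lemma C2_L1 v : Afix v -> lspan C2gen (L (-1) v).
Proof.
move=> Av; have [_ _ <-] := mode_creation p2 v; apply: lspan_gen.
by exists v, (es 0); split => //; exact: Afix_vac.
Qed.

(** omega_(-2) is L(-3). Bracketing with L(-1), whose image of an invariant vector is in C_2 by
    [C2_L1], reaches the deeper modes; [C2_Uv] descends in the same way. *)
Lemma C2_L k v : Afix v -> lspan C2gen (L (- k.+3%:Z) v).
Proof.
elim: k v => [|k IHk] v Av; first by apply: lspan_gen; exists om, v; split => //; exact: Afix_om.
have Wv : inW v by case: Av.
have := @L_comm_neg R p p2 (-1) (- k.+3%:Z) v Wv; rewrite (_ : -1 + - k.+3%:Z = - k.+4%:Z); last by lia.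
move=> /(_ isT) e; have h1 := C2_L1 (Afix_L (- k.+3%:Z) Av); have h2 := IHk _ (Afix_L (-1) Av).
apply: (@lspan_unscale C V C2gen _ ((-1)%:~R - (- k.+3%:Z)%:~R)); last first.
  by have := lspan_sub h1 h2; rewrite e addrAC subrr add0r.
by rewrite -rmorphB intr_eq0; lia.
Qed.

Lemma C2_Uv M k v : M%:R / m%:R \is a @Num.int rat -> Afix v -> lspan C2gen (mode (Uv M) (- k.+2%:Z) v).
Proof.
move=> Mm; have AU := Afix_Uv Mm; elim: k v => [|k IHk] v Av.
  by apply: lspan_gen; exists (Uv M), v.
have Wv : inW v by case: Av.
have := L_Uv p2 psi_lin psi_W psi_L psi_mode psiK M (-1) (- k.+2%:Z) Wv.
rewrite (_ : -1 + 1 = 0 :> int)// rmorph0 mulr0 sub0r (_ : - k.+2%:Z + -1 = - k.+3%:Z); last by lia.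
move=> e; have h1 := C2_L1 (Afix_mode (- k.+2%:Z) AU Av); have h2 := IHk _ (Afix_L (-1) Av).
apply: (@lspan_unscale C V C2gen _ (- (- k.+2%:Z)%:~R)); last first.
  by have := lspan_sub h1 h2; rewrite e addrAC subrr add0r.
by rewrite -rmorphN intr_eq0; lia.
Qed.

Lemma proj_Rgen g : Rgen p Psi m g -> lspan C2gen (proj g).
Proof.
have mQ : m%:R != 0 :> rat by rewrite pnatr_eq0 -lt0n.
case=> [n w Ww n0 n2|k j w Ww km j2].
  rewrite proj_L//; have Aw := proj_Afix Ww; have [->|n1] := eqVneq n (-1); first exact: C2_L1.
  have -> : n = - (`|n|%N - 3).+3%:Z by lia.
  exact: C2_L.
have kM : k%:R / m%:R \is a @Num.int rat.
  case/orP: km => /eqP ->; first by rewrite divff// rpred1.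
  by rewrite -mul2n natrM mulfK// rpred_nat.
rewrite proj_Uv//; have -> : j = - (`|j|%N - 2).+2%:Z by lia.
by apply: C2_Uv => //; exact: proj_Afix.
Qed.

Lemma orbifold_span : exists F : set V, [/\ finite_set F, forall x, F x -> Afix x &
  forall v, Afix v -> lspan (fun x => F x \/ C2gen x) v].
Proof.
have [B hB] := W_finite p2 psi_lin psi_W psi_L psi_mode psi_vv psiK m0.
(* The last bound comes from i <= 2n with n < 4m. *)
pose f (t : 'I_B * 'I_(4 * m) * 'I_(8 * m)) : V := proj (iter t.1.1 (L (-2)) (vv t.1.2 t.2)).
exists [set f t | t in setT]; split.
- by apply: finite_image; exact: finite_finset.
- by move=> _ [t _ <-]; apply: proj_Afix; apply: (W_iter p2); exact: (inW_vvW p2).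
move=> v Av; have Wv : inW v by case: Av.
rewrite -(proj_id Av); apply: (@lspan_map _ _ _ _ _ inW proj v (inW0 p) _ proj_lin _ (hB v Wv)).2.
  by move=> c x y; exact: inWP.
move=> g [Gg|[b [n [i [bB nN i2 ->]]]]].
  split; first by case: Gg => [k w Ww _ _|k j w Ww _ _]; [exact: (W_L p2)|apply: (@inW_mode R p p2) => //; exact: (inW_Uv p2 psi_W)].
  by have := proj_Rgen Gg; apply: lspan_trans => x Cx; apply: lspan_gen; right.
split; first by apply: (W_iter p2); exact: (inW_vvW p2).
have i8 : (i < 8 * m)%N by lia.
by apply: lspan_gen; left; exists (Ordinal bB, Ordinal nN, Ordinal i8).
Qed.

End Orbifold.

(** * Passage between the stated notions and the sealed operators *)

Section Translation.
Context {R : realType} (p m : nat) (Psi : fock R -> fock R).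
Local Notation C := R[i].
Local Notation V := (fock R).
Local Notation vv := (@vv R p).
Local Notation inW := (@inW R p).
Hypothesis p2 : (2 <= p)%N.
Hypothesis m0 : (0 < m)%N.
Hypothesis isP : is_Psi p Psi.
Let p0 : (0 < p)%N. Proof. exact: ltnW. Qed.

Lemma triplet_inW (v : V) : triplet p v <-> inW v.
Proof.
have e : Qtilde p v = Qt p v by rewrite /Qtilde modeE esE mode_es.
split=> [[vL vQ]|[vL vQ]]; split.
- by move=> b; rewrite mcoeff_neq0; exact: vL.
- by rewrite -e.
- by move=> b; rewrite -mcoeff_neq0; exact: vL.
by rewrite e.
Qed.

Lemma Psi_linear (c : C) u v : inW u -> inW v -> Psi (c *: u + v) = c *: Psi u + Psi v.
Proof. by case: isP => -[_ h _ _] _ _ _ /triplet_inW Wu /triplet_inW Wv; exact: h. Qed.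

Lemma Psi_inW v : inW v -> inW (Psi v).
Proof. by case: isP => -[[h _ _] _ _ _] _ _ _ /triplet_inW Wv; apply/triplet_inW; exact: h. Qed.

Lemma Psi_L n v : inW v -> Psi (L p n v) = L p n (Psi v).
Proof. by case: isP => _ _ h _ /triplet_inW Wv; rewrite -VirE; exact: h. Qed.

Lemma Psi_mode u n v : inW u -> inW v -> Psi (md p u n v) = md p (Psi u) n (Psi v).
Proof.
by case: isP => -[_ _ _ h] _ _ _ /triplet_inW Wu /triplet_inW Wv; rewrite -modeE; exact: h.
Qed.

Lemma Psi_invol v : inW v -> Psi (Psi v) = v.
Proof. by case: isP => _ [h _] _ _ /triplet_inW; exact: h. Qed.

Lemma Psi_vv n i : (i <= n.*2)%N ->
  Psi (vv n i) = ((-1) ^+ i * i`!%:R / (n.*2 - i)`!%:R) *: vv n (n.*2 - i).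
Proof.
case: isP => _ _ _ h i2; have := h n i; rewrite mul2n esE => /(_ i2).
have -> : Q p = Qo p :> (V -> V) by apply/funext => v; rewrite /Q modeE esE mode_es.
exact.
Qed.

Lemma rotation_coeffE (v : V) b : (rotation p m v)@_b =
  cexp ((0 +i* (pi / (m * p)%:R)) * ratr (2 * p%:R * b.2)) * v@_b.
Proof. exact: mcoeff_diag. Qed.

Lemma rotation_int s : cexp ((0 +i* (pi / (m * p)%:R)) * ratr (2 * p%:R * s%:~R)) = 1 :> C <->
  ((s%:~R / m%:R : rat) \is a Num.int).
Proof.
rewrite rotation_coeff// -(@sin_pi_rat R)//; split=> [[e _]|/eqP s0]; first by apply/eqP; exact: cos_double_eq1.
exact: cis_double_eq1.
Qed.

Lemma rotation_inW v : inW v -> inW (rotation p m v).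
Proof.
have rl : linear (rotation p m : V -> V) by exact: lin_ext_is_linear.
move: v; apply: (@inW_ind R p p2 (fun v => inW (rotation p m v))) => [|c u v _ _ hu hv|s w v vw qv].
- by rewrite (lin0 rl); exact: inW0.
- by rewrite (lin_elim rl); exact: inWP.
have -> : rotation p m v = cexp ((0 +i* (pi / (m * p)%:R)) * ratr (2 * p%:R * s%:~R)) *: v.
  apply/malgP => b; rewrite rotation_coeffE mcoeffZ.
  have [->|vb] := eqVneq (v@_b) 0; first by rewrite !mulr0.
  by have [-> _] := vw b vb.
exact: (inWZ _ (inW_hom vw qv)).
Qed.

Lemma rotation_inj : injective (rotation p m : V -> V).
Proof.
move=> u v e; apply/malgP => b; have := congr1 (fun x : V => x@_b) e.
by rewrite !rotation_coeffE => /(mulfI (cexp_neq0 _)).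
Qed.

Lemma rotation_Afix v : inW v -> (khom (ckey m) true v <-> rotation p m v = v).
Proof.
move=> [vi _]; split=> [kv|rv].
  apply/malgP => b; rewrite rotation_coeffE; have [->|vb] := eqVneq (v@_b) 0; first by rewrite mulr0.
  have /intrP[s sE] := vi b vb; have := kv b vb; rewrite /ckey sE => /rotation_int ->.
  exact: mul1r.
move=> b vb; have /intrP[s sE] := vi b vb; rewrite /ckey sE; apply/rotation_int.
have := congr1 (fun x : V => x@_b) rv; rewrite rotation_coeffE sE -[RHS]mul1r.
exact: mulIf.
Qed.

Lemma fixed_pointsP v : fixed_points (triplet p) (dihedral p m Psi) v <-> Afix p m Psi v.
Proof.
split=> [[/triplet_inW Wv fv]|[Wv kv ev]].
  split; [exact: Wv| |exact: (fv _ (dihedral_Psi _ _ _))].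
  by apply/(rotation_Afix Wv); exact: (fv _ (dihedral_rotation _ _ _)).
split; first exact/triplet_inW.
(* The induction over the generated group also carries stability and injectivity on W; injectivity
   is what makes an inverse of a map fixing v fix v as well. *)
move=> g dg; suff [_ _ h] : [/\ forall x, inW x -> inW (g x),
    forall x y, inW x -> inW y -> g x = g y -> x = y & g v = v] by exact: h.
elim: dg => [||| {}g h _ [gW gI gv] _ [hW hI hv]|{}g h _ [gW gI gv] [hW hI _] gh].
- split; [exact: Psi_inW| |exact: ev].
  by move=> x y Wx Wy e; rewrite -(Psi_invol Wx) e Psi_invol.
- split; [exact: rotation_inW|by move=> x y _ _ /rotation_inj|exact/(rotation_Afix Wv)].
- by split.
- split=> [x Wx|x y Wx Wy e|].
  + exact: (gW _ (hW _ Wx)).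
  + exact: (hI _ _ Wx Wy (gI _ _ (hW _ Wx) (hW _ Wy) e)).
  exact: (eq_trans (congr1 g hv) gv).
have hW' x : inW x -> inW (h x) by move=> /triplet_inW /hW /triplet_inW.
split=> // [x y /triplet_inW Wx /triplet_inW Wy e|].
  by apply: hI e; exact: mem_set.
apply: gI => //; first exact: hW'.
by rewrite gv; apply: gh; exact/triplet_inW.
Qed.

Lemma orbifold_C2_cofinite : C2_cofinite p (fixed_points (triplet p) (dihedral p m Psi)).
Proof.
have [F [fF FA hF]] := orbifold_span p2 m0 Psi_linear Psi_inW Psi_L Psi_mode Psi_invol Psi_vv.
exists F; split => //; first by move=> x /FA Ax; exact/fixed_pointsP.
move=> v /fixed_pointsP /hF; move/lspan_lin_span => [n [c [s [sG ->]]]].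
exists n, c, s; split => // i; case: (sG i) => [Fs|[a [b [Aa Ab ->]]]]; [by left|right].
exists 1%N, (fun=> 1), (fun=> md p a (-2) b); split=> [_|]; last by rewrite big_ord1 scale1r.
by exists a, b; split; [exact/fixed_pointsP|exact/fixed_pointsP|rewrite modeE].
Qed.

End Translation.

Theorem theorem9p4 (R : realType) (p m : nat) (Psi : fock R -> fock R) :
  (2 <= p)%N -> (1 <= m)%N -> is_Psi p Psi ->
  C2_cofinite p (fixed_points (triplet p) (dihedral p m Psi)).
Proof. exact: orbifold_C2_cofinite. Qed.
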